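(* Let $A,g,b$ and the parameters $p,q,\alpha,\beta,\mu,\mu_1$ satisfy the structure conditions $(H_1)$ and $(H_2)$ of the context, and suppose that $$N-d>\frac{pq}{q-p+1}.$$ Let $u\in W^{1,p}_{\mathrm{loc}}(\bar\Omega\setminus\Gamma;\vartheta_\alpha)\cap L^\infty_{\mathrm{loc}}(\bar\Omega\setminus\Gamma)$ be a weak solution in $\bar\Omega\setminus\Gamma$ of $$-\operatorname{div}[(1+|x|)^{-\alpha}A(\nabla u)]+(1+|x|)^{-\alpha}g(u)=0\ \text{ in }\Omega,\qquad (1+|x|)^{-\alpha}A(\nabla u)\cdot\nu+(1+|x|)^{-\beta}b(u)=0\ \text{ on }\partial\Omega,$$ and suppose that $u$ satisfies assumption $(A_2)$ of the context. Then the singularity of $u$ at $\Gamma$ is removable.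
   Context: Setting. $N\ge 3$, $d\in\{1,\dots,N-2\}$, $R\in(0,\infty]$, $B_R^+=\{(x_{d+1},\dots,x_N)\in\mathbb{R}^{N-1-d}\times(0,\infty): |(x_{d+1},\dots,x_N)|<R\}$, $\Omega=\mathbb{R}^d\times B_R^+$, $\Gamma=\{x\in\mathbb{R}^N: x_{d+1}=\cdots=x_N=0\}$. When $d=0$, $\Omega=B_R^+$ and $\Gamma=\{0\}$ (the variable $x''$ is then absent). Write $x'=(x_{d+1},\dots,x_N)$, $x''=(x_1,\dots,x_d)$. Put $\vartheta_\alpha(x)=(1+|x|)^{-\alpha}$, $d\vartheta_\alpha=\vartheta_\alpha\,dx$ on $\Omega$, and $d\vartheta_\beta=(1+|x|)^{-\beta}dS$ on $\partial\Omega$ with $dS$ surface measure; $\nu$ is the outward unit normal; boundary values are in the sense of traces. Structure conditions. $A:\mathbb{R}^N\to\mathbb{R}^N$, $g,b:\mathbb{R}\to\mathbb{R}$ are measurable, with $g,b$ locally bounded. $(H_1)$: $A(\eta)\cdot\eta\ge\mu|\eta|^p$ and $|A(\eta)|\le\mu^{-1}|\eta|^{p-1}$ for all $\eta\in\mathbb{R}^N$; $g(u)\operatorname{sign}u\ge|u|^q$ and $b(u)\operatorname{sign}u\ge\mu_1|u|^{p-1}$ for all $u\in\mathbb{R}$; where $p\in(1,N)$, $\alpha,\beta\in[0,N)$, $p-1\le\beta-\alpha$, $q-p+1>0$, $\mu>0$, $\mu_1\ge0$. $(H_2)$: $A(-\eta)=-A(\eta)$ for all $\eta\in\mathbb{R}^N$.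 Spaces. For a weight $w$ and open set $U$, $L^p(U;w)$ is the set of measurable $u$ with $\int_U|u|^pw\,dx<\infty$, and $W^{1,p}(U;w)=\{u\in L^p(U;w): |\nabla u|\in L^p(U;w)\}$. $W^{1,p}_{\mathrm{loc}}(\bar\Omega\setminus\Gamma;\vartheta_\alpha)$ is the set of $u:\Omega\to\mathbb{R}$ with $u\in W^{1,p}(U;\vartheta_\alpha)$ for every open $U\subset\Omega$ with $\bar U\cap\Gamma=\emptyset$; $L^\infty_{\mathrm{loc}}(\bar\Omega\setminus\Gamma)$ is defined similarly, and so are $W^{1,p}_{\mathrm{loc}}(\overline{B_R^+}\setminus\{0\};(1+|x'|)^{-\alpha})$ and $L^\infty_{\mathrm{loc}}(\overline{B_R^+}\setminus\{0\})$ (with $B_R^+$ and $\{0\}$ in place of $\Omega$ and $\Gamma$). Weak solution. $u\in W^{1,p}_{\mathrm{loc}}(\bar\Omega\setminus\Gamma;\vartheta_\alpha)\cap L^\infty_{\mathrm{loc}}(\bar\Omega\setminus\Gamma)$ is a weak solution in $\bar\Omega\setminus\Gamma$ if $$\int_\Omega\left(\langle A(\nabla u),\nabla\varphi\rangle+g(u)\varphi\right)d\vartheta_\alpha+\int_{\partial\Omega}b(u)\varphi\,d\vartheta_\beta=0\qquad( * )$$ for all $\varphi\in W^{1,p}_{\mathrm{loc}}(\bar\Omega\setminus\Gamma;\vartheta_\alpha)\cap L^\infty_{\mathrm{loc}}(\bar\Omega\setminus\Gamma)$ with $\operatorname{supp}\varphi\subset\bar\Omega\setminus\Gamma$. Removability.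 The singularity of $u$ at $\Gamma$ is removable if $u\in W^{1,p}(\Omega;\vartheta_\alpha)\cap L^\infty(\Omega)$ and $( * )$ holds for all $\varphi\in W^{1,p}(\Omega;\vartheta_\alpha)\cap L^\infty(\Omega)$. Assumption $(A_2)$. There are a number $q_1$ with $0<q_1<\frac{(N-d)(q-p+1)-pq}{2p}$ and functions $u_1\in W^{1,p}_{\mathrm{loc}}(\overline{B_R^+}\setminus\{0\};(1+|x'|)^{-\alpha})\cap L^\infty_{\mathrm{loc}}(\overline{B_R^+}\setminus\{0\})$ and $u_2\in W^{1,p}(\mathbb{R}^d;(1+|x''|)^{-\alpha})\cap L^{q+1}(\mathbb{R}^d;(1+|x''|)^{-\alpha})\cap L^{q_1}(\mathbb{R}^d;(1+|x''|)^{-\alpha})\cap L^\infty(\mathbb{R}^d)$ such that $u(x)=u_1(x')u_2(x'')$ and $u_2(x'')>0$ for every $x\in\Omega$, and $(u_2+|\nabla u_2|)^{p-1}\in L^1(\mathbb{R}^d;(1+|x''|)^{-\alpha})$. *)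

(* Defs.v *)
From HB Require Import structures.
From mathcomp Require Import all_boot all_order all_algebra.
From mathcomp Require Import all_classical all_reals all_analysis.
Set Implicit Arguments. Unset Strict Implicit. Unset Printing Implicit Defensive.
Import Order.TTheory GRing.Theory Num.Theory.
Import numFieldNormedType.Exports.
Local Open Scope classical_set_scope.
Local Open Scope ring_scope.

(* The Borel sigma-algebra of R^n, generated by the coordinate projections, and
   n-dimensional Lebesgue measure on it (iterated product measure).  L^p and
   Sobolev functions are a.e.-classes, and every class of Lebesgue measurable
   functions has a Borel representative, so "measurable" is Borel throughout. *)
Definition rV_display : measure_display. Proof. exact: default_measure_display. Qed.

Section rV_measurable.
Context {R : realType} (n : nat).
Let coords : 'I_n -> 'rV[R]_n -> R := fun i x => x ord0 i.
Let rV_set0 : g_sigma_preimage coords set0.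
Proof. exact: sigma_algebra0. Qed.
Let rV_setC A : g_sigma_preimage coords A -> g_sigma_preimage coords (~` A).
Proof. exact: sigma_algebraC. Qed.
Let rV_bigcup (F : _^nat) : (forall i, g_sigma_preimage coords (F i)) ->
  g_sigma_preimage coords (\bigcup_i (F i)).
Proof. exact: sigma_algebra_bigcup. Qed.
HB.instance Definition _ := @isMeasurable.Build rV_display
  'rV[R]_n (g_sigma_preimage coords) rV_set0 rV_setC rV_bigcup.
End rV_measurable.

Lemma measurable_fun_rVP d (T : measurableType d) (R : realType) n
    (f : T -> 'rV[R]_n) :
  measurable_fun setT f <-> forall i, measurable_fun setT (fun t => f t ord0 i).
Proof.
pose c (i : 'I_n) (x : 'rV[R]_n) : R := x ord0 i.
apply: (@iff_trans _ (g_sigma_preimage (fun i => c i \o f) `<=` measurable)).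
  rewrite g_sigma_preimage_comp; split=> [mf A [/= C preC <-]|prefS].
    exact: mf.
  by move=> _ A mA; apply: prefS; exists A.
split=> [cfS i|mf].
- move=> _ A mA; apply: cfS; apply: sub_sigma_algebra.
  case: n i => [[] []//|n i] in f c *.
  rewrite -bigcup_mkord_ord; exists i; first exact: ltn_ord.
  by exists A => //; rewrite inord_val.
- apply: smallest_sub; first exact: sigma_algebra_measurable.
  case: n => [|n] in f c mf *; first by rewrite big_ord0.
  rewrite -bigcup_mkord_ord; apply: bigcup_sub => i Ii.
  by move=> A [B mB <-]; exact: mf.
Qed.

Lemma measurable_rV_coord (R : realType) n (i : 'I_n) :
  measurable_fun setT (fun x : 'rV[R]_n => x ord0 i).
Proof.
by have /measurable_fun_rVP := @measurable_id _ 'rV[R]_n setT; exact.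
Qed.

Definition cons_rV (R : realType) n (z : measurableTypeR R * 'rV[R]_n) :
  'rV[R]_n.+1 := row_mx (const_mx z.1) z.2 : 'rV[R]_(1 + n).

Lemma measurable_cons_rV (R : realType) n :
  measurable_fun setT (@cons_rV R n).
Proof.
apply/measurable_fun_rVP => i.
have [j ->|j ->] := @split_ordP 1 n i.
  rewrite (_ : (fun _ => _) = fst); first exact: measurable_fst.
  by apply/funext => z; rewrite /cons_rV (@row_mxEl _ 1 1 n) mxE.
rewrite (_ : (fun _ => _) = (fun x : 'rV_n => x ord0 j) \o snd).
  by apply: (measurableT_comp (measurable_rV_coord j)); exact: measurable_snd.
by apply/funext => z; rewrite /cons_rV (@row_mxEr _ 1 1 n).
Qed.

Lemma measurable_behead_rV (R : realType) n :
  measurable_fun setT (fun x : 'rV[R]_n.+1 => rsubmx (x : 'rV_(1 + n))).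
Proof.
apply/measurable_fun_rVP => i.
rewrite (_ : (fun _ => _) = (fun x : 'rV_n.+1 => x ord0 (rshift 1 i : 'I_n.+1))).
  exact: measurable_rV_coord.
by apply/funext => x; rewrite mxE.
Qed.

Lemma sigma_finite_prod d1 d2 (T1 : measurableType d1) (T2 : measurableType d2)
    (R : realType) (m1 : {sigma_finite_measure set T1 -> \bar R})
    (m2 : {sigma_finite_measure set T2 -> \bar R}) :
  sigma_finite setT (m1 \x m2)%E.
Proof.
have /sigma_finiteP[F [TF ndF Foo]] := sigma_finiteT m1.
have /sigma_finiteP[G [TG ndG Goo]] := sigma_finiteT m2.
exists (fun n => F n `*` G n).
  rewrite -setXTT TF TG predeqE => -[x y]; split.
    move=> [/= [n _ Fnx] [k _ Gky]]; exists (maxn n k) => //; split.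
    - by move: x Fnx; exact/subsetPset/ndF/leq_maxl.
    - by move: y Gky; exact/subsetPset/ndG/leq_maxr.
  by move=> [n _ []/= ? ?]; split; exists n.
move=> k; have [? ?] := Foo k; have [? ?] := Goo k.
split; first exact: measurableX.
by rewrite product_measure1E// lte_mul_pinfty// ge0_fin_numE.
Qed.

Section lebesgue_rV_succ.
Context (R : realType) (n : nat).
Variable m : {sigma_finite_measure set 'rV[R]_n -> \bar R}.

Definition lebesgue_rV_succ :=
  pushforward (@lebesgue_measure R \x m)%E (@cons_rV R n).

Let lebesgue_rV_succ0 : lebesgue_rV_succ set0 = 0%E.
Proof. by rewrite /lebesgue_rV_succ /pushforward preimage_set0 measure0. Qed.

Let lebesgue_rV_succ_ge0 A : (0 <= lebesgue_rV_succ A)%E.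
Proof. by rewrite /lebesgue_rV_succ /pushforward measure_ge0. Qed.

Let measurable_preimage_cons_rV (A : set 'rV[R]_n.+1) :
  measurable A -> measurable (@cons_rV R n @^-1` A).
Proof. by move=> mA; rewrite -[X in measurable X]setTI; exact: measurable_cons_rV. Qed.

Let lebesgue_rV_succ_sigma_additive : semi_sigma_additive lebesgue_rV_succ.
Proof.
move=> F mF tF mUF; rewrite /lebesgue_rV_succ /pushforward preimage_bigcup.
apply: measure_semi_sigma_additive.
- by move=> k; exact: measurable_preimage_cons_rV.
- apply/trivIsetP => i j _ _ ij; rewrite -preimage_setI.
  by move/trivIsetP : tF => /(_ _ _ _ _ ij) ->//; rewrite preimage_set0.
- by rewrite -preimage_bigcup; exact: measurable_preimage_cons_rV.
Qed.

HB.instance Definition _ := isMeasure.Build _ _ _ lebesgue_rV_succ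
  lebesgue_rV_succ0 lebesgue_rV_succ_ge0 lebesgue_rV_succ_sigma_additive.

Let lebesgue_rV_succ_sigma_finite : sigma_finite setT lebesgue_rV_succ.
Proof.
have [F TF Foo] := sigma_finite_prod (@lebesgue_measure R) m.
pose g (x : 'rV[R]_n.+1) : measurableTypeR R * 'rV[R]_n :=
  (x ord0 ord0, rsubmx (x : 'rV_(1 + n))).
have mg : measurable_fun setT g.
  apply/measurable_fun_pairP; split.
    exact: measurable_rV_coord.
  exact: measurable_behead_rV.
have fgK z : g (cons_rV z) = z.
  case: z => a b; rewrite /g /cons_rV; congr pair; last exact: row_mxKr.
  transitivity ((row_mx (const_mx a : 'M[R]_(1, 1)) b) ord0 (lshift n ord0)).
    by congr (fun_of_matrix _ _ _); exact/val_inj.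
  by rewrite row_mxEl mxE.
exists (fun k => g @^-1` F k).
  by rewrite -preimage_bigcup -TF preimage_setT.
move=> k; have [mF Fk] := Foo k; split.
  by rewrite -[X in measurable X]setTI; exact: mg.
rewrite /lebesgue_rV_succ /pushforward -comp_preimage.
by rewrite (_ : g \o _ = id)//; apply/funext => z /=; rewrite fgK.
Qed.

HB.instance Definition _ := @Measure_isSigmaFinite.Build _ _ _ lebesgue_rV_succ
  lebesgue_rV_succ_sigma_finite.

End lebesgue_rV_succ.

Fixpoint lebesgue_rV (R : realType) (n : nat) :
    {sigma_finite_measure set 'rV[R]_n -> \bar R} :=
  if n is n'.+1 then lebesgue_rV_succ (lebesgue_rV R n')
  else dirac (0 : 'rV[R]_0).

Section calculus.
Context {R : realType} {n : nat}.
Implicit Types (x y : 'rV[R]_n) (f phi u : 'rV[R]_n -> R) (U : set 'rV[R]_n).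

(* The library norm on 'rV[R]_n is the sup norm. *)
Definition dotrV x y : R := \sum_(i < n) x ord0 i * y ord0 i.
Definition enorm x : R := Num.sqrt (dotrV x x).

Definition partial (i : 'I_n) f x : R := 'D_(delta_mx ord0 i) f x.
Definition gradient f x : 'rV[R]_n := \row_(i < n) partial i f x.

Fixpoint C_k (m : nat) f : Prop :=
  if m is m'.+1 then
    continuous f /\ forall i : 'I_n,
      (forall x, derivable f x (delta_mx ord0 i)) /\ C_k m' (partial i f)
  else continuous f.
Definition smooth f : Prop := forall m, C_k m f.

Definition test_function U phi : Prop :=
  [/\ smooth phi, compact (closure [set x | phi x != 0]) &
      closure [set x | phi x != 0] `<=` U].

Definition L1_loc U f : Prop :=
  measurable_fun U f /\
  forall K, compact K -> K `<=` U ->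
    (lebesgue_rV R n).-integrable K (EFin \o f).

Definition is_weak_gradient U u (G : 'rV[R]_n -> 'rV[R]_n) : Prop :=
  L1_loc U u /\ forall i : 'I_n, L1_loc U (fun x => G x ord0 i) /\
    forall phi, test_function U phi ->
      (\int[lebesgue_rV R n]_(x in U) (u x * partial i phi x)%:E =
       - \int[lebesgue_rV R n]_(x in U) (G x ord0 i * phi x)%:E)%E.

(* A representative of the a.e.-unique weak gradient (0 if there is none). *)
Definition weak_gradient U u : 'rV[R]_n -> 'rV[R]_n :=
  xget (cst 0) [set G | is_weak_gradient U u G].

Definition Lp (p : R) (w : 'rV[R]_n -> R) U u : Prop :=
  measurable_fun U u /\
  (\int[lebesgue_rV R n]_(x in U) (`|u x| `^ p * w x)%:E < +oo)%E.

Definition Linfty U u : Prop :=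
  measurable_fun U u /\
  exists M : R, {ae lebesgue_rV R n, forall x, U x -> `|u x| <= M}.

Definition W1p (p : R) (w : 'rV[R]_n -> R) U u : Prop :=
  [/\ Lp p w U u, exists G, is_weak_gradient U u G &
      Lp p w U (fun x => enorm (weak_gradient U u x))].

(* F_loc(closure Om \ K), for a function space F. *)
Definition locally_off (F : set 'rV[R]_n -> ('rV[R]_n -> R) -> Prop)
    (Om K : set 'rV[R]_n) u : Prop :=
  forall U, open U -> U `<=` Om -> closure U `&` K = set0 -> F U u.

Definition topo_boundary U : set 'rV[R]_n := closure U `\` interior U.

(* v is the trace on the boundary of Om, away from K, of u, which is locally
   W^{1,p} on closure Om \ K; S is surface measure on the boundary.  Near any
   bounded V whose closure misses K, v is the L^p-limit of the restrictions of
   smooth functions that converge to u in W^{1,p}(Om `&` V); weights are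
   irrelevant as they are bounded above and away from 0 on V. *)
Definition is_trace (p : R) (S : set 'rV[R]_n -> \bar R)
    (Om K : set 'rV[R]_n) u (v : 'rV[R]_n -> R) : Prop :=
  measurable_fun (topo_boundary Om) v /\
  forall V, open V -> (exists M : R, forall x, V x -> enorm x <= M) ->
    closure V `&` K = set0 ->
  exists f : nat -> 'rV[R]_n -> R,
    [/\ forall j, smooth (f j),
        (\int[lebesgue_rV R n]_(x in Om `&` V) (`|f j x - u x| `^ p)%:E)%E
          @[j --> \oo] --> 0%E,
        (\int[lebesgue_rV R n]_(x in Om `&` V)
          (enorm (gradient (f j) x - weak_gradient Om u x) `^ p)%:E)%E
          @[j --> \oo] --> 0%E &
        (\int[S]_(x in topo_boundary Om `&` V) (`|f j x - v x| `^ p)%:E)%E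
          @[j --> \oo] --> 0%E].

Definition trace p S Om K u : 'rV[R]_n -> R :=
  xget (cst 0) [set v | is_trace p S Om K u v].

(* (1 + |x|)^(-a) *)
Definition weight (a : R) x : R := (1 + enorm x) `^ (- a).

(* The point (y, t) of R^n, for y in R^(n-1) and t real. *)
Definition snoc_rV (y : 'rV[R]_n.-1) (t : R) : 'rV[R]_n :=
  \row_(j < n) oapp (fun i : 'I_n.-1 => y ord0 i) t (insub (val j)).

End calculus.

(* Surface measure of the graph x_n = psi(x_1, .., x_(n-1)) over D. *)
Definition graph_measure (R : realType) (n : nat) (D : set 'rV[R]_n.-1)
    (psi : 'rV[R]_n.-1 -> R) (B : set 'rV[R]_n) : \bar R :=
  (\int[lebesgue_rV R n.-1]_(y in D `&` [set y | B (snoc_rV y (psi y))])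
    (Num.sqrt (1 + enorm (gradient psi y) ^+ 2))%:E)%E.

(* Conventions: R^N is 'rV[R]_(d + k) with N = d + k; for x in R^N, lsubmx x is
   x'' = (x_1, .., x_d) and rsubmx x is x' = (x_(d+1), .., x_N); r : \bar R is
   the radius. *)
Section domain.
Context {R : realType}.

Definition half_ball (k : nat) (r : \bar R) : set 'rV[R]_k :=
  [set y | ((enorm y)%:E < r)%E /\
           forall j : 'I_k, val j = k.-1 -> 0 < y ord0 j].

Variables (d k : nat) (r : \bar R).

Definition Omega : set 'rV[R]_(d + k) :=
  [set x | half_ball r (rsubmx x)].

Definition Gamma : set 'rV[R]_(d + k) := [set x | rsubmx x = 0].

(* |(x_(d+1), .., x_(N-1))| as a function of (x_1, .., x_(N-1)) *)
Definition flat_radius (y : 'rV[R]_(d + k).-1) : R :=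
  enorm (rsubmx (snoc_rV y 0 : 'rV[R]_(d + k))).

(* Up to the null set {x_N = 0, |x'| = r}, the boundary of Omega is the union of
   the graphs of 0 and, if r is finite, of the half-sphere
   x_N = sqrt (r^2 - x_(d+1)^2 - .. - x_(N-1)^2), over the same base. *)
Definition surface_base : set 'rV[R]_(d + k).-1 :=
  [set y | ((flat_radius y)%:E < r)%E].

Definition surface_measure (B : set 'rV[R]_(d + k)) : \bar R :=
  (graph_measure surface_base (fun=> 0%R) B +
   if r is r0%:E then
     graph_measure surface_base
       (fun y => Num.sqrt (r0 ^+ 2 - flat_radius y ^+ 2)%R) B
   else 0)%E.

End domain.
Arguments Omega {R} d k r.
Arguments Gamma {R} d k.
Arguments surface_measure {R} d k r.

Section equation.
Context {R : realType}.

Definition locally_bounded (f : R -> R) : Prop :=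
  forall t : R, exists C : R, \forall s \near t, `|f s| <= C.

Definition cond_H1 (n : nat) (A : 'rV[R]_n -> 'rV[R]_n) (g b : R -> R)
    (p q alpha beta mu mu1 : R) : Prop :=
  [/\ measurable_fun setT A, measurable_fun setT g /\ locally_bounded g &
      measurable_fun setT b /\ locally_bounded b] /\
  [/\ forall eta, mu * enorm eta `^ p <= dotrV (A eta) eta,
      forall eta, enorm (A eta) <= mu^-1 * enorm eta `^ (p - 1),
      forall t, `|t| `^ q <= g t * Num.sg t &
      forall t, mu1 * `|t| `^ (p - 1) <= b t * Num.sg t] /\
  [/\ 1 < p < n%:R, 0 <= alpha < n%:R & 0 <= beta < n%:R] /\
  [/\ p - 1 <= beta - alpha, 0 < q - p + 1, 0 < mu & 0 <= mu1].

Definition cond_H2 (n : nat) (A : 'rV[R]_n -> 'rV[R]_n) : Prop :=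
  forall eta, A (- eta) = - A eta.

Context {d k : nat}.
Variables (r : \bar R) (A : 'rV[R]_(d + k) -> 'rV[R]_(d + k)) (g b : R -> R).
Variables (p q alpha beta : R).
Implicit Types u phi : 'rV[R]_(d + k) -> R.

Let Om := Omega d k r.
Let dx := lebesgue_rV R (d + k).
Let dS := surface_measure d k r.

(* The weak formulation tested with phi; its integrals must converge.  Boundary
   values are traces away from K. *)
Definition weak_identity (K : set 'rV[R]_(d + k)) u phi : Prop :=
  let tr := trace p dS Om K in
  let F x := ((dotrV (A (weak_gradient Om u x)) (weak_gradient Om phi x)
               + g (u x) * phi x) * weight alpha x)%:E in
  let B x := (b (tr u x) * tr phi x * weight beta x)%:E in
  [/\ dx.-integrable Om F, dS.-integrable (topo_boundary Om) B &
      (\int[dx]_(x in Om) F x + \int[dS]_(x in topo_boundary Om) B x = 0)%E].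

Definition weak_solution u : Prop :=
  [/\ locally_off (W1p p (weight alpha)) Om (Gamma d k) u,
      locally_off Linfty Om (Gamma d k) u &
      forall phi,
        locally_off (W1p p (weight alpha)) Om (Gamma d k) phi ->
        locally_off Linfty Om (Gamma d k) phi ->
        closure (Om `&` [set x | phi x != 0]) `<=` closure Om `\` Gamma d k ->
        weak_identity (Gamma d k) u phi].

Definition removable u : Prop :=
  [/\ W1p p (weight alpha) Om u, Linfty Om u &
      forall phi, W1p p (weight alpha) Om phi -> Linfty Om phi ->
        weak_identity set0 u phi].

Definition cond_A2 u : Prop :=
  exists (q1 : R) (u1 : 'rV[R]_k -> R) (u2 : 'rV[R]_d -> R),
  [/\ 0 < q1 < (k%:R * (q - p + 1) - p * q) / (2 * p),
      locally_off (W1p p (weight alpha)) (half_ball r) [set 0] u1 /\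
      locally_off Linfty (half_ball r) [set 0] u1,
      [/\ W1p p (weight alpha) setT u2, Lp (q + 1) (weight alpha) setT u2,
          Lp q1 (weight alpha) setT u2 & Linfty setT u2],
      forall x, Om x ->
        u x = u1 (rsubmx x) * u2 (lsubmx x) /\ 0 < u2 (lsubmx x) &
      Lp 1 (weight alpha) setT
        (fun y => (u2 y + enorm (weak_gradient setT u2 y)) `^ (p - 1))].

End equation.

(* Main.v *)
Require Import Defs.
From HB Require Import structures.
From mathcomp Require Import all_boot all_order all_algebra.
From mathcomp Require Import all_classical all_reals all_analysis.
From mathcomp Require Import measurable_realfun lebesgue_integral_under hoelder.
From mathcomp Require Import ring lra.
Set Implicit Arguments. Unset Strict Implicit. Unset Printing Implicit Defensive.
Import Order.TTheory GRing.Theory Num.Theory.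
Import numFieldNormedType.Exports.
Local Open Scope classical_set_scope.
Local Open Scope ring_scope.

(** Write [k] for the codimension [N - d] of [Gamma], [x'] for the last [k]
    coordinates and [x''] for the first [d]. The dimension condition and
    [q / (q - p + 1) >= 1] give [p < k], so [Gamma] has zero [p]-capacity. This
    removes singularities of solutions that are already bounded with a gradient
    in L^p up to [Gamma], and that regularity follows from separation of
    variables.

    Regularity. The class of functions that are Sobolev and bounded off [Gamma]
    tests every open set whose closure misses [Gamma], bounded or not. Among
    these are the cusps, unions over [n] of the regions
    [|x''| > n, |x'| > eps n], where the radii [eps n] may decrease at any
    speed. Since [u = u1(x') u2(x'')] with [u2] positive everywhere, a
    singularity of [u1] at [0] would be seen at every point of [Gamma], in
    particular far away, where the radius can be adapted to it. If [u1] were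
    unbounded, or its gradient not in L^p near [0], some cusp would carry an
    unbounded [u], or an infinite integral of the [p]th power of its gradient
    ([bounded_of_cusps], [gradient_fin_of_cusps]). Hence [u] is bounded and in
    the weighted Sobolev space of [Om] ([sobolev_of_product], with the weak
    gradient of a product from [weak_grad_prod]).

    Passing to the limit. For a bounded Sobolev function [phi] the function
    [phi * eta] is admissible in the equation off [Gamma] when the smooth cutoff
    [eta] vanishes near [Gamma]. As [Gamma] is unbounded, [1 - eta] is a locally
    finite sum of bumps, one for each bounded patch of [Gamma], whose radii are
    chosen independently ([patch_cut], [cutoff]). The gradient of a bump of
    radius [s] is of size [1 / s] on a set of measure of order [s ^+ k], so that
    its [p]th power has small integral ([gradient_patch_cvg0]). The flux term is
    controlled by the growth condition on [A], and the terms lost near [Gamma]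
    by dominated convergence. With geometrically small costs for the patches,
    the identity holds for [phi] up to an arbitrarily small error
    ([integral_le_geometric], [integral_perturb], [weak_identity_of_cutoff]).

    Boundary values. A trace is only defined as some function to which smooth
    approximations converge, on bounded sets whose closure misses the singular
    set, and the equation off [Gamma] and the one to be proved refer to
    different choices. The comparison rests on three facts. Traces off [Gamma]
    are unique almost everywhere, by an inequality along vertical segments
    ([trace_le], [trace_unique]). Bounded Sobolev functions have bounded traces
    up to [Gamma] ([trace_exists]); the smooth approximations come from
    mollification after an affine map pushing [Om] into itself
    ([smooth_approx]). Traces are compatible with multiplication by [eta]
    ([is_trace_mul]). All of this takes place in the surface measure of the two
    graphs that form the boundary, which is finite on bounded sets and does not
    charge [Gamma]. *)

(** * Borel sets of R^n *)

(** The metric is that of the supremum norm, whose balls are products of intervals;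
    an open set is a countable union of balls with rational centers. *)
Lemma open_measurable_rV (R : realType) n (U : set 'rV[R]_n) : open U -> measurable U.
Proof.
move=> oU.
have mball (c : 'rV[R]_n) e : measurable (ball c e : set 'rV[R]_n).
  have [e0|e0] := leP e 0.
    rewrite (_ : ball c e = set0)//; apply/seteqP; split => // x [].
    by rewrite ltNge e0.
  rewrite (_ : ball c e =
     \bigcap_(i in [set` [set: 'I_n]]) (fun x : 'rV[R]_n => x ord0 i) @^-1` ball (c ord0 i) e).
    apply: fin_bigcap_measurable => // i _; rewrite -[X in measurable X]setTI.
    apply: measurable_rV_coord => //; apply: open_measurable; exact: ball_open.
  apply/seteqP; split => x.
    by move=> [_ h] i _ ; exact: h.
  move=> h; split => // i j; rewrite (ord1 i); by apply: (h j); rewrite /= inE.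
pose B (k : 'rV[rat]_n * nat) : set 'rV[R]_n := ball (map_mx ratr k.1 : 'rV[R]_n) (k.2.+1%:R^-1).
rewrite (_ : U = \bigcup_(k in [set k | B k `<=` U]) B k).
  rewrite bigcup_mkcond; apply: countable_bigcupT_measurable => [|k].
    exact: countableP.
  by case: ifPn => // _; exact: mball.
apply/seteqP; split; last by move=> x [k]; exact.
move=> x Ux.
have /nbhs_ballP[e /= e0 eU] : nbhs x U by apply: open_nbhs_nbhs; split.
have [m me] : exists m : nat, (m.+1%:R^-1 : R) < e / 2.
  by have [m _ /(_ m (leqnn m))] := near_infty_natSinv_lt (PosNum (divr_gt0 e0 (ltr0n _ 2))); exists m.
have hq i : exists q : rat, x ord0 i - m.+1%:R^-1 < ratr q < x ord0 i + m.+1%:R^-1.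
  have [|q] := @rat_in_itvoo R (x ord0 i - m.+1%:R^-1) (x ord0 i + m.+1%:R^-1).
    by rewrite ltrD2l gtrN ?invr_gt0.
  by rewrite in_itv /= => hq0; exists q.
have [q Hq] := choice hq.
pose c : 'rV[rat]_n := \row_i q i.
have xc : B (c, m) x.
  split=> [|i j]; first by rewrite /= invr_gt0.
  rewrite (ord1 i) !mxE; have := Hq j; rewrite -ltr_distl => h; rewrite /ball /=; exact: h.
exists (c, m) => // y [_ hy]; apply: eU; split => // i j.
rewrite (ord1 i).
have h2 : `|map_mx ratr c ord0 j - x ord0 j| < m.+1%:R^-1 by exact: (xc.2 ord0 j).
have h1 : `|map_mx ratr c ord0 j - y ord0 j| < m.+1%:R^-1 by exact: (hy ord0 j).
rewrite /ball /= [e]splitr (le_lt_trans (ler_distD (map_mx ratr c ord0 j) _ _))//.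
by rewrite ltrD// ?(lt_trans h1)// distrC (lt_trans h2).
Qed.

Lemma closed_measurable_rV (R : realType) n (U : set 'rV[R]_n) : closed U -> measurable U.
Proof. by move=> cU; rewrite -[U]setCK; apply: measurableC; apply: open_measurable_rV; exact: closed_openC. Qed.

Lemma open_continuous_measurable_rV (R : realType) n (D : set 'rV[R]_n) (f : 'rV[R]_n -> R) :
  open D -> {in D, continuous f} -> measurable_fun D f.
Proof.
move=> oD cf mD; apply: (measurability _ (RGenOpens.measurableE R)) => //.
move=> _ [_ [a [b ->] <-]]; apply: open_measurable_rV.
rewrite openE => x [Dx fx]; near=> y; split.
  by near: y; apply: open_nbhs_nbhs.
near: y; apply: (cf x); first by rewrite inE.
by apply: open_nbhs_nbhs; split => //; exact: interval_open.
Unshelve. all: by end_near. Qed.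

Lemma continuous_measurable_rV (R : realType) n (f : 'rV[R]_n -> R) :
  continuous f -> measurable_fun setT f.
Proof. by move=> cf; apply: open_continuous_measurable_rV => [|x _]; [exact: openT|exact: cf]. Qed.

(** * Tonelli's theorem for iterated and split variables *)

Section tonelli.
Context {R : realType}.
Local Open Scope ereal_scope.
Local Notation mu := (@lebesgue_measure R).
Local Notation L n := (lebesgue_rV R n).

Lemma cons_rV0 n (z : measurableTypeR R * 'rV[R]_n) : cons_rV z ord0 ord0 = z.1.
Proof.
transitivity ((row_mx (const_mx z.1 : 'M[R]_(1, 1)) z.2) ord0 (lshift n ord0)).
  by congr (fun_of_matrix _ _ _); exact/val_inj.
by rewrite row_mxEl mxE.
Qed.

Lemma cons_rVS n (z : measurableTypeR R * 'rV[R]_n) (j : 'I_n) :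
  cons_rV z ord0 (lift ord0 j) = z.2 ord0 j.
Proof.
transitivity ((row_mx (const_mx z.1 : 'M[R]_(1, 1)) z.2) ord0 (rshift 1 j)).
  by congr (fun_of_matrix _ _ _); exact/val_inj.
by rewrite row_mxEr.
Qed.

Lemma measurable_cons_rV_pair n (t : R) :
  measurable_fun setT (fun y : 'rV[R]_n => cons_rV (t, y)).
Proof.
apply/measurable_fun_rVP => i; have [j0 ->|j ->] := split_ordP (i : 'I_(1 + n)).
  rewrite (ord1 j0) (_ : lshift _ ord0 = ord0); last exact/val_inj.
  by under eq_fun do rewrite cons_rV0; exact: measurable_cst.
rewrite (_ : rshift 1 j = lift ord0 j); last exact/val_inj.
by under eq_fun do rewrite cons_rVS; exact: measurable_rV_coord.
Qed.

Lemma integral_rV0 (f : 'rV[R]_0 -> \bar R) : \int[L 0]_x f x = f 0%R.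
Proof.
rewrite /= (_ : f = cst (f 0%R)); last first.
  by apply/funext => x; rewrite (thinmx0 x).
by rewrite integral_cst//= diracT mule1.
Qed.

Lemma ge0_integral_cons n (f : 'rV[R]_n.+1 -> \bar R) :
  measurable_fun setT f -> (forall x, 0 <= f x) ->
  \int[L n.+1]_x f x = \int[mu]_t \int[L n]_y f (cons_rV (t, y)).
Proof.
move=> mf f0.
rewrite -[LHS]/(\int[pushforward (mu \x L n) (@cons_rV R n)]_x f x).
rewrite ge0_integral_pushforward//; last exact: measurable_cons_rV.
rewrite preimage_setT fubini_tonelli1//.
- by apply: measurableT_comp => //; exact: measurable_cons_rV.
- by move=> z; exact: f0.
Qed.

Lemma measurable_row_mx d k :
  measurable_fun setT (fun z : 'rV[R]_d * 'rV[R]_k => row_mx z.1 z.2).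
Proof.
apply/measurable_fun_rVP => i; have [j ->|j ->] := split_ordP i.
  under eq_fun do rewrite row_mxEl.
  by apply: (measurableT_comp (measurable_rV_coord j)); exact: measurable_fst.
under eq_fun do rewrite row_mxEr.
by apply: (measurableT_comp (measurable_rV_coord j)); exact: measurable_snd.
Qed.

Lemma cons_row_mx d k (t : R) (a : 'rV[R]_d) (b : 'rV[R]_k) :
  cons_rV (t, row_mx a b) = row_mx (cons_rV (t, a) : 'rV[R]_d.+1) b :> 'rV[R]_(d.+1 + k).
Proof.
apply/rowP => i; have [j ->|j ->] := split_ordP i.
  rewrite row_mxEl; have [j0 ->|{}j ->] := split_ordP (j : 'I_(1 + d)).
    rewrite (ord1 j0) (_ : lshift d ord0 = ord0); last exact/val_inj.
    by rewrite (_ : lshift k ord0 = ord0) ?cons_rV0//; exact/val_inj.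
  rewrite (_ : rshift 1 j = lift ord0 j); last exact/val_inj.
  rewrite (_ : lshift k (lift ord0 j) = lift ord0 (lshift k j)); last exact/val_inj.
  by rewrite !cons_rVS /= row_mxEl.
rewrite row_mxEr (_ : rshift d.+1 j = lift ord0 (rshift d j)); last exact/val_inj.
by rewrite cons_rVS /= row_mxEr.
Qed.

(** The measure on R^n is built by prepending one coordinate at a time, so a split
    of the coordinates into two blocks follows by induction on the first block. *)
Lemma ge0_integral_row_mx d k (f : 'rV[R]_(d + k) -> \bar R) :
  measurable_fun setT f -> (forall x, 0 <= f x) ->
  \int[L (d + k)]_x f x = \int[L d]_a \int[L k]_b f (row_mx a b).
Proof.
elim: d f => [|d IH] f mf f0.
  by rewrite integral_rV0; apply: eq_integral => b _; rewrite row_thin_mx.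
rewrite (@ge0_integral_cons (d + k) f)// ge0_integral_cons//.
- apply: eq_integral => t _; rewrite IH; last by move=> x; exact: f0.
    by apply: eq_integral => a _; apply: eq_integral => b _; rewrite cons_row_mx.
  by apply: (measurableT_comp mf); exact: measurable_cons_rV_pair.
- apply: (@measurable_fun_fubini_tonelli_F _ _ _ _ _ (L k) (fun z => f (row_mx z.1 z.2))) => //.
  by apply: (measurableT_comp mf); exact: measurable_row_mx.
- by move=> x; apply: integral_ge0 => b _; exact: f0.
Qed.

Lemma measurable_snoc_rV n :
  measurable_fun setT (fun z : 'rV[R]_n * measurableTypeR R => @snoc_rV R n.+1 z.1 z.2).
Proof.
apply/measurable_fun_rVP => i; under eq_fun do rewrite mxE.
case: insubP => /= [j _ _|_]; last exact: measurable_snd.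
by apply: (measurableT_comp (measurable_rV_coord j)); exact: measurable_fst.
Qed.

Lemma snoc_rV_lt n (y : 'rV[R]_n) (t : R) (i : 'I_n.+1) (j : 'I_n) :
  i = j :> nat -> @snoc_rV R n.+1 y t ord0 i = y ord0 j.
Proof.
move=> ij; have h : (val i < n)%N by rewrite /= ij.
by rewrite mxE (insubT (fun k => k < n)%N h) /=; congr (y _ _); exact/val_inj.
Qed.

Lemma snoc_rV_max n (y : 'rV[R]_n) (t : R) (i : 'I_n.+1) :
  i = n :> nat -> @snoc_rV R n.+1 y t ord0 i = t.
Proof. by move=> ij; rewrite mxE insubF //= ij ltnn. Qed.

Lemma snoc_cons_rV n (s : R) (y : 'rV[R]_n) (t : R) :
  @snoc_rV R n.+2 (cons_rV (s, y)) t = cons_rV (s, @snoc_rV R n.+1 y t).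
Proof.
apply/rowP => i; have [j0 ->|j ->] := split_ordP (i : 'I_(1 + n.+1)).
  rewrite (ord1 j0) (_ : lshift _ ord0 = ord0) ?cons_rV0; last exact/val_inj.
  by rewrite (@snoc_rV_lt _ _ _ _ ord0)// cons_rV0.
rewrite (_ : rshift 1 j = lift ord0 j); last exact/val_inj.
rewrite cons_rVS /=; have [jn|] := ltnP j n.
  rewrite (@snoc_rV_lt _ _ _ _ (lift ord0 (Ordinal jn)))// cons_rVS /=.
  by rewrite (@snoc_rV_lt _ _ _ _ (Ordinal jn)).
rewrite leq_eqVlt ltnNge -ltnS ltn_ord orbF => /eqP nj.
by rewrite !snoc_rV_max//= /bump -nj.
Qed.

(** The same for the last coordinate, which is the one transversal to the flat part
    of the boundary: vertical segments are segments in this variable. *)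
Lemma ge0_integral_snoc n (f : 'rV[R]_n.+1 -> \bar R) :
  measurable_fun setT f -> (forall x, 0 <= f x) ->
  \int[L n.+1]_x f x = \int[L n]_y \int[mu]_t f (@snoc_rV R n.+1 y t).
Proof.
elim: n f => [|n IH] f mf f0.
  rewrite ge0_integral_cons// integral_rV0; apply: eq_integral => t _.
  rewrite integral_rV0; congr f; apply/rowP => i; rewrite (ord1 i) cons_rV0 mxE.
  by rewrite insubF.
rewrite ge0_integral_cons// [RHS]ge0_integral_cons//.
- apply: eq_integral => t _; rewrite IH; last by move=> x; exact: f0.
    by apply: eq_integral => a _; apply: eq_integral => b _; rewrite snoc_cons_rV.
  by apply: (measurableT_comp mf); exact: measurable_cons_rV_pair.
- apply: (@measurable_fun_fubini_tonelli_F _ _ _ _ _ mu (fun z => f (snoc_rV z.1 z.2))) => //.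
  by apply: (measurableT_comp mf); exact: measurable_snoc_rV.
- by move=> x; apply: integral_ge0 => b _; exact: f0.
Qed.

End tonelli.

(** * Smoothness along a family of directions, and a smooth step *)

Section directional_smoothness.
Context {R : realType} {V : normedModType R} {I : Type} (v : I -> V).
Implicit Types f g : V -> R.

(** Continuity of all iterated derivatives of order at most [m] along the directions
    [v i].  One notion serves functions on R, with the single direction [1], and
    functions on R^n, with the coordinate directions, and passes through affine maps
    that send directions to directions. *)
Fixpoint Cd (m : nat) f : Prop :=
  if m is m'.+1 then
    continuous f /\ forall i,
      (forall x, derivable f x (v i)) /\ Cd m' (fun x => 'D_(v i) f x)
  else continuous f.

Lemma Cd_pred m f : Cd m.+1 f -> Cd m f.
Proof.
elim: m f => [|m IH] f; first by case.
by move=> [cf df]; split => // i; have [dfi Ci] := df i; split => //; exact: IH.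
Qed.

Lemma eq_Cd m f g : f =1 g -> Cd m f -> Cd m g.
Proof. by move=> /funext ->. Qed.

Lemma CdD m f g : Cd m f -> Cd m g -> Cd m (fun x => f x + g x).
Proof.
elim: m f g => [|m IH] f g; first by move=> cf cg x; apply: cvgD; [exact: cf|exact: cg].
move=> [cf df] [cg dg]; split; first by move=> x; apply: cvgD; [exact: cf|exact: cg].
move=> i; have [dfi Cf] := df i; have [dgi Cg] := dg i; split.
  by move=> x; apply: (@derivableD _ _ _ f g).
apply: eq_Cd (IH _ _ Cf Cg) => x; by rewrite (@deriveD _ _ _ f g).
Qed.

Lemma CdM m f g : Cd m f -> Cd m g -> Cd m (fun x => f x * g x).
Proof.
elim: m f g => [|m IH] f g; first by move=> cf cg x; apply: cvgM; [exact: cf|exact: cg].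
move=> Hf Hg; have [cf df] := Hf; have [cg dg] := Hg.
split; first by move=> x; apply: cvgM; [exact: cf|exact: cg].
move=> i; have [dfi Cf] := df i; have [dgi Cg] := dg i; split.
  by move=> x; apply: (@derivableM _ _ f g).
apply: eq_Cd (CdD (IH _ _ (Cd_pred Hf) Cg) (IH _ _ (Cd_pred Hg) Cf)) => x.
by rewrite (@deriveM _ _ f g).
Qed.

Lemma Cd_cst m (c : R) : Cd m (fun=> c).
Proof.
elim: m c => [|m IH] c; first exact: cst_continuous.
split; first exact: cst_continuous.
move=> i; split => [x|]; first exact: derivable_cst.
by apply: eq_Cd (IH 0) => x; rewrite derive_cst.
Qed.

Lemma CdN m f : Cd m f -> Cd m (fun x => - f x).
Proof. by move=> Cf; apply: eq_Cd (CdM (Cd_cst m (-1)) Cf) => x; rewrite mulN1r. Qed.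

Lemma CdB m f g : Cd m f -> Cd m g -> Cd m (fun x => f x - g x).
Proof. by move=> Cf /CdN; exact: CdD. Qed.

(** By induction on [m], since the derivative of [1 / f] is [- f' / f^2]. *)
Lemma CdV m f : (forall x, f x != 0) -> Cd m f -> Cd m (fun x => (f x)^-1).
Proof.
move=> f0; have cV : continuous f -> continuous (fun x => (f x)^-1).
  by move=> cf x; apply: cvgV => //; exact: cf.
elim: m => [|m IH] //; move=> Hf; have [cf df] := Hf; split; first exact: cV.
move=> i; have [dfi Cf] := df i; split; first by move=> x; exact: derivableV.
have Cfi := IH (Cd_pred Hf).
apply: eq_Cd (CdM (CdN (CdM Cfi Cfi)) Cf) => x.
by rewrite deriveV// -expr2 exprVn.
Qed.

Lemma Cd_sum m (J : Type) (s : seq J) (F : J -> V -> R) :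
  (forall j, Cd m (F j)) -> Cd m (fun x => \sum_(j <- s) F j x).
Proof.
move=> CF; elim: s => [|j s IH].
  by apply: eq_Cd (Cd_cst m 0) => x; rewrite big_nil.
by apply: eq_Cd (CdD (CF j) IH) => x; rewrite big_cons.
Qed.

Lemma Cd_prod m (J : Type) (s : seq J) (F : J -> V -> R) :
  (forall j, Cd m (F j)) -> Cd m (fun x => \prod_(j <- s) F j x).
Proof.
move=> CF; elim: s => [|j s IH].
  by apply: eq_Cd (Cd_cst m 1) => x; rewrite big_nil.
by apply: eq_Cd (CdM (CF j) IH) => x; rewrite big_cons.
Qed.

Lemma Cd_local m f :
  (forall x : V, exists2 g : V -> R, Cd m g & \forall y \near x, g y = f y) -> Cd m f.
Proof.
have lc f' : (forall x : V, exists2 g : V -> R, continuous g & \forall y \near x, g y = f' y) -> continuous f'.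
  move=> H x; have [g cg gf] := H x.
  rewrite /continuous_at -(nbhs_singleton gf); apply: cvg_trans (cg x); exact: near_eq_cvg.
elim: m f => [|m IH] f H; first exact: lc.
split; first by apply: lc => x; have [g [cg _] gf] := H x; exists g.
move=> i; split.
  move=> x; have [g [cg dg] gf] := H x; apply: near_eq_derivable gf _.
  by have [+ _] := dg i; exact.
apply: IH => x; have [g [cg dg] gf] := H x; exists (fun x => 'D_(v i) g x).
  by have [] := dg i.
have /= := near_join gf; apply: filterS => y; exact: near_eq_derive.
Qed.

End directional_smoothness.

Section one_dim.
Context {R : realType}.
Definition smooth1 (k : R -> R) := forall m, Cd (fun=> 1 : R) (I := unit) m k.

Lemma smooth1_derivable k : smooth1 k -> forall t, derivable k t 1.
Proof. by move=> /(_ 1) [_ /(_ tt) []]. Qed.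
Lemma smooth1_derive k : smooth1 k -> smooth1 (derive1 k).
Proof.
move=> sk m; have [_ /(_ tt) [_ +]] := sk m.+1.
by apply: eq_Cd => x; rewrite derive1E.
Qed.
Lemma smooth1_continuous k : smooth1 k -> continuous k.
Proof. by move=> /(_ 0). Qed.

Lemma is_derive_comp_dir {V : normedModType R} (k : R -> R) (f : V -> R) (x v : V) :
  derivable k (f x) 1 -> derivable f x v ->
  is_derive x v (fun y => k (f y)) ((derive1 k) (f x) * 'D_v f x).
Proof.
move=> dk df.
pose g (h : R) := f (h *: v + x).
have dg : derivable g 0 1 := (derivable1P f x v).1 df.
have g0 : g 0 = f x by rewrite /g scale0r add0r.
have DE (F : V -> R) : 'D_v F x = derive1 (fun h => F (h *: v + x)) 0.
  rewrite /derive1 /derive; apply: (congr1 (fun q : R -> R => lim (q @ 0^'))).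
  by apply/funext => h /=; rewrite addr0 scale0r add0r.
have dk0 : derivable k (g 0) 1 by rewrite g0.
have dkg : differentiable (k \o g) 0.
  by apply: differentiable_comp; [exact: (derivable1_diffP g 0).1|exact: (derivable1_diffP k (g 0)).1].
apply: DeriveDef; first exact/(derivable1P (fun y => k (f y)) x v).2/(derivable1_diffP (k \o g) 0).2.
have e := derive1_comp dg dk0; rewrite g0 in e.
by rewrite (DE f) -/g -e (DE (fun y => k (f y))).
Qed.

Lemma Cd_comp {V : normedModType R} {I : Type} (v : I -> V) m (k : R -> R) (f : V -> R) :
  smooth1 k -> Cd v m f -> Cd v m (fun x => k (f x)).
Proof.
have cc k' f' : smooth1 k' -> continuous f' -> continuous (fun x : V => k' (f' x)).
  by move=> /smooth1_continuous ck cf x; apply: (@continuous_comp _ _ _ f' k'); [exact: cf|exact: ck].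
elim: m k f => [|m IH] k f sk; first by move=> cf; exact: cc.
move=> Hf; have [cf df] := Hf; split; first exact: cc.
have D i x : is_derive x (v i) (fun y => k (f y)) ((derive1 k) (f x) * 'D_(v i) f x).
  apply: is_derive_comp_dir; first exact: smooth1_derivable.
  by have [] := df i.
move=> i; split; first by move=> x; have [] := D i x.
apply: eq_Cd (CdM (IH _ _ (smooth1_derive sk) (Cd_pred Hf)) (df i).2) => x.
by rewrite derive_val.
Qed.

(** The negative powers of [t] are carried along because the family they form is
    closed under differentiation, which makes smoothness an induction. *)
Definition flat_exp (n : nat) (t : R) : R := if 0 < t then t ^- n * expR (- t^-1) else 0.

(** From [exp(1/t) >= (1/t)^(n+1) / (n+1)!]; it gives both the continuity at [0]
    of the whole family and the vanishing of the derivatives there. *)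
Lemma flat_exp_bound n t : `|flat_exp n t| <= n.+1`!%:R * `|t|.
Proof.
rewrite /flat_exp; case: ifPn => [t0|_]; last by rewrite normr0 mulr_ge0.
rewrite ger0_norm; last by rewrite mulr_ge0 ?expR_ge0// invr_ge0 exprn_ge0// ltW.
rewrite gtr0_norm// expRN -lef_pV2 ?posrE; last 2 first.
- by rewrite mulr_gt0// ltr0n fact_gt0.
- by rewrite divr_gt0 ?expR_gt0// invr_gt0 exprn_gt0.
rewrite !invfM !invrK -[expR _]mul1r.
have := @expR_ge1Dxn R t^-1 n; rewrite invr_ge0 ltW// => /(_ isT) h.
have {}h : t^-1 ^+ n.+1 / n.+1`!%:R <= expR t^-1 by rewrite (le_trans _ h)// lerDr.
rewrite mul1r -ler_pdivrMl ?exprn_gt0//; apply: le_trans h.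
by rewrite exprVn exprS invfM; lra.
Qed.

Lemma flat_exp_derive n (t : R) :
  is_derive t (1 : R) (flat_exp n) (flat_exp n.+2 t - n%:R * flat_exp n.+1 t).
Proof.
have sE (a b : R) : a *: b = a * b by [].
have [t0|t0|->] := ltgtP t 0.
- apply: (@near_eq_is_derive _ _ _ (cst 0)).
    near=> s; rewrite /flat_exp /= ltNge ltW//.
    near: s; exact: lt_nbhsl.
  by rewrite /flat_exp !ltNge !(ltW t0)/= mulr0 subr0; exact: is_derive_cst.
- apply: (@near_eq_is_derive _ R R (fun s : R => s ^- n * expR (- s^-1))).
    near=> s; rewrite /flat_exp /= ifT//; near: s; exact: lt_nbhsr.
  have tn0 : t != 0 by rewrite gt_eqF.
  have tnn0 : t ^+ n != 0 by rewrite expf_neq0.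
  rewrite /flat_exp t0.
  have d1 : is_derive t 1 (fun s : R => s^-1) (- t ^- 2).
    apply: DeriveDef; first exact: derivableV.
    by rewrite (@deriveV _ _ id)// derive_id [_ *: _]mulr1.
  have d2 : is_derive t 1 (fun s : R => (- s^-1)) (t ^- 2).
    by apply: is_derive_eq; rewrite opprK.
  have d3 : is_derive t 1 (fun s : R => expR (- s^-1)) (expR (- t^-1) * t ^- 2).
    have [dd de] := d2.
    have /= := @is_derive_comp_dir _ expR (fun s : R => - s^-1) t 1 (@derivable_expR _ _) dd.
    by rewrite derive1E derive_val de.
  have d4 : is_derive t 1 (fun s : R => s ^- n) (- n%:R * t ^- n.+1).
    have -> : (fun s : R => s ^- n) = (fun s : R => s^-1) ^+ n.
      by apply/funext => s; rewrite fctE/= exprVn.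
    apply: is_derive_eq; rewrite sE.
    case: n tnn0 => [|n] tnn0; first by rewrite !mul0r oppr0 mul0r.
    by rewrite /= -!exprVn !exprS; ring.
  have -> : (fun s : R => s ^- n * expR (- s^-1)) = (fun s : R => s ^- n) * (fun s : R => expR (- s^-1)) by [].
  apply: is_derive_eq; rewrite !sE -!exprVn !exprS; ring.
- have f0 m : flat_exp m 0 = 0 by rewrite /flat_exp ltxx.
  rewrite !f0 mulr0 subr0.
  have cv0 m : flat_exp m h @[h --> 0] --> 0.
    apply: norm_cvg0; apply: (@squeeze_cvgr _ _ _ _ (cst 0) (fun h => m.+1`!%:R * `|h|)).
    - by near=> h; rewrite normr_ge0 flat_exp_bound.
    - exact: cvg_cst.
    - rewrite -[X in _ --> X](mulr0 m.+1`!%:R); apply: cvgM; first exact: cvg_cst.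
      by have := @norm_continuous _ R 0; rewrite /continuous_at normr0.
  have D : h^-1 *: (flat_exp n (h *: 1 + 0) - flat_exp n 0) @[h --> 0^'] --> 0.
    have c0 : flat_exp n.+1 h @[h --> 0^'] --> (0 : R) by apply: cvg_within_filter; exact: cv0.
    apply: cvg_trans c0.
    apply: near_eq_cvg; near=> h; rewrite f0 /flat_exp subr0 addr0 !sE mulr1.
    by case: ifPn => h0; rewrite ?mulr0// exprS invfM mulrA.
  apply: DeriveDef; first by apply/cvg_ex; exists 0.
  exact: cvg_lim D.
Unshelve. all: by end_near. Qed.

Lemma derivable_continuous_at (f : R -> R) t : derivable f t 1 -> {for t, continuous f}.
Proof. by move=> df; apply/differentiable_continuous/derivable1_diffP. Qed.

Lemma smooth1_flat_exp n : smooth1 (flat_exp n).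
Proof.
have d k t : derivable (flat_exp k) t 1 by have [] := flat_exp_derive k t.
move=> m; elim: m n => [|m IH] n; first by move=> t; apply: derivable_continuous_at.
split=> [t|_]; first exact: derivable_continuous_at.
split=> //.
apply: eq_Cd (CdB (IH n.+2) (CdM (Cd_cst _ m n%:R) (IH n.+1))) => t.
by have [_ ->] := flat_exp_derive n t.
Qed.

Lemma smooth1_affine (a b : R) : smooth1 (fun t => a * t + b).
Proof.
have sid : smooth1 id.
  case=> [|m]; first by move=> t; exact: cvg_id.
  split=> [t|_]; first exact: cvg_id.
  split=> [t|]; first exact: derivable_id.
  by apply: eq_Cd (Cd_cst _ m 1) => t; rewrite derive_id.
by move=> m; apply: CdD; [apply: CdM; [exact: Cd_cst|exact: sid]|exact: Cd_cst].
Qed.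

Lemma flat_exp_ge0 n t : 0 <= flat_exp n t.
Proof.
rewrite /flat_exp; case: ifPn => // t0.
by rewrite mulr_ge0 ?expR_ge0// invr_ge0 exprn_ge0// ltW.
Qed.

Lemma flat_exp_gt0 n t : 0 < t -> 0 < flat_exp n t.
Proof.
by move=> t0; rewrite /flat_exp t0 mulr_gt0 ?expR_gt0// invr_gt0 exprn_gt0.
Qed.

Lemma flat_exp_le0 n t : t <= 0 -> flat_exp n t = 0.
Proof. by move=> t0; rewrite /flat_exp ltNge t0. Qed.

(** The denominator never vanishes, since [t] and [1 - t] are not both negative; it
    equals the numerator from [1] on, where its second term is zero. *)
Definition smooth_step t := flat_exp 0 t / (flat_exp 0 t + flat_exp 0 (1 - t)).

Let den_gt0 t : 0 < flat_exp 0 t + flat_exp 0 (1 - t).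
Proof.
have [t0|t0] := ltP 0 t; first by rewrite ltr_wpDr ?flat_exp_ge0// flat_exp_gt0.
by rewrite ltr_wpDl ?flat_exp_ge0// flat_exp_gt0// subr_gt0; lra.
Qed.

Lemma smooth_step_ge0 t : 0 <= smooth_step t.
Proof. by rewrite divr_ge0 ?flat_exp_ge0// ltW. Qed.

Lemma smooth_step_le1 t : smooth_step t <= 1.
Proof. by rewrite ler_pdivrMr// mul1r lerDl flat_exp_ge0. Qed.

Lemma smooth_step_0 t : t <= 0 -> smooth_step t = 0.
Proof. by move=> t0; rewrite /smooth_step flat_exp_le0// mul0r. Qed.

Lemma smooth_step_1 t : 1 <= t -> smooth_step t = 1.
Proof.
move=> t1; rewrite /smooth_step [X in _ + X]flat_exp_le0 ?addr0 ?divff//; last by rewrite subr_le0.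
by rewrite gt_eqF// flat_exp_gt0//; lra.
Qed.

Lemma smooth1_step : smooth1 smooth_step.
Proof.
have s1 : smooth1 (fun t => flat_exp 0 (1 - t)).
  move=> m; apply: (@Cd_comp R unit (fun=> 1) m (flat_exp 0) (fun t => 1 - t)).
    exact: smooth1_flat_exp.
  by apply: eq_Cd (smooth1_affine (-1) 1 m) => t; lra.
move=> m; apply: CdM; first exact: smooth1_flat_exp.
apply: CdV; first by move=> t; rewrite gt_eqF.
by apply: CdD; [exact: smooth1_flat_exp|exact: s1].
Qed.

Lemma smooth_step_derive_ge0 t : 0 <= derive1 smooth_step t.
Proof.
have sE (a b : R) : a *: b = a * b by [].
have d1 := flat_exp_derive 0 t.
have d2 : is_derive t (1 : R) (fun t : R => flat_exp 0 (1 - t)) (- flat_exp 2 (1 - t)).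
  have [da de] := flat_exp_derive 0 (1 - t).
  have [db dbe] : is_derive t (1 : R) (fun t : R => 1 - t) (- 1).
    have -> : (fun t : R => 1 - t) = cst 1 - id by [].
    by apply: is_derive_eq; rewrite sub0r.
  have := @is_derive_comp_dir R (flat_exp 0) (fun t => 1 - t) t 1 da db.
  by rewrite derive1E de dbe mul0r subr0 mulrN1.
have d3 : is_derive t (1 : R) (fun t : R => flat_exp 0 t + flat_exp 0 (1 - t)) (flat_exp 2 t - flat_exp 2 (1 - t)).
  have -> : (fun t => flat_exp 0 t + flat_exp 0 (1 - t)) = flat_exp 0 + (fun t : R => flat_exp 0 (1 - t)) by [].
  by apply: is_derive_eq; rewrite mul0r subr0.
rewrite derive1E.
have -> : smooth_step = flat_exp 0 * (fun t : R => (flat_exp 0 t + flat_exp 0 (1 - t))^-1) by [].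
have n0 : flat_exp 0 t + flat_exp 0 (1 - t) != 0 by rewrite gt_eqF.
rewrite deriveM; [|by have [] := d1|by apply: derivableV => //; have [] := d3].
rewrite deriveV//.
have [_ ->] := d3; have [_ ->] := d1; rewrite !sE mul0r subr0.
set a := flat_exp 0 t; set b := flat_exp 0 (1 - t); set a' := flat_exp 2 t; set b' := flat_exp 2 (1 - t).
have n0' : a + b != 0 by [].
have -> : a * (- (a + b) ^- 2 * (a' - b')) + (a + b)^-1 * a' = (a + b) ^- 2 * (a * b' + b * a').
  by field.
by rewrite mulr_ge0// ?invr_ge0 ?exprn_ge0 ?addr_ge0 ?mulr_ge0 ?flat_exp_ge0.
Qed.

Lemma smooth_step_derive_out t : t < 0 \/ 1 < t -> derive1 smooth_step t = 0.
Proof.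
move=> [t0|t1]; rewrite derive1E.
  rewrite (near_eq_derive _ (_ : \near t, smooth_step t = cst 0 t)) ?derive_cst//.
  by near=> s; rewrite smooth_step_0//; apply: ltW; near: s; exact: lt_nbhsl.
rewrite (near_eq_derive _ (_ : \near t, smooth_step t = cst 1 t)) ?derive_cst//.
by near=> s; rewrite smooth_step_1//; apply: ltW; near: s; exact: lt_nbhsr.
Unshelve. all: by end_near. Qed.

End one_dim.

Section affine.
Context {R : realType} {V W : normedModType R} {I J : Type} (v : I -> V) (w : J -> W).
Variables (s : J -> I) (phi : W -> V).
Hypothesis cphi : continuous phi.
Hypothesis aphi : forall j h a, phi (h *: w j + a) = h *: v (s j) + phi a.

Lemma derive_affine (f : V -> R) j a :
  'D_(w j) (fun a => f (phi a)) a = 'D_(v (s j)) f (phi a).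
Proof.
rewrite /derive; apply: (congr1 (fun q : R -> R => lim (q @ 0^'))).
by apply/funext => h /=; rewrite aphi.
Qed.

Lemma derivable_affine (f : V -> R) j a :
  derivable f (phi a) (v (s j)) -> derivable (fun a => f (phi a)) a (w j).
Proof.
rewrite /derivable; set q1 := fun h => h^-1 *: _; set q2 := fun h => h^-1 *: _.
by suff -> : q2 = q1 by []; apply/funext => h; rewrite /q1 /q2 /= aphi.
Qed.

(** An affine change of variables turns the derivative along [w j] into the
    derivative along [v (s j)]: translations, slices and embeddings of lines are
    all instances. *)
Lemma Cd_affine m (f : V -> R) : Cd v m f -> Cd w m (fun a => f (phi a)).
Proof.
have cc g : continuous g -> continuous (fun a => g (phi a) : R).
  by move=> cg a; apply: (@continuous_comp _ _ _ phi g); [exact: cphi|exact: cg].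
elim: m f => [|m IH] f; first exact: cc.
move=> [cf df]; split; first exact: cc.
move=> j; have [dj Cj] := df (s j); split; first by move=> a; exact: derivable_affine.
by apply: eq_Cd (IH _ Cj) => a; rewrite derive_affine.
Qed.
End affine.

(** * Smooth functions and test functions on R^n *)

Section smooth_rV.
Context {R : realType} {n : nat}.
Implicit Types (f g phi : 'rV[R]_n -> R) (x y : 'rV[R]_n).
Let e (i : 'I_n) : 'rV[R]_n := delta_mx ord0 i.

Lemma smoothE f : smooth f <-> forall m, Cd e m f.
Proof.
have H m h : C_k m h <-> Cd e m h.
  by elim: m h => [|m IH] h //=; split=> -[ch dh]; split=> // i; have [d C] := dh i; split => //; apply/IH.
by split=> h m; apply/H; exact: h.
Qed.

Lemma smooth_continuous f : smooth f -> continuous f.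
Proof. by move=> /(_ 0%N). Qed.

Lemma smooth_derivable f : smooth f -> forall i x, derivable f x (e i).
Proof. by move=> /(_ 1%N) [_ d] i; have [] := d i. Qed.

Lemma smooth_partial f i : smooth f -> smooth (partial i f).
Proof. by move=> sf m; have [_ d] := sf m.+1; have [] := d i. Qed.

Lemma smooth_cst (c : R) : smooth (fun _ : 'rV[R]_n => c).
Proof. by apply/smoothE => m; exact: Cd_cst. Qed.

Lemma smoothD f g : smooth f -> smooth g -> smooth (fun x => f x + g x).
Proof. by move=> /smoothE sf /smoothE sg; apply/smoothE => m; exact: CdD. Qed.

Lemma smoothB f g : smooth f -> smooth g -> smooth (fun x => f x - g x).
Proof. by move=> /smoothE sf /smoothE sg; apply/smoothE => m; exact: CdB. Qed.

Lemma smoothM f g : smooth f -> smooth g -> smooth (fun x => f x * g x).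
Proof. by move=> /smoothE sf /smoothE sg; apply/smoothE => m; exact: CdM. Qed.

Lemma smooth_comp (k : R -> R) f : smooth1 k -> smooth f -> smooth (fun x => k (f x)).
Proof. by move=> sk /smoothE sf; apply/smoothE => m; exact: Cd_comp. Qed.

Lemma smooth_sum (J : Type) (s : seq J) (F : J -> 'rV[R]_n -> R) :
  (forall j, smooth (F j)) -> smooth (fun x => \sum_(j <- s) F j x).
Proof. by move=> sF; apply/smoothE => m; apply: Cd_sum => j; exact: (smoothE _).1. Qed.

Lemma smooth_prod (J : Type) (s : seq J) (F : J -> 'rV[R]_n -> R) :
  (forall j, smooth (F j)) -> smooth (fun x => \prod_(j <- s) F j x).
Proof. by move=> sF; apply/smoothE => m; apply: Cd_prod => j; exact: (smoothE _).1. Qed.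

(** Lets a locally finite sum be smooth because it agrees near each point with a
    finite one. *)
Lemma smooth_local f :
  (forall x : 'rV[R]_n, exists2 g : 'rV[R]_n -> R, smooth g & \forall y \near x, g y = f y) -> smooth f.
Proof.
move=> H; apply/smoothE => m; apply: Cd_local => x; have [g sg gf] := H x.
by exists g => //; exact: (smoothE g).1 sg m.
Qed.

Lemma is_derive_coord (j : 'I_n) x (v : 'rV[R]_n) :
  is_derive x v (fun x : 'rV[R]_n => x ord0 j) (v ord0 j).
Proof.
have D : h^-1 *: ((((fun x : 'rV[R]_n => x ord0 j) \o shift x) (h *: v)) - x ord0 j)
   @[h --> (0:R)^'] --> v ord0 j.
  apply: cvg_near_cst; near=> h; rewrite /= !mxE addrK scalerA mulVf ?scale1r//.
  by near: h; exact: nbhs_dnbhs_neq.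
apply: DeriveDef; first by apply/cvg_ex; exists (v ord0 j).
exact: cvg_lim D.
Unshelve. all: by end_near. Qed.

Lemma smooth_coord (j : 'I_n) : smooth (fun x : 'rV[R]_n => x ord0 j).
Proof.
apply/smoothE; case=> [|m]; first exact: coord_continuous.
split; first exact: coord_continuous.
move=> i; split=> [x|]; first by have [] := is_derive_coord j x (e i).
apply: eq_Cd (Cd_cst _ m (e i ord0 j)) => x.
by have [_ ->] := is_derive_coord j x (e i).
Qed.

Lemma partial_coord i j x : partial i (fun x : 'rV[R]_n => x ord0 j) x = (j == i)%:R.
Proof. by rewrite /partial; have [_ ->] := is_derive_coord j x (e i); rewrite mxE eqxx. Qed.

Lemma partialM f g i x : smooth f -> smooth g ->
  partial i (fun x => f x * g x) x = f x * partial i g x + g x * partial i f x.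
Proof. by move=> sf sg; rewrite /partial [LHS](@deriveM _ _ f g)//; exact: smooth_derivable. Qed.

Lemma partialD f g i x : smooth f -> smooth g ->
  partial i (fun x => f x + g x) x = partial i f x + partial i g x.
Proof. by move=> sf sg; rewrite /partial [LHS](@deriveD _ _ _ f g)//; exact: smooth_derivable. Qed.

Lemma partialB f g i x : smooth f -> smooth g ->
  partial i (fun x => f x - g x) x = partial i f x - partial i g x.
Proof. by move=> sf sg; rewrite /partial [LHS](@deriveB _ _ _ f g)//; exact: smooth_derivable. Qed.

Lemma partial_cst (c : R) i x : partial i (fun _ : 'rV[R]_n => c) x = 0.
Proof. exact: derive_cst. Qed.

Lemma partial_comp (k : R -> R) f i x : smooth1 k -> smooth f ->
  partial i (fun x => k (f x)) x = derive1 k (f x) * partial i f x.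
Proof.
move=> sk sf; rewrite /partial.
by have [_ ->] := is_derive_comp_dir (@smooth1_derivable _ _ sk (f x)) (@smooth_derivable _ sf i x).
Qed.

Lemma partial_sum (J : Type) (s : seq J) (F : J -> 'rV[R]_n -> R) i x :
  (forall j, smooth (F j)) ->
  partial i (fun x => \sum_(j <- s) F j x) x = \sum_(j <- s) partial i (F j) x.
Proof.
move=> sF; elim: s => [|j s IH].
  by rewrite big_nil (_ : (fun x => _) = fun=> 0) ?partial_cst//; apply/funext => y; rewrite big_nil.
rewrite big_cons -IH -partialD//; last exact: smooth_sum.
by congr (partial i _ x); apply/funext => y; rewrite big_cons.
Qed.

Lemma near_eq_partial f g i x : (\forall y \near x, f y = g y) -> partial i f x = partial i g x.
Proof. exact: near_eq_derive. Qed.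

Lemma test_function_sub U K phi : smooth phi -> compact K -> K `<=` U ->
  (forall x, phi x != 0 -> K x) -> test_function U phi.
Proof.
move=> sphi cK KU phiK.
have clK : closure [set x | phi x != 0] `<=` K.
  have /closure_id -> : closed K by apply: compact_closed => //; exact: norm_hausdorff.
  exact: closure_subset.
split => //; last exact: subset_trans KU.
by apply: subclosed_compact cK _ => //; exact: closed_closure.
Qed.

Lemma test_functionMl U phi eta : smooth eta -> test_function U phi ->
  test_function U (fun x => eta x * phi x).
Proof.
move=> se [sp cp pU]; apply: (test_function_sub _ cp pU); first exact: smoothM.
by move=> x; rewrite mulf_eq0 negb_or => /andP[_ h]; exact: subset_closure.
Qed.

Lemma test_function_partial U phi i : test_function U phi -> test_function U (partial i phi).
Proof.
move=> [sp cp pU]; apply: (test_function_sub _ cp pU); first exact: smooth_partial.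
move=> x; apply: contraNP => nx; apply/eqP.
have : \forall y \near x, phi y = 0.
  have : open (~` closure [set x | phi x != 0]) by apply: closed_openC; exact: closed_closure.
  rewrite openE => /(_ _ nx); apply: filterS => y; apply: contra_notP => /eqP h.
  exact: subset_closure.
by move=> /near_eq_partial ->; rewrite partial_cst.
Qed.

Lemma test_function_bounded U phi : test_function U phi ->
  exists2 M : R, 0 <= M & forall x, `|phi x| <= M.
Proof.
move=> [sp cp _].
have cphi : compact (phi @` closure [set x | phi x != 0]).
  apply: continuous_compact => //; apply: continuous_subspaceT; exact: smooth_continuous.
have [M [_ HM]] := compact_bounded cphi.
exists (`|M| + 1) => [|x]; first by rewrite addr_ge0.
have [->|px] := eqVneq (phi x) 0; first by rewrite normr0 addr_ge0.
apply: HM; first by rewrite (le_lt_trans (ler_norm _))// ltrDl.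
by exists x => //; exact: subset_closure.
Qed.

End smooth_rV.

(** * Euclidean norm, boxes, and the sets they generate *)

Section enorm_theory.
Context {R : realType} {n : nat}.
Implicit Types (x y : 'rV[R]_n).

Lemma dotrV_ge0 x : 0 <= dotrV x x.
Proof. by apply: sumr_ge0 => i _; rewrite -expr2 sqr_ge0. Qed.

Lemma enorm_ge0 x : 0 <= enorm x.
Proof. exact: sqrtr_ge0. Qed.

Lemma enorm_sqr x : enorm x ^+ 2 = dotrV x x.
Proof. by rewrite sqr_sqrtr ?dotrV_ge0. Qed.

Lemma coord_le_enorm x i : `|x ord0 i| <= enorm x.
Proof.
rewrite -sqrtr_sqr ler_sqrt ?dotrV_ge0// /dotrV (bigD1 i)//= expr2 lerDl.
by apply: sumr_ge0 => j _; rewrite -expr2 sqr_ge0.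
Qed.

Lemma enorm_le_sum x : enorm x <= \sum_i `|x ord0 i|.
Proof.
have s0 : 0 <= \sum_i `|x ord0 i| by apply: sumr_ge0.
rewrite -[leRHS]ger0_norm// -sqrtr_sqr ler_sqrt ?sqr_ge0// expr2 mulr_suml.
rewrite /dotrV; apply: ler_sum => i _.
rewrite -[x ord0 i * _]ger0_norm; last by rewrite -expr2 sqr_ge0.
by rewrite normrM ler_wpM2l// (bigD1 i)//= lerDl sumr_ge0.
Qed.

Lemma enorm_le_max x (M : R) : 0 <= M -> (forall i, `|x ord0 i| <= M) -> enorm x <= n%:R * M.
Proof.
move=> M0 xM; apply: le_trans (enorm_le_sum x) _.
have -> : n%:R * M = \sum_(i < n) M by rewrite sumr_const card_ord mulr_natl.
exact: ler_sum.
Qed.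

Lemma enormN x : enorm (- x) = enorm x.
Proof. by congr Num.sqrt; apply: eq_bigr => i _; rewrite !mxE mulrNN. Qed.

Lemma enorm0 : enorm (0 : 'rV[R]_n) = 0.
Proof. by rewrite /enorm /dotrV big1 ?sqrtr0// => i _; rewrite mxE mul0r. Qed.

Lemma enorm_eq0 x : enorm x = 0 -> x = 0.
Proof.
move=> x0; apply/rowP => i; apply/eqP; rewrite mxE -normr_le0 -x0; exact: coord_le_enorm.
Qed.

Lemma enormZ (a : R) x : enorm (a *: x) = `|a| * enorm x.
Proof.
rewrite /enorm /dotrV (_ : \sum_i _ = a ^+ 2 * \sum_(i < n) x ord0 i * x ord0 i).
  by rewrite sqrtrM ?sqr_ge0// sqrtr_sqr.
by rewrite mulr_sumr; apply: eq_bigr => i _; rewrite !mxE; ring.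
Qed.

Lemma continuous_dotrV2 : continuous (fun x => dotrV x x : R).
Proof.
apply: (@smooth_continuous R n); rewrite /dotrV.
by apply: smooth_sum => j; apply: smoothM; exact: smooth_coord.
Qed.

Lemma continuous_enorm : continuous (enorm : 'rV[R]_n -> R).
Proof.
move=> x; apply: (@continuous_comp _ _ _ (fun x => dotrV x x) Num.sqrt).
  exact: continuous_dotrV2.
exact: sqrt_continuous.
Qed.

Lemma measurable_dotrV d (T : measurableType d) (D : set T) (f g : T -> 'rV[R]_n) :
  (forall i, measurable_fun D (fun t => f t ord0 i)) ->
  (forall i, measurable_fun D (fun t => g t ord0 i)) ->
  measurable_fun D (fun t => dotrV (f t) (g t)).
Proof.
move=> mf mg; rewrite /dotrV.
by apply: measurable_sum => i; apply: measurable_funM.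
Qed.

Lemma measurable_enorm d (T : measurableType d) (D : set T) (f : T -> 'rV[R]_n) :
  (forall i, measurable_fun D (fun t => f t ord0 i)) ->
  measurable_fun D (fun t => enorm (f t)).
Proof.
move=> mf; have ms : measurable_fun setT (@Num.sqrt R).
  by apply: continuous_measurable_fun; exact: sqrt_continuous.
exact: (measurableT_comp ms (measurable_dotrV mf mf)).
Qed.

End enorm_theory.

Section boxes.
Context {R : realType}.
Local Notation L n := (lebesgue_rV R n).

(** Product integrands reduce to one-dimensional integrals; used for the measure of
    boxes and for the mass of the mollifier. *)
Lemma ge0_integral_prod1 n (f : 'I_n -> R -> R) :
  (forall i, measurable_fun setT (f i)) -> (forall i t, 0 <= f i t) ->
  (\int[L n]_x (\prod_(i < n) f i (x ord0 i))%:E =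
   \prod_(i < n) \int[@lebesgue_measure R]_t (f i t)%:E)%E.
Proof.
elim: n f => [|n IH] f mf f0; first by rewrite integral_rV0 !big_ord0.
have mp k (g : 'I_k -> R -> R) : (forall i, measurable_fun setT (g i)) ->
    measurable_fun setT (fun x : 'rV[R]_k => (\prod_(i < k) g i (x ord0 i))%:E).
  move=> mg; apply/measurable_EFinP; apply: measurable_prod => i _.
  exact: (measurableT_comp (mg i) (measurable_rV_coord i)).
rewrite ge0_integral_cons; [|exact: mp|by move=> x; rewrite lee_fin prodr_ge0].
under eq_integral do under eq_integral do rewrite big_ord_recl cons_rV0 /= EFinM.
rewrite big_ord_recl.
have E t : (\int[L n]_y ((f ord0 t)%:E *
   (\prod_(i < n) f (lift ord0 i) (cons_rV (t, y) ord0 (lift ord0 i)))%:E)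
   = (f ord0 t)%:E * \prod_(i < n) \int[@lebesgue_measure R]_t (f (lift ord0 i) t)%:E)%E.
  rewrite -IH// -ge0_integralZl_EFin//.
  - by apply: eq_integral => y _; congr (_ * _%:E)%E; apply: eq_bigr => i _; rewrite cons_rVS.
  - by move=> y _; rewrite lee_fin prodr_ge0.
  - exact: (mp n (fun i => f (lift ord0 i)) (fun i => mf _)).
under eq_integral do rewrite E.
rewrite ge0_integralZr//; first by apply/measurable_EFinP; exact: mf.
- by move=> t _; rewrite lee_fin.
- by apply: prode_ge0 => i _; apply: integral_ge0 => t _; rewrite lee_fin.
Qed.

Definition box n (a b : 'I_n -> R) : set 'rV[R]_n :=
  [set x | forall i, a i < x ord0 i < b i].
Definition cbox n (a b : 'I_n -> R) : set 'rV[R]_n :=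
  [set x | forall i, a i <= x ord0 i <= b i].

Lemma box_sub_cbox n (a b : 'I_n -> R) : box a b `<=` cbox a b.
Proof. by move=> x h i; have /andP[/ltW -> /ltW ->] := h i. Qed.

Lemma measurable_coords n (B : 'I_n -> set R) : (forall i, measurable (B i)) ->
  measurable [set x : 'rV[R]_n | forall i, B i (x ord0 i)].
Proof.
move=> mB; rewrite (_ : [set x | _] =
    \bigcap_(i in [set` [set: 'I_n]]) (fun x : 'rV[R]_n => x ord0 i) @^-1` B i).
  apply: fin_bigcap_measurable => // i _; rewrite -[X in measurable X]setTI.
  by apply: measurable_rV_coord => //; exact: mB.
apply/seteqP; split => x /= h i; first by move=> _; exact: h.
by apply: (h i); rewrite /= inE.
Qed.

Lemma measurable_box n (a b : 'I_n -> R) : measurable (box a b).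
Proof.
rewrite (_ : box a b = [set x | forall i, `]a i, b i[%classic (x ord0 i)]).
  by apply: (@measurable_coords n (fun i => `]a i, b i[%classic)) => i; exact: measurable_itv.
by apply/seteqP; split => x h i; have := h i; rewrite /= in_itv.
Qed.

Lemma measurable_cbox n (a b : 'I_n -> R) : measurable (cbox a b).
Proof.
rewrite (_ : cbox a b = [set x | forall i, `[a i, b i]%classic (x ord0 i)]).
  by apply: (@measurable_coords n (fun i => `[a i, b i]%classic)) => i; exact: measurable_itv.
by apply/seteqP; split => x h i; have := h i; rewrite /= in_itv.
Qed.

Lemma compact_cbox n (a b : 'I_n -> R) : compact (cbox a b).
Proof.
have := @rV_compact R n (fun i => `[a i, b i]%classic) (fun i => @segment_compact R (a i) (b i)).
by congr compact; apply/seteqP; split => x h i; have := h i; rewrite /= in_itv.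
Qed.

Lemma cbox_measure n (a b : 'I_n -> R) :
  L n (cbox a b) = (\prod_(i < n) @lebesgue_measure R `[a i, b i]%classic)%E.
Proof.
have mI i : measurable_fun setT (\1_`[a i, b i] : R -> R).
  by apply: measurable_indic; exact: measurable_itv.
have <- : (\int[L n]_x (\prod_(i < n) (\1_`[a i, b i] (x ord0 i) : R))%:E = L n (cbox a b))%E.
  rewrite -[in RHS](setIT (cbox a b)) -integral_indic//.
    apply: eq_integral => x _; congr EFin.
    have [h|h] := pselect (cbox a b x).
      rewrite indicE mem_set//= big1// => i _; rewrite indicE mem_set//= in_itv; exact: h.
    rewrite indicE memNset//=.
    have [i Hi] : exists i, ~ (a i <= x ord0 i <= b i) by apply: contrapT => /forallNP hh; apply: h => i; exact: contrapT.
    by rewrite (bigD1 i)//= indicE memNset ?mul0r//= in_itv.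
  exact: measurable_cbox.
rewrite (@ge0_integral_prod1 n (fun i => \1_`[a i, b i] : R -> R))//.
by apply: eq_bigr => i _; rewrite integral_indic// setIT.
Qed.

Lemma cbox_fin n (a b : 'I_n -> R) : (L n (cbox a b) < +oo)%E.
Proof.
rewrite cbox_measure ltey_eq; apply/orP; left.
apply: (big_ind (fun x : \bar R => x \is a fin_num)) => //; first exact: fin_numM.
move=> i _; apply: (eq_ind_r (fun z => z \is a fin_num) _ (lebesgue_measure_itv `[a i, b i])).
by case: ifP.
Qed.


Lemma coord_le_norm n (x : 'rV[R]_n) i : `|x ord0 i| <= `|x|.
Proof.
have -> : `|x| = mx_norm x by [].
rewrite mx_normrE.
exact: (@le_bigmax _ _ _ 0 (fun i : 'I_1 * 'I_n => `|x i.1 i.2|) (ord0, i)).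
Qed.

Lemma compact_fin n (K : set 'rV[R]_n) : compact K -> (L n K < +oo)%E.
Proof.
move=> cK; have [M [_ HM]] := compact_bounded cK.
have mK : measurable K.
  by apply: closed_measurable_rV; apply: compact_closed => //; exact: norm_hausdorff.
apply: le_lt_trans (@cbox_fin n (fun=> - (`|M| + 1)) (fun=> `|M| + 1)).
apply: le_measure; rewrite ?inE//; first exact: measurable_cbox.
move=> x Kx i; rewrite -ler_norml; have := HM (`|M| + 1) _ x Kx.
rewrite (le_lt_trans (ler_norm _)) ?ltrDl// => /(_ isT); apply: le_trans.
exact: coord_le_norm.
Qed.

(** At a fixed point these smooth functions agree with the indicator function of
    the box as soon as [j] is large, which is what lets an identity tested with
    smooth functions reach all boxes by dominated convergence. *)
Definition box_bump n (a b : 'I_n -> R) (j : nat) (x : 'rV[R]_n) : R :=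
  \prod_(i < n) (smooth_step (j%:R * (x ord0 i - a i)) * smooth_step (j%:R * (b i - x ord0 i))).

Lemma smooth_bump n (a b : 'I_n -> R) j : smooth (box_bump a b j).
Proof.
apply: smooth_prod => i; apply: smoothM; apply: smooth_comp; try exact: smooth1_step.
- by apply: smoothM; [exact: smooth_cst|apply: smoothB; [exact: smooth_coord|exact: smooth_cst]].
- by apply: smoothM; [exact: smooth_cst|apply: smoothB; [exact: smooth_cst|exact: smooth_coord]].
Qed.

Lemma bump_ge0 n (a b : 'I_n -> R) j x : 0 <= box_bump a b j x.
Proof. by apply: prodr_ge0 => i _; rewrite mulr_ge0 ?smooth_step_ge0. Qed.

Lemma bump_le1 n (a b : 'I_n -> R) j x : box_bump a b j x <= 1.
Proof.
rewrite -[leRHS](@big1 _ 1 *%R 'I_n (index_enum _) xpredT (fun=> 1))//.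
by apply: ler_prod => i _; rewrite mulr_ge0 ?smooth_step_ge0//= mulr_ile1 ?smooth_step_ge0 ?smooth_step_le1.
Qed.

Lemma bump_out n (a b : 'I_n -> R) j x : ~ box a b x -> box_bump a b j x = 0.
Proof.
move=> nb; have [i Hi] : exists i, ~ (a i < x ord0 i < b i).
  by apply: contrapT => /forallNP hh; apply: nb => i; exact: contrapT.
rewrite /box_bump (bigD1 i)//=; move/negP : Hi; rewrite negb_and -!leNgt => /orP[h|h].
  by rewrite smooth_step_0 ?mul0r// mulr_ge0_le0// subr_le0.
by rewrite [X in _ * X * _]smooth_step_0 ?mulr0 ?mul0r// mulr_ge0_le0// subr_le0.
Qed.

Lemma bump_cvg n (a b : 'I_n -> R) x : \forall j \near \oo, box_bump a b j x = \1_(box a b) x.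
Proof.
have [h|h] := pselect (box a b x); last first.
  by near=> j; rewrite bump_out// indicE memNset.
rewrite indicE mem_set//=.
have H (d : R) : 0 < d -> \forall j \near \oo, 1 <= j%:R * d.
  move=> d0; near=> j; rewrite -ler_pdivrMr// div1r; near: j; exact: nbhs_infty_ger.
suff : \forall j \near \oo, forall i : 'I_n,
    1 <= j%:R * (x ord0 i - a i) /\ 1 <= j%:R * (b i - x ord0 i).
  by apply: filterS => j Hj; rewrite /box_bump big1// => i _; have [? ?] := Hj i; rewrite !smooth_step_1// mulr1.
apply: filter_forall => i; have /andP[h1 h2] := h i.
by apply: filterI; apply: H; rewrite subr_gt0.
Unshelve. all: by end_near. Qed.

Lemma test_function_bump n (a b : 'I_n -> R) j U : cbox a b `<=` U ->
  test_function U (box_bump a b j).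
Proof.
move=> abU; apply: (test_function_sub _ (@compact_cbox n a b) abU); first exact: smooth_bump.
move=> x; apply: contraNP => nx; apply/eqP/bump_out; apply: contra_not nx.
exact: box_sub_cbox.
Qed.

Lemma boxI n (a b c d : 'I_n -> R) : box a b `&` box c d =
  box (fun i => Num.max (a i) (c i)) (fun i => Num.min (b i) (d i)).
Proof.
apply/seteqP; split => x.
  by move=> [h1 h2] i; rewrite gt_max lt_min; have /andP[-> ->] := h1 i; have /andP[-> ->] := h2 i.
by move=> h; split=> i; have := h i; rewrite gt_max lt_min => /andP[/andP[h1 h2] /andP[h3 h4]]; apply/andP.
Qed.

Definition boxes n : set (set 'rV[R]_n) := [set A | exists a b, A = box a b].

(** Coordinate half spaces are countable unions of boxes, and coordinates generate
    the Borel sets. *)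
Lemma boxes_generate n (A : set 'rV[R]_n) : measurable A -> <<s @boxes n >> A.
Proof.
move=> mA.
suff mid : @measurable_fun _ _ (g_sigma_algebraType (@boxes n)) 'rV[R]_n setT id.
  by have := mid measurableT _ mA; rewrite setTI preimage_id.
apply/measurable_fun_rVP => i.
apply: (measurability _ (RGenOInfty.measurableE R)) => //.
move=> _ [_ [t ->] <-]; rewrite setTI.
rewrite (_ : _ @^-1` _ = \bigcup_(m : nat) box (fun j => if j == i then t else - m%:R) (fun=> m%:R)).
  by apply: bigcupT_measurable => m; apply: sub_sigma_algebra; do 2 eexists.
apply/seteqP; split => x /=; last first.
  by move=> [m _ /(_ i)]; rewrite eqxx in_itv/= andbT => /andP[].
rewrite in_itv/= andbT => tx.
have [m Hm] : exists m : nat, \sum_j `|x ord0 j| < m%:R.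
  exists (Num.bound (\sum_j `|x ord0 j|)); apply: archi_boundP.
  by apply: sumr_ge0.
exists m => // j.
have : `|x ord0 j| < m%:R.
  by apply: le_lt_trans Hm; rewrite (bigD1 j)//= lerDl sumr_ge0.
by rewrite ltr_norml => /andP[h1 h2]; rewrite h2 andbT; case: ifP => // /eqP ->.
Qed.

(** Dynkin's theorem for the boxes, which are stable under intersection. *)
Lemma measurable_rV_ind n (P : set (set 'rV[R]_n)) :
  (forall a b, P (box a b)) -> P setT ->
  (forall A, measurable A -> P A -> P (~` A)) ->
  (forall F : (set 'rV[R]_n)^nat, trivIset setT F -> (forall k, measurable (F k)) ->
     (forall k, P (F k)) -> P (\bigcup_k F k)) ->
  forall A, measurable A -> P A.
Proof.
move=> Pb PT PC PU A mA.
pose H := [set A | measurable A /\ P A].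
suff : <<s @boxes n >> `<=` H by move=> /(_ _ (boxes_generate mA)) [].
apply: (@lambda_system_subset _ (@boxes n) _ setT H).
- by move=> _ _ [a [b ->]] [c [d ->]]; rewrite boxI; do 2 eexists.
- apply/dynkin_lambda_system; split.
  + by split => //; exact: PT.
  + by move=> B [mB PB]; split; [exact: measurableC|exact: PC].
  + move=> F tF HF; split; first by apply: bigcupT_measurable => k; have [] := HF k.
    by apply: PU => // k; have [] := HF k.
- by move=> _ [a [b ->]]; split; [exact: measurable_box|exact: Pb].
- by move=> X _; exact: subsetT.
Qed.

End boxes.

(** * The fundamental lemma of the calculus of variations *)

Lemma integral_support d (T : measurableType d) (R : realType)
    (mu : {measure set T -> \bar R}) (D E : set T) (f : T -> \bar R) :
  E `<=` D -> (forall x, D x -> ~ E x -> f x = 0%E) ->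
  (\int[mu]_(x in D) f x = \int[mu]_(x in E) f x)%E.
Proof.
move=> ED f0; rewrite integral_mkcond [RHS]integral_mkcond; congr integral.
apply/funext => x; rewrite !patchE; case: ifPn => [|]; rewrite ?inE ?notin_setE => Dx.
  by case: ifPn => //; rewrite notin_setE => Ex; rewrite f0.
by rewrite memNset// => /ED.
Qed.

Lemma integrable_support d (T : measurableType d) (R : realType)
    (mu : {measure set T -> \bar R}) (D E : set T) (f : T -> \bar R) :
  measurable D -> measurable E -> E `<=` D -> (forall x, D x -> ~ E x -> f x = 0%E) ->
  mu.-integrable E f -> mu.-integrable D f.
Proof.
move=> mD mE ED f0 /(integrable_mkcond _ mE) H; apply/(integrable_mkcond _ mD).
have -> // : f \_ D = f \_ E.
apply/funext => x; rewrite !patchE; case: ifPn => [|]; rewrite ?inE ?notin_setE => Dx.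
  by case: ifPn => //; rewrite notin_setE => Ex; rewrite f0.
by rewrite memNset// => /ED.
Qed.

Section fundamental_lemma.
Context {R : realType} {n : nat}.
Local Notation L := (lebesgue_rV R n).
Implicit Types (U V K : set 'rV[R]_n) (f g h u : 'rV[R]_n -> R).

Lemma compact_measurable_rV K : compact K -> measurable K.
Proof.
by move=> cK; apply: closed_measurable_rV; apply: compact_closed => //; exact: norm_hausdorff.
Qed.

Lemma L1_loc_sub U V f : measurable V -> measurable U -> V `<=` U -> L1_loc U f -> L1_loc V f.
Proof.
move=> mV mU VU [mf If]; split; first exact: measurable_funS VU mf.
by move=> K cK KV; apply: If => //; exact: subset_trans VU.
Qed.

Lemma continuous_bounded_on K g : continuous g -> compact K -> [bounded g x | x in K].
Proof.
move=> cg cK; have /compact_bounded [M [Mr HM]] : compact (g @` K).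
  by apply: continuous_compact => //; exact: continuous_subspaceT.
by exists M; split=> // x Mx y Ky; apply: HM => //; exists y.
Qed.

Lemma L1_locM U f g : L1_loc U f -> continuous g -> L1_loc U (fun x => f x * g x).
Proof.
move=> [mf If] cg; have mg := continuous_measurable_rV cg.
split; first by apply: measurable_funM => //; exact: measurable_funTS.
move=> K cK KU; rewrite (_ : EFin \o _ = (EFin \o f) \* (EFin \o g))%E//.
apply: integrableMl; [exact: compact_measurable_rV|exact: If|exact: measurable_funTS|].
exact: continuous_bounded_on.
Qed.

Lemma L1_locD U f g : L1_loc U f -> L1_loc U g -> L1_loc U (fun x => f x + g x).
Proof.
move=> [mf If] [mg Ig]; split; first exact: measurable_funD.
move=> K cK KU; rewrite (_ : EFin \o _ = (EFin \o f) \+ (EFin \o g))%E//.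
by apply: integrableD; [exact: compact_measurable_rV|exact: If|exact: Ig].
Qed.

Lemma L1_locB U f g : L1_loc U f -> L1_loc U g -> L1_loc U (fun x => f x - g x).
Proof.
move=> Hf Hg; have := L1_locD Hf (L1_locM Hg (smooth_continuous (@smooth_cst R n (-1)))).
by congr L1_loc; apply/funext => x; rewrite mulrN1.
Qed.

Lemma test_supp U phi x : test_function U phi -> ~ closure [set x | phi x != 0] x -> phi x = 0.
Proof.
move=> _; apply: contra_notP => /eqP h; exact: subset_closure.
Qed.

Lemma L1_loc_test_integrable U f phi : open U -> L1_loc U f -> test_function U phi ->
  L.-integrable U (fun x => (f x * phi x)%:E).
Proof.
move=> oU Lf tp; have [sp cp pU] := tp.
apply: (@integrable_support _ _ _ _ U (closure [set x | phi x != 0])) => //.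
- exact: open_measurable_rV.
- exact: compact_measurable_rV.
- by move=> x _ nx; rewrite (test_supp tp nx) mulr0.
- have [_] := L1_locM Lf (smooth_continuous sp); exact.
Qed.

Lemma integral_box_eq0 U h : open U -> L1_loc U h ->
  (forall phi, test_function U phi -> \int[L]_(x in U) (h x * phi x)%:E = 0)%E ->
  forall a b, cbox a b `<=` U -> (\int[L]_(x in box a b) (h x)%:E = 0)%E.
Proof.
move=> oU [mh Ih] h0 a b abU.
have mU := open_measurable_rV oU.
set C := cbox a b in abU.
have cC : compact C := @compact_cbox R n a b.
have mC : measurable C := @measurable_cbox R n a b.
have hC : L.-integrable C (EFin \o h) by exact: Ih.
have E j : (\int[L]_(x in C) (h x * box_bump a b j x)%:E = 0)%E.
  rewrite -(h0 _ (test_function_bump j abU)); apply/esym/integral_support => // x _ nx.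
  by rewrite bump_out ?mulr0// => /box_sub_cbox.
have [] := @dominated_convergence _ _ _ L C mC (fun j x => (h x * box_bump a b j x)%:E)
  (fun x => (h x * \1_(box a b) x)%:E) (fun x => `|(h x)%:E|%E).
- move=> j; apply/measurable_EFinP; apply: measurable_funM; first exact: measurable_funS abU mh.
  by apply: measurable_funTS; apply: continuous_measurable_rV; exact/smooth_continuous/smooth_bump.
- apply/measurable_EFinP; apply: measurable_funM; first exact: measurable_funS abU mh.
  by apply: measurable_funTS; apply: measurable_indic; exact: measurable_box.
- apply: aeW => x _; apply: cvg_near_cst; have := bump_cvg a b x.
  by apply: filterS => j ->.
- exact: integrable_abse.
- apply: aeW => x j _; rewrite lee_fin normrM ler_piMr// ger0_norm ?bump_ge0 ?bump_le1//.
move=> _ _; rewrite (_ : [sequence _]_j = cst 0%E); last first.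
  by apply/funext => j; rewrite /= E.
move=> /(@cvg_unique _ (@ereal_hausdorff R) _ _ _ _ (cvg_cst _)) => E0.
rewrite E0 (@integral_support _ _ _ L C (box a b)) //; first last.
- by move=> x _ nx; rewrite indicE memNset ?mulr0.
- exact: box_sub_cbox.
by apply: eq_integral => x; rewrite inE => bx; rewrite indicE mem_set ?mulr1.
Qed.

(** The sets over which [h] integrates to [0] inside the box form a Dynkin system
    containing the boxes, hence contain all Borel sets. *)
Lemma ae_eq0_box U h : open U -> L1_loc U h ->
  (forall phi, test_function U phi -> \int[L]_(x in U) (h x * phi x)%:E = 0)%E ->
  forall a b, cbox a b `<=` U -> {ae L, forall x, box a b x -> h x = 0}.
Proof.
move=> oU Lh h0 a b abU.
set Q := box a b; have mQ : measurable Q by exact: measurable_box.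
have mU : measurable U by exact: open_measurable_rV.
have QU : Q `<=` U by apply: subset_trans abU; exact: box_sub_cbox.
have hQ : L.-integrable Q (EFin \o h).
  apply: (@integrableS _ _ _ _ (cbox a b)) => //; [exact: measurable_cbox|exact: box_sub_cbox|].
  by apply: Lh.2 => //; exact: compact_cbox.
have mhQ : measurable_fun Q (EFin \o h) by apply/measurable_EFinP; exact: measurable_funS QU Lh.1.
have main A : measurable A -> (\int[L]_(x in A `&` Q) (h x)%:E = 0)%E.
  move: A; apply: measurable_rV_ind.
  - move=> c d; rewrite boxI; apply: (integral_box_eq0 oU Lh h0) => x /(_ _) H; apply: abU => i.
    by have := H i; rewrite ge_max le_min => /andP[/andP[_ ->] /andP[_ ->]].
  - by rewrite setTI; exact: (integral_box_eq0 oU Lh h0).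
  - move=> A mA A0; have : (\int[L]_(x in Q) (h x)%:E = 0)%E by exact: (integral_box_eq0 oU Lh h0).
    rewrite -[in X in X -> _](setTI Q) -(setUv A) setIUl integral_setU; last 4 first.
    + exact: measurableI.
    + by apply: measurableI => //; exact: measurableC.
    + by rewrite -setIUl setUv setTI.
    + by apply/disj_setPS => x [[Ax _] [nAx _]].
    by rewrite A0 add0e.
  - move=> F tF mF F0; rewrite setI_bigcupl integral_bigcup.
    + by apply: eseries0 => i _ _; exact: F0.
    + exact: trivIset_setIr.
    + by move=> k; exact: measurableI.
    + rewrite -setI_bigcupl; apply: (integrableS mQ) => //.
      by apply: measurableI => //; exact: bigcupT_measurable.
have : ae_eq L Q (EFin \o h) (cst 0%E).
  apply: integral_ae_eq => // E EQ mE.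
  by rewrite integral0 -(main E mE); congr (integral _ _ _); rewrite setIidl.
by apply: filterS => x Hx Qx; have [] := Hx Qx.
Qed.

(** Only countably many boxes are needed to cover an open set, so that almost
    everywhere statements on boxes add up. *)
Lemma open_rational_box U x : open U -> U x ->
  exists q : 'rV[rat]_n * 'rV[rat]_n,
    let a i := ratr (q.1 ord0 i) : R in let b i := ratr (q.2 ord0 i) : R in
    box a b x /\ cbox a b `<=` U.
Proof.
move=> oU Ux; have /nbhs_ballP[e /= e0 eU] : nbhs x U by apply: open_nbhs_nbhs; split.
have hq i : exists q : rat * rat, x ord0 i - e < ratr q.1 < x ord0 i /\ x ord0 i < ratr q.2 < x ord0 i + e.
  have [|q1] := @rat_in_itvoo R (x ord0 i - e) (x ord0 i); first by rewrite gtrBl.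
  have [|q2] := @rat_in_itvoo R (x ord0 i) (x ord0 i + e); first by rewrite ltrDl.
  by rewrite !in_itv /= => h1 h2; exists (q1, q2).
have [q Hq] := choice hq.
exists (\row_i (q i).1, \row_i (q i).2) => /=; split.
  by move=> i; rewrite !mxE; have [/andP[_ ->] /andP[->]] := Hq i.
move=> y Hy; apply: eU; split => // i j; rewrite (ord1 i); have := Hy j; rewrite !mxE.
have [/andP[h1 h2] /andP[h3 h4]] := Hq j => /andP[h5 h6].
rewrite /ball /= distrC ltr_distl; apply/andP; split.
  exact: lt_le_trans h5.
exact: le_lt_trans h4.
Qed.

Lemma ae_open_boxes U (P : set 'rV[R]_n) : open U ->
  (forall a b, cbox a b `<=` U -> {ae L, forall x, box a b x -> P x}) ->
  {ae L, forall x, U x -> P x}.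
Proof.
move=> oU H.
pose Q (k : nat) : set 'rV[R]_n :=
  if unpickle k is Some q then
    let a i := ratr ((q : 'rV[rat]_n * 'rV[rat]_n).1 ord0 i) : R in let b i := ratr (q.2 ord0 i) : R in
    [set x | cbox a b `<=` U /\ box a b x] else set0.
have : {ae L, forall x, forall k, Q k x -> P x}.
  apply: ae_foralln => k; rewrite /Q; case: unpickle => [q|]; last by apply: aeW.
  have [cU|ncU] := pselect (cbox (fun i => ratr (q.1 ord0 i) : R) (fun i => ratr (q.2 ord0 i)) `<=` U).
    by apply: filterS (H _ _ cU) => x Hx [_ /Hx].
  by apply: aeW => x [].
apply: filterS => x Hx Ux; have [q /= [h1 h2]] := open_rational_box oU Ux.
by apply: (Hx (pickle q)); rewrite /Q pickleK.
Qed.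

(** The indicator function of a box whose closure lies in [U] is a bounded
    pointwise limit of test functions, so [h] integrates to [0] over boxes,
    hence over Borel sets, hence vanishes almost everywhere. *)
Lemma fundamental_lemma U h : open U -> L1_loc U h ->
  (forall phi, test_function U phi -> \int[L]_(x in U) (h x * phi x)%:E = 0)%E ->
  {ae L, forall x, U x -> h x = 0}.
Proof. by move=> oU Lh h0; apply: ae_open_boxes => // a b; exact: (ae_eq0_box oU). Qed.

End fundamental_lemma.

(** * Weak gradients *)

Lemma ae_integrable d (T : measurableType d) (R : realType)
    (mu : {measure set T -> \bar R}) (D : set T) (f g : T -> \bar R) :
  measurable D -> measurable_fun D g -> ae_eq mu D f g ->
  mu.-integrable D f -> mu.-integrable D g.
Proof.
move=> mD mg fg /integrableP[mf If]; apply/integrableP; split => //.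
rewrite -(@ge0_ae_eq_integral _ _ _ mu D (abse \o f) (abse \o g))//; last exact: ae_eq_abse.
- exact: measurableT_comp.
- exact: measurableT_comp.
- by move=> x _; exact: abse_ge0.
- by move=> x _; exact: abse_ge0.
Qed.

Section weak_gradients.
Context {R : realType} {n : nat}.
Local Notation L := (lebesgue_rV R n).
Implicit Types (U V K : set 'rV[R]_n) (f g h u : 'rV[R]_n -> R) (G : 'rV[R]_n -> 'rV[R]_n).

Lemma weak_grad_measurable U u G i : is_weak_gradient U u G ->
  measurable_fun U (fun x => G x ord0 i).
Proof. by move=> [_ /(_ i) [[]]]. Qed.

Lemma weak_gradientP U u : (exists G, is_weak_gradient U u G) ->
  is_weak_gradient U u (weak_gradient U u).
Proof. by move=> [G HG]; rewrite /weak_gradient; exact: (@xgetI _ _ _ G). Qed.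

Lemma weak_grad_unique U u G G' : open U ->
  is_weak_gradient U u G -> is_weak_gradient U u G' ->
  {ae L, forall x, U x -> G x = G' x}.
Proof.
move=> oU [Lu HG] [_ HG'].
have mU := open_measurable_rV oU.
suff : {ae L, forall x, forall i, U x -> G x ord0 i - G' x ord0 i = 0}.
  by apply: filterS => x Hx Ux; apply/rowP => i; apply/eqP; rewrite -subr_eq0; apply/eqP; exact: Hx.
apply: filter_forall => i; have [LG I1] := HG i; have [LG' I2] := HG' i.
apply: (fundamental_lemma oU); first exact: L1_locB.
move=> phi tp; under eq_integral do rewrite mulrBl EFinB.
rewrite integralB; [|by []|exact: L1_loc_test_integrable|exact: L1_loc_test_integrable].
have := I1 _ tp; rewrite (I2 _ tp) => /oppe_inj ->; apply: subee.
by apply: integrable_fin_num => //; exact: L1_loc_test_integrable.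
Qed.

Lemma weak_gradientE U u G : open U -> is_weak_gradient U u G ->
  {ae L, forall x, U x -> weak_gradient U u x = G x}.
Proof. by move=> oU HG; apply: (weak_grad_unique oU (weak_gradientP _) HG); exists G. Qed.

Lemma test_function_subset U V phi : V `<=` U -> test_function V phi -> test_function U phi.
Proof. by move=> VU [? ? ?]; split => //; exact: subset_trans VU. Qed.

Lemma integral_test_sub U V f phi : V `<=` U -> test_function V phi ->
  (\int[L]_(x in U) (f x * phi x)%:E = \int[L]_(x in V) (f x * phi x)%:E)%E.
Proof.
move=> VU tp; apply: integral_support => // x _ nV.
rewrite (test_supp tp) ?mulr0//; apply: contra_not nV; by have [_ _] := tp; exact.
Qed.

Lemma weak_grad_sub U V u G : open U -> open V -> V `<=` U ->
  is_weak_gradient U u G -> is_weak_gradient V u G.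
Proof.
move=> oU oV VU [Lu HG].
have mU := open_measurable_rV oU; have mV := open_measurable_rV oV.
split; first exact: L1_loc_sub Lu.
move=> i; have [LG I] := HG i; split; first exact: L1_loc_sub LG.
move=> phi tp; rewrite -(integral_test_sub _ VU); last exact: test_function_partial.
by rewrite -(integral_test_sub _ VU)// I//; exact: test_function_subset tp.
Qed.

Lemma weak_grad_eq U u u' G : {in U, u =1 u'} ->
  is_weak_gradient U u G -> is_weak_gradient U u' G.
Proof.
move=> uu' [[mu Iu] HG]; split; first split.
- exact: eq_measurable_fun mu.
- move=> K cK KU; apply: eq_integrable (Iu K cK KU); first exact: compact_measurable_rV.
  by move=> x xK /=; rewrite uu'//; apply: mem_set; apply: KU; exact: set_mem.
- move=> i; have [LG I] := HG i; split => // phi tp; rewrite -I//.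
  by apply: eq_integral => x xU; rewrite uu'.
Qed.

(** If [phi] is a test function, so is [eta * phi]; the product rule for it is the
    identity to prove. *)
Lemma weak_gradM U u G (eta : 'rV[R]_n -> R) : open U -> smooth eta ->
  is_weak_gradient U u G ->
  is_weak_gradient U (fun x => u x * eta x) (fun x => eta x *: G x + u x *: gradient eta x).
Proof.
move=> oU se [Lu HG]; have mU := open_measurable_rV oU.
have ce := smooth_continuous se.
split; first exact: L1_locM.
move=> i; have [LG I] := HG i.
have cp : continuous (partial i eta) := smooth_continuous (smooth_partial i se).
have E x : (eta x *: G x + u x *: gradient eta x) ord0 i = G x ord0 i * eta x + u x * partial i eta x.
  by rewrite !mxE mulrC.
split.
  under eq_fun do rewrite E.
  by apply: L1_locD; exact: L1_locM.
move=> phi tp; under [in RHS]eq_integral do rewrite E mulrDl EFinD.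
have tep := test_functionMl se tp.
have tpe : test_function U (fun x => partial i eta x * phi x) by apply: test_functionMl => //; exact: smooth_partial.
have tpp : test_function U (fun x => eta x * partial i phi x) by apply: test_functionMl => //; exact: test_function_partial.
have sp : smooth phi by case: tp.
rewrite integralD; last 3 first.
- by [].
- by apply: (@L1_loc_test_integrable _ _ U (fun x => G x ord0 i * eta x)) => //; exact: L1_locM.
- by apply: (@L1_loc_test_integrable _ _ U (fun x => u x * partial i eta x)) => //; exact: L1_locM.
have H : (\int[L]_(x in U) (u x * partial i (fun x => eta x * phi x)%R x)%:E =
  \int[L]_(x in U) (u x * (eta x * partial i phi x))%:E +
  \int[L]_(x in U) (u x * (phi x * partial i eta x))%:E)%E.
  rewrite -integralD; last 3 first.
  - by [].
  - exact: (L1_loc_test_integrable oU Lu tpp).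
  - by under eq_fun do rewrite [phi _ * _]mulrC; exact: (L1_loc_test_integrable oU Lu tpe).
  by apply: eq_integral => x _; rewrite partialM// mulrDr.
rewrite (I _ tep) in H.
have -> : (\int[L]_(x in U) (u x * eta x * partial i phi x)%:E =
  \int[L]_(x in U) (u x * (eta x * partial i phi x))%:E)%E.
  by apply: eq_integral => x _; rewrite mulrA.
have F1 : (\int[L]_(x in U) (u x * (partial i eta x * phi x))%:E)%E \is a fin_num.
  by apply: integrable_fin_num => //; exact: (L1_loc_test_integrable oU Lu tpe).
have F2 : (\int[L]_(x in U) (G x ord0 i * (eta x * phi x))%:E)%E \is a fin_num.
  by apply: integrable_fin_num => //; exact: (L1_loc_test_integrable oU LG tep).
have E1 : (\int[L]_(x in U) (u x * (phi x * partial i eta x))%:E =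
   \int[L]_(x in U) (u x * (partial i eta x * phi x))%:E)%E.
  by apply: eq_integral => x _; rewrite (mulrC (phi x)).
have E2 : (\int[L]_(x in U) (G x ord0 i * eta x * phi x)%:E =
   \int[L]_(x in U) (G x ord0 i * (eta x * phi x))%:E)%E.
  by apply: eq_integral => x _; rewrite mulrA.
have E3 : (\int[L]_(x in U) (u x * partial i eta x * phi x)%:E =
   \int[L]_(x in U) (u x * (partial i eta x * phi x))%:E)%E.
  by apply: eq_integral => x _; rewrite mulrA.
rewrite E2 E3; rewrite E1 in H.
by rewrite fin_num_oppeD// H addeK.
Qed.

(** By uniqueness the gradients on the open sets [W k] agree almost everywhere, and
    the support of a test function, being compact, lies in one of them.  A gradient
    on each set off a singular point thus gives one on the punctured domain. *)
Lemma weak_grad_glue U (W : nat -> set 'rV[R]_n) u : open U -> (forall k, open (W k)) ->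
  (forall j k, (j <= k)%N -> W j `<=` W k) -> \bigcup_k W k = U ->
  (forall k, exists G, is_weak_gradient (W k) u G) ->
  exists G, is_weak_gradient U u G.
Proof.
move=> oU oW ndW WU exG; have [Gk HGk] := choice exG.
have mW k := open_measurable_rV (oW k).
have mU := open_measurable_rV oU.
have WsubU k : W k `<=` U by rewrite -WU; exact: bigcup_sup.
pose D k := W k `\` \bigcup_(j in `I_k) W j.
have mD k : measurable (D k) by apply: measurableD => //; exact: bigcup_measurable.
have DU : U = \bigcup_k D k.
  apply/seteqP; split => x; last by move=> [k _ [Wkx _]]; exact: WsubU Wkx.
  rewrite -WU => -[k _]; elim/ltn_ind: k => k IH Wkx.
  have [[j /= jk Wjx]|h] := pselect ((\bigcup_(j in `I_k) W j) x); first exact: (IH j).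
  by exists k.
have Dj k j x : D k x -> D j x -> k = j.
  move=> [Wkx nk] [Wjx nj]; have [kj|jk|//] := ltngtP k j.
    by exfalso; apply: nj; exists k.
  by exfalso; apply: nk; exists j.
pose kx x := xget 0%N [set k | D k x].
have kxE k x : D k x -> kx x = k.
  by move=> Dk; rewrite /kx; case: xgetP => [y -> Dy|/(_ k)//]; exact: Dj Dy Dk.
pose G x := Gk (kx x) x.
have GE k x : D k x -> G x = Gk k x by rewrite /G => /kxE ->.
have GW k : {ae L, forall x, W k x -> G x = Gk k x}.
  have : {ae L, forall x, forall j, W (minn j k) x -> Gk j x = Gk k x}.
    apply: ae_foralln => j; apply: (@weak_grad_unique _ u); first exact: oW.
      by apply: weak_grad_sub (HGk j) => //; apply: ndW; exact: geq_minl.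
    by apply: weak_grad_sub (HGk k) => //; apply: ndW; exact: geq_minr.
  apply: filterS => x Hx Wkx; have : U x := WsubU _ _ Wkx.
  rewrite {1}DU => -[j _ Djx]; rewrite (GE j)//; apply: Hx.
  by have [jk|kj] := leqP j k; [exact: Djx.1|].
have compW K : compact K -> K `<=` U -> exists k, K `<=` W k.
  rewrite compact_cover => cK KU.
  have [] := cK nat setT W (fun k _ => oW k); first by move=> x /KU; rewrite -WU.
  move=> S _ KS; exists (\max_(k <- finmap.enum_fset S) k) => x /KS [k kS Wkx].
  apply: ndW Wkx; apply: (@leq_bigmax_seq _ _ xpredT id) => //.
exists G; split.
  split; first by rewrite -WU; apply/measurable_fun_bigcup => // k; have [[]] := HGk k.
  move=> K cK /(compW _ cK)[k KW]; have [[_ I] _] := HGk k; exact: I.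
move=> i.
have mGi : measurable_fun U (fun x => G x ord0 i).
  rewrite DU; apply/measurable_fun_bigcup => // k.
  apply: (@eq_measurable_fun _ _ _ _ _ (fun x => Gk k x ord0 i)).
    by move=> x; rewrite inE => Dx; rewrite (GE k).
  by apply: measurable_funS (weak_grad_measurable i (HGk k)) => // x [].
have aeG k K (f : 'rV[R]_n -> R) : K `<=` W k ->
    ae_eq L K (fun x => (Gk k x ord0 i * f x)%:E) (fun x => (G x ord0 i * f x)%:E).
  by move=> KW; apply: filterS (GW k) => x Hx Kx; rewrite Hx//; exact: KW.
split.
  split=> // K cK KU; have [k KW] := compW _ cK KU.
  have mK := compact_measurable_rV cK.
  have [_ /(_ i) [[_ I] _]] := HGk k.
  apply: (ae_integrable mK _ _ (I K cK KW)).
    by apply/measurable_EFinP; exact: measurable_funS mGi.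
  by apply: filterS (aeG k K (fun=> 1) KW) => x; rewrite !mulr1.
move=> phi tp; have [sp cp pU] := tp.
have [k KW] := compW _ cp pU.
have tpk : test_function (W k) phi by split.
rewrite (integral_test_sub _ (WsubU k)); last exact: test_function_partial.
rewrite (integral_test_sub _ (WsubU k) tpk).
have [_ /(_ i) [[mGk _] I]] := HGk k.
rewrite I//; congr (- _)%E; apply: ae_eq_integral => //.
- apply/measurable_EFinP; apply: measurable_funM => //.
  by apply: measurable_funTS; apply: continuous_measurable_rV; exact: smooth_continuous.
- apply/measurable_EFinP; apply: measurable_funM; first exact: measurable_funS mGi.
  by apply: measurable_funTS; apply: continuous_measurable_rV; exact: smooth_continuous.
- exact: aeG.
Qed.

End weak_gradients.

(** * Powers, and density of compactly supported continuous functions in L^p *)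

Section powers.
Context {R : realType}.
Implicit Types (a b p : R).

Lemma powR_add_le a b p : 0 <= a -> 0 <= b -> 0 <= p ->
  (a + b) `^ p <= 2 `^ p * (a `^ p + b `^ p).
Proof.
move=> a0 b0 p0; wlog ab : a b a0 b0 / a <= b.
  by move=> H; have [/H|/ltW/H] := leP a b; [exact|rewrite addrC [_ `^ p + _]addrC; exact].
apply: (@le_trans _ _ ((2 * b) `^ p)).
  by apply: ge0_ler_powR => //; rewrite ?nnegrE ?addr_ge0 ?mulr_ge0//; lra.
by rewrite powRM// ler_wpM2l ?powR_ge0// lerDr powR_ge0.
Qed.

Lemma powR_le a b p : 0 <= p -> 0 <= a -> a <= b -> a `^ p <= b `^ p.
Proof. by move=> p0 a0 ab; apply: ge0_ler_powR => //; rewrite nnegrE// (le_trans a0). Qed.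

Lemma measurable_powR_abs d (T : measurableType d) (D : set T) (f : T -> R) p :
  measurable_fun D f -> measurable_fun D (fun x => `|f x| `^ p).
Proof.
move=> mf; have mfa : measurable_fun D (fun x => `|f x|) by exact: measurableT_comp.
exact: (measurableT_comp (measurable_powR p) mfa).
Qed.

Lemma cvg_powR0 (u : nat -> R) p : 0 < p -> (forall k, 0 <= u k) ->
  u @ \oo --> 0 -> (u k) `^ p @[k --> \oo] --> 0.
Proof.
move=> p0 u0 cu; apply/cvgrPdist_lt => e e0.
have ep : 0 < e `^ p^-1 by rewrite powR_gt0.
move/cvgrPdist_lt : cu => /(_ _ ep); apply: filterS => k.
rewrite !sub0r !normrN !ger0_norm ?powR_ge0// => uk.
rewrite (lt_le_trans (gt0_ltr_powR p0 _ _ uk)) ?nnegrE ?powR_ge0//.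
by rewrite -powRrM mulVf ?gt_eqF// powRr1 // ltW.
Qed.

(** The tangent to the convex function [t `^ p] at [m]. *)
Lemma young_le (t m p : R) : 1 < p -> 0 <= t -> 0 <= m ->
  t * m `^ (p - 1) <= t `^ p / p + m `^ p * (1 - p^-1).
Proof.
move=> p1 t0 m0; have p0 : 0 < p by lra.
have pp : p - 1 != 0 by lra.
have pn0 : p != 0 by rewrite gt_eqF.
have := @conjugate_powR _ t (m `^ (p - 1)) p (p / (p - 1)) t0 (powR_ge0 _ _).
rewrite -powRrM (_ : (p - 1) * (p / (p - 1)) = p); last by field.
move=> /(_ p0); rewrite divr_gt0// ?subr_gt0// => /(_ isT).
rewrite (_ : p^-1 + (p / (p - 1))^-1 = 1); last by field; rewrite ?pn0 ?pp.
move=> /(_ erefl) h; apply: le_trans h _; rewrite lerD2l ler_wpM2l ?powR_ge0//.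
by rewrite le_eqVlt; apply/orP; left; apply/eqP; field; rewrite ?pn0 ?pp.
Qed.

(** The left side is at most [max(a, b) `^ p]; this replaces Hoelder's inequality
    with exponents [p / (p - 1)] and [p] whenever only smallness matters. *)
Lemma powRB1_mul_le (a b p : R) : 1 <= p -> 0 <= a -> 0 <= b ->
  a `^ (p - 1) * b <= a `^ p + b `^ p.
Proof.
move=> p1 a0 b0.
have p0 : 0 < p by lra.
have [ab|/ltW ba] := leP a b.
  apply: (@le_trans _ _ (b `^ (p - 1) * b)).
    by rewrite ler_wpM2r//; apply: powR_le => //; lra.
  by rewrite mulrC mulr_powRB1// lerDr powR_ge0.
apply: (@le_trans _ _ (a `^ (p - 1) * a)); first by rewrite ler_wpM2l ?powR_ge0.
by rewrite mulrC mulr_powRB1// lerDl powR_ge0.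
Qed.

End powers.

(** Integrate [young_le] at [m] equal to the mean value against [rho]. *)
Lemma jensen_powR d (T : measurableType d) (R : realType) (mu : {measure set T -> \bar R})
    (t rho : T -> R) (p : R) : 1 < p ->
  measurable_fun setT t -> measurable_fun setT rho ->
  (forall x, 0 <= t x) -> (forall x, 0 <= rho x) ->
  (\int[mu]_x (rho x)%:E = 1)%E ->
  mu.-integrable setT (fun x => (t x * rho x)%:E) ->
  (((\int[mu]_x (t x * rho x)) `^ p)%:E <= \int[mu]_x (t x `^ p * rho x)%:E)%E.
Proof.
move=> p1 mt mr t0 r0 r1 Itr; set m := (\int[mu]_x (t x * rho x)).
have m0 : 0 <= m by apply: Rintegral_ge0 => x _; rewrite mulr_ge0.
have p0 : 0 < p by lra.
have mtp : measurable_fun setT (fun x => t x `^ p).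
  by exact: (measurableT_comp (measurable_powR p) mt).
have Em : (\int[mu]_x (t x * rho x)%:E = m%:E)%E.
  by rewrite /m /Rintegral fineK//; exact: integrable_fin_num.
have tp0 x : (0 <= (t x `^ p * rho x)%:E)%E by rewrite lee_fin mulr_ge0// powR_ge0.
have H : (\int[mu]_x ((m `^ (p - 1))%:E * (t x * rho x)%:E) <=
   \int[mu]_x ((p^-1)%:E * (t x `^ p * rho x)%:E + (m `^ p * (1 - p^-1))%:E * (rho x)%:E))%E.
  apply: ge0_le_integral => //.
  - by move=> x _; rewrite -EFinM lee_fin !mulr_ge0// powR_ge0.
  - by apply/measurable_EFinP; do 2! apply: measurable_funM => //.
  - by apply: emeasurable_funD; apply: emeasurable_funM => //; apply/measurable_EFinP => //; exact: measurable_funM.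
  - move=> x _; rewrite -!EFinM -EFinD lee_fin.
    rewrite [leLHS](_ : _ = (t x * m `^ (p - 1)) * rho x); last by ring.
    rewrite [leRHS](_ : _ = (t x `^ p / p + m `^ p * (1 - p^-1)) * rho x); last by ring.
    by rewrite ler_wpM2r// young_le.
have pv : 0 <= 1 - p^-1 by rewrite subr_ge0 invf_le1// ltW.
rewrite ge0_integralZl_EFin ?powR_ge0// in H; last 2 first.
- by move=> x _; rewrite lee_fin mulr_ge0.
- by apply/measurable_EFinP; exact: measurable_funM.
rewrite Em ge0_integralD// in H; last 4 first.
- by move=> x _; rewrite mule_ge0// lee_fin invr_ge0 ltW.
- by apply: emeasurable_funM => //; apply/measurable_EFinP => //; exact: measurable_funM.
- by move=> x _; rewrite mule_ge0 ?lee_fin// mulr_ge0// powR_ge0.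
- by apply: emeasurable_funM => //; exact/measurable_EFinP.
rewrite !ge0_integralZl_EFin// ?r1 ?mule1 in H; try by apply/measurable_EFinP => //; exact: measurable_funM.
- have : (0 <= \int[mu]_x (t x `^ p * rho x)%:E)%E by apply: integral_ge0.
  move: H; case: (\int[mu]_x (t x `^ p * rho x)%:E)%E => [s| |]; last 2 first.
  + by move=> _ _; rewrite leey.
  + by move=> _; rewrite leeNy_eq.
  rewrite -!EFinM -EFinD !lee_fin => H s0.
  have E : m `^ (p - 1) * m = m `^ p by rewrite mulrC mulr_powRB1.
  rewrite E in H; have : p^-1 * m `^ p <= p^-1 * s by lra.
  by rewrite ler_pM2l ?invr_gt0.
- by move=> x _; rewrite lee_fin.
- by rewrite mulr_ge0// powR_ge0.
- by rewrite invr_ge0 ltW.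
Qed.

Section Lp_density.
Context {R : realType} {n : nat} (p : R) (p1 : 1 < p).
Local Notation L := (lebesgue_rV R n).
Let p0 : 0 < p. Proof. exact: lt_trans p1. Qed.

Definition Cc (c : 'rV[R]_n -> R) := continuous c /\ exists2 K, compact K & forall x, ~ K x -> c x = 0.

(** The [p]th power of the distance in L^p; taking no root keeps all estimates
    additive, at the price of factors [2 `^ p]. *)
Definition dist_p (f g : 'rV[R]_n -> R) := (\int[L]_x (`|f x - g x| `^ p)%:E)%E.

Definition Lp_approx (f : 'rV[R]_n -> R) := measurable_fun setT f /\
  forall e : R, 0 < e -> exists2 c, Cc c & (dist_p f c <= e%:E)%E.

Let one_pow : 1 `^ p = 1 :> R. Proof. by rewrite powR1. Qed.

Let scale_le (C e : R) (A B : \bar R) : 0 < C ->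
  (A <= (C^-1 * (e / 2))%:E -> B <= (C^-1 * (e / 2))%:E -> C%:E * (A + B) <= e%:E)%E.
Proof.
move=> C0 hA hB; apply: (@le_trans _ _ (C%:E * ((C^-1 * (e / 2))%:E + (C^-1 * (e / 2))%:E))%E).
  by apply: lee_wpmul2l; [rewrite lee_fin ltW|exact: leeD].
rewrite -EFinD -EFinM lee_fin -mulrDr mulrA divff ?gt_eqF// mul1r; lra.
Qed.

Let m_pow (f : 'rV[R]_n -> R) : measurable_fun setT f ->
  measurable_fun setT (fun x => (`|f x| `^ p)%:E).
Proof. by move=> mf; apply/measurable_EFinP; exact: measurable_powR_abs. Qed.

Lemma dist_p_triangle f g h : measurable_fun setT f -> measurable_fun setT g -> measurable_fun setT h ->
  (dist_p f h <= (2 `^ p)%:E * (dist_p f g + dist_p g h))%E.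
Proof.
move=> mf mg mh; rewrite /dist_p.
rewrite -ge0_integralD//; try by apply: m_pow; exact: measurable_funB.
rewrite -ge0_integralZl_EFin ?powR_ge0//; last 2 first.
- by move=> x _; rewrite -EFinD lee_fin addr_ge0// powR_ge0.
- by apply: emeasurable_funD; apply: m_pow; exact: measurable_funB.
apply: ge0_le_integral => //.
- by apply: m_pow; exact: measurable_funB.
- by apply: emeasurable_funM => //; apply: emeasurable_funD; apply: m_pow; exact: measurable_funB.
- move=> x _; rewrite -EFinD -EFinM lee_fin.
  apply: le_trans (powR_add_le _ _ (ltW p0)); rewrite ?normr_ge0//.
  by apply: powR_le; rewrite ?normr_ge0 ?(ltW p0)// ler_distD.
Qed.

Lemma Cc_measurable c : Cc c -> measurable_fun setT c.
Proof. by move=> [cc _]; exact: continuous_measurable_rV. Qed.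

Lemma CcB c d : Cc c -> Cc d -> Cc (fun x => c x - d x).
Proof.
move=> [cc [K cK c0]] [cd [K' cK' d0]]; split.
  by move=> x; exact: (cvgB (cc x) (cd x)).
exists (K `|` K'); first exact: compactU.
by move=> x /not_orP[h1 h2]; rewrite c0// d0// subr0.
Qed.

Lemma CcZ (a : R) c : Cc c -> Cc (fun x => a * c x).
Proof.
move=> [cc [K cK c0]]; split; first by move=> x; exact: (cvgM (cvg_cst a) (cc x)).
by exists K => // x Kx; rewrite c0// mulr0.
Qed.

Lemma Lp_approx_lim f : measurable_fun setT f ->
  (forall e : R, 0 < e -> exists2 g, Lp_approx g & (dist_p f g <= e%:E)%E) -> Lp_approx f.
Proof.
move=> mf H; split => // e e0.
pose d : R := (2 `^ p)^-1 * (e / 2).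
have d0 : 0 < d by rewrite mulr_gt0// ?invr_gt0 ?powR_gt0// divr_gt0.
have [g [mg Hg] fg] := H _ d0; have [c cc gc] := Hg _ d0.
exists c => //; apply: le_trans (dist_p_triangle mf mg (Cc_measurable cc)) _.
apply: (scale_le _ fg gc); exact: powR_gt0.
Qed.

Lemma Lp_approxB f g : Lp_approx f -> Lp_approx g -> Lp_approx (fun x => f x - g x).
Proof.
move=> [mf Hf] [mg Hg]; split; first exact: measurable_funB.
move=> e e0; pose d : R := (2 `^ p)^-1 * (e / 2).
have d0 : 0 < d by rewrite mulr_gt0// ?invr_gt0 ?powR_gt0// divr_gt0.
have [c cc fc] := Hf _ d0; have [c' cc' gc] := Hg _ d0.
exists (fun x => c x - c' x); first exact: CcB.
have mc := Cc_measurable cc; have mc' := Cc_measurable cc'.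
apply: (le_trans (@dist_p_triangle _ (fun x => c x - g x) _ _ _ _)); try exact: measurable_funB.
have E1 : dist_p (fun x => f x - g x) (fun x => c x - g x) = dist_p f c.
  by apply: eq_integral => x _; congr (`|_| `^ _)%:E; ring.
have E2 : dist_p (fun x => c x - g x) (fun x => c x - c' x) = dist_p g c'.
  by apply: eq_integral => x _; rewrite -normrN; congr (`|_| `^ _)%:E; ring.
rewrite E1 E2; apply: (scale_le _ fc gc); exact: powR_gt0.
Qed.

Lemma Lp_approxZ a f : Lp_approx f -> Lp_approx (fun x => a * f x).
Proof.
move=> [mf Hf]; split; first exact: measurable_funM.
move=> e e0; have d0 : 0 < (`|a| `^ p + 1)^-1 * e by rewrite mulr_gt0 ?invr_gt0 ?ltr_wpDl ?powR_ge0.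
have [c cc fc] := Hf _ d0; exists (fun x => a * c x); first exact: CcZ.
have -> : dist_p (fun x => a * f x) (fun x => a * c x) = ((`|a| `^ p)%:E * dist_p f c)%E.
  rewrite /dist_p -ge0_integralZl_EFin ?powR_ge0//.
  - by apply: eq_integral => x _; rewrite -mulrBr normrM powRM.
  - by apply: m_pow; apply: measurable_funB => //; exact: Cc_measurable.
  apply: (@le_trans _ _ ((`|a| `^ p)%:E * ((`|a| `^ p + 1)^-1 * e)%:E)%E).
  by rewrite lee_wpmul2l// lee_fin powR_ge0.
rewrite -EFinM lee_fin mulrA ler_piMl ?(ltW e0)// ler_pdivrMr ?ltr_wpDl ?powR_ge0//; lra.
Qed.

Lemma Lp_approx_dominated (f : 'rV[R]_n -> R) (g : nat -> 'rV[R]_n -> R) (G : 'rV[R]_n -> R) :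
  measurable_fun setT f -> (forall k, Lp_approx (g k)) ->
  (forall x, g k x @[k --> \oo] --> f x) ->
  (forall k x, `|f x - g k x| `^ p <= G x) -> L.-integrable setT (EFin \o G) ->
  Lp_approx f.
Proof.
move=> mf Hg gf fG IG; apply: Lp_approx_lim => // e e0.
have : dist_p f (g k) @[k --> \oo] --> 0%E.
  rewrite -(@integral0 _ _ _ L setT).
  apply: (@dominated_cvg _ _ _ _ _ measurableT _ _ (EFin \o G)) => //.
  - by move=> k; apply: m_pow; apply: measurable_funB => //; have [] := Hg k.
  - move=> x _; apply: cvg_EFin; first by apply: nearW => k.
    apply: cvg_powR0 => //; rewrite -[X in _ --> X](normr0 R) -(subrr (f x)).
    by apply: cvg_norm; apply: cvgB => //; exact: cvg_cst.
  - by move=> k x _ /=; rewrite ger0_norm ?powR_ge0// lee_fin.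
move=> /fine_cvgP[fin /cvgrPdist_le/(_ _ e0) H].
near \oo => k; exists (g k) => //.
have fk : dist_p f (g k) \is a fin_num by near: k.
rewrite -(fineK fk) lee_fin.
have : `|0 - fine (dist_p f (g k))| <= e by near: k.
by apply: le_trans; rewrite sub0r normrN ler_norm.
Unshelve. all: by end_near. Qed.

Lemma Lp_approx_indic_box a b : Lp_approx (\1_(box a b)).
Proof.
apply: (@Lp_approx_dominated _ (box_bump a b) (\1_(cbox a b))).
- by apply: measurable_indic; exact: measurable_box.
- move=> j; have cB := smooth_continuous (smooth_bump a b j).
  have CB : Cc (box_bump a b j).
    split=> //; exists (cbox a b); first exact: compact_cbox.
    by move=> x nx; apply: bump_out => /box_sub_cbox.
  split; first exact: Cc_measurable.
  move=> e e0; exists (box_bump a b j) => //; rewrite /dist_p.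
  under eq_integral do rewrite subrr normr0 powR0 ?gt_eqF//.
  by rewrite integral0 lee_fin ltW.
- by move=> x; apply: cvg_near_cst; exact: bump_cvg.
- move=> j x; have [bx|nb] := pselect (box a b x).
    rewrite !indicE !mem_set//=; last exact: box_sub_cbox.
    rewrite -[leRHS]one_pow; apply: powR_le; rewrite ?normr_ge0 ?(ltW p0)// ger0_norm.
      by rewrite lerBlDr lerDl bump_ge0.
    by rewrite subr_ge0 bump_le1.
  by rewrite bump_out// indicE memNset//= subrr normr0 powR0 ?gt_eqF.
- apply/integrableP; split; first by apply/measurable_EFinP; apply: measurable_indic; exact: measurable_cbox.
  under eq_integral do rewrite /= ger0_norm//.
  by have mC := measurable_cbox a b; rewrite integral_indic// setIT; exact: cbox_fin.
Qed.

Lemma Lp_approxD f g : Lp_approx f -> Lp_approx g -> Lp_approx (fun x => f x + g x).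
Proof.
move=> Hf Hg; have := Lp_approxB Hf (Lp_approxZ (-1) Hg).
by congr Lp_approx; apply/funext => x; rewrite mulN1r opprK.
Qed.

Lemma Lp_approx_sum (I : Type) (s : seq I) (f : I -> 'rV[R]_n -> R) :
  (forall i, Lp_approx (f i)) -> Lp_approx (fun x => \sum_(i <- s) f i x).
Proof.
move=> Hf; elim: s => [|i s IH]; last first.
  by have := Lp_approxD (Hf i) IH; congr Lp_approx; apply/funext => x; rewrite big_cons.
under eq_fun do rewrite big_nil; split=> // e e0.
exists (fun=> 0); first by split; [exact: cst_continuous|exists set0 => //; exact: compact0].
rewrite /dist_p; under eq_integral do rewrite subrr normr0 powR0 ?gt_eqF//.
by rewrite integral0 lee_fin ltW.
Qed.

(** Inside a box, the sets with approximable indicator function form a Dynkin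
    system. *)
Lemma Lp_approx_indic a b A : measurable A -> Lp_approx (\1_(A `&` box a b)).
Proof.
have mQ := @measurable_box R n a b.
have I01 (B : set 'rV[R]_n) x : 0 <= (\1_B x : R) <= 1.
  by rewrite indicE; case: (x \in B) => /=; rewrite ?ler01 ?lexx.
move: A; apply: measurable_rV_ind.
- by move=> c d; rewrite boxI; exact: Lp_approx_indic_box.
- by rewrite setTI; exact: Lp_approx_indic_box.
- move=> A mA HA; have := Lp_approxB (Lp_approx_indic_box a b) HA.
  congr Lp_approx; apply/funext => x; rewrite !indicE !in_setI in_setC.
  by case: (x \in A); case: (x \in box a b); rewrite /= ?subrr ?subr0.
- move=> F tF mF HF.
  pose g k x : R := \sum_(i < k) \1_(F i `&` box a b) x.
  have gE k : g k = \1_((\big[setU/set0]_(i < k) F i) `&` box a b).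
    apply/funext => x; rewrite /g; elim: k => [|k IH].
      by rewrite !big_ord0 set0I indicE in_set0.
    rewrite !big_ord_recr/= IH setIUl !indicE in_setU.
    have [xFk|] := boolP (x \in F k `&` box a b); last by rewrite addr0 orbF.
    rewrite (_ : (x \in _) = false) ?add0r//; apply/negbTE; rewrite notin_setE => -[].
    rewrite -bigcup_mkord => -[i /= ik Fix] _; move: xFk; rewrite inE => -[Fkx _].
    by have ki := tF i k I I (ex_intro _ x (conj Fix Fkx)); rewrite ki ltnn in ik.
  apply: (@Lp_approx_dominated _ g (\1_(cbox a b))).
  + by apply: measurable_indic; apply: measurableI => //; exact: bigcupT_measurable.
  + move=> k; apply: (@Lp_approx_sum 'I_k) => i; exact: HF.
  + move=> x; apply: cvg_near_cst.
    have [[[i _ Fix] bx]|nx] := pselect ((\bigcup_k F k `&` box a b) x).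
      near=> k; rewrite gE !indicE mem_set ?mem_set//; last first.
      split=> //; rewrite -bigcup_mkord; exists i => //=; near: k; exact: nbhs_infty_gt.
      by split => //; exists i.
    near=> k; rewrite gE !indicE memNset ?memNset// => -[+ bx]; rewrite -bigcup_mkord => -[i _ Fix].
    by apply: nx; split=> //; exists i.
  + move=> k x; have [bx|nb] := pselect (box a b x); last first.
      have z B : \1_(B `&` box a b) x = 0 :> R by rewrite indicE memNset// => -[].
      by rewrite gE !z subrr normr0 powR0 ?gt_eqF//; have /andP[] := I01 (cbox a b) x.
    rewrite [\1_(cbox _ _) x]indicE mem_set//=; last exact: box_sub_cbox.
    rewrite -[leRHS]one_pow; apply: powR_le; rewrite ?normr_ge0 ?(ltW p0)// gE.
    have := I01 (\bigcup_k F k `&` box a b) x; have := I01 (\big[setU/set0]_(i < k) F i `&` box a b) x.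
    by move=> /andP[h1 h2] /andP[h3 h4]; rewrite ler_norml; lra.
  + apply/integrableP; split; first by apply/measurable_EFinP; apply: measurable_indic; exact: measurable_cbox.
    under eq_integral do rewrite /= ger0_norm//.
    by have mC := measurable_cbox a b; rewrite integral_indic// setIT; exact: cbox_fin.
Unshelve. all: by end_near. Qed.

Import HBNNSimple.
(** A nonnegative function is the increasing limit of simple functions; these are cut
    off by growing boxes. *)
Lemma Lp_approx_nonneg (f : 'rV[R]_n -> R) : measurable_fun setT f -> (forall x, 0 <= f x) ->
  (\int[L]_x (`|f x| `^ p)%:E < +oo)%E -> Lp_approx f.
Proof.
move=> mf f0 If.
have mEf : measurable_fun setT (EFin \o f) by exact/measurable_EFinP.
have Ef0 x : setT x -> (0 <= (EFin \o f) x)%E by move=> _; rewrite lee_fin.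
pose Q k := box (fun _ : 'I_n => - k%:R : R) (fun=> k%:R : R).
pose s k := nnsfun_approx measurableT mEf k.
have sle k x : s k x <= f x by rewrite -lee_fin /s nnsfun_approxE; exact: le_approx.
apply: (@Lp_approx_dominated _ (fun k x => s k x * \1_(Q k) x) (fun x => `|f x| `^ p)) => //.
- move=> k.
  have -> : (fun x => s k x * \1_(Q k) x) = (fun x => \sum_(y <- finmap.enum_fset (fset_set (range (s k)))) (y * \1_((s k) @^-1` [set y] `&` Q k) x)).
    apply/funext => x; rewrite {1}fimfunE fsbig_finite//= mulr_suml.
    apply: eq_bigr => y _; rewrite -mulrA !indicE in_setI; congr (_ * _).
    by case: (_ \in _); case: (_ \in _); rewrite ?mulr1 ?mulr0.
  apply: Lp_approx_sum => y; apply: Lp_approxZ; apply: Lp_approx_indic.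
  exact: measurable_sfunP.
- move=> x; rewrite -[X in _ --> X]mulr1; apply: cvgM.
    have /fine_cvgP[_] := @cvg_nnsfun_approx _ _ _ _ measurableT _ mEf Ef0 x I.
    exact.
  apply: cvg_near_cst; near=> k; rewrite indicE mem_set// => i.
  rewrite -ltr_norml; apply: (@le_lt_trans _ _ (enorm x)); first exact: coord_le_enorm.
  near: k; exact: nbhs_infty_gtr.
- move=> k x; apply: powR_le; rewrite ?normr_ge0 ?(ltW p0)//.
  have s0 : 0 <= s k x by exact: fun_ge0.
  have [h|h] : (\1_(Q k) x : R) = 0 \/ (\1_(Q k) x : R) = 1 by rewrite indicE; case: (_ \in _); [right|left].
    by rewrite h mulr0 subr0.
  by rewrite h mulr1 !ger0_norm// ?subr_ge0// gerBl.
- apply/integrableP; split; first by exact: m_pow.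
  by under eq_integral do rewrite /= ger0_norm ?powR_ge0//.
Unshelve. all: by end_near. Qed.

Lemma Lp_density (f : 'rV[R]_n -> R) : measurable_fun setT f ->
  (\int[L]_x (`|f x| `^ p)%:E < +oo)%E -> Lp_approx f.
Proof.
move=> mf If.
have H (g : 'rV[R]_n -> R) : measurable_fun setT g -> (forall x, 0 <= g x <= `|f x|) -> Lp_approx g.
  move=> mg gf; apply: (Lp_approx_nonneg mg); first by move=> x; have /andP[] := gf x.
  apply: le_lt_trans If; apply: ge0_le_integral => //.
    - exact: m_pow.
  - exact: m_pow.
  - move=> x _; have /andP[g0 gfx] := gf x.
    by rewrite lee_fin; apply: powR_le; rewrite ?normr_ge0 ?(ltW p0)// ger0_norm.
have := Lp_approxB (H (fun x => Num.max (f x) 0) _ _) (H (fun x => Num.max (- f x) 0) _ _).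
have -> : (fun x => Num.max (f x) 0 - Num.max (- f x) 0) = f.
  by apply/funext => x; have [h|h] := leP (f x) 0; have [h'|h'] := leP (- f x) 0; lra.
apply.
- exact: measurable_maxr.
- by move=> x; rewrite le_max lexx orbT ge_max ler_norm normr_ge0.
- by apply: measurable_maxr => //; exact: measurableT_comp.
- by move=> x; rewrite le_max lexx orbT ge_max -normrN ler_norm normr_ge0.
Qed.
End Lp_density.

(** * Convolution with a smooth kernel along an affine map *)

Section affine1.
Context {R : realType}.
Lemma is_derive_affine1 (c b t : R) : is_derive t (1 : R) (fun t => c * t + b) c.
Proof.
have sE (x y : R) : x *: y = x * y by [].
have -> : (fun t : R => c * t + b) = cst c * id + cst b by [].
by apply: is_derive_eq; rewrite !sE mulr1 addr0 mulr0 addr0.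
Qed.

Lemma is_derive_comp_affine (k : R -> R) (c b t : R) : derivable k (c * t + b) 1 ->
  is_derive t (1 : R) (fun t => k (c * t + b)) (derive1 k (c * t + b) * c).
Proof.
move=> dk; have [d dE] := is_derive_affine1 c b t.
have := @is_derive_comp_dir R R k (fun t : R => c * t + b) t 1 dk d.
by rewrite dE.
Qed.

Lemma is_derive_mulc (V : normedModType R) (c : R) (f : V -> R) (x v : V) (df : R) :
  is_derive x v f df -> is_derive x v (fun y => c * f y) (c * df).
Proof.
move=> [d e]; have sE (y z : R) : y *: z = y * z by [].
split; first exact: (@derivableM _ _ (cst c) f x v (derivable_cst c x v) d).
have -> := @deriveM _ _ (cst c) f x v (derivable_cst c x v) d.
by rewrite derive_cst e !sE mulr0 addr0.
Qed.
End affine1.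

Section kernel1.
Context {R : realType} (e : R) (e0 : 0 < e).

Definition step_e (t : R) := smooth_step ((2 * e)^-1 * t + 2^-1).
(** As the derivative of a function that rises from [0] to [1] on [[-e, e]], this
    kernel has mass one by the fundamental theorem of calculus, without any
    normalizing constant. *)
Definition kern (t : R) := derive1 step_e t.

Lemma smooth1_step_e : smooth1 step_e.
Proof.
by move=> m; apply: (@Cd_comp R R unit (fun=> 1) m _ _ (@smooth1_step R)); exact: smooth1_affine.
Qed.

Lemma smooth1_kern : smooth1 kern.
Proof. exact: (smooth1_derive smooth1_step_e). Qed.

Lemma kernE t : kern t = derive1 (@smooth_step R) ((2 * e)^-1 * t + 2^-1) * (2 * e)^-1.
Proof.
have ds : derivable (@smooth_step R) ((2 * e)^-1 * t + 2^-1) 1 by exact: (@smooth1_derivable R _ (@smooth1_step R)).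
have [_ E] := is_derive_comp_affine ds.
by rewrite /kern derive1E; exact: E.
Qed.

Lemma kern_ge0 t : 0 <= kern t.
Proof. by rewrite kernE mulr_ge0 ?smooth_step_derive_ge0// invr_ge0 mulr_ge0// ltW. Qed.

Lemma kern_out t : e < `|t| -> kern t = 0.
Proof.
move=> et; rewrite kernE smooth_step_derive_out ?mul0r//.
have e2 : 0 < (2 * e)^-1 by rewrite invr_gt0 mulr_gt0.
have E : (2 * e)^-1 * e = 2^-1 by field; rewrite gt_eqF.
move: et; rewrite real_lter_normr ?num_real// => /orP[h|h]; [right|left].
  have : (2 * e)^-1 * e < (2 * e)^-1 * t by rewrite ltr_pM2l.
  lra.
have : (2 * e)^-1 * e < (2 * e)^-1 * - t by rewrite ltr_pM2l.
rewrite mulrN; lra.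
Qed.

Lemma step_e0 t : t <= - e -> step_e t = 0.
Proof.
move=> te; rewrite /step_e smooth_step_0//.
have e2 : 0 < (2 * e)^-1 by rewrite invr_gt0 mulr_gt0.
have E : (2 * e)^-1 * e = 2^-1 by field; rewrite gt_eqF.
have : (2 * e)^-1 * t <= (2 * e)^-1 * - e by rewrite ler_pM2l.
rewrite mulrN; lra.
Qed.

Lemma step_e1 t : e <= t -> step_e t = 1.
Proof.
move=> te; rewrite /step_e smooth_step_1//.
have e2 : 0 < (2 * e)^-1 by rewrite invr_gt0 mulr_gt0.
have E : (2 * e)^-1 * e = 2^-1 by field; rewrite gt_eqF.
have : (2 * e)^-1 * e <= (2 * e)^-1 * t by rewrite ler_pM2l.
lra.
Qed.

(** A primitive of the integrand is [step_e (c * t + b) / c]. *)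
Lemma integral_kern_affine (c b : R) : c != 0 ->
  (\int[@lebesgue_measure R]_t (kern (c * t + b))%:E = (`|c|^-1)%:E)%E.
Proof.
move=> c0; have c0' : 0 < `|c| by rewrite normr_gt0.
pose M := (e + `|b| + 1) / `|c|.
have M0 : 0 < M by rewrite divr_gt0// addr_gt0// ltr_wpDr.
have cM : `|c| * M = e + `|b| + 1 by rewrite mulrC divfK// gt_eqF.
rewrite (@integral_support _ (measurableTypeR R) R (@lebesgue_measure R) setT `[- M, M]%classic (fun t => (kern (c * t + b))%:E))//; last first.
  move=> t _ /=; rewrite in_itv/= -ler_norml => /negP; rewrite -ltNge => tM.
  rewrite kern_out//; have : `|c| * M < `|c * t| by rewrite normrM ltr_pM2l.
  have := lerB_normD (c * t) b; lra.
pose F t := c^-1 * step_e (c * t + b).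
have dF t : is_derive t (1 : R) F (kern (c * t + b)).
  have ds : derivable step_e (c * t + b) 1 by exact: (@smooth1_derivable R _ smooth1_step_e).
  have [d2 dE2] := is_derive_comp_affine ds.
  have := is_derive_mulc c^-1 (DeriveDef d2 dE2).
  by rewrite [_ * c]mulrC mulrA mulVf// mul1r.
have cF : continuous F by move=> t; apply: derivable_continuous_at; have [] := dF t.
rewrite (@continuous_FTC2 _ _ F).
- have bb := ler_norm b; have bb2 : - b <= `|b| by rewrite -normrN ler_norm.
  rewrite -EFinB; congr EFin; rewrite /F -mulrBr.
  have [cn|cp] := ltP c 0.
    rewrite ltr0_norm// in cM *; rewrite step_e0 ?step_e1; last 2 first.
    + by rewrite mulrN -mulNr; lra.
    + by rewrite -[c]opprK mulNr; lra.
    by rewrite sub0r mulrN1 invrN.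
  rewrite ger0_norm// in cM *; rewrite step_e1 ?step_e0 ?subr0 ?mulr1//.
  + by rewrite mulrN; lra.
  + by lra.
- by lra.
- apply: continuous_subspaceT => t; apply: (@continuous_comp _ _ _ (fun t => c * t + b) kern).
    by apply: derivable_continuous_at; have [] := is_derive_affine1 c b t.
  exact: (smooth1_continuous smooth1_kern).
- split.
  + by move=> t _; have [] := dF t.
  + exact: (cvg_at_right_filter (cF _)).
  + exact: (cvg_at_left_filter (cF _)).
- by move=> t _; rewrite derive1E; have [] := dF t.
Qed.

End kernel1.

Section mollifier.
Context {R : realType} {n : nat}.
Local Notation L := (lebesgue_rV R n).
Implicit Types (K h : 'rV[R]_n -> R) (x w z : 'rV[R]_n).

Definition rho (e : R) z : R := \prod_(i < n) kern e (z ord0 i).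

Lemma rho_ge0 e z : 0 < e -> 0 <= rho e z.
Proof. by move=> e0; apply: prodr_ge0 => i _; exact: kern_ge0. Qed.

Lemma rho_out e z : 0 < e -> ~ cbox (fun=> - e) (fun=> e) z -> rho e z = 0.
Proof.
move=> e0 nz; have [i Hi] : exists i, ~ (- e <= z ord0 i <= e).
  by apply: contrapT => /forallNP hh; apply: nz => i; exact: contrapT.
rewrite /rho (bigD1 i)//= kern_out ?mul0r//.
by move/negP : Hi; rewrite -ler_norml -ltNge.
Qed.

Lemma test_rho e : 0 < e -> test_function setT (rho e).
Proof.
move=> e0; apply: (test_function_sub _ (@compact_cbox R n (fun=> - e) (fun=> e))) => //.
  apply: smooth_prod => i; apply: smooth_comp; [exact: smooth1_kern|exact: smooth_coord].
by move=> x; apply: contraNP => nx; apply/eqP; exact: rho_out.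
Qed.

Variables (a b : 'I_n -> R).
(** A diagonal affine map.  Mollifying [h] at [aff x] in place of [x] moves the
    sampling ball into the domain when [x] is close to the boundary. *)
Definition aff x : 'rV[R]_n := \row_i (a i * x ord0 i + b i).

Lemma aff_shift (h : R) i x : aff (h *: delta_mx ord0 i + x) = aff x + (h * a i) *: delta_mx ord0 i.
Proof.
apply/rowP => j; rewrite !mxE eqxx/=; have [->|ji] := eqVneq j i; rewrite ?mulr0 ?mulr1 ?add0r ?addr0//; ring.
Qed.

(** The variable [x] occurs only in the kernel, so that smoothness comes from [K]
    alone; [aff] is absorbed in the shift. *)
Definition convol h K x : R := \int[L]_w (h w * K (w - aff x)).

Lemma measurable_shift (y : 'rV[R]_n) : measurable_fun setT (fun w : 'rV[R]_n => w - y).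
Proof.
apply/measurable_fun_rVP => i; under eq_fun do rewrite !mxE.
apply: measurable_funD; [exact: measurable_rV_coord|exact: measurable_cst].
Qed.

Lemma convol_integrable h K y : L.-integrable setT (EFin \o h) -> test_function setT K ->
  L.-integrable setT (fun w => (h w * K (w - y))%:E).
Proof.
move=> Ih tK; have [M M0 KM] := test_function_bounded tK.
have mK : measurable_fun setT (fun w => K (w - y)).
  apply: measurableT_comp (measurable_shift y).
  by apply: continuous_measurable_rV; apply: smooth_continuous; have [] := tK.
apply: (integrableMl measurableT Ih mK).
by exists M; split; [exact: num_real|move=> z Mz w _; exact: le_trans (KM _) (ltW Mz)].
Qed.

Lemma test_function_Cc U K : test_function U K -> Cc K.
Proof.
move=> [sK cK KU]; split; first exact: smooth_continuous.
exists (closure [set x | K x != 0]) => // x nx; apply/eqP; apply: contraPT nx => Kx.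
by move=> h; apply: h; exact: subset_closure.
Qed.

(** Heine's theorem, in terms of coordinates. *)
Lemma Cc_unif_cont K : Cc K -> forall e : R, 0 < e ->
  exists2 d : R, 0 < d & forall x y : 'rV[R]_n, (forall i, `|x ord0 i - y ord0 i| < d) -> `|K x - K y| <= e.
Proof.
move=> [cK [S cS K0]] e e0.
have ballE (d : R) (x y : 'rV[R]_n) : 0 < d -> (forall i, `|x ord0 i - y ord0 i| < d) -> ball x d y.
  by move=> d0 H; split=> // i j; rewrite (ord1 i); exact: H.
pose P (d : R) (x : 'rV[R]_n) := 0 < d -> forall y, ball x d y -> `|K x - K y| <= e.
have : \forall d \near (0:R)^'+, S `<=` P d.
  apply: ((compact_near_coveringP S).1 cS R _ P) => x Sx.
  have e20 : 0 < e / 2 by rewrite divr_gt0.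
  have /nbhs_ballP[r /= r0 Hr] : \forall y \near x, `|K x - K y| < e / 2.
    by have /cvgrPdist_lt := cK x; exact.
  exists (ball x (r / 2), [set d | 0 < d < r / 2]) => /=.
    split; first by apply: nbhsx_ballx; rewrite divr_gt0.
    near=> d; apply/andP; split; first by near: d; exact: nbhs_right_gt.
    by near: d; apply: nbhs_right_lt; rewrite divr_gt0.
  move=> [x' d] /= [bx' /andP[d0 dr]] _ y bxy.
  have h1 : `|K x - K x'| < e / 2.
    by apply: Hr; apply: le_ball bx'; rewrite ler_pdivrMr//; lra.
  have h2 : `|K x - K y| < e / 2.
    apply: Hr; rewrite [r]splitr; apply: ball_triangle bx' _; exact: le_ball (ltW dr) _ bxy.
  by rewrite (le_trans (ler_distD (K x) _ _))// [e]splitr distrC lerD// ltW// distrC.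
move=> H; have [d [SP d0]] : exists d : R, S `<=` P d /\ 0 < d.
  near ((0:R)^'+) => d; exists d; split; first by near: d.
  near: d; exact: nbhs_right_gt.
exists d => // x y Hxy.
have [Sx|nSx] := pselect (S x); first by apply: SP => //; exact: ballE.
have [Sy|nSy] := pselect (S y); last by rewrite !K0// subrr normr0 ltW.
by rewrite distrC; apply: SP => //; apply: ballE => // i; rewrite distrC.
Unshelve. all: by end_near. Qed.

Lemma convol_continuous h K : L.-integrable setT (EFin \o h) -> test_function setT K ->
  continuous (convol h K).
Proof.
move=> Ih tK; suff H (x : 'rV[R]_n) : convol h K y @[y --> x] --> convol h K x by move=> x; exact: H.
have Iabs : (\int[L]_w `|(h w)%:E| < +oo)%E by case/integrableP : Ih.
pose A := \int[L]_w `|h w|.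
have A0 : 0 <= A by apply: Rintegral_ge0.
apply/(@cvgrPdist_le _ _ _ (nbhs x) (nbhs_filter x)) => e e0.
have e1 : 0 < e / (A + 1) by rewrite divr_gt0// ltr_wpDl.
have [d d0 Kd] := Cc_unif_cont (test_function_Cc tK) e1.
have caff : \forall y \near x, forall i, `|(aff x) ord0 i - (aff y) ord0 i| < d.
  apply: (@filter_forall _ _ _ (nbhs x) (nbhs_filter x)) => i.
  have C : continuous (fun y : 'rV[R]_n => aff y ord0 i).
    have -> : (fun y => aff y ord0 i) = (fun y : 'rV[R]_n => a i * y ord0 i + b i).
      by apply/funext => y; rewrite mxE.
    apply: (@smooth_continuous R n).
    exact: (smoothD (smoothM (smooth_cst (a i)) (smooth_coord i)) (smooth_cst (b i))).
  by have /(@cvgrPdist_lt _ _ _ (nbhs x) (nbhs_filter x)) /(_ d d0) := C x.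
apply: filterS caff => y Hy.
have I1 y := convol_integrable (aff y) Ih tK.
have IB := integrableB measurableT (I1 x) (I1 y).
rewrite /convol -RintegralB//; [|exact: I1|exact: I1].
apply: le_trans (le_normr_Rintegral _ _) _ => //.
apply: (@le_trans _ _ (\int[L]_w (`|h w| * (e / (A + 1))))).
  apply: le_Rintegral => //.
  - apply: (@integrable_norm _ _ _ _ setT).
    exact: IB.
  - exact: (integrableZr measurableT (e / (A + 1)) (integrable_norm Ih)).
  move=> w _; rewrite -mulrBr normrM ler_wpM2l// Kd// => i.
  have := Hy i; rewrite !mxE distrC; congr (`|_| < _); ring.
rewrite RintegralZr//; last exact: integrable_norm.
rewrite -/A mulrA ler_pdivrMr ?ltr_wpDl// mulrC ler_wpM2l ?ltW//; lra.
Qed.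

(** Differentiation under the integral sign; along the line through [x] in direction
    [i] the argument of [K] moves with speed [- a i]. *)
Lemma convol_derive h K i x : L.-integrable setT (EFin \o h) -> test_function setT K ->
  is_derive x (delta_mx ord0 i : 'rV[R]_n) (convol h K) (- a i * convol h (partial i K) x).
Proof.
move=> Ih tK; have sK : smooth K by case: tK.
have tpK := test_function_partial i tK.
have [M M0 KM] := test_function_bounded tpK.
pose f (t : R) w := h w * K (w - aff (t *: delta_mx ord0 i + x)).
have fE t w : f t w = h w * K (- (t * a i) *: delta_mx ord0 i + (w - aff x)).
  by rewrite /f aff_shift; congr (_ * K _); apply/rowP => j; rewrite !mxE; ring.
have df t w : is_derive t (1 : R) (f ^~ w) (- a i * (h w * partial i K (w - aff (t *: delta_mx ord0 i + x)))).
  have [d1 e1] : is_derive t (1 : R) (fun t => K (- (t * a i) *: delta_mx ord0 i + (w - aff x)))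
      (- a i * partial i K (w - aff (t *: delta_mx ord0 i + x))).
    pose g (s : R) := K (s *: delta_mx ord0 i + (w - aff x)).
    have aphi (j : unit) (s : R) (s0 : R) : (s *: (1 : R) + s0) *: (delta_mx ord0 i : 'rV[R]_n) + (w - aff x) =
        s *: delta_mx ord0 i + (s0 *: delta_mx ord0 i + (w - aff x)).
      have -> : s *: (1 : R) = s by exact: mulr1.
      by apply/rowP => l; rewrite !mxE; ring.
    have dg : derivable g (- a i * t + 0) 1.
      apply: (@derivable_affine R 'rV[R]_n R unit unit (fun=> delta_mx ord0 i) (fun=> 1) id
        (fun s : R => s *: delta_mx ord0 i + (w - aff x)) aphi K tt).
      exact: smooth_derivable.
    have dgE := @derive_affine R 'rV[R]_n R unit unit (fun=> delta_mx ord0 i) (fun=> 1) id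
        (fun s : R => s *: delta_mx ord0 i + (w - aff x)) aphi K tt (- a i * t + 0).
    have [dc ec] := is_derive_comp_affine dg.
    have gE : (fun t => g (- a i * t + 0)) = (fun t => K (- (t * a i) *: delta_mx ord0 i + (w - aff x))).
      by apply/funext => s; rewrite /g addr0 mulNr [a i * _]mulrC.
    rewrite gE in dc ec; apply: DeriveDef => //.
    rewrite ec derive1E /g dgE mulrC addr0; congr (_ * _).
    have -> // : (- a i * t) *: delta_mx ord0 i + (w - aff x) = w - aff (t *: delta_mx ord0 i + x).
    by rewrite aff_shift; apply/rowP => j; rewrite !mxE; ring.
  have -> : f ^~ w = (fun t => h w * K (- (t * a i) *: delta_mx ord0 i + (w - aff x))).
    by apply/funext => s; rewrite fE.
  have := is_derive_mulc (h w) (DeriveDef d1 e1).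
  by congr (is_derive _ _ _ _); ring.
have df1 t w : partial1of2 f t w = - a i * (h w * partial i K (w - aff (t *: delta_mx ord0 i + x))).
  by rewrite partial1of2E; have [_ ->] := df t w.
pose G w := `|a i| * (M * `|h w|).
have i11 : (0:R) \in `](-1 : R), 1[ by rewrite in_itv/= ltrN10 ltr01.
have intf t : L.-integrable setT (EFin \o f t).
  exact: (convol_integrable (aff (t *: delta_mx ord0 i + x)) Ih tK).
have G0 w : 0 <= G w by rewrite !mulr_ge0.
have intG : L.-integrable setT (EFin \o G).
  have := integrableZl measurableT `|a i| (integrableZl measurableT M (integrable_norm Ih)).
  by apply: eq_integrable => // w _; rewrite /= -!EFinM.
have Gub t w : (t \in `]-1, 1[) -> setT w -> `|partial1of2 f t w| <= G w.
  move=> _ _; rewrite df1 mulNr normrN normrM ler_wpM2l// normrM mulrC ler_wpM2r//.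
have dd := @derivable_under_integral R _ _ L f setT measurableT 0 (-1) 1 i11
  (fun t _ => intf t) (fun t w _ _ => (@ex_derive _ _ _ _ _ _ _ (df t w))) G G0 intG Gub.
have de := @differentiation_under_integral R _ _ L f setT measurableT 0 (-1) 1 i11
  (fun t _ => intf t) (fun t w _ _ => (@ex_derive _ _ _ _ _ _ _ (df t w))) G G0 intG Gub.
apply: DeriveDef; first exact: (derivable1P (convol h K) x (delta_mx ord0 i)).2 dd.
have DE (F : 'rV[R]_n -> R) v : 'D_v F x = derive1 (fun s : R => F (s *: v + x)) 0.
  rewrite /derive1 /derive; apply: (congr1 (fun q : R -> R => lim (q @ 0^'))).
  by apply/funext => s /=; rewrite addr0 scale0r add0r.
rewrite DE; apply: etrans de _.
rewrite /convol -RintegralZl//; last exact: convol_integrable.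
by apply: eq_Rintegral => w _; rewrite df1 scale0r add0r.
Qed.

Lemma convol_smooth h K : L.-integrable setT (EFin \o h) -> test_function setT K ->
  smooth (convol h K).
Proof.
move=> Ih tK m; elim: m K tK => [|m IH] K tK; first exact: convol_continuous.
split; first exact: convol_continuous.
have dK i x := convol_derive i x Ih tK.
move=> i; split; first by move=> x; have [] := dK i x.
have -> : partial i (convol h K) = (fun x => - a i * convol h (partial i K) x).
  by apply/funext => x; rewrite /partial; have [_ ->] := dK i x.
have CE : forall m f, C_k m f -> forall c : R, C_k m (fun x => c * f x).
  elim=> [|m' IH'] f /=; first by move=> cf c x; exact: (cvgM (cvg_cst c) (cf x)).
  move=> [cf df] c; split; first by move=> x; exact: (cvgM (cvg_cst c) (cf x)).
  move=> j; have [dj Cj] := df j.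
  have D x : is_derive x (delta_mx ord0 j : 'rV[R]_n) (fun x => c * f x) (c * partial j f x).
    by apply: is_derive_mulc; exact: DeriveDef.
  split; first by move=> x; have [] := D x.
  have -> : partial j (fun x => c * f x) = (fun x => c * partial j f x).
    by apply/funext => x; rewrite /partial; have [_ ->] := D x.
  exact: IH'.
by apply: CE; apply: IH; exact: test_function_partial.
Qed.

Lemma partial_convol h K i x : L.-integrable setT (EFin \o h) -> test_function setT K ->
  partial i (convol h K) x = - a i * convol h (partial i K) x.
Proof. by move=> Ih tK; rewrite /partial; have [_ ->] := convol_derive i x Ih tK. Qed.

End mollifier.

(** * Mollification in L^p and of weak gradients *)

Section mollifier_Lp.
Context {R : realType} {n : nat}.
Local Notation L := (lebesgue_rV R n).
Implicit Types (K h c : 'rV[R]_n -> R) (x w z y : 'rV[R]_n).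

Lemma measurable_kern_affine (e c b : R) : 0 < e -> measurable_fun setT (fun t : R => kern e (c * t + b)).
Proof.
move=> e0; apply: continuous_measurable_fun => t.
apply: (@continuous_comp _ _ _ (fun t => c * t + b) (kern e)).
  by apply: derivable_continuous_at; have [] := is_derive_affine1 c b t.
exact: (smooth1_continuous (smooth1_kern e)).
Qed.

Lemma integral_rho_w e y : 0 < e -> (\int[L]_w (rho e (w - y))%:E = 1)%E.
Proof.
move=> e0.
have := @ge0_integral_prod1 R n (fun i t => kern e (1 * t + - y ord0 i))
  (fun i => @measurable_kern_affine e 1 (- y ord0 i) e0) (fun i t => kern_ge0 e0 _).
rewrite big1 => [<-|i _]; last by rewrite integral_kern_affine// normr1 invr1.
by apply: eq_integral => w _; congr EFin; apply: eq_bigr => i _; rewrite !mxE mul1r.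
Qed.

Lemma integral_rho_x (a b : 'I_n -> R) e w : 0 < e -> (forall i, 2^-1 <= a i) ->
  (\int[L]_x (rho e (w - aff a b x))%:E <= (2 ^+ n)%:E)%E.
Proof.
move=> e0 a2; have a0 i : 0 < a i by rewrite (lt_le_trans _ (a2 i))// invr_gt0.
have := @ge0_integral_prod1 R n (fun i t => kern e (- a i * t + (w ord0 i - b i)))
  (fun i => @measurable_kern_affine e _ _ e0) (fun i t => kern_ge0 e0 _).
rewrite (_ : (fun x : 'rV[R]_n => _) = (fun x => (rho e (w - aff a b x))%:E)); last first.
  by apply/funext => x; congr EFin; apply: eq_bigr => i _; rewrite !mxE; congr kern; ring.
move=> ->.
rewrite (eq_bigr (fun i => ((a i)^-1)%:E)); last first.
  by move=> i _; rewrite integral_kern_affine ?oppr_eq0 ?gt_eqF// normrN gtr0_norm.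
rewrite prodEFin lee_fin -[X in _ ^+ X](card_ord n) -prodr_const.
apply: ler_prod => i _; rewrite invr_ge0 (ltW (a0 i))/=.
by rewrite -[leRHS]invrK lef_pV2// posrE// invr_gt0.
Qed.

Lemma measurable_rho (e : R) : 0 < e -> measurable_fun setT (rho e : 'rV[R]_n -> R).
Proof.
move=> e0; apply: continuous_measurable_rV; apply: smooth_continuous.
by have [] := test_rho (n := n) e0.
Qed.

Lemma measurable_rho_aff (a b : 'I_n -> R) e : 0 < e ->
  measurable_fun setT (fun z : 'rV[R]_n * 'rV[R]_n => rho e (z.2 - aff a b z.1)).
Proof.
move=> e0; apply: (measurableT_comp (measurable_rho e0)).
apply/measurable_fun_rVP => i; under eq_fun do rewrite !mxE.
apply: measurable_funB.
  by apply: (measurableT_comp (measurable_rV_coord i)); exact: measurable_snd.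
apply: measurable_funD => //; apply: measurable_funM => //.
by apply: (measurableT_comp (measurable_rV_coord i)); exact: measurable_fst.
Qed.

(** Jensen's inequality for the probability density [rho e (w - aff x)] in [w], then
    Tonelli; in the variable [x] this density has integral at most [2 ^+ n], because
    [aff] contracts by a factor at most two. *)
Lemma moll_Lp (p : R) (a b : 'I_n -> R) e h : 1 < p -> 0 < e -> (forall i, 2^-1 <= a i) ->
  L.-integrable setT (EFin \o h) ->
  (\int[L]_x (`|convol a b h (rho e) x| `^ p)%:E <= (2 ^+ n)%:E * \int[L]_x (`|h x| `^ p)%:E)%E.
Proof.
move=> p1 e0 a2 Ih; have p0 : 0 < p by lra.
have mh : measurable_fun setT h by case/integrableP : Ih => /measurable_EFinP.
have mhp : measurable_fun setT (fun w => `|h w| `^ p) := measurable_powR_abs p mh.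
have mF : measurable_fun setT (fun z : 'rV[R]_n * 'rV[R]_n => (`|h z.2| `^ p * rho e (z.2 - aff a b z.1))%:E).
  apply/measurable_EFinP; apply: measurable_funM; last exact: measurable_rho_aff.
  by apply: (measurableT_comp mhp); exact: measurable_snd.
have F0 (z : 'rV[R]_n * 'rV[R]_n) : (0 <= (`|h z.2| `^ p * rho e (z.2 - aff a b z.1))%:E)%E.
  by rewrite lee_fin mulr_ge0 ?powR_ge0 ?rho_ge0.
have mrho x : measurable_fun setT (fun w => rho e (w - aff a b x)).
  by apply: (measurableT_comp (measurable_rho e0)); exact: measurable_shift.
apply: (@le_trans _ _ (\int[L]_x \int[L]_w (`|h w| `^ p * rho e (w - aff a b x))%:E)%E).
  apply: ge0_le_integral => //.
  - apply/measurable_EFinP; apply: measurable_powR_abs; apply: continuous_measurable_rV.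
    by apply: convol_continuous => //; exact: test_rho.
  - by apply: (@measurable_fun_fubini_tonelli_F _ _ _ _ _ L (fun z : 'rV[R]_n * 'rV[R]_n => (`|h z.2| `^ p * rho e (z.2 - aff a b z.1))%:E)).
  move=> x _.
  have Irho : L.-integrable setT (fun w => (`|h w| * rho e (w - aff a b x))%:E).
    apply: convol_integrable; [exact: integrable_norm|exact: test_rho].
  apply: le_trans (jensen_powR p1 _ (mrho x) _ _ (integral_rho_w _ e0) Irho); last 3 first.
  - exact: measurableT_comp.
  - by [].
  - by move=> w; exact: rho_ge0.
  rewrite lee_fin; apply: powR_le => //; first exact: ltW.
  apply: le_trans (le_normr_Rintegral _ _) _ => //.
    by apply: convol_integrable => //; exact: test_rho.
  rewrite le_eqVlt; apply/orP; left; apply/eqP; apply: eq_Rintegral => w _.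
  by rewrite normrM [X in _ * X]ger0_norm// rho_ge0.
rewrite (fubini_tonelli (fun z : 'rV[R]_n * 'rV[R]_n => (`|h z.2| `^ p * rho e (z.2 - aff a b z.1))%:E))//.
rewrite -ge0_integralZl//; last exact/measurable_EFinP.
apply: ge0_le_integral => //.
- by move=> w _; apply: integral_ge0 => x _; exact: (F0 (x, w)).
- by apply: (@measurable_fun_fubini_tonelli_G _ _ _ _ _ L (fun z : 'rV[R]_n * 'rV[R]_n => (`|h z.2| `^ p * rho e (z.2 - aff a b z.1))%:E)).
- by apply: emeasurable_funM => //; exact/measurable_EFinP.
- move=> w _; under eq_integral do rewrite /= EFinM.
  have mx : measurable_fun setT (fun x => rho e (w - aff a b x)).
    by have /= := measurableT_comp (measurable_rho_aff a b e0) (@measurable_pair2 _ _ _ _ w); exact.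
  rewrite ge0_integralZl_EFin ?powR_ge0//; last 2 first.
  + by move=> x _; rewrite lee_fin rho_ge0.
  + exact/measurable_EFinP.
  by rewrite muleC; apply: lee_wpmul2r; [rewrite lee_fin powR_ge0|exact: integral_rho_x].
Qed.

Lemma Cc_integrable c : Cc c -> L.-integrable setT (EFin \o c).
Proof.
move=> [cc [K cK c0]]; have mK := compact_measurable_rV cK.
apply: (@integrable_support _ _ _ _ setT K) => //.
  by move=> x _ nK; rewrite /= c0.
apply: measurable_bounded_integrable => //; first exact: compact_fin.
  by apply: measurable_funTS; exact: continuous_measurable_rV.
exact: continuous_bounded_on.
Qed.

Lemma moll_close (a b : 'I_n -> R) e c (eta d : R) x : 0 < e -> Cc c -> 0 <= eta ->
  (forall x y, (forall i, `|x ord0 i - y ord0 i| < d) -> `|c x - c y| <= eta) ->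
  e < d / 2 -> (forall i, `|aff a b x ord0 i - x ord0 i| < d / 2) ->
  `|convol a b c (rho e) x - c x| <= eta.
Proof.
move=> e0 cc eta0 Hc ed xd.
have Irho : L.-integrable setT (fun w => (rho e (w - aff a b x))%:E).
  apply/integrableP; split.
    apply/measurable_EFinP.
    by apply: (measurableT_comp (measurable_rho e0)); exact: measurable_shift.
  under eq_integral do rewrite /= ger0_norm ?rho_ge0//.
  by rewrite integral_rho_w// ltry.
have R1 : \int[L]_w rho e (w - aff a b x) = 1 by rewrite /Rintegral integral_rho_w.
have Ic : L.-integrable setT (fun w => (c w * rho e (w - aff a b x))%:E).
  by apply: convol_integrable; [exact: Cc_integrable|exact: test_rho].
have Icx : L.-integrable setT (fun w => (c x * rho e (w - aff a b x))%:E).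
  by have := integrableZl measurableT (c x) Irho; apply: eq_integrable => // w _; rewrite EFinM.
rewrite -[X in _ - X]mulr1 -R1 -RintegralZl// /convol -RintegralB//.
have IB := integrableB measurableT Ic Icx.
apply: le_trans (le_normr_Rintegral _ _) _ => //.
rewrite -[leRHS]mulr1 -R1 -RintegralZl//; apply: le_Rintegral => //.
- exact: (integrable_norm (f := fun w => c w * rho e (w - aff a b x) - c x * rho e (w - aff a b x))).
- by have := integrableZl measurableT eta Irho; apply: eq_integrable => // w _; rewrite /= EFinM.
move=> w _; rewrite -mulrBl normrM [X in _ * X]ger0_norm ?rho_ge0//.
have [->|r0] := eqVneq (rho e (w - aff a b x)) 0; first by rewrite !mulr0.
rewrite ler_wpM2r ?rho_ge0//; apply: Hc => i.
have : cbox (fun=> - e) (fun=> e) (w - aff a b x).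
  by apply: contrapT => h; move/eqP: r0; apply; exact: rho_out.
move=> /(_ i); rewrite -ler_norml 2!mxE => h1.
have h2 := xd i; rewrite [d]splitr (le_lt_trans (ler_distD (aff a b x ord0 i) _ _))//.
by rewrite ltrD// (le_lt_trans _ ed).
Qed.

Lemma convolB (a b : 'I_n -> R) h g K x : L.-integrable setT (EFin \o h) ->
  L.-integrable setT (EFin \o g) -> test_function setT K ->
  convol a b (fun w => h w - g w) K x = convol a b h K x - convol a b g K x.
Proof.
move=> Ih Ig tK; rewrite /convol -RintegralB//; try exact: convol_integrable.
by apply: eq_Rintegral => w _; rewrite mulrBl.
Qed.

(** For continuous functions of compact support this is uniform continuity; the
    operator is bounded on L^p by [moll_Lp], so density gives the general case. *)
Lemma moll_approx (p : R) (V : set 'rV[R]_n) h : 1 < p -> measurable V -> (L V < +oo)%E ->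
  L.-integrable setT (EFin \o h) -> (\int[L]_x (`|h x| `^ p)%:E < +oo)%E ->
  forall eps : R, 0 < eps -> exists2 d : R, 0 < d &
  forall (a b : 'I_n -> R) e, (forall i, 2^-1 <= a i) -> 0 < e < d ->
  (forall x, V x -> forall i, `|aff a b x ord0 i - x ord0 i| < d) ->
  (\int[L]_(x in V) (`|convol a b h (rho e) x - h x| `^ p)%:E <= eps%:E)%E.
Proof.
move=> p1 mV Vfin Ih Ihp eps eps0; have p0 : 0 < p by lra.
have mh : measurable_fun setT h by case/integrableP : Ih => /measurable_EFinP.
pose C : R := 2 `^ p * (2 ^+ n + 2 `^ p * 2).
have C0 : 0 < C by rewrite mulr_gt0 ?powR_gt0// addr_gt0 ?exprn_gt0// mulr_gt0 ?powR_gt0.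
pose e1 := eps / C; have e10 : 0 < e1 by rewrite divr_gt0.
have [_ /(_ _ e10) [c cc hc]] := Lp_density p1 mh Ihp.
have mc := Cc_measurable cc; have Ic := Cc_integrable cc.
pose v := fine (L V); have Ev : L V = v%:E by rewrite fineK// ge0_fin_numE.
have v0 : 0 <= v by rewrite fine_ge0.
pose eta := (e1 / (v + 1)) `^ p^-1.
have eta0 : 0 < eta by rewrite powR_gt0// divr_gt0// ltr_wpDl.
have etap : eta `^ p * v <= e1.
  have ev0 : 0 <= e1 / (v + 1) by rewrite divr_ge0 ?(ltW e10)// addr_ge0.
  rewrite /eta -powRrM mulVf ?gt_eqF// powRr1//.
  rewrite mulrAC ler_pdivrMr ?ltr_wpDl// ler_wpM2l ?(ltW e10)//; lra.
have [d d0 Hd] := Cc_unif_cont cc eta0.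
exists (d / 2); first by rewrite divr_gt0.
move=> a b e a2 /andP[e0 ed] Hx.
pose H x := convol a b h (rho e) x.
pose Hc x := convol a b c (rho e) x.
pose Hd' x := convol a b (fun w => h w - c w) (rho e) x.
have Ihc : L.-integrable setT (EFin \o (fun w => h w - c w)) by exact: (integrableB measurableT Ih Ic).
have tr := test_rho (n := n) e0.
have mconv g : L.-integrable setT (EFin \o g) -> measurable_fun setT (convol a b g (rho e)).
  by move=> Ig; apply: continuous_measurable_rV; exact: convol_continuous.
have mP (D : set 'rV[R]_n) (f : 'rV[R]_n -> R) : measurable_fun setT f -> measurable_fun D (fun x => (`|f x| `^ p)%:E).
  by move=> mf; apply: measurable_funTS; apply/measurable_EFinP; exact: measurable_powR_abs.
have P0 (f : 'rV[R]_n -> R) x : (0 <= (`|f x| `^ p)%:E)%E by rewrite lee_fin powR_ge0.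
have m1 : measurable_fun setT Hd' by exact: mconv.
have m2 : measurable_fun setT (fun x => Hc x - c x) by apply: measurable_funB => //; exact: mconv.
have m3 : measurable_fun setT (fun x => h x - c x) by exact: measurable_funB.
apply: (@le_trans _ _ (\int[L]_(x in V) ((2 `^ p)%:E * ((`|Hd' x| `^ p)%:E +
   (2 `^ p)%:E * ((`|Hc x - c x| `^ p)%:E + (`|h x - c x| `^ p)%:E))))%E).
  apply: ge0_le_integral => //.
  - by apply: (mP V (fun x => convol a b h (rho e) x - h x)); apply: measurable_funB => //; exact: mconv.
  - apply: emeasurable_funM => //; apply: emeasurable_funD; first exact: mP.
    apply: emeasurable_funM => //; apply: emeasurable_funD.
      exact: (mP V (fun x => Hc x - c x)).
    exact: (mP V (fun x => h x - c x)).
  - move=> x _; rewrite -?(EFinD, EFinM) lee_fin.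
    apply: (@le_trans _ _ ((`|Hd' x| + (`|Hc x - c x| + `|h x - c x|)) `^ p)).
      apply: powR_le; [exact: ltW|exact: normr_ge0|].
      rewrite [X in `|X|](_ : _ = Hd' x + ((Hc x - c x) - (h x - c x))); last first.
        by rewrite /Hd' convolB// /Hc; ring.
      by rewrite (le_trans (ler_normD _ _))// lerD2l; exact: ler_normB.
    apply: le_trans (powR_add_le _ _ (ltW p0)) _; rewrite ?addr_ge0//.
    rewrite ler_wpM2l ?powR_ge0// lerD2l; apply: powR_add_le; [exact: normr_ge0|exact: normr_ge0|exact: ltW].
rewrite ge0_integralZl_EFin ?powR_ge0//; last 2 first.
- by move=> x _; rewrite adde_ge0// mule_ge0 ?lee_fin ?powR_ge0// addr_ge0 ?powR_ge0.
- apply: emeasurable_funD; first exact: mP.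
  apply: emeasurable_funM => //; apply: emeasurable_funD.
    exact: (mP V (fun x => Hc x - c x)).
  exact: (mP V (fun x => h x - c x)).
rewrite ge0_integralD//; last 3 first.
- exact: mP.
- by move=> x _; rewrite mule_ge0 ?lee_fin ?powR_ge0// addr_ge0 ?powR_ge0.
- apply: emeasurable_funM => //; apply: emeasurable_funD.
    exact: (mP V (fun x => Hc x - c x)).
  exact: (mP V (fun x => h x - c x)).
rewrite ge0_integralZl_EFin ?powR_ge0//; last 2 first.
- by move=> x _; rewrite adde_ge0 ?lee_fin ?powR_ge0.
- apply: emeasurable_funD; first exact: (mP V (fun x => Hc x - c x)).
  exact: (mP V (fun x => h x - c x)).
rewrite ge0_integralD//; [|exact: (mP V (fun x => Hc x - c x))|exact: (mP V (fun x => h x - c x))].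
have I3 : (\int[L]_(x in V) (`|h x - c x| `^ p)%:E <= e1%:E)%E.
  by apply: le_trans hc; apply: ge0_subset_integral => //; exact: (mP setT (fun x => h x - c x)).
have I1 : (\int[L]_(x in V) (`|Hd' x| `^ p)%:E <= (2 ^+ n * e1)%:E)%E.
  apply: (@le_trans _ _ (\int[L]_x (`|Hd' x| `^ p)%:E)%E).
    by apply: ge0_subset_integral => //; exact: mP.
  apply: le_trans (moll_Lp _ p1 e0 a2 Ihc) _.
  by rewrite EFinM; apply: lee_wpmul2l => //; rewrite lee_fin exprn_ge0.
have I2 : (\int[L]_(x in V) (`|Hc x - c x| `^ p)%:E <= e1%:E)%E.
  apply: (@le_trans _ _ (\int[L]_(x in V) (cst (eta `^ p)%:E x))%E).
    apply: ge0_le_integral => //; first exact: (mP V (fun x => Hc x - c x)).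
    move=> x Vx; rewrite lee_fin; apply: powR_le; [exact: ltW|exact: normr_ge0|].
    by apply: (moll_close e0 cc (ltW eta0) Hd ed); exact: Hx.
  by rewrite integral_cst// [X in (_ * X)%E]Ev -EFinM lee_fin.
apply: (@le_trans _ _ ((2 `^ p)%:E * ((2 ^+ n * e1)%:E + (2 `^ p)%:E * (e1%:E + e1%:E)))%E).
  apply: lee_wpmul2l; first by rewrite lee_fin powR_ge0.
  apply: leeD => //; apply: lee_wpmul2l; first by rewrite lee_fin powR_ge0.
  exact: leeD.
rewrite -?(EFinD, EFinM) lee_fin.
rewrite [leLHS](_ : _ = C * e1); last by rewrite /C; ring.
by rewrite /e1 mulrC divfK// gt_eqF.
Qed.

(** The translated kernel is a test function supported in the domain by the
    hypothesis on the cube around [aff x], and the definition of the weak gradient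
    moves the derivative from this kernel to [u]. *)
Lemma moll_gradient (a b : 'I_n -> R) e (U E : set 'rV[R]_n) (u : 'rV[R]_n -> R)
    (G : 'rV[R]_n -> 'rV[R]_n) i x : 0 < e ->
  open U -> E `<=` U -> is_weak_gradient U u G ->
  L.-integrable setT (EFin \o (u \_ E)) ->
  cbox (fun j => aff a b x ord0 j - e) (fun j => aff a b x ord0 j + e) `<=` E ->
  partial i (convol a b (u \_ E) (rho e)) x =
  a i * convol a b ((fun w => G w ord0 i) \_ E) (rho e) x.
Proof.
move=> e0 oU EU [Lu HG] Iu cE; have [LG I] := HG i.
rewrite partial_convol//; last exact: test_rho.
pose phi (w : 'rV[R]_n) := rho e (w - aff a b x).
have [sr cr _] := test_rho (n := n) e0.
have cs : continuous (fun w => w - aff a b x).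
  move=> w; apply: (@continuousB R 'rV[R]_n 'rV[R]_n id (cst (aff a b x)) w).
    by have := @cvg_id _ (nbhs w); exact.
  exact: cst_continuous.
have aphi (j : 'I_n) (h : R) (w : 'rV[R]_n) : h *: delta_mx ord0 j + w - aff a b x =
   h *: (delta_mx ord0 j : 'rV[R]_n) + (w - aff a b x) by rewrite addrA.
have sphi : smooth phi.
  apply/smoothE => m.
  exact: (@Cd_affine R _ _ _ _ (fun j => delta_mx ord0 j) (fun j => delta_mx ord0 j) id _ cs aphi m (rho e) ((smoothE _).1 sr m)).
have pphi w : partial i phi w = partial i (rho e) (w - aff a b x).
  exact: (@derive_affine R _ _ _ _ (fun j => delta_mx ord0 j) (fun j => delta_mx ord0 j) id _ aphi (rho e) i w).
set B := cbox _ _ in cE.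
have phiB w : ~ B w -> phi w = 0.
  move=> nB; apply: rho_out => // hB; apply: nB => j; have := hB j; rewrite !mxE; lra.
have tphi : test_function U phi.
  apply: (test_function_sub sphi (@compact_cbox R n (fun j => aff a b x ord0 j - e) (fun j => aff a b x ord0 j + e))).
    exact: subset_trans EU.
  by move=> w; apply: contraNP => nB; apply/eqP; exact: phiB.
have pphiB w : ~ B w -> partial i phi w = 0.
  move=> nB; rewrite -(near_eq_partial (f := fun=> 0)) ?partial_cst//.
  have : open (~` B) by apply: closed_openC; apply: compact_closed; [exact: norm_hausdorff|exact: compact_cbox].
  by rewrite openE => /(_ _ nB); apply: filterS => y /phiB.
have R1 (f k : 'rV[R]_n -> R) : (forall w, ~ B w -> k w = 0) ->
    (\int[L]_w ((f \_ E) w * k w)%:E = \int[L]_(w in U) (f w * k w)%:E)%E.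
  move=> k0; rewrite (@integral_support _ _ _ L setT B)//; last by move=> w _ nB; rewrite k0// mulr0.
  rewrite [RHS](@integral_support _ _ _ L U B)//; last 2 first.
  - exact: subset_trans EU.
  - by move=> w _ nB; rewrite k0// mulr0.
  by apply: eq_integral => w; rewrite inE => Bw; rewrite patchE mem_set//; exact: cE.
rewrite mulNr -mulrN; congr (_ * _); rewrite /convol /Rintegral.
have -> : (\int[L]_w ((u \_ E) w * partial i (rho e) (w - aff a b x))%:E = \int[L]_w ((u \_ E) w * partial i phi w)%:E)%E.
  by apply: eq_integral => w _; rewrite pphi.
by rewrite (R1 u _ pphiB) (R1 (fun w => G w ord0 i) phi phiB) I// fineN opprK.
Qed.

End mollifier_Lp.

(** * The trace inequality on a segment, and the area of a hemisphere *)

Section one_dim.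
Context {R : realType}.
Local Notation mu := (@lebesgue_measure R).
Implicit Types (h : R -> R) (a b s t : R).

Lemma ftc_abs h (h' : R -> R) a b s t : continuous h' -> (forall x : R, is_derive x (1 : R) h (h' x)) ->
  a <= s -> s <= t -> t <= b ->
  (`|h t - h s|%:E <= \int[mu]_(x in `[a, b]) (`|h' x|)%:E)%E.
Proof.
move=> ch' dh as_ st tb.
have mh' : measurable_fun setT h' by exact: continuous_measurable_fun.
have ch : continuous h by move=> x; apply: derivable_continuous_at; have [] := dh x.
move: st; rewrite le_eqVlt => /orP[/eqP ->|st].
  by rewrite subrr normr0; apply: integral_ge0 => x _; rewrite lee_fin.
have I : (\int[mu]_(x in `[s, t]) (h' x)%:E = (h t)%:E - (h s)%:E)%E.
  apply: continuous_FTC2 => //.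
  - exact: continuous_subspaceT.
  - split.
    + by move=> x _; have [] := dh x.
    + exact: (cvg_at_right_filter (ch _)).
    + exact: (cvg_at_left_filter (ch _)).
  - by move=> x _; rewrite derive1E; have [] := dh x.
have -> : `|h t - h s|%:E = `|\int[mu]_(x in `[s, t]) (h' x)%:E|%E by rewrite I.
apply: le_trans (le_abse_integral _ _ _) _ => //.
  by apply: measurable_funTS; exact/measurable_EFinP.
apply: ge0_subset_integral => //.
- by apply: measurable_funTS; apply/measurable_EFinP; exact: measurableT_comp.
- move=> x /=; rewrite !in_itv/= => /andP[sx xt].
  by rewrite (le_trans as_ sx) (le_trans xt tb).
Qed.

(** [|h s|] is at most [|h x|] plus the integral of [|h'|] over the segment; take the
    mean in [x]. *)
Lemma trace_segment h (h' : R -> R) a b s : continuous h' -> (forall x : R, is_derive x (1 : R) h (h' x)) ->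
  a < b -> a <= s <= b ->
  (`|h s|%:E <= ((b - a)^-1)%:E * \int[mu]_(x in `[a, b]) (`|h x|)%:E +
     \int[mu]_(x in `[a, b]) (`|h' x|)%:E)%E.
Proof.
move=> ch' dh ab /andP[as_ sb].
have ba : 0 < b - a by rewrite subr_gt0.
have ch : continuous h by move=> x; apply: derivable_continuous_at; have [] := dh x.
have mh : measurable_fun `[a, b] (fun x => (`|h x|)%:E).
  by apply: measurable_funTS; apply/measurable_EFinP; apply: measurableT_comp => //; exact: continuous_measurable_fun.
set J := (X in (_ + X)%E).
have J0 : (0 <= J)%E by apply: integral_ge0 => x _; rewrite lee_fin.
have Iab : mu `[a, b]%classic = (b - a)%:E by rewrite lebesgue_measure_itv/= lte_fin ab.
have K : ((b - a)%:E * `|h s|%:E <= \int[mu]_(x in `[a, b]) (`|h x|)%:E + (b - a)%:E * J)%E.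
  rewrite -Iab muleC -integral_cst//= muleC -integral_cst//= -ge0_integralD//.
  apply: ge0_le_integral => //.
    by apply: emeasurable_funD => //; exact: measurable_cst.
  move=> x /=; rewrite in_itv/= => /andP[ax xb].
  apply: (@le_trans _ _ (`|h x|%:E + `|h s - h x|%:E)%E).
    by rewrite -EFinD lee_fin -[X in `|X| <= _](subrK (h x)) addrC ler_normD.
  apply: leeD => //; have [sx|xs] := leP s x.
    by rewrite distrC; exact: ftc_abs.
  by apply: ftc_abs => //; exact: ltW.
have -> : `|h s|%:E = (((b - a)^-1)%:E * ((b - a)%:E * `|h s|%:E))%E.
  by rewrite -!EFinM mulrA mulVf ?mul1r// gt_eqF.
apply: le_trans (lee_wpmul2l _ K) _; first by rewrite lee_fin invr_ge0 ltW.
rewrite ge0_muleDr//; last 2 first.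
- by apply: integral_ge0 => x _; rewrite lee_fin.
- by rewrite mule_ge0// lee_fin ltW.
by rewrite muleA -EFinM mulVf ?gt_eqF// mul1e.
Qed.

Lemma is_derive_arc (c t : R) : 0 < c -> - c < t < c ->
  is_derive t (1 : R) (fun t => asin (c^-1 * t + 0)) (Num.sqrt (c ^+ 2 - t ^+ 2))^-1.
Proof.
move=> c0 /andP[ct tc].
have tc1 : -1 < c^-1 * t + 0 < 1.
  by rewrite addr0 mulrC ltr_pdivlMr// mulN1r ct ltr_pdivrMr// mul1r.
have [dd dE] := is_derive1_asin tc1.
have [d2 dE2] := is_derive_comp_affine dd.
apply: DeriveDef => //; rewrite dE2 derive1E dE.
have -> : c ^+ 2 - t ^+ 2 = c ^+ 2 * (1 - (c^-1 * t + 0) ^+ 2) by field; rewrite gt_eqF.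
by rewrite sqrtrM ?sqr_ge0// sqrtr_sqr gtr0_norm// invfM mulrC.
Qed.

Lemma arc_integral_le (c a : R) : 0 < a -> a < c ->
  (\int[mu]_(t in `[(- a)%R, a]) ((Num.sqrt (c ^+ 2 - t ^+ 2))^-1)%:E <= pi%:E)%E.
Proof.
move=> a0 ac; have c0 : 0 < c by exact: lt_trans ac.
pose F t : R := asin (c^-1 * t + 0).
have io t : - a <= t <= a -> - c < t < c.
  by move=> /andP[at_ ta]; rewrite (lt_le_trans _ at_) ?ltrN2// (le_lt_trans ta).
have dF t : - a <= t <= a -> is_derive t (1 : R) F (Num.sqrt (c ^+ 2 - t ^+ 2))^-1.
  by move=> /io; exact: is_derive_arc.
have cF t : - a <= t <= a -> {for t, continuous F}.
  by move=> /dF [d _]; exact: derivable_continuous_at.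
have ia : - a <= a <= a by rewrite lexx andbT; lra.
have iNa : - a <= - a <= a by rewrite lexx/=; lra.
rewrite (@continuous_FTC2 _ _ F).
- rewrite -EFinB lee_fin /F.
  have h (t : R) : - a <= t <= a -> - (pi / 2) <= asin (c^-1 * t + 0) <= pi / 2.
    move=> /io/andP[ct tc].
    have h1 : -1 <= c^-1 * t + 0 <= 1.
      by rewrite addr0 mulrC ler_pdivlMr// mulN1r (ltW ct) ler_pdivrMr// mul1r ltW.
    by rewrite asin_geNpi2// asin_lepi2.
  have /andP[_ h1] := h a ia; have /andP[h2 _] := h (- a) iNa; lra.
- by lra.
- apply: continuous_in_subspaceT => t; rewrite inE /= in_itv/= => /io/andP[ct tc].
  apply: cvgV.
    rewrite gt_eqF// sqrtr_gt0 subr_gt0 -[ltLHS]real_normK ?num_real// ltr_pXn2r ?nnegrE ?(ltW c0)//.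
    by rewrite ltr_norml ct.
  apply: (@continuous_comp _ _ _ (fun t => c ^+ 2 - t ^+ 2) Num.sqrt); last exact: sqrt_continuous.
  apply: cvgB; first exact: cvg_cst.
  exact: exprn_continuous.
- split.
  + move=> t; rewrite in_itv/= => /andP[at_ ta]; have [] // := dF t.
    by rewrite !ltW.
  + exact: (cvg_at_right_filter (cF _ iNa)).
  + exact: (cvg_at_left_filter (cF _ ia)).
- move=> t; rewrite in_itv/= => /andP[at_ ta]; rewrite derive1E; have [] // := dF t.
  by rewrite !ltW.
Qed.

Lemma arc_measurable (c : R) (D : set R) :
  measurable_fun D (fun t : R => (`|c ^+ 2 - t ^+ 2| `^ (- 2^-1))%:E).
Proof.
apply/measurable_EFinP; apply: (measurable_powR_abs (- 2^-1)).
apply: measurable_funB => //; apply: measurable_funX => //.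
Qed.

Lemma sqrtV_powR (x : R) : 0 <= x -> (Num.sqrt x)^-1 = `|x| `^ (- 2^-1).
Proof. by move=> x0; rewrite ger0_norm// powRN powR12_sqrt. Qed.

(** The integrand is the derivative of the arc sine of [t / c]. *)
Lemma arc_integral (c : R) : 0 < c ->
  (\int[mu]_(t in `](- c)%R, c[) (`|c ^+ 2 - t ^+ 2| `^ (- 2^-1))%:E <= pi%:E)%E.
Proof.
move=> c0; pose a m : R := c - c / m.+2%:R.
pose F m : set (measurableTypeR R) := `[- a m, a m]%classic.
have a0 m : 0 < a m by rewrite subr_gt0 ltr_pdivrMr// ltr_pMr// ltr1n.
have ac m : a m < c by rewrite gtrBl divr_gt0.
have aS : {homo a : m1 m2 / (m1 <= m2)%N >-> m1 <= m2}.
  move=> m1 m2 m12; rewrite lerB// ler_pM2l// lef_pV2 ?posrE// ler_nat !ltnS; exact: m12.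
have FU : \bigcup_m F m = `]- c, c[%classic.
  apply/seteqP; split => t.
    move=> [m _]; rewrite /F /= !in_itv/= => /andP[h1 h2]; have := ac m.
    by move=> acm; rewrite (lt_le_trans _ h1) ?ltrN2// (le_lt_trans h2).
  rewrite /= in_itv/= -ltr_norml => tc.
  have ct : 0 < c - `|t| by rewrite subr_gt0.
  exists (Num.truncn (c / (c - `|t|))) => //.
  rewrite /F /= in_itv/= -ler_norml /a lerBrDr -lerBrDl.
  rewrite ler_pdivrMr// mulrC -ler_pdivrMr//.
  have h1 : c / (c - `|t|) < (Num.truncn (c / (c - `|t|))).+1%:R by exact: truncnS_gt.
  by rewrite (le_trans (ltW h1))// ler_nat.
have ndF : nondecreasing_seq F.
  move=> m1 m2 m12; apply/subsetPset => t; rewrite /F /= !in_itv/= => /andP[h1 h2].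
  have := aS _ _ m12 => h3; rewrite (le_trans _ h1) ?lerN2//=; exact: le_trans h3.
have cv : (\int[mu]_(x in F i) (`|c ^+ 2 - x ^+ 2| `^ (- 2^-1))%:E @[i --> \oo] -->
    \int[mu]_(x in \bigcup_i F i) (`|c ^+ 2 - x ^+ 2| `^ (- 2^-1))%:E)%E.
  apply: (@ge0_nondecreasing_set_cvg_integral _ (measurableTypeR R) R F (fun t : R => (`|c ^+ 2 - t ^+ 2| `^ (- 2^-1))%:E)) => //.
  - by move=> m; exact: measurable_itv.
  - by move=> m; exact: arc_measurable.
rewrite FU in cv; rewrite -(cvg_lim _ cv)//; apply: lime_le.
  by apply/cvg_ex; eexists; exact: cv.
near=> m; apply: le_trans (arc_integral_le (a0 m) (ac m)).
rewrite le_eqVlt; apply/orP; left; apply/eqP; apply: eq_integral => t.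
rewrite inE /F /= in_itv/= => /andP[h1 h2]; have h3 := ac m.
rewrite -sqrtV_powR// subr_ge0 -[leLHS]real_normK ?num_real// ler_pXn2r ?nnegrE ?(ltW c0)//.
by rewrite ler_norml; apply/andP; split; [rewrite (le_trans _ h1)// lerN2 ltW|exact: le_trans (ltW h3)].
Unshelve. all: by end_near.
Qed.

End one_dim.

Section tail_sq.
Context {R : realType}.
Local Notation L n := (lebesgue_rV R n).

(** The square of the distance to [Gamma], as a polynomial; it also makes sense on
    the hyperplane that parametrizes the boundary. *)
Definition tail_sq (d n : nat) (y : 'rV[R]_n) : R :=
  \sum_(i < n) (if (d <= i)%N then y ord0 i * y ord0 i else 0).

Lemma tail_sq_ge0 d n (y : 'rV[R]_n) : 0 <= tail_sq d y.
Proof. by apply: sumr_ge0 => i _; case: ifP => // _; rewrite -expr2 sqr_ge0. Qed.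

Lemma tail_sq0 n (y : 'rV[R]_n) : tail_sq 0 y = enorm y ^+ 2.
Proof. by rewrite enorm_sqr. Qed.

Lemma enorm_rsubmx d k (x : 'rV[R]_(d + k)) : enorm (rsubmx x) ^+ 2 = tail_sq d x.
Proof.
rewrite enorm_sqr /tail_sq big_split_ord /= big1 ?add0r => [|i _].
  by apply: eq_bigr => i _; rewrite leq_addr !mxE.
by rewrite leqNgt ltn_ord.
Qed.

Lemma tail_sq_snoc d n (y : 'rV[R]_n) (t : R) : (d <= n)%N ->
  tail_sq d (@snoc_rV R n.+1 y t) = tail_sq d y + t ^+ 2.
Proof.
move=> dn; rewrite /tail_sq big_ord_recr /= dn snoc_rV_max// expr2; congr (_ + _).
by apply: eq_bigr => i _; rewrite (@snoc_rV_lt _ _ _ _ _ i).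
Qed.

Lemma tail_sq_snoc_pred d n (y : 'rV[R]_n.-1) (t : R) : (d < n)%N ->
  tail_sq d (snoc_rV y t) = tail_sq d y + t ^+ 2.
Proof. by case: n y => // n y dn; exact: tail_sq_snoc. Qed.

Lemma flat_radius_sqr d k (y : 'rV[R]_(d + k).-1) : (0 < k)%N ->
  flat_radius y ^+ 2 = tail_sq d y.
Proof.
move=> k0; rewrite /flat_radius enorm_rsubmx tail_sq_snoc_pred ?expr0n ?addr0//.
by rewrite -[ltnLHS]addn0 ltn_add2l.
Qed.

Lemma smooth_tail_sq d n : smooth (@tail_sq d n).
Proof.
apply: (@smooth_sum R n _ _ (fun (i : 'I_n) (y : 'rV[R]_n) => if (d <= i)%N then y ord0 i * y ord0 i else 0)) => i.
case: (d <= i)%N; last exact: smooth_cst.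
by apply: smoothM; exact: smooth_coord.
Qed.

Lemma partial_tail_sq d n (i : 'I_n) (y : 'rV[R]_n) :
  partial i (@tail_sq d n) y = if (d <= i)%N then 2 * y ord0 i else 0.
Proof.
rewrite (@partial_sum _ _ _ _ (fun (j : 'I_n) (y : 'rV[R]_n) => if (d <= j)%N then y ord0 j * y ord0 j else 0)).
  rewrite (bigD1 i)//= big1 => [|j ji].
    rewrite addr0; case: (d <= i)%N; last exact: partial_cst.
    by rewrite partialM ?partial_coord ?eqxx ?mulr1; [ring|exact: smooth_coord|exact: smooth_coord].
  case: (d <= j)%N; last exact: partial_cst.
  by rewrite partialM ?partial_coord ?(negbTE ji) ?mulr0 ?addr0//; exact: smooth_coord.
move=> j; case: (d <= j)%N; last exact: smooth_cst.
by apply: smoothM; exact: smooth_coord.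
Qed.

Definition hemisphere (d n : nat) (c : R) (y : 'rV[R]_n) : R := Num.sqrt (c ^+ 2 - tail_sq d y).

(** The area element [c / sqrt(c^2 - |y'|^2)] of the sphere, written as a power of an
    absolute value so that it is defined and measurable everywhere. *)
Lemma hemisphere_weight d n (c : R) (y : 'rV[R]_n) : 0 < c -> tail_sq d y < c ^+ 2 ->
  Num.sqrt (1 + enorm (gradient (@hemisphere d n c) y) ^+ 2) = c * `|c ^+ 2 - tail_sq d y| `^ (- 2^-1).
Proof.
move=> c0 yc; have q0 : 0 < c ^+ 2 - tail_sq d y by rewrite subr_gt0.
have sq : smooth (fun y : 'rV[R]_n => c ^+ 2 - tail_sq d y).
  by apply: smoothB; [exact: smooth_cst|exact: smooth_tail_sq].
have G i : gradient (@hemisphere d n c) y ord0 i =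
    - (Num.sqrt (c ^+ 2 - tail_sq d y))^-1 * (if (d <= i)%N then y ord0 i else 0).
  rewrite mxE /partial /hemisphere; have [dd dE] := is_derive1_sqrt q0.
  have [_ ->] := @is_derive_comp_dir R 'rV[R]_n Num.sqrt (fun y => c ^+ 2 - tail_sq d y) y (delta_mx ord0 i) dd (@smooth_derivable _ _ _ sq i y).
  rewrite derive1E dE.
  have -> : 'D_(delta_mx ord0 i) (fun y : 'rV[R]_n => c ^+ 2 - tail_sq d y) y = - (if (d <= i)%N then 2 * y ord0 i else 0).
    transitivity (partial i (fun y : 'rV[R]_n => c ^+ 2 - tail_sq d y) y); first by [].
    have -> := @partialB _ _ (fun=> c ^+ 2) (@tail_sq d n) i y (smooth_cst _) (smooth_tail_sq _ _).
    by rewrite partial_cst partial_tail_sq sub0r.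
  by case: ifP => _; [field; rewrite gt_eqF// sqrtr_gt0|rewrite oppr0 !mulr0].
have -> : enorm (gradient (@hemisphere d n c) y) ^+ 2 = tail_sq d y / (c ^+ 2 - tail_sq d y).
  rewrite enorm_sqr /dotrV [in RHS]/tail_sq mulr_suml; apply: eq_bigr => i _.
  rewrite !G; case: ifP => _; last by rewrite !mulr0 mul0r.
  rewrite -[in RHS](@sqr_sqrtr _ (c ^+ 2 - tail_sq d y)) ?(ltW q0)//.
  by field; rewrite gt_eqF// sqrtr_gt0.
rewrite -sqrtV_powR ?(ltW q0)//.
have -> : 1 + tail_sq d y / (c ^+ 2 - tail_sq d y) = c ^+ 2 * (c ^+ 2 - tail_sq d y)^-1.
  by field; rewrite gt_eqF.
by rewrite sqrtrM ?sqr_ge0// sqrtr_sqr gtr0_norm// sqrtrV ?(ltW q0).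
Qed.

Lemma measurable_tail_sq d n (D : set 'rV[R]_n) : measurable_fun D (@tail_sq d n).
Proof.
by apply: measurable_funTS; apply: continuous_measurable_rV; apply: smooth_continuous; exact: smooth_tail_sq.
Qed.

Lemma measurable_hemisphere_weight d n (c : R) (D : set 'rV[R]_n) :
  measurable_fun D (fun y => c * `|c ^+ 2 - tail_sq d y| `^ (- 2^-1)).
Proof.
apply: measurable_funM => //.
apply: (measurable_powR_abs (- 2^-1)); apply: measurable_funB => //; exact: measurable_tail_sq.
Qed.

Lemma measurable_sqrt : measurable_fun setT (@Num.sqrt R).
Proof. by apply: continuous_measurable_fun => x; exact: sqrt_continuous. Qed.

Definition tail_ball (d n : nat) (c : R) : set 'rV[R]_n := [set y | tail_sq d y < c ^+ 2].

Lemma measurable_tail_ball d n c : measurable (@tail_ball d n c).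
Proof.
have := @measurable_tail_sq d n setT measurableT _ (measurable_itv `]-oo, c ^+ 2[).
by rewrite setTI; congr measurable; apply/seteqP; split => y; rewrite /= in_itv.
Qed.

(** The area element blows up at the equator, but by [arc_integral] its integral in
    the last variable is at most [c * pi] on each line. *)
Lemma hemisphere_area_fin d n (c M : R) : (d < n)%N -> 0 < c ->
  (\int[L n]_(y in @tail_ball d n c `&` cbox (fun=> - M)%R (fun=> M))
     (c * `|c ^+ 2 - tail_sq d y| `^ (- 2^-1))%:E < +oo)%E.
Proof.
case: n => // n dn c0.
set D := (_ `&` _); pose f (y : 'rV[R]_n.+1) : \bar R := (c * `|c ^+ 2 - tail_sq d y| `^ (- 2^-1))%:E.
have mD : measurable D by apply: measurableI; [exact: measurable_tail_ball|exact: measurable_cbox].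
have f0 y : (0 <= f y)%E by rewrite lee_fin mulr_ge0 ?powR_ge0// ltW.
have mf : measurable_fun setT f by apply/measurable_EFinP; exact: measurable_hemisphere_weight.
rewrite integral_mkcond ge0_integral_snoc; last 2 first.
- by apply/(measurable_restrictT _ mD); exact: measurable_funTS.
- by move=> y; rewrite patchE; case: ifP => // _; exact: f0.
pose B : set 'rV[R]_n := cbox (fun=> - M) (fun=> M).
apply: (@le_lt_trans _ _ (\int[L n]_(z in B) (cst (c * pi)%:E z))%E); last first.
  by rewrite integral_cst ?lte_mul_pinfty ?lee_fin ?mulr_ge0 ?pi_ge0 ?(ltW c0)//; [exact: cbox_fin|exact: measurable_cbox].
rewrite [leRHS]integral_mkcond; apply: ge0_le_integral => //.
- by move=> z _; apply: integral_ge0 => t _; rewrite patchE; case: ifP => // _; exact: f0.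
- apply: (@measurable_fun_fubini_tonelli_F _ _ _ _ _ (@lebesgue_measure R) (fun z : 'rV[R]_n * measurableTypeR R => (f \_ D) (@snoc_rV R n.+1 z.1 z.2))).
    apply: (measurableT_comp (f := f \_ D)); last exact: measurable_snoc_rV.
    by apply/(measurable_restrictT _ mD); exact: measurable_funTS.
  by move=> z; rewrite patchE; case: ifP => // _; exact: f0.
- apply/(measurable_restrictT _ (measurable_cbox _ _)); exact: measurable_cst.
move=> z _; rewrite [leRHS]patchE.
have zD t : D (@snoc_rV R n.+1 z t) -> B z /\ tail_sq d z + t ^+ 2 < c ^+ 2.
  rewrite /D /tail_ball /= tail_sq_snoc// => -[h1 h2]; split => // i.
  by have := h2 (widen_ord (leqnSn n) i); rewrite (@snoc_rV_lt _ _ _ _ _ i).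
have [zB|zB] := boolP (z \in B); last first.
  rewrite integral0_eq// => t _; rewrite patchE; case: ifPn => // /set_mem/zD[zB' _].
  by move/negP : zB; rewrite inE.
have [zc|zc] := ltP (tail_sq d z) (c ^+ 2); last first.
  rewrite integral0_eq//; first by rewrite lee_fin mulr_ge0 ?pi_ge0// ltW.
  move=> t _; rewrite patchE; case: ifPn => // /set_mem/zD[_ h].
  by exfalso; have h2 : 0 <= (t : R) ^+ 2 := sqr_ge0 t; move: h; rewrite ltNge => /negP; apply; rewrite (le_trans zc)// lerDl.
pose e := Num.sqrt (c ^+ 2 - tail_sq d z).
have e0 : 0 < e by rewrite sqrtr_gt0 subr_gt0.
have e2 : e ^+ 2 = c ^+ 2 - tail_sq d z by rewrite sqr_sqrtr// subr_ge0 ltW.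
apply: (@le_trans _ _ (\int[@lebesgue_measure R]_(t in `](- e)%R, e[) (c%:E * (`|e ^+ 2 - t ^+ 2| `^ (- 2^-1))%:E))%E).
  rewrite [leRHS]integral_mkcond; apply: ge0_le_integral => //.
  - by move=> t _; rewrite patchE; case: ifP => // _; exact: f0.
  - apply: (measurableT_comp (f := f \_ D)); last first.
      by have := measurableT_comp (@measurable_snoc_rV R n) (@measurable_pair1 _ _ _ _ z); exact.
    by apply/(measurable_restrictT _ mD); exact: measurable_funTS.
  - apply/(measurable_restrictT _ (measurable_itv _)).
    by apply: emeasurable_funM; [exact: measurable_cst|exact: arc_measurable].
  move=> t _; rewrite !patchE; case: ifPn => [/set_mem /zD[_ ht]|_]; last first.
    by case: ifP => // _; rewrite -EFinM lee_fin mulr_ge0 ?powR_ge0 ?(ltW c0).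
  rewrite mem_set; last first.
    rewrite /= in_itv/= -ltr_norml -(@ltr_pXn2r _ 2) ?nnegrE ?(ltW e0)// real_normK ?num_real// e2; lra.
  by rewrite /f tail_sq_snoc// e2 -EFinM lee_fin opprD addrA.
rewrite ge0_integralZl_EFin ?(ltW c0)//; last first.
  exact: arc_measurable.
rewrite /cst EFinM; apply: lee_wpmul2l; [by rewrite lee_fin ltW|exact: arc_integral].
Qed.

End tail_sq.

(** * The surface measure of the boundary *)

Section graph.
Context {R : realType}.
Local Notation L n := (lebesgue_rV R n).

Lemma measurable_graph_map n (psi : 'rV[R]_n.-1 -> R) : (0 < n)%N ->
  measurable_fun setT psi -> measurable_fun setT (fun y => snoc_rV y (psi y) : 'rV[R]_n).
Proof.
case: n psi => // n psi _ mpsi.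
apply: (measurableT_comp (f := fun z : 'rV[R]_n * measurableTypeR R => @snoc_rV R n.+1 z.1 z.2) (g := fun y => (y, psi y))).
  exact: measurable_snoc_rV.
by apply: measurable_fun_pair; [exact: measurable_id|].
Qed.

Definition graph_weight n (psi : 'rV[R]_n -> R) (y : 'rV[R]_n) : R :=
  Num.sqrt (1 + enorm (gradient psi y) ^+ 2).

Lemma graph_weight_ge1 n (psi : 'rV[R]_n -> R) y : 1 <= graph_weight psi y.
Proof. by rewrite -[leLHS]sqrtr1 ler_sqrt ?lerDl ?sqr_ge0// addr_ge0 ?sqr_ge0. Qed.

Lemma graph_sigma_additive n (D : set 'rV[R]_n.-1) (psi : 'rV[R]_n.-1 -> R) : (0 < n)%N ->
  measurable D -> measurable_fun setT psi -> measurable_fun D (graph_weight psi) ->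
  semi_sigma_additive (graph_measure D psi).
Proof.
move=> n0 mD mpsi mw F mF tF mUF.
have mg := measurable_funTS (measurable_graph_map n0 mpsi) : measurable_fun D _.
rewrite /graph_measure.
have -> : D `&` [set y | (\bigcup_i F i) (snoc_rV y (psi y))] =
    \bigcup_i (D `&` [set y | F i (snoc_rV y (psi y))]).
  apply/seteqP; split => [y [Dy [i _ Fi]]|y [i _ [Dy Fi]]]; first by exists i.
  by split => //; exists i.
rewrite ge0_integral_bigcup.
- by apply: is_cvg_nneseries => i _ _; apply: integral_ge0 => y _; rewrite lee_fin sqrtr_ge0.
- by move=> i; exact: mg.
- apply/measurable_EFinP; apply: measurable_funS mw => //.
  by move=> y [i _ []].
- by move=> y _; rewrite lee_fin sqrtr_ge0.
- apply/trivIsetP => i j _ _ ij; move/trivIsetP : tF => /(_ _ _ I I ij) FF.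
  apply/seteqP; split => y //= [[_ Fi] [_ Fj]].
  by rewrite -[False]/(set0 (snoc_rV y (psi y))) -FF.
Qed.

Lemma graph_measure_ge0 n (D : set 'rV[R]_n.-1) (psi : 'rV[R]_n.-1 -> R) B :
  (0 <= graph_measure D psi B)%E.
Proof. by apply: integral_ge0 => y _; rewrite lee_fin sqrtr_ge0. Qed.

Lemma graph_measure0 n (D : set 'rV[R]_n.-1) (psi : 'rV[R]_n.-1 -> R) :
  graph_measure D psi (set0 : set 'rV[R]_n) = 0%E.
Proof.
rewrite /graph_measure (_ : _ `&` _ = set0) ?integral_set0//.
by apply/seteqP; split => // y [].
Qed.

Lemma sigma_additiveD d (T : measurableType d) (m1 m2 : set T -> \bar R) :
  (forall A, 0 <= m1 A)%E -> (forall A, 0 <= m2 A)%E ->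
  semi_sigma_additive m1 -> semi_sigma_additive m2 ->
  semi_sigma_additive (fun A => m1 A + m2 A)%E.
Proof.
move=> m10 m20 s1 s2 F mF tF mUF.
rewrite (_ : (fun n => _) = (fun n => \sum_(0 <= i < n) m1 (F i) + \sum_(0 <= i < n) m2 (F i))%E).
  apply: cvgeD; [|exact: s1|exact: s2].
  by apply: ge0_adde_def; rewrite inE.
by apply/funext => n; rewrite big_split.
Qed.

Definition drop_last n (x : 'rV[R]_n) : 'rV[R]_n.-1 := \row_i x ord0 (widen_ord (leq_pred n) i).

Lemma measurable_drop_last n : measurable_fun setT (@drop_last n).
Proof. by apply/measurable_fun_rVP => i; under eq_fun do rewrite mxE; exact: measurable_rV_coord. Qed.

Lemma drop_last_snoc n (y : 'rV[R]_n.-1) t : (0 < n)%N -> drop_last (snoc_rV y t : 'rV[R]_n) = y.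
Proof. by case: n y => // n y _; apply/rowP => i; rewrite mxE (@snoc_rV_lt _ _ _ _ _ i). Qed.

Definition last_coord n (x : 'rV[R]_n) : R := oapp (fun i : 'I_n => x ord0 i) 0 (insub n.-1).

Lemma measurable_last_coord n : measurable_fun setT (@last_coord n).
Proof. by rewrite /last_coord; case: insubP => /= *; [exact: measurable_rV_coord|exact: measurable_cst]. Qed.

Lemma last_coord_snoc n (y : 'rV[R]_n.-1) t : (0 < n)%N -> last_coord (snoc_rV y t : 'rV[R]_n) = t.
Proof.
case: n y => // n y _; rewrite /last_coord; case: insubP => /= [u _ un|]; last by rewrite ltnSn.
exact: snoc_rV_max.
Qed.

Lemma snoc_drop_last n (x : 'rV[R]_n) : (0 < n)%N -> snoc_rV (drop_last x) (last_coord x) = x.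
Proof.
case: n x => // n x _; apply/rowP => i; have [ni|ni] := ltnP i n.
  rewrite (@snoc_rV_lt _ _ _ _ _ (Ordinal ni))// mxE; congr (x _ _); exact/val_inj.
have ein : i = n :> nat by apply/eqP; rewrite eqn_leq ni -ltnS ltn_ord.
rewrite snoc_rV_max// /last_coord; case: insubP => /= [u _ un|]; last by rewrite ltnSn.
by congr (x _ _); apply/val_inj; rewrite /= un.
Qed.

(** Dropping the last coordinate inverts the graph map, so the image of a measurable
    set is described by a measurable condition. *)
Lemma graph_measurable n (E : set 'rV[R]_n.-1) (psi : 'rV[R]_n.-1 -> R) :
  measurable E -> measurable_fun setT psi ->
  measurable [set x : 'rV[R]_n | E (drop_last x) /\ last_coord x = psi (drop_last x)].
Proof.
move=> mE mpsi; apply: measurableI.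
  by rewrite -[X in measurable X]setTI; exact: measurable_drop_last.
have mf : measurable_fun setT (fun x : 'rV[R]_n => last_coord x - psi (drop_last x)).
  apply: measurable_funB; first exact: measurable_last_coord.
  by apply: (measurableT_comp mpsi); exact: measurable_drop_last.
have := mf measurableT _ (measurable_set1 0); rewrite setTI; congr measurable.
by apply/seteqP; split => x /=; [move/eqP; rewrite subr_eq0 => /eqP|move=> ->; rewrite subrr].
Qed.

End graph.

Section surface.
Context {R : realType} (d k : nat) (r : \bar R).
Hypothesis k2 : (1 < k)%N.
Local Notation n := (d + k)%N.
Local Notation L n := (lebesgue_rV R n).
Local Notation base := (@surface_base R d k r).
Implicit Types (psi : 'rV[R]_n.-1 -> R) (y : 'rV[R]_n.-1).

Let k0 : (0 < k)%N. Proof. exact: ltnW. Qed.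
Let n0 : (0 < d + k)%N. Proof. by rewrite addn_gt0 k0 orbT. Qed.

Lemma flat_radius_ge0 y : 0 <= flat_radius y.
Proof. exact: enorm_ge0. Qed.

Lemma flat_radiusE y : flat_radius y = Num.sqrt (tail_sq d y).
Proof. rewrite -(flat_radius_sqr y k0); apply/esym; rewrite sqrtr_sqr ger0_norm//; exact: flat_radius_ge0. Qed.

Lemma measurable_flat_radius : measurable_fun setT (@flat_radius R d k).
Proof.
rewrite (_ : @flat_radius R d k = Num.sqrt \o @tail_sq R d n.-1); last by apply/funext => y; rewrite flat_radiusE.
by apply: (measurableT_comp measurable_sqrt); exact: measurable_tail_sq.
Qed.

Lemma measurable_base : measurable base.
Proof.
have := measurable_flat_radius => /measurable_EFinP h.
have := emeasurable_fun_infty_o measurableT h r.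
by rewrite setTI; congr measurable; apply/seteqP; split.
Qed.

Lemma base_ball (c : R) y : r = c%:E -> base y -> 0 < c /\ tail_sq d y < c ^+ 2.
Proof.
rewrite /surface_base /= => -> ; rewrite lte_fin => yc.
have c0 : 0 < c by rewrite (le_lt_trans _ yc)// flat_radius_ge0.
by split => //; rewrite -(flat_radius_sqr y k0) ltr_pXn2r ?nnegrE ?flat_radius_ge0 ?(ltW c0).
Qed.

(** The boundary is the union of the flat part and, for finite radius, the
    spherical part; both are graphs over the same base, so that every statement
    about the boundary is proved once, for a function satisfying [sheet]. *)
Definition sheet psi : Prop :=
  psi = (fun=> 0) \/ exists2 c, r = c%:E & psi = @hemisphere R d n.-1 c.

Lemma sheet_sphereE (c : R) :
  (fun y => Num.sqrt (c ^+ 2 - flat_radius y ^+ 2)) = @hemisphere R d n.-1 c.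
Proof. by apply/funext => y; rewrite (flat_radius_sqr y k0). Qed.

Lemma measurable_sheet psi : sheet psi -> measurable_fun setT psi.
Proof.
move=> [->|[c _ ->]]; first exact: measurable_cst.
by apply: (measurableT_comp measurable_sqrt); apply: measurable_funB => //; exact: measurable_tail_sq.
Qed.

Lemma flat_weight y : graph_weight (fun _ : 'rV[R]_n.-1 => 0) y = 1.
Proof.
rewrite /graph_weight (_ : gradient _ y = 0) ?enorm0 ?expr0n ?addr0 ?sqrtr1//.
by apply/rowP => i; rewrite !mxE partial_cst.
Qed.

Lemma measurable_sheet_weight psi : sheet psi -> measurable_fun base (graph_weight psi).
Proof.
move=> [->|[c rc ->]].
  by rewrite (_ : graph_weight _ = cst 1); [exact: measurable_cst|apply/funext => y; exact: flat_weight].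
apply: (eq_measurable_fun (fun y => c * `|c ^+ 2 - tail_sq d y| `^ (- 2^-1))); last exact: measurable_hemisphere_weight.
move=> y; rewrite inE => yb; have [c0 yc] := base_ball rc yb.
by rewrite /graph_weight hemisphere_weight.
Qed.

Lemma sheet_sigma_additive psi : sheet psi -> semi_sigma_additive (graph_measure base psi).
Proof.
move=> sp; apply: (graph_sigma_additive n0); first exact: measurable_base.
- exact: measurable_sheet.
- exact: measurable_sheet_weight.
Qed.

Lemma surface_measureE (B : set 'rV[R]_n) : surface_measure d k r B =
  (graph_measure base (fun=> 0%R) B +
    if r is c%:E then graph_measure base (@hemisphere R d n.-1 c) B else 0)%E.
Proof.
by case: r => [c| |]; [rewrite /surface_measure sheet_sphereE; reflexivity|reflexivity|reflexivity].
Qed.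

Lemma surface_measure_sigma_additive : semi_sigma_additive (surface_measure d k r).
Proof.
have -> : surface_measure d k r = (fun B => graph_measure base (fun=> 0%R) B +
    if r is c%:E then graph_measure base (@hemisphere R d n.-1 c) B else 0)%E.
  by apply/funext => B; exact: surface_measureE.
apply: sigma_additiveD.
- by move=> B; exact: graph_measure_ge0.
- by move=> B; case: r => [c| |] //; exact: graph_measure_ge0.
- by apply: sheet_sigma_additive; left.
have h c : r = c%:E -> semi_sigma_additive (graph_measure base (@hemisphere R d n.-1 c)).
  by move=> rc; apply: sheet_sigma_additive; right; exists c.
case: r h => [c h| _| _]; first exact: (h c erefl).
- exact: (@measure_semi_sigma_additive _ _ _ mzero).
- exact: (@measure_semi_sigma_additive _ _ _ mzero).
Qed.

Lemma surface_measure0 : surface_measure d k r set0 = 0%E.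
Proof. by rewrite surface_measureE graph_measure0; case: r => [c| |]; rewrite ?graph_measure0 add0e. Qed.

Lemma surface_measure_ge0 (B : set 'rV[R]_n) : (0 <= surface_measure d k r B)%E.
Proof.
rewrite surface_measureE; apply: adde_ge0; first exact: graph_measure_ge0.
by case: r => [c| |] //; exact: graph_measure_ge0.
Qed.

(** The surface measure of the boundary with its structure of a measure, which gives
    access to the theorems on integrals. *)
Definition surface : {measure set 'rV[R]_n -> \bar R} :=
  HB.pack_for {measure set 'rV[R]_n -> \bar R} (surface_measure d k r)
    (isMeasure.Build _ _ _ (surface_measure d k r) surface_measure0 surface_measure_ge0
       surface_measure_sigma_additive).

Lemma surfaceE : (surface : set 'rV[R]_n -> \bar R) = surface_measure d k r.
Proof. by []. Qed.

Lemma sheet_le_surface psi (B : set 'rV[R]_n) : sheet psi ->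
  (graph_measure base psi B <= surface B)%E.
Proof.
rewrite surfaceE surface_measureE => -[->|[c -> ->]].
  by apply: leeDl; case: r => [c| |] //; exact: graph_measure_ge0.
by apply: leeDr; exact: graph_measure_ge0.
Qed.

Lemma measurable_sheet_preimage psi (B : set 'rV[R]_n) : sheet psi -> measurable B ->
  measurable (base `&` [set y | B (snoc_rV y (psi y))]).
Proof.
move=> sp mB; have := measurable_funTS (measurable_graph_map n0 (measurable_sheet sp)) : measurable_fun base _.
by apply; [exact: measurable_base|].
Qed.

(** The area element is at least [1]. *)
Lemma base_le_surface psi (B : set 'rV[R]_n) : sheet psi -> measurable B ->
  (L n.-1 (base `&` [set y | B (snoc_rV y (psi y))]) <= surface B)%E.
Proof.
move=> sp mB; apply: le_trans (sheet_le_surface _ sp).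
have mE := measurable_sheet_preimage sp mB.
rewrite /graph_measure -[leLHS]mul1e -integral_cst//; apply: ge0_le_integral => //.
  by apply/measurable_EFinP; apply: measurable_funS (measurable_sheet_weight sp) => //; exact: measurable_base.
by move=> y _; rewrite lee_fin graph_weight_ge1.
Qed.

(** Images of null sets of the base are null, as both parametrizations are injective
    and have a density with respect to Lebesgue measure. *)
Lemma ae_surface (P : 'rV[R]_n -> Prop) :
  (forall psi, sheet psi -> {ae L n.-1, forall y, base y -> P (snoc_rV y (psi y))}) ->
  {ae surface, forall x, P x}.
Proof.
move=> H.
have {}H psi : exists N, sheet psi -> [/\ measurable N, L n.-1 N = 0%E &
    forall y, base y -> ~ N y -> P (snoc_rV y (psi y))].
  have [sp|] := pselect (sheet psi); last by exists set0.
  have [N [mN N0 HN]] := H _ sp; exists N => _; split => // y yb Ny.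
  by apply: contrapT => nP; apply: Ny; apply: HN => /=; move=> /(_ yb).
have [N HN] := choice H.
pose G psi := [set x : 'rV[R]_n | (base `\` N psi) (drop_last x) /\ last_coord x = psi (drop_last x)].
have mG psi : sheet psi -> measurable (G psi).
  move=> sp; apply: graph_measurable; last exact: measurable_sheet.
  by apply: measurableD; [exact: measurable_base|case: (HN _ sp)].
pose A := ~` [set x | exists2 psi, sheet psi & G psi x].
have AE : A = ~` (G (fun=> 0) `|` [set x | exists2 c, r = c%:E & G (@hemisphere R d n.-1 c) x]).
  congr (~` _); apply/seteqP; split => [x [psi sp]|x [Gx|[c rc Gx]]].
  - by case: sp => [->|[c rc ->]] Gx; [left|right; exists c].
  - by exists (fun=> 0) => //; left.
  - by exists (@hemisphere R d n.-1 c) => //; right; exists c.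
have mA : measurable A.
  rewrite AE; apply: measurableC; apply: measurableU; first by apply: mG; left.
  have [[c rc]|nr] := pselect (exists c, r = c%:E).
    rewrite (_ : [set _ | _] = G (@hemisphere R d n.-1 c)); first by apply: mG; right; exists c.
    apply/seteqP; split => x; last by exists c.
    by move=> [c']; rewrite rc => -[->].
  rewrite (_ : [set _ | _] = set0) //; apply/seteqP; split => // x [c rc _]; by apply: nr; exists c.
have A0 psi : sheet psi -> graph_measure base psi A = 0%E.
  move=> sp; have [mN N0 _] := HN _ sp.
  have mE := measurable_sheet_preimage sp mA.
  rewrite /graph_measure; apply: (@null_set_integral _ _ _ (L n.-1)) => //.
    by apply/measurable_EFinP; apply: measurable_funS (measurable_sheet_weight sp) => //; exact: measurable_base.
  apply: (@subset_measure0 _ _ _ (L n.-1) _ (N psi)) => // y [by_ Ay].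
  apply: contrapT => Ny; apply: Ay; exists psi => //; split.
    by rewrite (drop_last_snoc _ _ n0).
  by rewrite (last_coord_snoc _ _ n0) (drop_last_snoc _ _ n0).
exists A; split => //.
  rewrite surfaceE surface_measureE A0; last by left.
  by rewrite add0e; case E : r => [c| |] //; rewrite -E A0//; right; exists c.
move=> x /= nP [psi sp [[by_ Ny] xl]]; apply: nP; have [_ _ HP] := HN _ sp.
have := HP _ by_ Ny; rewrite -xl.
suff -> : snoc_rV (drop_last x) (last_coord x) = x by [].
exact: (snoc_drop_last x n0).
Qed.

(** The flat part has the area of a bounded set; the spherical part is
    [hemisphere_area_fin]. *)
Lemma surface_fin (B : set 'rV[R]_n) (M : R) : measurable B -> (forall x, B x -> enorm x <= M) ->
  (surface B < +oo)%E.
Proof.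
move=> mB BM; rewrite surfaceE surface_measureE.
have sub psi : base `&` [set y | B (snoc_rV y (psi y))] `<=` base `&` cbox (fun=> - M) (fun=> M).
  move=> y [by_ By]; split => // i; rewrite -ler_norml.
  have -> : y ord0 i = (snoc_rV y (psi y)) ord0 (widen_ord (leq_pred n) i).
    by rewrite -[in LHS](drop_last_snoc y (psi y) n0) mxE.
  by apply: le_trans (BM _ By); exact: coord_le_enorm.
have mb := measurable_base; have mc := measurable_cbox (fun=> - M : R) (fun=> M : R).
have mbc : measurable (base `&` cbox (fun=> - M) (fun=> M)) by exact: measurableI.
have le psi : sheet psi -> (graph_measure base psi B <=
    \int[L n.-1]_(y in base `&` cbox (fun=> - M)%R (fun=> M)) (graph_weight psi y)%:E)%E.
  move=> sp; apply: ge0_subset_integral => //.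
  - exact: measurable_sheet_preimage.
  - by apply/measurable_EFinP; apply: measurable_funS (measurable_sheet_weight sp).
apply: lte_add_pinfty.
  have sp : sheet (fun=> 0) by left.
  apply: le_lt_trans (le _ sp) _; under eq_integral do rewrite flat_weight.
  rewrite integral_cst// mul1e; apply: le_lt_trans (@cbox_fin R n.-1 (fun=> - M) (fun=> M)).
  by apply: le_measure; rewrite ?inE; [exact: mbc|exact: mc|exact: subIsetr].
case E : r => [c| |] //.
have sp : sheet (@hemisphere R d n.-1 c) by right; exists c.
have [c0|c0] := leP c 0.
  rewrite /graph_measure (_ : _ `&` _ = set0) ?integral_set0//.
  apply/seteqP; split => // y [by_ _]; rewrite -E in by_; have [] := base_ball E by_.
  by rewrite ltNge c0.
rewrite -E; apply: le_lt_trans (le _ sp) _.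
have dn : (d < n.-1)%N by case: k k2 => [|[|k']] // _; rewrite !addnS /=; rewrite ltnS leq_addr.
apply: le_lt_trans (hemisphere_area_fin M dn c0).
have -> : base = @tail_ball R d n.-1 c.
  apply/seteqP; split => y; first by move=> /(base_ball E)[].
  rewrite /tail_ball /surface_base /= E lte_fin -(flat_radius_sqr y k0) ltr_pXn2r ?nnegrE ?(ltW c0)//.
  exact: flat_radius_ge0.
rewrite le_eqVlt; apply/orP; left; apply/eqP; apply: eq_integral => y; rewrite inE => -[yc _].
by rewrite /graph_weight hemisphere_weight.
Qed.

End surface.

(** * Vertical segments, and almost everywhere limits *)

Section segments.
Context {R : realType}.
Local Notation L n := (lebesgue_rV R n).

Lemma dotrV_cauchy n (x y : 'rV[R]_n) : dotrV x y <= enorm x * enorm y.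
Proof.
have [->|x0] := eqVneq x 0.
  by rewrite enorm0 mul0r /dotrV big1// => i _; rewrite mxE mul0r.
have [->|y0] := eqVneq y 0.
  by rewrite enorm0 mulr0 /dotrV big1// => i _; rewrite mxE mulr0.
have pos (z : 'rV[R]_n) : z != 0 -> 0 < enorm z.
  by move=> z0; rewrite lt_neqAle enorm_ge0 andbT eq_sym; apply: contraNneq z0 => /enorm_eq0 ->.
have X := pos _ x0; have Y := pos _ y0.
pose a := enorm x; pose b := enorm y.
have a0 : 0 < a by []. have b0 : 0 < b by [].
have -> : enorm x * enorm y = 2^-1 * (b / a * enorm x ^+ 2 + a / b * enorm y ^+ 2).
  by rewrite -/a -/b; field; rewrite !gt_eqF.
rewrite !enorm_sqr /dotrV !mulr_sumr -big_split mulr_sumr; apply: ler_sum => i _ /=.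
rewrite -subr_ge0 (_ : _ - _ = 2^-1 * ((b * x ord0 i - a * y ord0 i) ^+ 2 / (a * b))).
  by rewrite mulr_ge0// divr_ge0 ?sqr_ge0// mulr_ge0 ?ltW.
by field; rewrite !gt_eqF.
Qed.

Lemma enorm_triangle n (x y : 'rV[R]_n) : enorm (x + y) <= enorm x + enorm y.
Proof.
rewrite -(@ler_pXn2r _ 2) ?nnegrE ?addr_ge0 ?enorm_ge0// sqrrD !enorm_sqr.
rewrite (_ : dotrV (x + y) (x + y) = dotrV x x + dotrV x y *+ 2 + dotrV y y).
  by rewrite lerD2r lerD2l lerMn2r dotrV_cauchy orbT.
rewrite /dotrV -!sumrMnl -!big_split; apply: eq_bigr => i _ /=; rewrite !mxE; ring.
Qed.

Lemma ge0_integral_snoc_pred n (f : 'rV[R]_n -> \bar R) : (0 < n)%N ->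
  measurable_fun setT f -> (forall x, 0 <= f x)%E ->
  (\int[L n]_x f x = \int[L n.-1]_y \int[@lebesgue_measure R]_t f (snoc_rV y t))%E.
Proof. by case: n f => // n f _; exact: ge0_integral_snoc. Qed.

Lemma measurable_snoc_pred n : (0 < n)%N ->
  measurable_fun setT (fun z : 'rV[R]_n.-1 * measurableTypeR R => snoc_rV z.1 z.2 : 'rV[R]_n).
Proof. by case: n => // n _; exact: measurable_snoc_rV. Qed.

Lemma snoc_last n (y : 'rV[R]_n.-1) t (i : 'I_n) : i = n.-1 :> nat -> snoc_rV y t ord0 i = t.
Proof. by case: n y i => [y []//|n y i]; exact: snoc_rV_max. Qed.

Lemma snoc_affine n (y : 'rV[R]_n.-1) (h t : R) (i : 'I_n) : i = n.-1 :> nat ->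
  snoc_rV y (h * 1 + t) = h *: delta_mx ord0 i + snoc_rV y t.
Proof.
case: n y i => [y []//|n y i] /= ni; apply/rowP => j.
rewrite !mxE eqxx/=; have [jn|jn] := ltnP j n.
  rewrite !(insubT (fun k => k < n)%N jn)/= (_ : (j == i) = false) ?mulr0 ?add0r//.
  by apply/eqP => ji; move: jn; rewrite ji ni ltnn.
rewrite insubN -?leqNgt// /= (_ : (j == i) = true) ?mulr1//.
by apply/eqP/val_inj; rewrite /= ni; apply/eqP; rewrite eqn_leq jn -ltnS ltn_ord.
Qed.

Lemma continuous_snoc n (y : 'rV[R]_n.-1) : continuous (fun t : R => snoc_rV y t : 'rV[R]_n).
Proof.
move=> t; apply/cvgrPdist_lt => e e0; near=> s.
rewrite [X in X < _](_ : _ = mx_norm (snoc_rV y t - snoc_rV y s))//.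
rewrite mx_normrE; apply: bigmax_lt => // -[i j] _ /=; rewrite !mxE.
case: (insub _) => [k|]/=; first by rewrite subrr normr0.
by near: s; apply: cvgr_dist_lt.
Unshelve. all: by end_near. Qed.

Lemma is_derive_snoc n (f : 'rV[R]_n -> R) (y : 'rV[R]_n.-1) (i : 'I_n) (t : R) :
  smooth f -> i = n.-1 :> nat ->
  is_derive t (1 : R) (fun t => f (snoc_rV y t)) (partial i f (snoc_rV y t)).
Proof.
move=> sf il.
have aphi (j : unit) (h a : R) : snoc_rV y (h *: (1 : R) + a) = h *: (delta_mx ord0 i : 'rV[R]_n) + snoc_rV y a.
  exact: snoc_affine.
apply: DeriveDef.
  apply: (@derivable_affine R 'rV[R]_n R unit unit (fun=> delta_mx ord0 i) (fun=> 1) id (fun t => snoc_rV y t) aphi f tt t).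
  exact: smooth_derivable.
exact: (@derive_affine R 'rV[R]_n R unit unit (fun=> delta_mx ord0 i) (fun=> 1) id (fun t => snoc_rV y t) aphi f tt t).
Qed.

(** The vertical segments over [D], of length [e] and contained in [W], turn the
    one-dimensional inequality [trace_segment] into a bound by integrals over
    [W]. *)
Lemma trace_le n (D : set 'rV[R]_n.-1) (W : set 'rV[R]_n) (psi : 'rV[R]_n.-1 -> R) (e : R)
    (f : 'rV[R]_n -> R) (i : 'I_n) : 0 < e -> measurable D -> measurable W ->
  measurable_fun setT psi -> smooth f -> i = n.-1 :> nat ->
  (forall y, D y -> exists2 a : R, a <= psi y <= a + e & forall t, a < t < a + e -> W (snoc_rV y t)) ->
  (\int[L n.-1]_(y in D) (`|f (snoc_rV y (psi y))|)%:E <=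
   (e^-1)%:E * \int[L n]_(x in W) (`|f x|)%:E + \int[L n]_(x in W) (`|partial i f x|)%:E)%E.
Proof.
move=> e0 mD mW mpsi sf il HD.
have n0 : (0 < n)%N by case: n i {D W psi f mD mW mpsi sf il HD} => // -[].
have cf := smooth_continuous sf; have cpf := smooth_continuous (smooth_partial i sf).
have mf : measurable_fun setT (fun x => `|f x|).
  by apply: measurableT_comp => //; exact: continuous_measurable_rV.
have mpf : measurable_fun setT (fun x => `|partial i f x|).
  by apply: measurableT_comp => //; exact: continuous_measurable_rV.
pose H x : \bar R := (e^-1 * `|f x| + `|partial i f x|)%:E.
have H0 x : (0 <= H x)%E by rewrite lee_fin addr_ge0// mulr_ge0// invr_ge0 ltW.
have mH : measurable_fun setT H.
  by apply/measurable_EFinP; apply: measurable_funD => //; exact: measurable_funM.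
have mHW : measurable_fun setT (H \_ W).
  by apply/(measurable_restrictT _ mW); exact: measurable_funTS.
have HW0 x : (0 <= (H \_ W) x)%E by rewrite patchE; case: ifP.
have -> : ((e^-1)%:E * \int[L n]_(x in W) (`|f x|)%:E + \int[L n]_(x in W) (`|partial i f x|)%:E =
    \int[L n]_(x in W) H x)%E.
  rewrite -ge0_integralZl_EFin//; last 2 first.
  - by apply/measurable_EFinP; exact: measurable_funTS.
  - by rewrite invr_ge0 ltW.
  rewrite -ge0_integralD//.
  - by move=> x _; rewrite -EFinM lee_fin mulr_ge0// invr_ge0 ltW.
  - by apply/measurable_EFinP; apply: measurable_funM => //; exact: measurable_funTS.
  - by apply/measurable_EFinP; exact: measurable_funTS.
rewrite [leRHS]integral_mkcond ge0_integral_snoc_pred// [leLHS]integral_mkcond.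
apply: ge0_le_integral => //.
- by move=> y _; rewrite patchE; case: ifP => // _; rewrite lee_fin.
- apply/(measurable_restrictT _ mD); apply: measurable_funTS; apply/measurable_EFinP.
  by apply: (measurableT_comp mf); exact: measurable_graph_map.
- apply: (@measurable_fun_fubini_tonelli_F _ _ _ _ _ (@lebesgue_measure R) (fun z : 'rV[R]_n.-1 * measurableTypeR R => (H \_ W) (snoc_rV z.1 z.2))).
    by apply: (measurableT_comp mHW); exact: measurable_snoc_pred.
  by move=> z; exact: HW0.
move=> y _; rewrite [leLHS]patchE; case: ifPn => [/set_mem yD|_]; last first.
  by apply: integral_ge0 => t _; exact: HW0.
have [a /andP[ay ya] aW] := HD _ yD.
have mHy : measurable_fun setT (fun t : measurableTypeR R => H (snoc_rV y t)).
  have /= := measurableT_comp (measurableT_comp mH (measurable_snoc_pred n0)) (@measurable_pair1 _ _ _ _ y); exact.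
apply: (@le_trans _ _ (\int[@lebesgue_measure R]_(t in `]a, (a + e)%R[) H (snoc_rV y t))%E); last first.
  rewrite [leLHS]integral_mkcond; apply: ge0_le_integral => //.
  - by move=> t _; rewrite patchE; case: ifP.
  - by apply/(measurable_restrictT _ (measurable_itv _)); exact: measurable_funTS.
  - have /= := measurableT_comp (measurableT_comp mHW (measurable_snoc_pred n0)) (@measurable_pair1 _ _ _ _ y); exact.
  move=> t _; rewrite patchE; case: ifPn => [/set_mem|_]; last exact: HW0.
  by rewrite /= in_itv/= => /aW Wt; rewrite patchE mem_set.
rewrite -(@integral_itv_bndoo R a (a + e) (fun t => H (snoc_rV y t)) true false); last exact: measurable_funTS.
have ch' : continuous (fun t : R => partial i f (snoc_rV y t)).
  move=> t; apply: (@continuous_comp _ _ _ (fun t : R => snoc_rV y t) (partial i f)); last exact: cpf.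
  exact: continuous_snoc.
have := @trace_segment R (fun t => f (snoc_rV y t)) _ a (a + e) (psi y) ch' (fun t => is_derive_snoc y t sf il).
rewrite ay ya ltrDl => /(_ e0 isT) h; apply: le_trans h _.
rewrite addrAC subrr add0r le_eqVlt; apply/orP; left; apply/eqP.
have mcf : measurable_fun setT (fun t : measurableTypeR R => `|f (snoc_rV y t)|).
  have /= := measurableT_comp (measurableT_comp mf (measurable_snoc_pred n0)) (@measurable_pair1 _ _ _ _ y); exact.
have mcp : measurable_fun setT (fun t : measurableTypeR R => `|partial i f (snoc_rV y t)|).
  have /= := measurableT_comp (measurableT_comp mpf (measurable_snoc_pred n0)) (@measurable_pair1 _ _ _ _ y); exact.
rewrite -ge0_integralZl_EFin//; last 2 first.
- by apply/measurable_EFinP; exact: measurable_funTS.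
- by rewrite invr_ge0 ltW.
rewrite -ge0_integralD//.
- by move=> x _; rewrite -EFinM lee_fin mulr_ge0// invr_ge0 ltW.
- by apply/measurable_EFinP; apply: measurable_funM => //; exact: measurable_funTS.
- by apply/measurable_EFinP; exact: measurable_funTS.
Qed.

End segments.

Section ae_limits.
Local Open Scope ereal_scope.
Context d (T : measurableType d) {R : realType} (mu : {measure set T -> \bar R}).

(** The sum of the absolute differences has a finite integral, hence is finite almost
    everywhere, and an absolutely convergent series converges. *)
Lemma ae_cvg_of_L1 (D : set T) (g : nat -> T -> R) (C : R) (J : nat) : measurable D -> (0 <= C)%R ->
  (forall j, measurable_fun setT (g j)) ->
  (forall j, (J <= j)%N -> \int[mu]_(y in D) (`|g j.+1 y - g j y|%R)%:E <= (C * 2^-1 ^+ j)%:E) ->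
  {ae mu, forall y, D y -> cvgn (fun j => g j y)}.
Proof.
move=> mD C0 mg Hg.
pose h j y := (`|g (J + j).+1 y - g (J + j)%N y|%R)%:E.
have mh j : measurable_fun D (h j).
  by apply: measurable_funTS; apply/measurable_EFinP; apply: measurableT_comp => //; exact: measurable_funB.
have h0 j y : D y -> 0 <= h j y by rewrite lee_fin.
have I : \int[mu]_(y in D) (\sum_(j <oo) h j y) < +oo.
  rewrite integral_nneseries//.
  apply: (@le_lt_trans _ _ (\sum_(j <oo) (C * 2 / (2 ^ j.+1)%:R)%:E)).
    apply: lee_nneseries => [j _ _|j _]; first by apply: integral_ge0 => y; exact: h0.
    apply: le_trans (Hg _ (leq_addr _ _)) _.
    rewrite lee_fin -mulrA ler_wpM2l// exprD expnS natrM invfM mulrA mulfV ?mul1r//.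
    rewrite natrX -exprVn ler_piMl ?exprn_ge0 ?invr_ge0//; apply: exprn_ile1; [by rewrite invr_ge0|by rewrite invf_le1// ler1n].
  apply: le_lt_trans (ltry (C * 2)%R).
  exact: (@epsilon_trick0 R (C * 2)%R xpredT (mulr_ge0 C0 (ler0n _ 2))).
have Ih : mu.-integrable D (fun y => \sum_(j <oo) h j y).
  apply/integrableP; split; first by apply: ge0_emeasurable_sum => // j y Dy _; exact: h0.
  rewrite (eq_integral (fun y => \sum_(j <oo) h j y))// => y; rewrite inE => Dy.
  by rewrite gee0_abs//; apply: nneseries_ge0 => j _ _; exact: h0.
apply: filterS (integrable_ae mD Ih) => y Hy Dy.
have {}Hy := Hy Dy; pose a j : R := (g (J + j).+1 y - g (J + j)%N y)%R.
have ca : cvgn (series (fun j => `|a j|%R)).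
  apply: nondecreasing_is_cvgn.
    by apply/nondecreasing_seqP => n; rewrite /series/= big_nat_recr//= lerDl.
  exists (fine (\sum_(j <oo) h j y)) => _ [n _ <-].
  rewrite -lee_fin fineK// /series /= -sumEFin.
  by apply: (@nneseries_lim_ge _ (fun j => h j y) xpredT 0 n) => j _ _; exact: h0.
have := normed_cvg ca.
have -> : series a = (fun j => g (J + j)%N y - g J y)%R.
  apply/funext => n; rewrite /series /= /a.
  have := @telescope_sumr R 0 n (fun j => g (J + j)%N y) (leq0n n).
  by rewrite addn0 => <-; apply: eq_bigr => i _; rewrite addnS.
move=> /cvg_ex[l cl]; apply/cvg_ex; exists (l + g J y)%R; rewrite -(cvg_shiftn J).
rewrite (_ : [sequence _]_n = (fun j => (g (J + j)%N y - g J y) + g J y)%R).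
  by apply: cvgD => //; exact: cvg_cst.
by apply/funext => j /=; rewrite subrK addnC.
Qed.
End ae_limits.

(** * Uniqueness of traces *)

Section finite_measure.
Local Open Scope ereal_scope.
Context dd (T : measurableType dd) {R : realType} (mu : {measure set T -> \bar R}).

(** On a set of finite measure, [|f|] is at most [c + c `^ (1 - p) * |f| `^ p] for
    every positive [c]. *)
Lemma Lp_L1_small (p : R) (W : set T) : (1 < p)%R -> measurable W -> mu W < +oo ->
  forall eta : R, (0 < eta)%R -> exists2 eps : R, (0 < eps)%R &
  forall f : T -> R, measurable_fun W f ->
    \int[mu]_(x in W) (`|f x| `^ p)%:E <= eps%:E -> \int[mu]_(x in W) (`|f x|%R)%:E <= eta%:E.
Proof.
move=> p1 mW Wfin eta eta0.
pose m := fine (mu W); have Em : mu W = m%:E by rewrite fineK// ge0_fin_numE.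
have m0 : (0 <= m)%R by rewrite fine_ge0.
pose t := (eta / 2 / (m + 1))%R.
have m1 : (0 < m + 1)%R by rewrite ltr_wpDl.
have t0 : (0 < t)%R by rewrite !divr_gt0.
pose c := (t `^ (1 - p))%R; have c0 : (0 < c)%R by rewrite powR_gt0.
exists (eta / 2 / c)%R; first by rewrite !divr_gt0.
move=> f mf If.
have mfp : measurable_fun W (fun x => (`|f x| `^ p)%:E).
  by apply/measurable_EFinP; exact: measurable_powR_abs.
apply: (@le_trans _ _ (\int[mu]_(x in W) (t%:E + c%:E * (`|f x| `^ p)%:E))).
  apply: ge0_le_integral => //.
  - by apply/measurable_EFinP; exact: measurableT_comp.
  - by apply: emeasurable_funD => //; apply: emeasurable_funM.
  move=> x _; rewrite -EFinM -EFinD lee_fin.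
  have [h|h] := leP `|f x|%R t; first by rewrite (le_trans h)// lerDl mulr_ge0 ?powR_ge0// ltW.
  have a0 : (0 < `|f x|)%R by exact: lt_trans h.
  rewrite -[leLHS]add0r lerD ?(ltW t0)// -ler_pdivrMl// /c -powRN opprB.
  have -> : (`|f x| `^ p = `|f x| `^ (p - 1) * `|f x|)%R.
    rewrite -[X in (_ = _ * X)%R](powRr1 (ltW a0)) -powRD; first by rewrite subrK.
    by rewrite (gt_eqF a0) implybT.
  by rewrite ler_wpM2r ?(ltW a0)//; apply: powR_le; [lra|exact: ltW|exact: ltW].
rewrite ge0_integralD//; last 3 first.
- by move=> x _; rewrite lee_fin ltW.
- by move=> x _; rewrite -EFinM lee_fin mulr_ge0 ?powR_ge0// ltW.
- exact: emeasurable_funM.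
rewrite integral_cst// Em ge0_integralZl_EFin//; last exact: ltW.
apply: (@le_trans _ _ ((t * m)%:E + c%:E * (eta / 2 / c)%:E)).
  by rewrite EFinM; apply: leeD => //; apply: lee_wpmul2l => //; rewrite lee_fin ltW.
rewrite -EFinM -EFinD lee_fin [X in (_ + X)%R](_ : _ = eta / 2)%R; last by field; rewrite gt_eqF.
rewrite [leRHS]splitr lerD2r /t mulrAC ler_pdivrMr// ler_wpM2l ?divr_ge0 ?(ltW eta0)//; lra.
Qed.

Lemma Lp_dist_le (p : R) (W : set T) (f g u : T -> R) : (0 <= p)%R -> measurable W ->
  measurable_fun W f -> measurable_fun W g -> measurable_fun W u ->
  \int[mu]_(x in W) (`|f x - g x| `^ p)%:E <=
  (2 `^ p)%:E * (\int[mu]_(x in W) (`|f x - u x| `^ p)%:E + \int[mu]_(x in W) (`|g x - u x| `^ p)%:E).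
Proof.
move=> p0 mW mf mg mu_.
have mP (h k : T -> R) : measurable_fun W h -> measurable_fun W k ->
    measurable_fun W (fun x => (`|h x - k x| `^ p)%:E).
  by move=> mh mk; apply/measurable_EFinP; apply: measurable_powR_abs; exact: measurable_funB.
rewrite -ge0_integralD//; [|exact: mP|exact: mP].
rewrite -ge0_integralZl_EFin ?powR_ge0//; last first.
- by apply: emeasurable_funD; exact: mP.
- by move=> x _; rewrite -EFinD lee_fin addr_ge0 ?powR_ge0.
apply: ge0_le_integral => //.
- exact: mP.
- by apply: emeasurable_funM => //; apply: emeasurable_funD; exact: mP.
move=> x _; rewrite -EFinD -EFinM lee_fin.
apply: le_trans (powR_add_le _ _ p0) => //.
apply: powR_le => //; rewrite -(subrK (u x) (f x)) -addrA (le_trans (ler_normD _ _))//.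
by rewrite subrK lerD2l distrC.
Qed.

Lemma chebyshev_powR (p a : R) (W : set T) (f : T -> R) : (0 < p)%R -> (0 < a)%R -> measurable W ->
  measurable_fun W f ->
  (a `^ p)%:E * mu (W `&` [set x | a <= `|f x|]%R) <= \int[mu]_(x in W) (`|f x| `^ p)%:E.
Proof.
move=> p0 a0 mW mf.
have mfp : measurable_fun W (fun x => (`|f x| `^ p)%:E).
  by apply/measurable_EFinP; exact: measurable_powR_abs.
have := le_integral_abse mu mW mfp (powR_gt0 p a0).
have absE x : `|(`|f x| `^ p)%:E| = (`|f x| `^ p)%:E by rewrite gee0_abs// lee_fin powR_ge0.
rewrite (_ : W `&` _ = W `&` [set x | a <= `|f x|]%R); last first.
  apply/seteqP; split => x [Wx] h; split => //.
    have {}h : (a `^ p)%:E <= (`|f x| `^ p)%:E by rewrite -absE; exact: h.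
    rewrite /= leNgt; apply/negP => h2; move: h; rewrite lee_fin leNgt => /negP; apply.
    by apply: gt0_ltr_powR => //; rewrite nnegrE// ltW.
  change ((a `^ p)%:E <= `|(`|f x| `^ p)%:E|); rewrite absE lee_fin.
  by apply: powR_le; [exact: ltW|exact: ltW|exact: h].
by move=> h; apply: le_trans h _; under eq_integral do rewrite absE.
Qed.

End finite_measure.

Section geometry.
Context {R : realType}.
Local Notation L n := (lebesgue_rV R n).

Lemma hyperplane_null n (i : 'I_n) : L n [set y : 'rV[R]_n | y ord0 i = 0] = 0%E.
Proof.
pose f (j : 'I_n) (t : R) : R := if j == i then \1_[set 0] t else 1.
have mf j : measurable_fun setT (f j).
  by rewrite /f; case: (j == i); [exact: measurable_indic|exact: measurable_cst].
have f0 j t : 0 <= f j t by rewrite /f; case: ifP.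
have := ge0_integral_prod1 mf f0.
have mA : measurable [set y : 'rV[R]_n | y ord0 i = 0].
  by have := measurable_rV_coord i measurableT (measurable_set1 (0 : R)); rewrite setTI.
rewrite (_ : (fun x : 'rV[R]_n => _) = (fun x => (\1_[set y : 'rV[R]_n | y ord0 i = 0] x)%:E)); last first.
  apply/funext => x; congr EFin; rewrite (bigD1 i)//= big1 ?mulr1; last first.
    by move=> j /negbTE ji; rewrite /f ji.
  by rewrite /f eqxx !indicE; congr (_%:R); apply/idP/idP; rewrite !inE.
rewrite integral_indic// setIT => ->; rewrite (bigD1 i)//= [X in (X * _)%E](_ : _ = 0%E) ?mul0e//.
rewrite /f eqxx integral_indic// setIT; exact: lebesgue_measure_set1.
Qed.

Lemma open_lt_fun n (f : 'rV[R]_n -> R) (c : R) : continuous f -> open [set x | f x < c].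
Proof. by move=> cf; apply: (@open_comp _ _ f [set t | t < c]) => [x _|]; [exact: cf|exact: open_lt]. Qed.

Lemma open_gt_fun n (f : 'rV[R]_n -> R) (c : R) : continuous f -> open [set x | c < f x].
Proof. by move=> cf; apply: (@open_comp _ _ f [set t | c < t]) => [x _|]; [exact: cf|exact: open_gt]. Qed.

Lemma closed_ge_fun n (f : 'rV[R]_n -> R) (c : R) : continuous f -> closed [set x | c <= f x].
Proof.
move=> cf; rewrite -[X in closed X]setCK; apply: open_closedC.
rewrite (_ : ~` _ = [set x | f x < c]); first exact: open_lt_fun.
by apply/seteqP; split => x /=; rewrite ltNge => /negP.
Qed.

Lemma half_ballE k (r : \bar R) (l : 'I_k) : val l = k.-1 ->
  half_ball r = [set y : 'rV[R]_k | ((enorm y)%:E < r)%E] `&` [set y | 0 < y ord0 l].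
Proof.
move=> lk; apply/seteqP; split => y [yr yl]; split => //; first exact: yl.
by move=> j jk; rewrite (_ : j = l)//; apply/val_inj; rewrite lk.
Qed.

Lemma open_lt_efun n (f : 'rV[R]_n -> R) (r : \bar R) : continuous f -> open [set y | ((f y)%:E < r)%E].
Proof.
move=> cf; case: r => [r| |].
- rewrite (_ : [set _ | _] = [set y | f y < r]); last by apply/seteqP; split => y; rewrite /= lte_fin.
  exact: open_lt_fun.
- by rewrite (_ : [set _ | _] = setT); [exact: openT|apply/seteqP; split => y //= _; exact: ltry].
- by rewrite (_ : [set _ | _] = set0); [exact: open0|apply/seteqP; split].
Qed.

Lemma coord_continuous_rV k (l : 'I_k) : continuous (fun y : 'rV[R]_k => y ord0 l).
Proof. by apply: smooth_continuous; exact: smooth_coord. Qed.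

Lemma open_half_ball k (r : \bar R) : (0 < k)%N -> open (half_ball r : set 'rV[R]_k).
Proof.
move=> k0; have lk : (k.-1 < k)%N by rewrite prednK.
rewrite (@half_ballE k r (Ordinal lk))//; apply: openI; first exact: open_lt_efun (@continuous_enorm R k).
exact: open_gt_fun (@coord_continuous_rV k _).
Qed.

Lemma enorm_rsubmxE d k (x : 'rV[R]_(d + k)) : enorm (rsubmx x) = Num.sqrt (tail_sq d x).
Proof. by rewrite -enorm_rsubmx sqrtr_sqr ger0_norm ?enorm_ge0. Qed.

Lemma continuous_enorm_rsubmx d k : continuous (fun x : 'rV[R]_(d + k) => enorm (rsubmx x)).
Proof.
move=> x; have -> : (fun x : 'rV[R]_(d + k) => enorm (rsubmx x)) = Num.sqrt \o @tail_sq R d (d + k).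
  by apply/funext => y; rewrite enorm_rsubmxE.
apply: continuous_comp; [exact: (smooth_continuous (smooth_tail_sq _ _))|exact: sqrt_continuous].
Qed.

Lemma OmegaE d k (r : \bar R) (l : 'I_k) : val l = k.-1 ->
  Omega d k r = [set x | ((enorm (rsubmx x))%:E < r)%E] `&` [set x | 0 < x ord0 (rshift d l)].
Proof.
move=> lk; rewrite /Omega (half_ballE _ lk).
by apply/seteqP; split => x [h1 h2]; split => //; move: h2; rewrite /= mxE.
Qed.

Lemma open_Omega d k (r : \bar R) : (0 < k)%N -> open (@Omega R d k r).
Proof.
move=> k0; have lk : (k.-1 < k)%N by rewrite (prednK k0).
rewrite (@OmegaE d k r (Ordinal lk))//; apply: openI.
  exact: open_lt_efun (@continuous_enorm_rsubmx d k).
exact: open_gt_fun (@coord_continuous_rV _ _).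
Qed.

Lemma measurable_topo_boundary n (U : set 'rV[R]_n) : measurable (topo_boundary U).
Proof.
apply: measurableD; first by apply: closed_measurable_rV; exact: closed_closure.
by apply: open_measurable_rV; exact: open_interior.
Qed.

Lemma enorm_snoc_le n (y : 'rV[R]_n.-1) t : (0 < n)%N -> enorm (snoc_rV y t : 'rV[R]_n) <= enorm y + `|t|.
Proof.
move=> n0; rewrite -(@ler_pXn2r _ 2) ?nnegrE ?addr_ge0 ?enorm_ge0// -tail_sq0 tail_sq_snoc_pred//.
by rewrite tail_sq0 sqrrD real_normK ?num_real// lerD2r lerDl mulrn_wge0// mulr_ge0// enorm_ge0.
Qed.

End geometry.

Section trace_unique.
Context {R : realType} (d k : nat) (r : \bar R) (p : R).
Hypotheses (k2 : (1 < k)%N) (r0 : (0 < r)%E) (p1 : 1 < p).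
Local Notation n := (d + k)%N.
Local Notation L n := (lebesgue_rV R n).
Local Notation Om := (Omega d k r).
Local Notation base := (@surface_base R d k r).
Local Notation S := (@surface R d k r k2).
Local Notation sheet := (@sheet R d k r).
Implicit Types (psi : 'rV[R]_n.-1 -> R) (y : 'rV[R]_n.-1).

Let k0 : (0 < k)%N. Proof. exact: ltnW. Qed.
Let n0 : (0 < d + k)%N. Proof. by rewrite addn_gt0 k0 orbT. Qed.
Let dn : (d < d + k)%N. Proof. by rewrite -[ltnLHS]addn0 ltn_add2l k0. Qed.
Let ln : (n.-1 < n)%N. Proof. by rewrite (prednK n0). Qed.
Let p0 : 0 <= p. Proof. exact: ltW (lt_trans ltr01 p1). Qed.
Let last_i : 'I_n := Ordinal ln.

(** An exhaustion of the base, up to the null set [y' = 0], over which both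
    sheets are reached by vertical segments of length [e] inside [zone e]. *)
Definition good_base (e : R) : set 'rV[R]_n.-1 :=
  [set y | [/\ e < flat_radius y, ((flat_radius y + 2 * e)%:E < r)%E & enorm y < e^-1]].

Definition zone_bound (e : R) : R := e^-1 + e + fine r.

(** A bounded open set away from [Gamma]: the definition of a trace off [Gamma]
    applies to it. *)
Definition zone (e : R) : set 'rV[R]_n :=
  [set x | enorm x < zone_bound e] `&` [set x | e / 2 < enorm (rsubmx x)].

Lemma open_zone e : open (zone e).
Proof.
apply: openI; first exact: open_lt_fun (@continuous_enorm R n).
exact: open_gt_fun (@continuous_enorm_rsubmx R d k).
Qed.

Lemma closure_zone e : 0 < e -> closure (zone e) `&` Gamma d k = set0.
Proof.
move=> e0; apply/seteqP; split => // x [xc]; rewrite /Gamma /= => x0.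
have : [set x : 'rV[R]_n | e / 2 <= enorm (rsubmx x)] x.
  have /closure_id -> := @closed_ge_fun R _ _ (e / 2) (@continuous_enorm_rsubmx R d k).
  by apply: closureS xc => z [_ /ltW].
by rewrite /= x0 enorm0 leNgt divr_gt0.
Qed.

Lemma measurable_good_base e : measurable (good_base e).
Proof.
have mf : measurable_fun setT (@flat_radius R d k) := @measurable_flat_radius R d k k2.
rewrite (_ : good_base e = ([set y | e < flat_radius y] `&` [set y | ((flat_radius y + 2 * e)%:E < r)%E]) `&`
   [set y | enorm y < e^-1]); last by apply/seteqP; split => y; [move=> [? ? ?]; split|move=> [[? ?] ?]; split].
apply: measurableI; last by apply: open_measurable_rV; exact: open_lt_fun (@continuous_enorm R _).
apply: measurableI.
  have := mf measurableT _ (measurable_itv `]e, +oo[); rewrite setTI; congr measurable.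
  by apply/seteqP; split => y; rewrite /= in_itv/= andbT.
have mg : measurable_fun setT (fun y : 'rV[R]_n.-1 => (flat_radius y + 2 * e)%:E).
  by apply/measurable_EFinP; apply: measurable_funD => //; exact: mf.
by have := emeasurable_fun_infty_o measurableT mg r; rewrite setTI.
Qed.

Lemma good_base_base e : 0 < e -> good_base e `<=` base.
Proof.
move=> e0 y [_ yr _]; rewrite /surface_base /=; apply: lt_trans yr.
by rewrite lte_fin ltrDl mulr_gt0.
Qed.

Lemma snoc_Omega y t : 0 < t -> ((Num.sqrt (tail_sq d y + t ^+ 2))%:E < r)%E -> Om (snoc_rV y t).
Proof.
move=> t0 h; have lk : (k.-1 < k)%N by rewrite (prednK k0).
rewrite (@OmegaE R d k r (Ordinal lk))//; split.
  by rewrite /= enorm_rsubmxE tail_sq_snoc_pred.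
rewrite /= snoc_last//= -!subn1 addnBA//.
Qed.

Lemma snoc_zone e y t : 0 < e -> good_base e y -> 0 <= t -> t < e + fine r -> zone e (snoc_rV y t).
Proof.
move=> e0 [ye _ yb] t0 te; split.
  rewrite /= (le_lt_trans (enorm_snoc_le _ _ n0))// ger0_norm// /zone_bound -addrA; exact: ltrD.
rewrite /= enorm_rsubmxE tail_sq_snoc_pred//.
apply: (@lt_le_trans _ _ (flat_radius y)); first by lra.
by rewrite flat_radiusE// ler_sqrt ?lerDl ?sqr_ge0// addr_ge0 ?sqr_ge0 ?tail_sq_ge0.
Qed.

Lemma sqrtD_le (a t : R) : 0 <= a -> 0 <= t -> Num.sqrt (a + t ^+ 2) <= Num.sqrt a + t.
Proof.
move=> a0 t0; rewrite -(@ler_pXn2r _ 2) ?nnegrE ?addr_ge0 ?sqrtr_ge0// sqr_sqrtr ?addr_ge0 ?sqr_ge0//.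
by rewrite sqrrD sqr_sqrtr// lerD2r lerDl mulrn_wge0// mulr_ge0// sqrtr_ge0.
Qed.

(** Upwards from the flat part, downwards from the spherical part. *)
Lemma good_base_segment e psi y : 0 < e -> sheet psi -> good_base e y ->
  [/\ zone e (snoc_rV y (psi y)) &
    exists2 a : R, a <= psi y <= a + e & forall t, a < t < a + e -> (Om `&` zone e) (snoc_rV y t)].
Proof.
move=> e0 sp gy; have [ye yr yb] := gy.
have fr0 : 0 <= fine r by apply: fine_ge0; exact: ltW.
have q0 := tail_sq_ge0 d y.
have fE := flat_radiusE k2 y.
case: sp => [->|[c rc ->]].
  split; first by apply: snoc_zone => //; rewrite ltr_pwDl.
  exists 0 => [|t /andP[t0 te]]; first by rewrite lexx add0r ltW.
  rewrite add0r in te; split; last by apply: snoc_zone; rewrite ?ltW// ltr_wpDr.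
  apply: snoc_Omega => //; apply: le_lt_trans yr; rewrite lee_fin.
  by have := sqrtD_le q0 (ltW t0); rewrite -fE; lra.
have [c0 yc] := base_ball k2 rc (good_base_base e0 gy).
have frc : fine r = c by rewrite rc.
have yr' : flat_radius y + 2 * e < c by move: yr; rewrite rc lte_fin.
have f0 := flat_radius_ge0 y.
have a2 : 2 * e <= @hemisphere R d n.-1 c y.
  rewrite -[leLHS]ger0_norm ?mulr_ge0 ?(ltW e0)// -sqrtr_sqr /hemisphere ler_sqrt ?subr_ge0 ?(ltW yc)//.
  rewrite -(flat_radius_sqr y k0) subr_sqr expr2.
  by apply: ler_pM; rewrite ?mulr_ge0 ?(ltW e0)//; lra.
have h2 : (@hemisphere R d n.-1 c y) ^+ 2 = c ^+ 2 - tail_sq d y by rewrite sqr_sqrtr// subr_ge0 ltW.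
have hc : @hemisphere R d n.-1 c y <= c.
  rewrite -[leRHS]ger0_norm ?(ltW c0)// -sqrtr_sqr /hemisphere ler_sqrt ?sqr_ge0//; lra.
split; first by apply: snoc_zone => //; rewrite ?sqrtr_ge0// frc; lra.
exists (@hemisphere R d n.-1 c y - e) => [|t /andP[t0 te]]; first by lra.
have tp : 0 < t by lra.
have tc : t < @hemisphere R d n.-1 c y by lra.
split; last by apply: snoc_zone => //; [lra|rewrite frc; lra].
apply: snoc_Omega => //; rewrite rc lte_fin -[ltRHS]ger0_norm ?(ltW c0)// -sqrtr_sqr ltr_sqrt ?exprn_gt0//.
have : t ^+ 2 < (@hemisphere R d n.-1 c y) ^+ 2 by rewrite ltr_pXn2r ?nnegrE// ltW// sqrtr_gt0; lra.
by rewrite h2; lra.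
Qed.

Lemma measurable_Om_zone e : measurable (Om `&` zone e).
Proof. by apply: open_measurable_rV; apply: openI; [exact: open_Omega|exact: open_zone]. Qed.

Lemma trace_zone_le e psi (f : 'rV[R]_n -> R) : 0 < e -> sheet psi -> smooth f ->
  (\int[L n.-1]_(y in good_base e) (`|f (snoc_rV y (psi y))|)%:E <=
   (e^-1)%:E * \int[L n]_(x in Om `&` zone e) (`|f x|)%:E +
   \int[L n]_(x in Om `&` zone e) (`|partial last_i f x|)%:E)%E.
Proof.
move=> e0 sp sf; apply: trace_le => //.
- exact: measurable_good_base.
- exact: measurable_Om_zone.
- exact: measurable_sheet sp.
- by move=> y gy; have [] := good_base_segment e0 sp gy.
Qed.

Lemma zone_fin e : (L n (Om `&` zone e) < +oo)%E.
Proof.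
apply: le_lt_trans (@cbox_fin R n (fun=> - zone_bound e) (fun=> zone_bound e)).
apply: le_measure; rewrite ?inE; [exact: measurable_Om_zone|exact: measurable_cbox|].
by move=> x [_ [/= xe _]] i; rewrite -ler_norml (le_trans (coord_le_enorm _ _))// ltW.
Qed.

(** The sets [good_base e] exhaust the base up to the points with [y' = 0], which lie
    in a hyperplane; here [k] is at least two. *)
Lemma base_ae (P : 'rV[R]_n.-1 -> Prop) :
  (forall e, 0 < e -> {ae L n.-1, forall y, good_base e y -> P y}) ->
  {ae L n.-1, forall y, base y -> P y}.
Proof.
move=> H.
have {}H : {ae L n.-1, forall y, forall m : nat, good_base (m.+1%:R^-1) y -> P y}.
  by apply/ae_foralln => m; apply: H.
have n1 : (n.-2 < n.-1)%N by move: k2; case: k => [|[|k']] // _; rewrite !addnS.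
have dn2 : (d <= n.-2)%N by move: k2; case: k => [|[|k']] // _; rewrite !addnS /= leq_addr.
have Hnull : {ae L n.-1, forall y, y ord0 (Ordinal n1) != 0}.
  exists [set y : 'rV[R]_n.-1 | y ord0 (Ordinal n1) = 0]; split.
  - by have := measurable_rV_coord (Ordinal n1) measurableT (measurable_set1 (0 : R)); rewrite setTI.
  - exact: hyperplane_null.
  - by move=> y /= /negP; rewrite negbK => /eqP.
move: H Hnull; apply: filterS2 => y Hy y0 yb.
have f0 : 0 < flat_radius y.
  rewrite (flat_radiusE k2) sqrtr_gt0 /tail_sq (bigD1 (Ordinal n1))//= dn2 -expr2.
  apply: ltr_pwDl; first by rewrite lt_neqAle sqr_ge0 andbT eq_sym expf_neq0.
  by apply: sumr_ge0 => i _; case: ifP => // _; rewrite -expr2 sqr_ge0.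
have [e e0 He] : exists2 e : R, 0 < e & forall e', 0 < e' -> e' <= e -> good_base e' y.
  have [m m0 mr] : exists2 m : R, 0 < m & ((flat_radius y + m)%:E <= r)%E.
    move: yb; rewrite /surface_base /=; case: (r) => [c| |] //.
      by rewrite lte_fin => yc; exists (c - flat_radius y); rewrite ?subr_gt0// subrKC.
    by move=> _; exists 1 => //; exact: leey.
  pose e := Num.min (flat_radius y / 2) (Num.min (m / 4) (enorm y + 1)^-1).
  have en0 : 0 < (enorm y + 1)^-1 by rewrite invr_gt0 ltr_wpDl ?enorm_ge0.
  exists e; first by rewrite !lt_min !divr_gt0.
  move=> e' e'0; rewrite !le_min => /and3P[h1 h2 h3]; split.
  - by lra.
  - by apply: lt_le_trans mr; rewrite lte_fin; lra.
  - have : (enorm y + 1)^-1^-1 <= e'^-1 by rewrite lef_pV2.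
    by rewrite invrK; lra.
apply: (Hy (Num.truncn e^-1)); apply: He => //.
rewrite -[leRHS]invrK lef_pV2 ?posrE ?invr_gt0// ltW//; exact: truncnS_gt.
Qed.

(** The trace inequality in the form of continuity: functions small in the Sobolev
    norm on [zone e] are small in L^1 on the boundary. *)
Lemma zone_trace_small e psi : 0 < e -> sheet psi -> forall eta : R, 0 < eta ->
  exists2 eps : R, 0 < eps & forall f : 'rV[R]_n -> R, smooth f ->
  (\int[L n]_(x in Om `&` zone e) (`|f x| `^ p)%:E <= eps%:E)%E ->
  (\int[L n]_(x in Om `&` zone e) (`|partial last_i f x| `^ p)%:E <= eps%:E)%E ->
  (\int[L n.-1]_(y in good_base e) (`|f (snoc_rV y (psi y))|)%:E <= eta%:E)%E.
Proof.
move=> e0 sp eta eta0; pose t := eta / (e^-1 + 1).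
have e10 : 0 < e^-1 + 1 by rewrite addr_gt0 ?invr_gt0.
have t0 : 0 < t by rewrite divr_gt0.
have [eps eps0 H] := @Lp_L1_small _ _ _ (L n) p _ p1 (measurable_Om_zone e) (zone_fin e) t t0.
exists eps => // f sf If Igf; apply: le_trans (trace_zone_le e0 sp sf) _.
have mf (g : 'rV[R]_n -> R) : smooth g -> measurable_fun (Om `&` zone e) g.
  by move=> sg; apply: measurable_funTS; apply: continuous_measurable_rV; exact: smooth_continuous.
apply: (@le_trans _ _ ((e^-1)%:E * t%:E + t%:E)%E).
  apply: leeD; last by apply: H => //; apply: mf; exact: smooth_partial.
  by apply: lee_wpmul2l; [rewrite lee_fin invr_ge0 ltW|apply: H => //; exact: mf].
by rewrite -EFinM -EFinD lee_fin -[X in _ + X]mul1r -mulrDl mulrC divfK// gt_eqF.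
Qed.

Lemma trace_approx K u v V eps : is_trace p (surface_measure d k r) Om K u v ->
  open V -> (exists M : R, forall x, V x -> enorm x <= M) -> closure V `&` K = set0 -> 0 < eps ->
  exists f : 'rV[R]_n -> R, [/\ smooth f,
    (\int[L n]_(x in Om `&` V) (`|f x - u x| `^ p)%:E <= eps%:E)%E,
    (\int[L n]_(x in Om `&` V) (enorm (gradient f x - weak_gradient Om u x) `^ p)%:E <= eps%:E)%E &
    (\int[S]_(x in topo_boundary Om `&` V) (`|f x - v x| `^ p)%:E <= eps%:E)%E].
Proof.
move=> [_ H] oV bV VK eps0; have [f [sf f1 f2 f3]] := H V oV bV VK.
have lt0 (F : nat -> \bar R) : F @ \oo --> 0%E -> \forall j \near \oo, (F j <= eps%:E)%E.
  move=> cF; have : nbhs (0%E : \bar R) [set x | (x < eps%:E)%E].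
    by apply: open_nbhs_nbhs; split; [exact: open_ereal_lt_ereal|rewrite /= lte_fin].
  move=> nF; have {nF} h : \forall j \near \oo, (F j < eps%:E)%E := cF _ nF.
  by apply: filterS h => j /ltW.
have [j [[h1 h2] h3]] := filter_ex (filterI (filterI (lt0 _ f1) (lt0 _ f2)) (lt0 _ f3)).
by exists (f j); split.
Qed.

Lemma partial_le_gradient (f : 'rV[R]_n -> R) (G : 'rV[R]_n -> 'rV[R]_n) (i : 'I_n) x :
  `|partial i f x - G x ord0 i| `^ p <= enorm (gradient f x - G x) `^ p.
Proof.
apply: powR_le; [exact: p0|exact: normr_ge0|].
by have := coord_le_enorm (gradient f x - G x) i; rewrite !mxE.
Qed.

(** Two smooth functions close to [u] in Sobolev norm are close to each other, hence
    so are their boundary values in L^1; each of them is close to its trace in L^p.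
    So the set where the traces differ by [eta] has arbitrarily small measure. *)
Lemma trace_unique u v1 v2 : (exists G, is_weak_gradient Om u G) ->
  is_trace p (surface_measure d k r) Om (Gamma d k) u v1 ->
  is_trace p (surface_measure d k r) Om (Gamma d k) u v2 ->
  {ae S, forall x, topo_boundary Om x -> v1 x = v2 x}.
Proof.
move=> uG T1 T2; have [Lu HG] := weak_gradientP uG.
pose B := topo_boundary Om; have mB : measurable B by exact: measurable_topo_boundary.
have mv1 : measurable_fun B v1 by case: T1.
have mv2 : measurable_fun B v2 by case: T2.
apply: ae_surface => psi sp; apply: base_ae => e e0.
have mpsi := measurable_sheet sp; have mD := measurable_good_base e.
have mgr := measurable_graph_map n0 mpsi.
have gz y : good_base e y -> zone e (snoc_rV y (psi y)) by move=> /(good_base_segment e0 sp)[].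
have mBV : measurable (B `&` zone e) by apply: measurableI => //; apply: open_measurable_rV; exact: open_zone.
have sub1 (v : 'rV[R]_n -> R) : measurable_fun B v -> measurable_fun (B `&` zone e) v.
  by move=> mv; apply: measurable_funS mv => //; exact: subIsetl.
have mfB (f : 'rV[R]_n -> R) (D : set 'rV[R]_n) : smooth f -> measurable_fun D f.
  by move=> sf; apply: measurable_funTS; apply: continuous_measurable_rV; exact: smooth_continuous.
pose E eta := [set y | good_base e y /\ (B `&` [set x | eta <= `|v1 x - v2 x|]) (snoc_rV y (psi y))].
have mset (f g : 'rV[R]_n -> R) eta (D : set 'rV[R]_n) : measurable D ->
    measurable_fun D f -> measurable_fun D g -> measurable (D `&` [set x | eta <= `|f x - g x|]).
  move=> mD' mf mg; have mh : measurable_fun D (fun x => `|f x - g x|).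
    by apply: measurableT_comp => //; exact: measurable_funB.
  have := mh mD' _ (measurable_itv `[eta, +oo[); congr measurable.
  by apply/seteqP; split => x /= [Dx]; rewrite in_itv/= andbT.
have mgE (X : set 'rV[R]_n) : measurable X -> measurable [set y | good_base e y /\ X (snoc_rV y (psi y))].
  by move=> mX; have := (measurable_funTS mgr : measurable_fun (good_base e) _) mD X mX.
have mE eta : measurable (E eta) by apply: mgE; exact: mset.
have E0 eta : 0 < eta -> L n.-1 (E eta) = 0%E.
  move=> eta0; apply/eqP; rewrite eq_le measure_ge0 andbT; apply/lee_addgt0Pr => t t0; rewrite add0e.
  (* If [v1] and [v2] differ by [eta] at a point, one of the three differences
     [f1 - v1], [f1 - f2], [f2 - v2] is at least [eta / 3] there. *)
  pose a := eta / 3; have a0 : 0 < a by rewrite divr_gt0.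
  have at0 : 0 < a * (t / 3) by rewrite mulr_gt0// divr_gt0.
  have [eps eps0 Heps] := zone_trace_small e0 sp at0.
  pose del := Num.min (eps / (2 `^ p * 2)) (a `^ p * (t / 3)).
  have c0 : 0 < 2 `^ p * 2 :> R by rewrite mulr_gt0 ?powR_gt0.
  have del0 : 0 < del by rewrite lt_min divr_gt0//= mulr_gt0 ?powR_gt0 ?divr_gt0.
  have bz : exists M : R, forall x, zone e x -> enorm x <= M.
    by exists (zone_bound e) => x [/ltW].
  have [f1 [sf1 I1 J1 K1]] := trace_approx T1 (@open_zone e) bz (closure_zone e0) del0.
  have [f2 [sf2 I2 J2 K2]] := trace_approx T2 (@open_zone e) bz (closure_zone e0) del0.
  have sf : smooth (fun x => f1 x - f2 x) by exact: smoothB.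
  have mOz := measurable_Om_zone e.
  have dle : ((2 `^ p)%:E * (del%:E + del%:E) <= eps%:E)%E.
    rewrite -EFinD -EFinM lee_fin; have : del <= eps / (2 `^ p * 2) by rewrite ge_min lexx.
    by rewrite ler_pdivlMr//; lra.
  have small (g1 g2 w : 'rV[R]_n -> R) : measurable_fun (Om `&` zone e) g1 -> measurable_fun (Om `&` zone e) g2 ->
     measurable_fun (Om `&` zone e) w ->
     (\int[L n]_(x in Om `&` zone e) (`|g1 x - w x| `^ p)%:E <= del%:E)%E ->
     (\int[L n]_(x in Om `&` zone e) (`|g2 x - w x| `^ p)%:E <= del%:E)%E ->
     (\int[L n]_(x in Om `&` zone e) (`|g1 x - g2 x| `^ p)%:E <= eps%:E)%E.
    move=> m1 m2 m3 h1 h2; apply: le_trans dle.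
    apply: le_trans (Lp_dist_le (L n) (u := w) p0 mOz m1 m2 m3) _.
    by apply: lee_wpmul2l; [rewrite lee_fin powR_ge0|exact: leeD].
  have mOm : measurable Om by apply: open_measurable_rV; exact: open_Omega.
  have mu' : measurable_fun (Om `&` zone e) u by case: Lu => mu' _; apply: measurable_funS mu' => //; exact: subIsetl.
  have mG i : measurable_fun (Om `&` zone e) (fun x => weak_gradient Om u x ord0 i).
    by have [[mG _] _] := HG i; apply: measurable_funS mG => //; exact: subIsetl.
  have grle (f : 'rV[R]_n -> R) i : smooth f ->
     (\int[L n]_(x in Om `&` zone e) (enorm (gradient f x - weak_gradient Om u x) `^ p)%:E <= del%:E)%E ->
     (\int[L n]_(x in Om `&` zone e) (`|partial i f x - weak_gradient Om u x ord0 i| `^ p)%:E <= del%:E)%E.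
    move=> sf'; apply: le_trans; apply: ge0_le_integral => //.
    - apply/measurable_EFinP; apply: measurable_powR_abs; apply: measurable_funB => //.
      by apply: mfB; exact: smooth_partial.
    - apply/measurable_EFinP.
      rewrite (_ : (fun x => _) = (fun x => `|enorm (gradient f x - weak_gradient Om u x)| `^ p)); last first.
        by apply/funext => x; rewrite ger0_norm ?enorm_ge0.
      apply: measurable_powR_abs; apply: measurable_enorm => j.
      under eq_fun do rewrite !mxE; apply: measurable_funB => //.
      by apply: mfB; exact: smooth_partial.
    - by move=> x _; rewrite lee_fin; exact: partial_le_gradient.
  have mid : (\int[L n.-1]_(y in good_base e) (`|f1 (snoc_rV y (psi y)) - f2 (snoc_rV y (psi y))|)%:E <= (a * (t / 3))%:E)%E.
    apply: (Heps _ sf).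
      exact: (small f1 f2 u (mfB _ _ sf1) (mfB _ _ sf2) mu' I1 I2).
    rewrite (eq_integral (fun x => (`|partial last_i f1 x - partial last_i f2 x| `^ p)%:E)).
      exact: (small (partial last_i f1) (partial last_i f2) (fun x => weak_gradient Om u x ord0 last_i)
        (mfB _ _ (smooth_partial last_i sf1)) (mfB _ _ (smooth_partial last_i sf2)) (mG last_i)
        (grle f1 last_i sf1 J1) (grle f2 last_i sf2 J2)).
    by move=> x _; rewrite partialB.
  pose Y (f v : 'rV[R]_n -> R) := [set y | good_base e y /\ (B `&` zone e `&` [set x | a <= `|f x - v x|]) (snoc_rV y (psi y))].
  have bd (f v : 'rV[R]_n -> R) : smooth f -> measurable_fun B v ->
      (\int[S]_(x in B `&` zone e) (`|f x - v x| `^ p)%:E <= del%:E)%E ->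
      (L n.-1 (Y f v) <= (t / 3)%:E)%E.
    move=> sf' mv Kf; have mX : measurable (B `&` zone e `&` [set x | a <= `|f x - v x|]).
      by apply: mset => //; [exact: mfB|exact: sub1].
    apply: (@le_trans _ _ (S (B `&` zone e `&` [set x | a <= `|f x - v x|]))).
      apply: le_trans (base_le_surface k2 sp mX); apply: le_measure; rewrite ?inE.
      - exact: mgE.
      - exact: (measurable_sheet_preimage k2 sp mX).
      - by move=> y [gy Xy]; split => //; exact: good_base_base gy.
    have pp : 0 < p := lt_trans ltr01 p1.
    have := chebyshev_powR S pp a0 mBV (measurable_funB (mfB f _ sf') (sub1 _ mv)).
    move=> /le_trans/(_ Kf); rewrite muleC -lee_pdivlMr ?powR_gt0// => h; apply: le_trans h _.
    rewrite -EFinM lee_fin ler_pdivrMr ?powR_gt0// mulrC; by rewrite ge_min lexx orbT.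
  pose X1 := [set y | good_base e y /\ (B `&` zone e `&` [set x | a <= `|f1 x - v1 x|]) (snoc_rV y (psi y))].
  pose X2 := [set y | good_base e y /\ (B `&` zone e `&` [set x | a <= `|f2 x - v2 x|]) (snoc_rV y (psi y))].
  pose X3 := [set y | good_base e y /\ [set x | a <= `|f1 x - f2 x|] (snoc_rV y (psi y))].
  have mX1 : measurable X1 by apply: mgE; apply: mset => //; [exact: mfB|exact: sub1].
  have mX2 : measurable X2 by apply: mgE; apply: mset => //; [exact: mfB|exact: sub1].
  have mX3 : measurable X3.
    apply: mgE; have := @mset f1 f2 a setT measurableT (mfB _ _ sf1) (mfB _ _ sf2); by rewrite setTI.
  have L3 : (L n.-1 X3 <= (t / 3)%:E)%E.
    have mg3 : measurable_fun (good_base e) (fun y => (f1 (snoc_rV y (psi y)) - f2 (snoc_rV y (psi y)))%:E).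
      apply/measurable_EFinP; apply: measurable_funTS.
      by apply: (measurableT_comp (f := fun x => f1 x - f2 x)); [exact: mfB|].
    have := le_integral_abse (L n.-1) mD mg3 a0.
    have -> : good_base e `&` [set x | (a%:E <= `|(f1 (snoc_rV x (psi x)) - f2 (snoc_rV x (psi x)))%:E|)%E] = X3.
      by apply/seteqP; split => y [gy h]; split.
    move=> /le_trans/(_ mid); rewrite muleC -lee_pdivlMr// => h; apply: le_trans h _.
    by rewrite -EFinM lee_fin mulrAC mulfV ?mul1r// gt_eqF.
  apply: (@le_trans _ _ (L n.-1 ((X1 `|` X2) `|` X3))).
    apply: le_measure; rewrite ?inE//; first by apply: measurableU => //; exact: measurableU.
    move=> y [gy [By hy]]; have zy := gz y gy.
    have [h1|h1] := leP a `|f1 (snoc_rV y (psi y)) - v1 (snoc_rV y (psi y))|; first by left; left.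
    have [h2|h2] := leP a `|f2 (snoc_rV y (psi y)) - v2 (snoc_rV y (psi y))|; first by left; right.
    right; split => //=; rewrite leNgt; apply/negP => h3; move: hy; rewrite /= leNgt => /negP; apply.
    rewrite (_ : _ - _ = - (f1 (snoc_rV y (psi y)) - v1 (snoc_rV y (psi y))) +
      (f1 (snoc_rV y (psi y)) - f2 (snoc_rV y (psi y))) + (f2 (snoc_rV y (psi y)) - v2 (snoc_rV y (psi y)))); last by ring.
    rewrite (le_lt_trans (ler_normD _ _))// (@le_lt_trans _ _ (`|f1 (snoc_rV y (psi y)) - v1 (snoc_rV y (psi y))| + `|f1 (snoc_rV y (psi y)) - f2 (snoc_rV y (psi y))| + `|f2 (snoc_rV y (psi y)) - v2 (snoc_rV y (psi y))|))//.
      by rewrite lerD2r (le_trans (ler_normD _ _))// normrN.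
    have -> : eta = a + a + a by rewrite /a; field.
    by rewrite !ltrD.
  apply: (@le_trans _ _ ((t / 3)%:E + (t / 3)%:E + (t / 3)%:E)%E).
    apply: le_trans (measureU2 _ _ _) _ => //; first exact: measurableU.
    apply: leeD => //; apply: le_trans (measureU2 _ _ _) _ => //.
    by apply: leeD; exact: bd.
  by rewrite -!EFinD lee_fin le_eqVlt; apply/orP; left; apply/eqP; field.
have H : {ae L n.-1, forall y, forall m : nat, ~ E (m.+1%:R^-1) y}.
  apply/ae_foralln => m; exists (E (m.+1%:R^-1)); split => //; first by apply: E0; rewrite invr_gt0.
  by move=> y /= /contrapT.
apply: filterS H => y Hy gy By; apply: contrapT => /eqP; rewrite -subr_eq0 -normr_gt0 => h.
apply: (Hy (Num.truncn (`|v1 (snoc_rV y (psi y)) - v2 (snoc_rV y (psi y))|^-1))); split => //; split => //=.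
by rewrite -[leRHS]invrK lef_pV2 ?posrE ?invr_gt0// ltW//; exact: truncnS_gt.
Qed.

End trace_unique.

(** * Existence of traces *)

Section approximation.
Context {R : realType} (d k : nat) (r : \bar R) (p : R).
Hypotheses (k2 : (1 < k)%N) (r0 : (0 < r)%E) (p1 : 1 < p).
Local Notation n := (d + k)%N.
Local Notation L := (lebesgue_rV R n).
Local Notation Om := (Omega d k r).

Let k0 : (0 < k)%N. Proof. exact: ltnW. Qed.
Let n0 : (0 < d + k)%N. Proof. by rewrite addn_gt0 k0 orbT. Qed.
Let p0 : 0 < p. Proof. exact: lt_trans ltr01 p1. Qed.
Let lk : (k.-1 < k)%N. Proof. by rewrite (prednK k0). Qed.

Definition eball (m : R) : set 'rV[R]_n := [set x | enorm x < m].

Lemma open_Om_eball m : open (Om `&` eball m).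
Proof. by apply: openI; [exact: open_Omega|exact: open_lt_fun (@continuous_enorm R n)]. Qed.

Lemma measurable_Om_eball m : measurable (Om `&` eball m).
Proof. by apply: open_measurable_rV; exact: open_Om_eball. Qed.

Lemma Om_eball_fin m : (L (Om `&` eball m) < +oo)%E.
Proof.
apply: le_lt_trans (@cbox_fin R n (fun=> - m) (fun=> m)).
apply: le_measure; rewrite ?inE; [exact: measurable_Om_eball|exact: measurable_cbox|].
by move=> x [_ /= xe] i; rewrite -ler_norml (le_trans (coord_le_enorm _ _))// ltW.
Qed.

Lemma Lp_fin_integrable (V : set 'rV[R]_n) (f : 'rV[R]_n -> R) : measurable V -> (L V < +oo)%E ->
  measurable_fun V f -> (\int[L]_(x in V) (`|f x| `^ p)%:E < +oo)%E ->
  L.-integrable setT (EFin \o (f \_ V)) /\ (\int[L]_x (`|(f \_ V) x| `^ p)%:E < +oo)%E.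
Proof.
move=> mV Vfin mf If; split; last first.
  rewrite (@integral_support _ _ _ L setT V)//.
    by apply: le_lt_trans If; rewrite le_eqVlt; apply/orP; left; apply/eqP; apply: eq_integral => x xV; rewrite patchE xV.
  by move=> x _ nV; rewrite patchE memNset// normr0 powR0// gt_eqF.
rewrite -restrict_EFin; apply/integrable_restrict => //=; rewrite setTI.
have mfp : measurable_fun V (fun x => (`|f x| `^ p)%:E).
  by apply/measurable_EFinP; exact: measurable_powR_abs.
apply/integrableP; split; first exact/measurable_EFinP.
apply: (@le_lt_trans _ _ (\int[L]_(x in V) (cst 1%E x + (`|f x| `^ p)%:E))%E).
  apply: ge0_le_integral => //.
  - by apply/measurable_EFinP; exact: measurableT_comp.
  - by apply: emeasurable_funD => //; exact: measurable_cst.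
  move=> x _; rewrite /= -EFinD lee_fin; have [h|h] := leP `|f x| 1.
    by rewrite (le_trans h)// lerDl powR_ge0.
  rewrite -[leLHS]add0r lerD//; rewrite -[leLHS]powRr1//; apply: ler_powR; [exact: ltW|exact: ltW].
rewrite ge0_integralD//.
by rewrite integral_cst// mul1e; exact: lte_add_pinfty.
Qed.

Lemma convol_bound (a b : 'I_n -> R) e (h : 'rV[R]_n -> R) M x : 0 < e -> 0 <= M ->
  L.-integrable setT (EFin \o h) -> {ae L, forall w, `|h w| <= M} ->
  `|convol a b h (rho e) x| <= M.
Proof.
move=> e0 M0 Ih hM; have tr := test_rho (n := n) e0.
have mh : measurable_fun setT h by case/integrableP : Ih => /measurable_EFinP.
have mr : measurable_fun setT (fun w : 'rV[R]_n => rho e (w - aff a b x)).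
  by apply: (measurableT_comp (measurable_rho e0)); exact: measurable_shift.
have Ihr := convol_integrable (aff a b x) Ih tr.
apply: le_trans (le_normr_Rintegral _ _) _ => //.
rewrite -lee_fin /Rintegral fineK; last first.
  by apply: integrable_fin_num => //; exact: (integrable_norm (f := fun w => h w * rho e (w - aff a b x))).
apply: (@le_trans _ _ (\int[L]_w (M * rho e (w - aff a b x))%:E)%E).
  apply: ae_ge0_le_integral => //.
  - by apply/measurable_EFinP; apply: measurableT_comp => //; exact: measurable_funM.
  - by move=> w _; rewrite lee_fin mulr_ge0 ?rho_ge0.
  - by apply/measurable_EFinP; exact: measurable_funM.
  by apply: filterS hM => w hw _; rewrite lee_fin normrM [X in _ * X]ger0_norm ?rho_ge0// ler_wpM2r ?rho_ge0.
under eq_integral do rewrite EFinM.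
rewrite ge0_integralZl_EFin//; last exact/measurable_EFinP.
  by rewrite integral_rho_w// mule1.
by move=> w _; rewrite lee_fin rho_ge0.
Qed.

(** The center of contraction is at height [c], at distance [m] or more from the
    spherical part. *)
Lemma interior_margin : exists c m : R, [/\ 0 < c <= 1, 0 < m <= 1 & ((c + m)%:E <= r)%E].
Proof.
move: r0; case: (r) => [c| |] //; last by exists 1, 1; rewrite !lexx !ltr01 leey.
rewrite lte_fin => c0; pose t := Num.min (c / 2) 1.
have t0 : 0 < t by rewrite lt_min divr_gt0/=.
have t1 : t <= 1 by rewrite ge_min lexx orbT.
have tc : t <= c / 2 by rewrite ge_min lexx.
by exists t, t; split; [rewrite t0|rewrite t0|rewrite lee_fin; lra].
Qed.

(** The affine map that pushes [Om] into itself contracts [x'] towards a point on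
    the axis of the half ball.  It moves points away from the flat part and from
    the spherical part at once, so that mollifying after it needs no extension of
    [u] across the boundary and no partition of unity. *)
Definition push_a (s : R) (i : 'I_n) : R := if (i < d)%N then 1 else 1 - s.
Definition push_b (t : R) (i : 'I_n) : R := if i == n.-1 :> nat then t else 0.

(** After the push with parameter [s], points have distance of order [s] from the
    boundary, so mollification at a scale [e] small with respect to [s] stays inside
    [Om]. *)
Lemma push_in (s c m e : R) (x w : 'rV[R]_n) : 0 < s -> s <= 2^-1 -> 0 < c -> 0 < m ->
  ((c + m)%:E <= r)%E -> 0 < e -> e < s * c -> n%:R * e < s * m ->
  Om x -> (forall i, `|w ord0 i - aff (push_a s) (push_b (s * c)) x ord0 i| <= e) -> Om w.
Proof.
move=> s0 s2 c0 m0 cmr e0 esc nem.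
rewrite (@OmegaE R d k r (Ordinal lk))// => -[/= xr xl] Hw.
have sc0 : 0 < s * c by rewrite mulr_gt0.
have last_n (j : 'I_k) : (rshift d j == n.-1 :> nat) = (j == k.-1 :> nat).
  have -> : n.-1 = (d + k.-1)%N by rewrite -!subn1 addnBA.
  by rewrite eqn_add2l.
split => /=.
  pose v : 'rV[R]_k := \row_j (if j == k.-1 :> nat then s * c else 0).
  pose z : 'rV[R]_k := \row_j (w ord0 (rshift d j) - aff (push_a s) (push_b (s * c)) x ord0 (rshift d j)).
  have wE : rsubmx w = (1 - s) *: rsubmx x + v + z.
    apply/rowP => j; rewrite !mxE /push_a /push_b last_n ltnNge leq_addr /= !(ord1 ord0); exact/esym/subrKC.
  have vn : enorm v = s * c.
    rewrite /enorm /dotrV (bigD1 (Ordinal lk))//= big1 => [|j jl].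
      by rewrite !mxE eqxx addr0 -expr2 sqrtr_sqr ger0_norm// ltW.
    rewrite !mxE ifF ?mulr0//; apply/negbTE; apply: contra jl => /eqP jl.
    by apply/eqP/val_inj.
  have zn : enorm z <= n%:R * e.
    apply: le_trans (enorm_le_max (ltW e0) _) _ => [j|]; first by rewrite mxE.
    by rewrite ler_wpM2r ?(ltW e0)// ler_nat leq_addl.
  have s1 : 0 <= 1 - s by lra.
  have nw : enorm (rsubmx w) <= (1 - s) * enorm (rsubmx x) + s * c + n%:R * e.
    rewrite wE; apply: le_trans (enorm_triangle _ _) _; apply: lerD => //.
    by apply: le_trans (enorm_triangle _ _) _; rewrite enormZ ger0_norm// vn.
  move: xr cmr; case: (r) => [q| |] //; last by move=> _ _; exact: ltry.
  rewrite !lte_fin lee_fin => xq cq; apply: le_lt_trans nw _.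
  have h1 : (1 - s) * enorm (rsubmx x) <= (1 - s) * q by rewrite ler_wpM2l// ltW.
  have h2 : s * c + s * m <= s * q by rewrite -mulrDr ler_wpM2l// ltW.
  lra.
have := Hw (rshift d (Ordinal lk)); rewrite mxE /push_a /push_b last_n eqxx ltnNge leq_addr /=.
rewrite ler_norml => /andP[h _].
have : 0 <= (1 - s) * x ord0 (rshift d (Ordinal lk)) by rewrite mulr_ge0 ?(ltW xl)//; lra.
lra.
Qed.

Lemma push_close (s c m : R) (x : 'rV[R]_n) i : 0 < s -> 0 < c -> c <= 1 -> enorm x < m ->
  `|aff (push_a s) (push_b (s * c)) x ord0 i - x ord0 i| < s * (m + 1).
Proof.
move=> s0 c0 c1 xm; rewrite mxE /push_a /push_b.
have xi : `|x ord0 i| < m by apply: le_lt_trans (coord_le_enorm _ _) xm.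
have m0 : 0 < m by apply: le_lt_trans xm; exact: enorm_ge0.
have sc : s * c <= s by rewrite ger_pMr.
have sx : s * `|x ord0 i| < s * m by rewrite ltr_pM2l.
have sm0 : 0 < s * m by rewrite mulr_gt0.
have sc0 : 0 < s * c by rewrite mulr_gt0.
rewrite mulrDr mulr1; case: ifP => _; case: ifP => _.
- by rewrite mul1r addrAC subrr add0r ger0_norm ?(ltW sc0)//; lra.
- by rewrite mul1r addr0 subrr normr0; lra.
- rewrite (_ : _ - _ = - (s * x ord0 i) + s * c); last by ring.
  rewrite (le_lt_trans (ler_normD _ _))// normrN normrM (gtr0_norm s0) (gtr0_norm sc0); lra.
- rewrite (_ : _ - _ = - (s * x ord0 i)); last by ring.
  by rewrite normrN normrM (gtr0_norm s0); lra.
Qed.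

Lemma fin_min_pos (P : 'I_n -> R -> Prop) :
  (forall i, exists2 t : R, 0 < t & forall s, 0 < s -> s <= t -> P i s) ->
  exists2 t : R, 0 < t & forall s, 0 < s -> s <= t -> forall i, P i s.
Proof.
move=> H; have {}H i : exists t : R, 0 < t /\ forall s, 0 < s -> s <= t -> P i s.
  by have [t t0 Ht] := H i; exists t.
have [t Ht] := choice H.
exists (\big[Num.min/1]_i t i); first by apply: lt_bigmin => // i _; case: (Ht i).
move=> s s0 st i; have [_] := Ht i; apply => //; apply: le_trans st _; exact: bigmin_le.
Qed.

(** Mollify, then compose with the push. Convergence in L^p of the function and
    of each partial derivative is [moll_approx], applied to the restrictions to
    a slightly larger ball; averaging preserves the bound [M]. *)
Lemma smooth_approx u G M m eps : is_weak_gradient Om u G -> 0 <= M ->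
  {ae L, forall x, Om x -> `|u x| <= M} ->
  (forall m', (\int[L]_(x in Om `&` eball m') (`|u x| `^ p)%:E < +oo)%E) ->
  (forall m' i, (\int[L]_(x in Om `&` eball m') (`|G x ord0 i| `^ p)%:E < +oo)%E) ->
  0 < m -> 0 < eps ->
  exists f : 'rV[R]_n -> R, [/\ smooth f, forall x, `|f x| <= M,
    (\int[L]_(x in Om `&` eball m) (`|f x - u x| `^ p)%:E <= eps%:E)%E &
    forall i, (\int[L]_(x in Om `&` eball m) (`|partial i f x - G x ord0 i| `^ p)%:E <= eps%:E)%E].
Proof.
move=> HG M0 uM Iu IG m0 eps0.
pose E := Om `&` eball (m + 2); pose V := Om `&` eball m.
have mE : measurable E by exact: measurable_Om_eball.
have mV : measurable V by exact: measurable_Om_eball.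
have VE : V `<=` E by move=> x [Ox xm]; split => //; rewrite /eball /= in xm *; lra.
have mOm : measurable Om by apply: open_measurable_rV; exact: open_Omega.
have mu' : measurable_fun E u by case: HG => -[mu' _] _; apply: measurable_funS mu' => //; exact: subIsetl.
have mG i : measurable_fun E (fun x => G x ord0 i).
  by apply: measurable_funS (weak_grad_measurable i HG) => //; exact: subIsetl.
have [Ih Ihp] := Lp_fin_integrable mE (Om_eball_fin _) mu' (Iu _).
have Hg i := Lp_fin_integrable mE (Om_eball_fin _) (mG i) (IG _ i).
pose eps1 := eps / (2 `^ p * 2).
have c0 : 0 < 2 `^ p * 2 :> R by rewrite mulr_gt0 ?powR_gt0.
have eps10 : 0 < eps1 by rewrite divr_gt0.
have [dh dh0 Hdh] := moll_approx p1 mV (Om_eball_fin _) Ih Ihp eps0.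
have [dg dg0 Hdg] : exists2 t : R, 0 < t & forall s, 0 < s -> s <= t -> forall i,
    forall (a b : 'I_n -> R) e, (forall i, 2^-1 <= a i) -> 0 < e < s ->
    (forall x, V x -> forall i, `|aff a b x ord0 i - x ord0 i| < s) ->
    (\int[L]_(x in V) (`|convol a b ((fun x => G x ord0 i) \_ E) (rho e) x - ((fun x => G x ord0 i) \_ E) x| `^ p)%:E <= eps1%:E)%E.
  apply: fin_min_pos => i; have [Ig Igp] := Hg i.
  have [t t0 Ht] := moll_approx p1 mV (Om_eball_fin _) Ig Igp eps10.
  exists t => // s s0 st a b e a2 /andP[e0 es] Hx; apply: Ht => //.
    by rewrite e0 (lt_le_trans es).
  by move=> x Vx j; rewrite (lt_le_trans _ st)// Hx.
pose Gam i := fine (\int[L]_(x in V) (`|G x ord0 i| `^ p)%:E)%E.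
have Gam0 i : 0 <= Gam i by apply: fine_ge0; apply: integral_ge0 => x _; rewrite lee_fin powR_ge0.
have EG i : (\int[L]_(x in V) (`|G x ord0 i| `^ p)%:E = (Gam i)%:E)%E.
  by rewrite fineK// ge0_fin_numE//; [exact: IG|apply: integral_ge0 => x _; rewrite lee_fin powR_ge0].
have [sg sg0 Hsg] : exists2 t : R, 0 < t & forall s, 0 < s -> s <= t -> forall i, s * Gam i <= eps1.
  apply: fin_min_pos => i; exists (eps1 / (Gam i + 1)); first by rewrite divr_gt0// ltr_wpDl.
  move=> s s0; rewrite ler_pdivlMr ?ltr_wpDl// => h; apply: le_trans h; rewrite ler_pM2l//; lra.
have [c [q [/andP[c_0 c_1] /andP[q_0 q_1] cqr]]] := interior_margin.
pose dd := Num.min dh dg.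
have dd0 : 0 < dd by rewrite lt_min dh0.
have n1 : 1 <= n%:R :> R by rewrite ler1n.
have nn0 : 0 < n%:R :> R by lra.
(* First the push [s], so small that it moves the ball [V] by less than the
   mollification thresholds; then the scale [e], small with respect to [s]. *)
pose s := Num.min (Num.min 2^-1 sg) (Num.min (dd / (m + 1)) ((n%:R * (m + 1))^-1)).
have m10 : 0 < m + 1 by lra.
have s0 : 0 < s by rewrite !lt_min invr_gt0 ltr0n sg0 divr_gt0//= invr_gt0 mulr_gt0.
have s_2 : s <= 2^-1 by rewrite !ge_min lexx.
have s_g : s <= sg by rewrite !ge_min lexx orbT.
have s_d : s * (m + 1) <= dd by rewrite -ler_pdivlMr// !ge_min lexx !orbT.
have s_n : n%:R * (s * (m + 1)) <= 1.
  rewrite mulrCA -ler_pdivlMr ?mulr_gt0// mul1r !ge_min lexx !orbT//.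
pose e := Num.min (s * c / 2) (Num.min (s * q / (2 * n%:R)) (Num.min (dd / 2) ((2 * n%:R)^-1))).
have e0 : 0 < e by rewrite !lt_min !divr_gt0 ?mulr_gt0//= invr_gt0 mulr_gt0.
have sc0 : 0 < s * c by rewrite mulr_gt0.
have sq0 : 0 < s * q by rewrite mulr_gt0.
have e_c : e < s * c by have : e <= s * c / 2 by [rewrite ge_min lexx]; lra.
have e_q : n%:R * e < s * q.
  have : e <= s * q / (2 * n%:R) by rewrite !ge_min lexx !orbT.
  rewrite ler_pdivlMr ?mulr_gt0// => h.
  have -> : n%:R * e = e * (2 * n%:R) / 2 by field.
  lra.
have e_d : e < dd by have : e <= dd / 2 by [rewrite !ge_min lexx !orbT]; lra.
have e_n : n%:R * e <= 1.
  have : e <= (2 * n%:R)^-1 by rewrite !ge_min lexx !orbT.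
  rewrite -[X in _ <= X]mul1r ler_pdivlMr ?mulr_gt0// => h.
  have -> : n%:R * e = e * (2 * n%:R) / 2 by field.
  lra.
pose a := push_a s; pose b := push_b (s * c).
have a2 i : 2^-1 <= a i by rewrite /a /push_a; case: ifP => _; lra.
have close x : V x -> forall i, `|aff a b x ord0 i - x ord0 i| < dd.
  by move=> [_ xm] i; apply: lt_le_trans s_d; exact: push_close.
have boxE x : V x -> cbox (fun j => aff a b x ord0 j - e) (fun j => aff a b x ord0 j + e) `<=` E.
  move=> [Ox xm] w Hw.
  have Hw' i : `|w ord0 i - aff a b x ord0 i| <= e.
    by have /andP[h1 h2] := Hw i; rewrite ler_norml; lra.
  split; first exact: (push_in s0 s_2 c_0 q_0 cqr e0 e_c e_q Ox).
  have -> : w = x + ((aff a b x - x) + (w - aff a b x)) by rewrite [X in x + X]addrC subrKA subrKC.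
  have h1 : enorm (aff a b x - x) <= n%:R * (s * (m + 1)).
    apply: enorm_le_max => [|i]; first by rewrite mulr_ge0// ltW.
    by have := push_close i s0 c_0 c_1 xm; rewrite -/a -/b !mxE => /ltW.
  have h2 : enorm (w - aff a b x) <= n%:R * e.
    by apply: enorm_le_max (ltW e0) _ => i; have := Hw' i; rewrite !mxE.
  have h3 := enorm_triangle x ((aff a b x - x) + (w - aff a b x)).
  have h4 := enorm_triangle (aff a b x - x) (w - aff a b x).
  rewrite /eball /=; rewrite /eball /= in xm; lra.
pose f := convol a b (u \_ E) (rho e).
have sf : smooth f by apply: convol_smooth => //; exact: test_rho.
exists f; split => //.
- move=> x; apply: convol_bound => //.
  apply: filterS uM => w uw; rewrite patchE; case: ifPn => [/set_mem [Ow _]|_]; first exact: uw.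
  by rewrite normr0.
- apply: le_trans (Hdh a b e a2 _ _).
  + rewrite le_eqVlt; apply/orP; left; apply/eqP; apply: eq_integral => x; rewrite inE => Vx.
    by rewrite patchE mem_set//; exact: VE.
  + by rewrite e0 (lt_le_trans e_d)// ge_min lexx.
  + by move=> x Vx i; rewrite (lt_le_trans (close x Vx i))// ge_min lexx.
move=> i.
have H1 := Hdg dd dd0 (ltac:(by rewrite ge_min lexx orbT)) i a b e a2 (ltac:(by rewrite e0 e_d)) close.
set g := (fun x => G x ord0 i) \_ E in H1.
have mcg : measurable_fun V (convol a b g (rho e)).
  apply: measurable_funTS; apply: continuous_measurable_rV; apply: convol_continuous; last exact: test_rho.
  by case: (Hg i).
have mGV : measurable_fun V (fun x => G x ord0 i) by exact: measurable_funS VE (mG i).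
have mP (h : 'rV[R]_n -> R) : measurable_fun V h -> measurable_fun V (fun x => (`|h x| `^ p)%:E).
  by move=> mh; apply/measurable_EFinP; exact: measurable_powR_abs.
have gV x : V x -> g x = G x ord0 i by move=> Vx; rewrite /g patchE mem_set//; exact: VE.
have mgV : measurable_fun V g.
  by apply: eq_measurable_fun mGV => x; rewrite inE => Vx; rewrite gV.
apply: (@le_trans _ _ (\int[L]_(x in V) ((2 `^ p)%:E * ((`|convol a b g (rho e) x - g x| `^ p)%:E + s%:E * (`|G x ord0 i| `^ p)%:E)))%E).
  apply: ge0_le_integral => //.
  - apply: mP; apply: measurable_funB => //.
    by apply: measurable_funTS; apply: continuous_measurable_rV; apply: smooth_continuous; exact: smooth_partial.
  - apply: emeasurable_funM => //; apply: emeasurable_funD; first by apply: mP; exact: measurable_funB.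
    by apply: emeasurable_funM => //; exact: mP.
  move=> x Vx; rewrite -?(EFinM, EFinD) lee_fin.
  have -> : partial i f x = a i * convol a b g (rho e) x.
    apply: (@moll_gradient R n a b e Om E u G i x e0 _ _ HG Ih (boxE x Vx)); [exact: open_Omega|exact: subIsetl].
  rewrite gV//; set q' := convol _ _ _ _ _; set G' := G x ord0 i.
  have a1 : `|a i| <= 1 by rewrite /a /push_a ler_norml; case: ifP => _; lra.
  have as_ : `|a i - 1| <= s.
    by rewrite /a /push_a; case: ifP => _; [rewrite subrr normr0 ltW|rewrite addrAC subrr add0r normrN gtr0_norm].
  apply: (@le_trans _ _ ((`|q' - G'| + s * `|G'|) `^ p)).
    apply: powR_le; [exact: ltW|exact: normr_ge0|].
    (* The factor [a i] from the chain rule differs from [1] by at most [s]. *)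
    rewrite (_ : a i * q' - G' = a i * (q' - G') + (a i - 1) * G'); last by ring.
    rewrite (le_trans (ler_normD _ _))// !normrM lerD ?ler_wpM2r//.
    by rewrite -[leRHS]mul1r ler_wpM2r.
  apply: le_trans (powR_add_le _ _ (ltW p0)) _; rewrite ?mulr_ge0 ?(ltW s0)//.
  rewrite ler_wpM2l ?powR_ge0// lerD2l powRM ?(ltW s0)// ler_wpM2r ?powR_ge0//.
  rewrite -[leRHS]powRr1 ?(ltW s0)//; apply: ger_powR; [rewrite s0/=; lra|exact: ltW].
rewrite ge0_integralZl_EFin ?powR_ge0//; last 2 first.
- by move=> x _; rewrite -EFinM -EFinD lee_fin addr_ge0 ?mulr_ge0 ?powR_ge0 ?(ltW s0).
- apply: emeasurable_funD; first by apply: mP; exact: measurable_funB.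
  by apply: emeasurable_funM => //; exact: mP.
rewrite ge0_integralD//; last 3 first.
- by apply: mP; exact: measurable_funB.
- by move=> x _; rewrite -EFinM lee_fin mulr_ge0 ?powR_ge0 ?(ltW s0).
- by apply: emeasurable_funM => //; exact: mP.
rewrite ge0_integralZl_EFin ?(ltW s0)//; last exact: mP.
apply: (@le_trans _ _ ((2 `^ p)%:E * (eps1%:E + eps1%:E))%E).
  apply: lee_wpmul2l; first by rewrite lee_fin powR_ge0.
  apply: leeD => //; rewrite EG -EFinM lee_fin; exact: Hsg.
rewrite -EFinD -EFinM lee_fin /eps1 le_eqVlt; apply/orP; left; apply/eqP; field.
by rewrite gt_eqF// powR_gt0.
Qed.

End approximation.

Section trace_exists.
Context {R : realType} (d k : nat) (r : \bar R) (p : R).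
Hypotheses (k2 : (1 < k)%N) (r0 : (0 < r)%E) (p1 : 1 < p).
Local Notation n := (d + k)%N.
Local Notation L n := (lebesgue_rV R n).
Local Notation Om := (Omega d k r).
Local Notation S := (@surface R d k r k2).
Local Notation ball m := (@eball R d k m).

Let k0 : (0 < k)%N. Proof. exact: ltnW. Qed.
Let n0 : (0 < d + k)%N. Proof. by rewrite addn_gt0 k0 orbT. Qed.
Let p0 : 0 < p. Proof. exact: lt_trans ltr01 p1. Qed.
Let ln : (n.-1 < n)%N. Proof. by rewrite (prednK n0). Qed.
Let last_i : 'I_n := Ordinal ln.

Lemma enorm_powR_le m (x : 'rV[R]_m) :
  enorm x `^ p <= m%:R `^ p * \sum_i `|x ord0 i| `^ p.
Proof.
pose s := \sum_i `|x ord0 i| `^ p.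
have s0 : 0 <= s by apply: sumr_ge0 => i _; exact: powR_ge0.
have xs i : `|x ord0 i| <= s `^ p^-1.
  have -> : `|x ord0 i| = (`|x ord0 i| `^ p) `^ p^-1 by rewrite -powRrM mulfV ?gt_eqF// powRr1.
   apply: powR_le; rewrite ?invr_ge0 ?(ltW p0) ?powR_ge0//.
  by rewrite /s (bigD1 i)//= lerDl; apply: sumr_ge0 => j _; exact: powR_ge0.
have h := enorm_le_max (powR_ge0 s p^-1) xs.
apply: le_trans (powR_le (ltW p0) (enorm_ge0 x) h) _.
by rewrite powRM ?powR_ge0// -powRrM mulVf ?gt_eqF// powRr1.
Qed.

Lemma cvg_geometric_bound (F : nat -> \bar R) (C : R) (J : nat) : (forall j, (0 <= F j)%E) ->
  (forall j, (J <= j)%N -> (F j <= (C * 2^-1 ^+ j)%:E)%E) -> F @ \oo --> 0%E.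
Proof.
move=> F0 FC; apply: (@squeeze_cvge _ _ _ _ (cst 0%E) _ (fun j => (C * 2^-1 ^+ j)%:E)).
- by near=> j; rewrite /cst F0/= FC//; near: j; exists J.
- exact: cvg_cst.
- apply: cvg_EFin; first by near=> j.
  have -> : (0 : R) = C * 0 by rewrite mulr0.
  apply: cvgM; first exact: cvg_cst.
  by apply: cvg_expr; rewrite ger0_norm ?invr_ge0// invf_lt1// ltr1n.
Unshelve. all: by end_near.
Qed.

(** Smooth approximations at speed [2^-j] converge almost everywhere on each
    [good_base e] by [trace_zone_le] and [ae_cvg_of_L1].  They are bounded by [M], so
    that their limit is a trace by dominated convergence; it is a trace up to [Gamma],
    since the approximation is global on bounded sets. *)
Lemma trace_exists u (M : R) : (exists G, is_weak_gradient Om u G) -> 0 <= M ->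
  {ae L n, forall x, Om x -> `|u x| <= M} ->
  (forall m, (\int[L n]_(x in Om `&` ball m) (`|u x| `^ p)%:E < +oo)%E) ->
  (forall m i, (\int[L n]_(x in Om `&` ball m) (`|weak_gradient Om u x ord0 i| `^ p)%:E < +oo)%E) ->
  exists2 v, is_trace p (surface_measure d k r) Om set0 u v & forall x, `|v x| <= M.
Proof.
move=> uG M0 uM Iu IG; set G := weak_gradient Om u.
have HG : is_weak_gradient Om u G by exact: weak_gradientP.
have mOm : measurable Om by apply: open_measurable_rV; exact: open_Omega.
have mu' : measurable_fun Om u by case: HG => -[].
have mG i : measurable_fun Om (fun x => G x ord0 i) by exact: weak_grad_measurable HG.
have mOb m : measurable (Om `&` ball m) by exact: measurable_Om_eball.
have mS (f : 'rV[R]_n -> R) (D : set 'rV[R]_n) : smooth f -> measurable_fun D f.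
  by move=> sf; apply: measurable_funTS; apply: continuous_measurable_rV; exact: smooth_continuous.
have h2 j : 0 < 2^-1 ^+ j :> R by rewrite exprn_gt0// invr_gt0.
have H j : exists f : 'rV[R]_n -> R, [/\ smooth f, forall x, `|f x| <= M,
    (\int[L n]_(x in Om `&` ball j.+1%:R) (`|f x - u x| `^ p)%:E <= (2^-1 ^+ j)%:E)%E,
    forall i, (\int[L n]_(x in Om `&` ball j.+1%:R) (`|partial i f x - G x ord0 i| `^ p)%:E <= (2^-1 ^+ j)%:E)%E &
    (\int[L n]_(x in Om `&` ball j.+1%:R) (`|f x - u x|)%:E <= (2^-1 ^+ j)%:E)%E /\
    forall i, (\int[L n]_(x in Om `&` ball j.+1%:R) (`|partial i f x - G x ord0 i|)%:E <= (2^-1 ^+ j)%:E)%E].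
  have [eps eps0 He] := @Lp_L1_small _ _ _ (L n) p _ p1 (mOb j.+1%:R) (Om_eball_fin d r k2 j.+1%:R) _ (h2 j).
  have e0 : 0 < Num.min eps (2^-1 ^+ j) by rewrite lt_min eps0 h2.
  have [f [sf fM f1 f2]] := smooth_approx k2 r0 p1 HG M0 uM Iu IG (ltr0Sn R j) e0.
  have le1 (F : \bar R) : (F <= (Num.min eps (2^-1 ^+ j))%:E)%E -> (F <= (2^-1 ^+ j)%:E)%E.
    by move=> h; apply: le_trans h _; rewrite lee_fin ge_min lexx orbT.
  have le2 (F : \bar R) : (F <= (Num.min eps (2^-1 ^+ j))%:E)%E -> (F <= eps%:E)%E.
    by move=> h; apply: le_trans h _; rewrite lee_fin ge_min lexx.
  exists f; split => //; [exact: le1|by move=> i; exact: le1|split].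
    apply: He; last exact: le2.
    by apply: measurable_funB; [exact: mS|apply: measurable_funS mu' => //; exact: subIsetl].
  move=> i; apply: He; last exact: le2.
  apply: measurable_funB; first by apply: mS; exact: smooth_partial.
  by apply: measurable_funS (mG i) => //; exact: subIsetl.
have [f Hf] := choice H.
have sf j : smooth (f j) by case: (Hf j).
have fM j x : `|f j x| <= M by case: (Hf j) => _ /(_ x).
(* A measurable everywhere defined function, bounded by [M] and equal to the
   limit wherever the limit exists. *)
pose v x := Num.max (- M) (Num.min M (fine (limn_esup (fun j => (f j x)%:E)))).
have vM x : `|v x| <= M.
  by rewrite ler_norml le_max lexx /= ge_max ge_min lexx andbT; lra.
have mv : measurable_fun setT v.
  apply: measurable_maxr => //; apply: measurable_minr => //.
  apply: measurableT_comp; first exact: fine_measurable.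
  apply: measurable_fun_limn_esup => j; apply/measurable_EFinP; exact: mS.
have vlim x : cvgn (fun j => f j x) -> f ^~ x @ \oo --> v x.
  move=> c; suff -> : v x = limn (fun j => f j x) by [].
  have cE : (fun j => (f j x)%:E) @ \oo --> (limn (fun j => f j x))%:E by apply: cvg_EFin; [by near=> j|exact: c].
  have -> : v x = Num.max (- M) (Num.min M (limn (fun j => f j x))).
    by rewrite /v is_cvg_limn_esupE; [rewrite (cvg_lim _ cE)|apply/cvg_ex; eexists; exact: cE].
  have h1 : limn (fun j => f j x) <= M.
    by apply: limr_le => //; near=> j; have := fM j x; rewrite ler_norml => /andP[].
  have h3 : - M <= limn (fun j => f j x).
    by apply: limr_ge => //; near=> j; have := fM j x; rewrite ler_norml => /andP[].
  by rewrite (min_idPr h1) (max_idPr h3).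
have aeS : {ae S, forall x, f ^~ x @ \oo --> v x}.
  apply: ae_surface => psi sp; apply: base_ae => // e e0.
  have mgr := measurable_graph_map n0 (measurable_sheet sp).
  have [J HJ] : exists J : nat, forall j, (J <= j)%N -> zone r e `<=` ball j.+1%:R.
    exists (Num.truncn (zone_bound r e)) => j Jj x [/= xb _]; rewrite /eball /=.
    apply: lt_trans xb _; apply: lt_le_trans (truncnS_gt _) _.
    by rewrite ler_nat ltnS.
  have mz : measurable (Om `&` zone r e) by exact: measurable_Om_zone.
  have sub j : (J <= j)%N -> Om `&` zone r e `<=` Om `&` ball j.+1%:R.
    by move=> Jj x [Ox /(HJ _ Jj)].
  pose C : R := (e^-1 + 1) * 2.
  have C0 : 0 <= C by rewrite mulr_ge0// addr_ge0// invr_ge0 ltW.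
  have L1 (g g' w : 'rV[R]_n -> R) j : (J <= j)%N -> measurable_fun Om g -> measurable_fun Om g' -> measurable_fun Om w ->
      (\int[L n]_(x in Om `&` ball j.+1%:R) (`|g x - w x|)%:E <= (2^-1 ^+ j)%:E)%E ->
      (\int[L n]_(x in Om `&` ball j.+2%:R) (`|g' x - w x|)%:E <= (2^-1 ^+ j.+1)%:E)%E ->
      (\int[L n]_(x in Om `&` zone r e) (`|g' x - g x|)%:E <= (2 * 2^-1 ^+ j)%:E)%E.
    move=> Jj mg mg' mw h1 h2'.
    have mO (h : 'rV[R]_n -> R) (D : set 'rV[R]_n) : D `<=` Om -> measurable_fun Om h -> measurable_fun D h.
      by move=> DO; exact: measurable_funS.
    have mA (h h' : 'rV[R]_n -> R) (D : set 'rV[R]_n) : D `<=` Om -> measurable_fun Om h -> measurable_fun Om h' ->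
        measurable_fun D (fun x => (`|h x - h' x|)%:E).
      move=> DO mh mh'; apply/measurable_EFinP; apply: measurableT_comp => //.
      by apply: measurable_funB; exact: mO.
    apply: (@le_trans _ _ (\int[L n]_(x in Om `&` zone r e) ((`|g' x - w x|)%:E + (`|g x - w x|)%:E))%E).
      apply: ge0_le_integral => //.
      - by apply: mA => //; exact: subIsetl.
      - by apply: emeasurable_funD; apply: mA => //; exact: subIsetl.
      - move=> x _; rewrite -EFinD lee_fin -(subrK (w x) (g' x)) -addrA (le_trans (ler_normD _ _))//.
        by rewrite subrK lerD2l distrC.
    rewrite ge0_integralD//; [|by apply: mA => //; exact: subIsetl|by apply: mA => //; exact: subIsetl].
    have -> : (2 * 2^-1 ^+ j)%:E = ((2^-1 ^+ j)%:E + (2^-1 ^+ j)%:E)%E :> \bar R by rewrite -EFinD; congr EFin; ring.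
    apply: leeD.
      apply: (@le_trans _ _ (\int[L n]_(x in Om `&` ball j.+2%:R) (`|g' x - w x|)%:E)%E).
        apply: ge0_subset_integral => //; first by apply: mA => //; exact: subIsetl.
        by apply: sub; exact: leqW.
      apply: le_trans h2' _; rewrite lee_fin exprS ler_piMl ?(ltW (h2 j))// invf_le1 ?ler1n ?ltr0n//.
    apply: le_trans h1; apply: ge0_subset_integral => //; first by apply: mA => //; exact: subIsetl.
    exact: sub.
  have key j : (J <= j)%N -> (\int[L n.-1]_(y in good_base r e) (`|f j.+1 (snoc_rV y (psi y)) - f j (snoc_rV y (psi y))|)%:E <= (C * 2^-1 ^+ j)%:E)%E.
    move=> Jj; have [s1 _ _ _ [A1 B1]] := Hf j; have [s2 _ _ _ [A2 B2]] := Hf j.+1.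
    have ss : smooth (fun x => f j.+1 x - f j x) by exact: smoothB.
    apply: le_trans (trace_zone_le k2 r0 e0 sp ss) _.
    have -> : (C * 2^-1 ^+ j)%:E = ((e^-1)%:E * (2 * 2^-1 ^+ j)%:E + (2 * 2^-1 ^+ j)%:E)%E :> \bar R.
      by rewrite -EFinM -EFinD /C; congr EFin; ring.
    apply: leeD.
      apply: lee_wpmul2l; first by rewrite lee_fin invr_ge0 ltW.
      by apply: (L1 _ _ u) => //; exact: mS.
    under eq_integral do rewrite partialB//.
    apply: (L1 (partial _ (f j)) (partial _ (f j.+1)) (fun x => G x ord0 _) j Jj _ _ (mG _) (B1 _) (B2 _)).
      by apply: mS; exact: smooth_partial.
    by apply: mS; exact: smooth_partial.
  have mgood := @measurable_good_base R d k r k2 e.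
  have mfg j : measurable_fun setT (fun y => f j (snoc_rV y (psi y))).
    by apply: (measurableT_comp (f := f j)); [exact: mS|].
  have := @ae_cvg_of_L1 _ _ R (L n.-1) (good_base r e) (fun j y => f j (snoc_rV y (psi y))) C J mgood C0 mfg key.
  by apply: filterS => y Hy gy; apply: vlim; exact: Hy.
exists v => //; split; first exact: measurable_funTS.
move=> V oV [m Vm] _; exists f.
have [J HJ] : exists J : nat, forall j, (J <= j)%N -> V `<=` ball j.+1%:R.
  exists (Num.truncn m) => j Jj x Vx; rewrite /eball /=; apply: le_lt_trans (Vm _ Vx) _.
  by apply: lt_le_trans (truncnS_gt _) _; rewrite ler_nat ltnS.
have mV := open_measurable_rV oV.
have mOV : measurable (Om `&` V) by exact: measurableI.
have mB := measurable_topo_boundary Om.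
have mBV : measurable (topo_boundary Om `&` V) by exact: measurableI.
have mP (D : set 'rV[R]_n) (g w : 'rV[R]_n -> R) : measurable_fun D g -> measurable_fun D w ->
    measurable_fun D (fun x => (`|g x - w x| `^ p)%:E).
  by move=> mg mw; apply/measurable_EFinP; apply: measurable_powR_abs; exact: measurable_funB.
have mI (D : set 'rV[R]_n) (g : 'rV[R]_n -> R) : measurable_fun Om g -> measurable_fun (Om `&` D) g.
  by move=> mg; apply: measurable_funS mg => //; exact: subIsetl.
split => //.
- apply: (@cvg_geometric_bound _ 1 J) => [j|j Jj]; first by apply: integral_ge0 => x _; rewrite lee_fin powR_ge0.
  rewrite mul1r; have [_ _ h _ _] := Hf j; apply: le_trans h; apply: ge0_subset_integral => //.
  + by apply: mP; [exact: mS|exact: mI].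
  + by move=> x [Ox /(HJ _ Jj)].
- apply: (@cvg_geometric_bound _ (n%:R `^ p * n%:R) J) => [j|j Jj]; first by apply: integral_ge0 => x _; rewrite lee_fin powR_ge0.
  have [_ _ _ h _] := Hf j.
  have mpG i : measurable_fun Om (fun x => (`|partial i (f j) x - G x ord0 i| `^ p)%:E).
    by apply: mP => //; apply: mS; exact: smooth_partial.
  apply: (@le_trans _ _ (\int[L n]_(x in Om `&` ball j.+1%:R) (enorm (gradient (f j) x - weak_gradient Om u x) `^ p)%:E)%E).
    apply: ge0_subset_integral => //.
    + apply/measurable_EFinP.
      rewrite (_ : (fun x => _) = (fun x => `|enorm (gradient (f j) x - weak_gradient Om u x)| `^ p)); last first.
        by apply/funext => x; rewrite ger0_norm ?enorm_ge0.
      apply: measurable_powR_abs; apply: measurable_enorm => i.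
      under eq_fun do rewrite !mxE; apply: measurable_funB; last exact: mI.
      by apply: mS; exact: smooth_partial.
    + by move=> x _; rewrite lee_fin powR_ge0.
    + by move=> x [Ox /(HJ _ Jj)].
  apply: (@le_trans _ _ (\int[L n]_(x in Om `&` ball j.+1%:R) ((n%:R `^ p)%:E * \sum_i (`|partial i (f j) x - G x ord0 i| `^ p)%:E))%E).
    apply: ge0_le_integral => //.
    + by move=> x _; rewrite lee_fin powR_ge0.
    + apply/measurable_EFinP.
      rewrite (_ : (fun x => _) = (fun x => `|enorm (gradient (f j) x - weak_gradient Om u x)| `^ p)); last first.
        by apply/funext => x; rewrite ger0_norm ?enorm_ge0.
      apply: measurable_powR_abs; apply: measurable_enorm => i.
      under eq_fun do rewrite !mxE; apply: measurable_funB; last exact: mI.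
      by apply: mS; exact: smooth_partial.
    + apply: emeasurable_funM => //; apply: emeasurable_sum => i.
      by apply: measurable_funS (mpG i) => //; exact: subIsetl.
    + move=> x _; rewrite sumEFin -EFinM lee_fin; apply: le_trans (enorm_powR_le _) _.
      by under eq_bigr do rewrite !mxE.
  rewrite ge0_integralZl_EFin ?powR_ge0//; last 2 first.
  + by move=> x _; apply: sume_ge0 => i _; rewrite lee_fin powR_ge0.
  + by apply: emeasurable_sum => i; apply: measurable_funS (mpG i) => //; exact: subIsetl.
  rewrite ge0_integral_sum//; last first.
    by move=> i; apply: measurable_funS (mpG i) => //; exact: subIsetl.
  rewrite -mulrA EFinM; apply: lee_wpmul2l; first by rewrite lee_fin powR_ge0.
  apply: (@le_trans _ _ (\sum_(i < n) (2^-1 ^+ j)%:E)%E); first exact: lee_sum.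
  by rewrite sumEFin lee_fin sumr_const card_ord mulr_natl.
have Sfin : (S (topo_boundary Om `&` V) < +oo)%E.
  by apply: (@surface_fin R d k r k2 _ m) => // x [_ /Vm].
pose gM (x : 'rV[R]_n) : R := (2 * M) `^ p.
have Ig : S.-integrable (topo_boundary Om `&` V) (EFin \o gM).
  rewrite (_ : gM = cst ((2 * M) `^ p))//.
  apply: measurable_bounded_integrable => //.
  by exists `|(2 * M) `^ p|; split; [exact: num_real|move=> y cy x _; exact: ltW].
have Smf j : measurable_fun (topo_boundary Om `&` V) (fun x => (`|f j x - v x| `^ p)%:E).
  by apply: mP; [exact: mS|exact: measurable_funTS].
have C1 : {ae S, forall x, (topo_boundary Om `&` V) x -> (fun j => (`|f j x - v x| `^ p)%:E) @ \oo --> (cst 0%E x : \bar R)}.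
  apply: filterS aeS => x cx _; apply: cvg_EFin; first by near=> j.
  apply: (@cvg_powR0 R (fun j => `|f j x - v x|) p p0) => //.
  rewrite -(normr0 R); apply: cvg_norm; rewrite -(subrr (v x)); apply: cvgB => //; exact: cvg_cst.
have C2 : {ae S, forall x j, (topo_boundary Om `&` V) x -> (`|(`|f j x - v x| `^ p)%:E|%E <= (EFin \o gM) x)%E}.
  apply: filterS C1 => x _ j _; rewrite gee0_abs ?lee_fin ?powR_ge0//.
  apply: powR_le; [exact: ltW|exact: normr_ge0|].
  by rewrite (le_trans (ler_normB _ _))// mulr2n mulrDl mul1r lerD.
have [_ _] := @dominated_convergence _ _ R S (topo_boundary Om `&` V) mBV
  (fun j x => (`|f j x - v x| `^ p)%:E) (cst 0%E) _ Smf (measurable_cst _) C1 Ig C2.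
by rewrite integral0.
Unshelve. all: by end_near.
Qed.

End trace_exists.

(** * Weak gradient of a product with separated variables *)

Section product_rV.
Context {R : realType} (d k : nat).
Local Notation L n := (lebesgue_rV R n).
Implicit Types (a : 'rV[R]_d) (b : 'rV[R]_k) (x : 'rV[R]_(d + k)).

(** The topology of row vectors is that of coordinatewise convergence. *)
Lemma continuous_rVP (T : topologicalType) n (f : T -> 'rV[R]_n) :
  (forall i, continuous (fun t => f t ord0 i)) -> continuous f.
Proof.
move=> cf t; apply/(@cvgrPdist_lt _ _ _ (nbhs t) (nbhs_filter t)) => e e0.
have H i : \forall s \near t, `|f t ord0 i - f s ord0 i| < e.
  by have := cf i t; move/(@cvgrPdist_lt _ _ _ (nbhs t) (nbhs_filter t)); apply.
have := @filter_forall _ _ _ (nbhs t) (nbhs_filter t) H.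
apply: filterS => s Hs.
rewrite [X in X < _](_ : _ = mx_norm (f t - f s))// mx_normrE.
apply: bigmax_lt => // -[i j] _ /=; rewrite (ord1 i) !mxE.
exact: Hs.
Qed.

Lemma continuous_lsubmx : continuous (fun x => lsubmx x).
Proof. by apply: continuous_rVP => i; under eq_fun do rewrite mxE; exact: coord_continuous_rV. Qed.

Lemma continuous_rsubmx : continuous (fun x => rsubmx x).
Proof. by apply: continuous_rVP => i; under eq_fun do rewrite mxE; exact: coord_continuous_rV. Qed.

Lemma continuous_row_mxr a : continuous (fun b => row_mx a b).
Proof.
apply: continuous_rVP => i; have [j ->|j ->] := split_ordP i.
  under eq_fun do rewrite row_mxEl; exact: cst_continuous.
under eq_fun do rewrite row_mxEr; exact: coord_continuous_rV.
Qed.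

Lemma continuous_row_mxl b : continuous (fun a => row_mx a b).
Proof.
apply: continuous_rVP => i; have [j ->|j ->] := split_ordP i.
  under eq_fun do rewrite row_mxEl; exact: coord_continuous_rV.
under eq_fun do rewrite row_mxEr; exact: cst_continuous.
Qed.

Lemma measurable_lsubmx : measurable_fun setT (fun x => lsubmx x).
Proof. by apply/measurable_fun_rVP => i; under eq_fun do rewrite mxE; exact: measurable_rV_coord. Qed.

Lemma measurable_rsubmx : measurable_fun setT (fun x => rsubmx x).
Proof. by apply/measurable_fun_rVP => i; under eq_fun do rewrite mxE; exact: measurable_rV_coord. Qed.

Lemma row_mx_affr a (j : 'I_k) (h : R) b :
  row_mx a (h *: delta_mx ord0 j + b) = h *: delta_mx ord0 (rshift d j) + row_mx a b :> 'rV[R]_(d + k).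
Proof.
apply/rowP => i; have [l ->|l ->] := split_ordP i.
  transitivity (h * (lshift k l == rshift d j)%:R + row_mx a b ord0 (lshift k l)).
    by rewrite eq_lrshift mulr0 add0r !row_mxEl.
  by rewrite !mxE eqxx.
transitivity (h * (l == j)%:R + b ord0 l); first by rewrite row_mxEr !mxE eqxx.
transitivity (h * (rshift d l == rshift d j)%:R + row_mx a b ord0 (rshift d l)).
  by rewrite row_mxEr eq_rshift.
by rewrite !mxE eqxx.
Qed.

Lemma row_mx_affl b (j : 'I_d) (h : R) a :
  row_mx (h *: delta_mx ord0 j + a) b = h *: delta_mx ord0 (lshift k j) + row_mx a b :> 'rV[R]_(d + k).
Proof.
apply/rowP => i; have [l ->|l ->] := split_ordP i.
  transitivity (h * (l == j)%:R + a ord0 l); first by rewrite row_mxEl !mxE eqxx.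
  transitivity (h * (lshift k l == lshift k j)%:R + row_mx a b ord0 (lshift k l)).
    by rewrite row_mxEl eq_lshift.
  by rewrite !mxE eqxx.
transitivity (h * (rshift d l == lshift k j)%:R + row_mx a b ord0 (rshift d l)).
  by rewrite eq_rlshift mulr0 add0r !row_mxEr.
by rewrite !mxE eqxx.
Qed.

Lemma ge0_integral_prodE (f : 'rV[R]_(d + k) -> \bar R) :
  measurable_fun setT f -> (forall x, 0 <= f x)%E ->
  (\int[L (d + k)]_x f x = \int[L d \x L k]_z f (row_mx z.1 z.2))%E.
Proof.
move=> mf f0; rewrite (ge0_integral_row_mx mf f0) fubini_tonelli1//.
by apply: (measurableT_comp mf); exact: measurable_row_mx.
Qed.

Lemma integrable_prodE (f : 'rV[R]_(d + k) -> \bar R) : (L (d + k)).-integrable setT f ->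
  (L d \x L k)%E.-integrable setT (fun z => f (row_mx z.1 z.2)) /\
  (\int[L (d + k)]_x f x = \int[L d \x L k]_z f (row_mx z.1 z.2))%E.
Proof.
move=> /integrableP[mf If]; split.
  apply/integrableP; split; first by apply: (measurableT_comp mf); exact: measurable_row_mx.
  by rewrite -(@ge0_integral_prodE (fun x => `|f x|%E))//; exact: measurableT_comp.
rewrite integralE [in RHS]integralE.
have -> := ge0_integral_prodE (measurable_funepos mf) (fun x => funepos_ge0 f x).
have -> := ge0_integral_prodE (measurable_funeneg mf) (fun x => funeneg_ge0 f x).
by congr (_ - _)%E; apply: eq_integral => z _; rewrite ?funeposE ?funenegE.
Qed.

Variable V : set 'rV[R]_k.
Hypothesis oV : open V.
Let OV : set 'rV[R]_(d + k) := [set x | V (rsubmx x)].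

Lemma open_cylinder : open OV.
Proof. by apply: (@open_comp _ _ (fun x => rsubmx x) V) => [x _|//]; exact: continuous_rsubmx. Qed.

Let mV : measurable V. Proof. exact: open_measurable_rV. Qed.
Let mOV : measurable OV. Proof. by apply: open_measurable_rV; exact: open_cylinder. Qed.

Lemma patch_cylinder (f : 'rV[R]_(d + k) -> \bar R) a b :
  (f \_ OV) (row_mx a b) = ((fun b => f (row_mx a b)) \_ V) b.
Proof.
rewrite !patchE (_ : (row_mx a b \in OV) = (b \in V))//.
by apply/idP/idP; rewrite !inE /OV /= row_mxKr.
Qed.

Lemma integral_cylinder (f : 'rV[R]_(d + k) -> \bar R) : (L (d + k)).-integrable OV f ->
  (\int[L (d + k)]_(x in OV) f x = \int[L d]_a \int[L k]_(b in V) f (row_mx a b))%E /\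
  (\int[L (d + k)]_(x in OV) f x = \int[L k]_(b in V) \int[L d]_a f (row_mx a b))%E.
Proof.
move=> If; have IfT : (L (d + k)).-integrable setT (f \_ OV).
  by apply/(integrable_mkcond f mOV).1.
have [Ip Ep] := integrable_prodE IfT.
rewrite integral_mkcond Ep; split.
  rewrite -(integral12_prod_meas1 Ip); apply: eq_integral => a _.
  by rewrite [RHS]integral_mkcond; apply: eq_integral => b _; exact: patch_cylinder.
rewrite -(integral21_prod_meas1 Ip) [RHS]integral_mkcond; apply: eq_integral => b _.
rewrite [RHS]patchE; case: ifPn => bV; last first.
  by rewrite /fubini_G integral0_eq// => a _ /=; rewrite patch_cylinder patchE (negbTE bV).
by apply: eq_integral => a _ /=; rewrite patch_cylinder patchE bV.
Qed.

(** A compact set is contained in the product of its two projections. *)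
Lemma L1_loc_prod (f : 'rV[R]_k -> R) (h : 'rV[R]_d -> R) : L1_loc V f -> L1_loc setT h ->
  L1_loc OV (fun x => f (rsubmx x) * h (lsubmx x)).
Proof.
move=> [mf If] [mh Ih].
have mF : measurable_fun OV (fun x => f (rsubmx x) * h (lsubmx x)).
  apply: measurable_funM.
    by apply: (measurable_comp mV _ mf); [move=> _ [x Ox <-]|apply: measurable_funTS; exact: measurable_rsubmx].
  by apply: measurable_funTS; apply: (measurableT_comp mh); exact: measurable_lsubmx.
split => // K cK KO; have mK := compact_measurable_rV cK.
pose K1 := (fun x => rsubmx x) @` K; pose K2 := (fun x => lsubmx x) @` K.
have cK1 : compact K1 by apply: continuous_compact => //; apply: continuous_subspaceT; exact: continuous_rsubmx.
have cK2 : compact K2 by apply: continuous_compact => //; apply: continuous_subspaceT; exact: continuous_lsubmx.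
have K1V : K1 `<=` V by move=> _ [x Kx <-]; exact: KO.
have mK1 := compact_measurable_rV cK1; have mK2 := compact_measurable_rV cK2.
have /integrableP[mf1 If1] := If K1 cK1 K1V.
have /integrableP[mh1 Ih1] := Ih K2 cK2 (@subsetT _ _).
apply/integrableP; split; first by apply/measurable_EFinP; apply: measurable_funS KO mF; exact: mOV.
pose f1 b := `|f b|%:E; pose h1 a := `|h a|%:E.
have mf1T : measurable_fun setT (f1 \_ K1).
  by apply/(measurable_restrictT _ mK1); apply/measurable_EFinP; apply: measurableT_comp => //; exact/measurable_EFinP.
have mh1T : measurable_fun setT (h1 \_ K2).
  by apply/(measurable_restrictT _ mK2); apply/measurable_EFinP; apply: measurableT_comp => //; exact/measurable_EFinP.
pose H x : \bar R := ((h1 \_ K2) (lsubmx x) * (f1 \_ K1) (rsubmx x))%E.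
have f10 b : (0 <= (f1 \_ K1) b)%E by rewrite patchE; case: ifP => // _; rewrite lee_fin.
have h10 a : (0 <= (h1 \_ K2) a)%E by rewrite patchE; case: ifP => // _; rewrite lee_fin.
have mH : measurable_fun setT H.
  apply: emeasurable_funM.
    by apply: (measurableT_comp mh1T); exact: measurable_lsubmx.
  by apply: (measurableT_comp mf1T); exact: measurable_rsubmx.
have H0 x : (0 <= H x)%E by exact: mule_ge0.
apply: (@le_lt_trans _ _ (\int[L (d + k)]_x H x)%E).
  rewrite [leLHS]integral_mkcond; apply: ge0_le_integral => //.
  - by move=> x _; rewrite patchE; case: ifP => // _; exact: abse_ge0.
  - by apply/(measurable_restrictT _ mK); apply: measurableT_comp => //; apply/measurable_EFinP; apply: measurable_funS KO mF; exact: mOV.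
  move=> x _; rewrite patchE; case: ifPn => [/set_mem Kx|_]; last exact: H0.
  have h1x : K1 (rsubmx x) by exists x.
  have h2x : K2 (lsubmx x) by exists x.
  by rewrite /H !patchE !mem_set// /f1 /h1 -EFinM /= normrM mulrC.
rewrite (ge0_integral_row_mx mH H0).
rewrite (_ : (fun a => _) = (fun a => (h1 \_ K2) a * \int[L k]_b (f1 \_ K1) b)%E); last first.
  apply/funext => a; rewrite -ge0_integralZl//.
  by apply: eq_integral => b _; rewrite /H row_mxKl row_mxKr.
rewrite ge0_integralZr//; last by apply: integral_ge0.
by rewrite -!integral_mkcond; apply: lte_mul_pinfty => //; [apply: integral_ge0 => a _; rewrite lee_fin|rewrite ge0_fin_numE//; apply: integral_ge0 => a _; rewrite lee_fin].
Qed.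

Lemma slice_testr (phi : 'rV[R]_(d + k) -> R) a : test_function OV phi -> test_function V (fun b => phi (row_mx a b)).
Proof.
move=> [sp cp pO]; set K := closure _ in cp pO.
apply: (@test_function_sub _ _ V ((fun x => rsubmx x) @` K)).
- apply/smoothE => m.
  have := (@Cd_affine R 'rV[R]_(d + k) 'rV[R]_k 'I_(d + k) 'I_k (fun i => delta_mx ord0 i) (fun j => delta_mx ord0 j) (@rshift d k) (fun b => row_mx a b) (@continuous_row_mxr a) (fun j h b => row_mx_affr a j h b) m phi ((smoothE _).1 sp m)); exact id.
- by apply: continuous_compact => //; apply: continuous_subspaceT; exact: continuous_rsubmx.
- by move=> _ [x Kx <-]; exact: pO.
- by move=> b pb; exists (row_mx a b); [exact: subset_closure|rewrite row_mxKr].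
Qed.

Lemma slice_testl (phi : 'rV[R]_(d + k) -> R) b : test_function OV phi -> test_function setT (fun a => phi (row_mx a b)).
Proof.
move=> [sp cp pO]; set K := closure _ in cp pO.
apply: (@test_function_sub _ _ setT ((fun x => lsubmx x) @` K)) => //.
- apply/smoothE => m.
  have := (@Cd_affine R 'rV[R]_(d + k) 'rV[R]_d 'I_(d + k) 'I_d (fun i => delta_mx ord0 i) (fun j => delta_mx ord0 j) (@lshift d k) (fun a => row_mx a b) (@continuous_row_mxl b) (fun j h a => row_mx_affl b j h a) m phi ((smoothE _).1 sp m)); exact id.
- by apply: continuous_compact => //; apply: continuous_subspaceT; exact: continuous_lsubmx.
- by move=> a pb; exists (row_mx a b); [exact: subset_closure|rewrite row_mxKl].
Qed.

Lemma partial_slicer (phi : 'rV[R]_(d + k) -> R) a b j :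
  partial (rshift d j) phi (row_mx a b) = partial j (fun b => phi (row_mx a b)) b.
Proof.
apply/esym; exact: (@derive_affine R 'rV[R]_(d + k) 'rV[R]_k 'I_(d + k) 'I_k (fun i => delta_mx ord0 i) (fun j => delta_mx ord0 j) (@rshift d k) (fun b => row_mx a b) (fun j h b => row_mx_affr a j h b) phi j b).
Qed.

Lemma partial_slicel (phi : 'rV[R]_(d + k) -> R) a b j :
  partial (lshift k j) phi (row_mx a b) = partial j (fun a => phi (row_mx a b)) a.
Proof.
apply/esym; exact: (@derive_affine R 'rV[R]_(d + k) 'rV[R]_d 'I_(d + k) 'I_d (fun i => delta_mx ord0 i) (fun j => delta_mx ord0 j) (@lshift d k) (fun a => row_mx a b) (fun j h a => row_mx_affl b j h a) phi j a).
Qed.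

Lemma integral_oppr dd (T : measurableType dd) (mu : {measure set T -> \bar R}) (D : set T) (f : T -> R) :
  measurable D -> mu.-integrable D (EFin \o f) ->
  (- (\int[mu]_(t in D) (f t)%:E) = \int[mu]_(t in D) (- f t)%R%:E)%E.
Proof.
move=> mD If; under [RHS]eq_integral do rewrite EFinN.
by rewrite integralN//; exact: integrable_add_def.
Qed.

Lemma integrable_oppr dd (T : measurableType dd) (mu : {measure set T -> \bar R}) (D : set T) (f : T -> R) :
  measurable D -> mu.-integrable D (EFin \o f) -> mu.-integrable D (fun t => (- f t)%R%:E).
Proof. by move=> mD If; have := integrableN If; apply: eq_integrable. Qed.

(** By Fubini, freeze one block of variables: slices of a test function are test
    functions of the other block, for which the identity is that of one factor. *)
Lemma weak_grad_prod u1 G1 u2 G2 : is_weak_gradient V u1 G1 -> is_weak_gradient setT u2 G2 ->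
  is_weak_gradient OV (fun x => u1 (rsubmx x) * u2 (lsubmx x))
    (fun x => row_mx (u1 (rsubmx x) *: G2 (lsubmx x)) (u2 (lsubmx x) *: G1 (rsubmx x))).
Proof.
move=> [L1 H1] [L2 H2].
have LL := L1_loc_prod L1 L2.
split => // i.
set u := (fun x => _) in LL *.
have [j ->|j ->] := split_ordP i.
- have [LG2 IG2] := H2 j; have LG := L1_loc_prod L1 LG2.
  have GE x : row_mx (u1 (rsubmx x) *: G2 (lsubmx x)) (u2 (lsubmx x) *: G1 (rsubmx x)) ord0 (lshift k j) =
     u1 (rsubmx x) * G2 (lsubmx x) ord0 j by rewrite row_mxEl mxE.
  split; first by rewrite (_ : (fun x => _) = (fun x => u1 (rsubmx x) * G2 (lsubmx x) ord0 j))//; apply/funext.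
  move=> phi tp; have tp' := test_function_partial (lshift k j) tp.
  have [_ ->] := integral_cylinder (L1_loc_test_integrable open_cylinder LL tp').
  under [in RHS]eq_integral do rewrite GE.
  have Ig := L1_loc_test_integrable open_cylinder LG tp.
  rewrite (integral_oppr mOV Ig); have [_ ->] := integral_cylinder (integrable_oppr mOV Ig).
  have E b : (\int[L d]_a (u (row_mx a b) * partial (lshift k j) phi (row_mx a b))%:E =
     \int[L d]_a (- (u1 (rsubmx (row_mx a b)) * G2 (lsubmx (row_mx a b)) ord0 j * phi (row_mx a b)))%:E)%E.
    have I1 := L1_loc_test_integrable openT L2 (test_function_partial j (slice_testl b tp)).
    have I2 := L1_loc_test_integrable openT LG2 (slice_testl b tp).
    rewrite (_ : (fun a => _) = (fun a => (u1 b)%:E * (u2 a * partial j (fun a => phi (row_mx a b)) a)%:E)%E); last first.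
      by apply/funext => a; rewrite /u row_mxKl row_mxKr partial_slicel -EFinM mulrA.
    rewrite [in RHS](_ : (fun a => _) = (fun a => (u1 b)%:E * (- (G2 a ord0 j * phi (row_mx a b)))%:E)%E); last first.
      by apply/funext => a; rewrite row_mxKl row_mxKr -EFinM; congr EFin; ring.
    rewrite !integralZl//; last exact: integrable_oppr.
    by rewrite -integral_oppr// IG2//; exact: slice_testl.
  by apply: eq_integral => b _; exact: E.
- have [LG1 IG1] := H1 j; have LG := L1_loc_prod LG1 L2.
  have GE x : row_mx (u1 (rsubmx x) *: G2 (lsubmx x)) (u2 (lsubmx x) *: G1 (rsubmx x)) ord0 (rshift d j) =
     G1 (rsubmx x) ord0 j * u2 (lsubmx x) by rewrite row_mxEr mxE mulrC.
  split; first by rewrite (_ : (fun x => _) = (fun x => G1 (rsubmx x) ord0 j * u2 (lsubmx x)))//; apply/funext.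
  move=> phi tp; have tp' := test_function_partial (rshift d j) tp.
  have [-> _] := integral_cylinder (L1_loc_test_integrable open_cylinder LL tp').
  under [in RHS]eq_integral do rewrite GE.
  have Ig := L1_loc_test_integrable open_cylinder LG tp.
  rewrite (integral_oppr mOV Ig); have [-> _] := integral_cylinder (integrable_oppr mOV Ig).
  have E a : (\int[L k]_(b in V) (u (row_mx a b) * partial (rshift d j) phi (row_mx a b))%:E =
     \int[L k]_(b in V) (- (G1 (rsubmx (row_mx a b)) ord0 j * u2 (lsubmx (row_mx a b)) * phi (row_mx a b)))%:E)%E.
    have I1 := L1_loc_test_integrable oV L1 (test_function_partial j (slice_testr a tp)).
    have I2 := L1_loc_test_integrable oV LG1 (slice_testr a tp).
    rewrite (_ : (fun b => _) = (fun b => (u2 a)%:E * (u1 b * partial j (fun b => phi (row_mx a b)) b)%:E)%E); last first.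
      by apply/funext => b; rewrite /u row_mxKl row_mxKr partial_slicer -EFinM; congr EFin; ring.
    rewrite [in RHS](_ : (fun b => _) = (fun b => (u2 a)%:E * (- (G1 b ord0 j * phi (row_mx a b)))%:E)%E); last first.
      by apply/funext => b; rewrite row_mxKl row_mxKr -EFinM; congr EFin; ring.
    rewrite !integralZl//; last exact: integrable_oppr.
    by rewrite -integral_oppr// IG1//; exact: slice_testr.
  by apply: eq_integral => a _; exact: E.
Qed.

End product_rV.

(** * Integrability on cusps controls both factors *)

Section rect.
Context {R : realType} {d k : nat}.
Local Notation L n := (lebesgue_rV R n).
Implicit Types (A : set 'rV[R]_d) (B : set 'rV[R]_k).

Lemma enorm_sqr_split (x : 'rV[R]_(d + k)) :
  enorm x ^+ 2 = enorm (lsubmx x) ^+ 2 + enorm (rsubmx x) ^+ 2.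
Proof.
rewrite !enorm_sqr /dotrV big_split_ord /=.
by congr (_ + _); apply: eq_bigr => i _; rewrite !mxE.
Qed.

Lemma enorm_lsub_le (x : 'rV[R]_(d + k)) : enorm (lsubmx x) <= enorm x.
Proof.
by rewrite -(@ler_pXn2r _ 2) ?nnegrE ?enorm_ge0// enorm_sqr_split lerDl sqr_ge0.
Qed.

Lemma enorm_le_split (x : 'rV[R]_(d + k)) : enorm x <= enorm (lsubmx x) + enorm (rsubmx x).
Proof.
rewrite -(@ler_pXn2r _ 2) ?nnegrE ?addr_ge0 ?enorm_ge0// enorm_sqr_split sqrrD.
by rewrite lerD2r lerDl mulrn_wge0// mulr_ge0 ?enorm_ge0.
Qed.

Definition rect A B : set 'rV[R]_(d + k) := [set x | A (lsubmx x) /\ B (rsubmx x)].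

Lemma measurable_rect A B : measurable A -> measurable B -> measurable (rect A B).
Proof.
move=> mA mB.
rewrite (_ : rect A B = (setT `&` (fun x => lsubmx x) @^-1` A) `&` (setT `&` (fun x => rsubmx x) @^-1` B)).
  apply: measurableI; first exact: (@measurable_lsubmx R d k).
  exact: (@measurable_rsubmx R d k).
by apply/seteqP; split => x; [move=> [? ?]; split|move=> [[_ ?] [_ ?]]; split].
Qed.

Lemma integral_rect A B (f : 'rV[R]_d -> \bar R) (h : 'rV[R]_k -> \bar R) :
  measurable A -> measurable B -> measurable_fun A f -> measurable_fun B h ->
  (forall a, 0 <= f a)%E -> (forall b, 0 <= h b)%E ->
  (\int[L (d + k)]_(x in rect A B) (f (lsubmx x) * h (rsubmx x)) =
   \int[L d]_(a in A) f a * \int[L k]_(b in B) h b)%E.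
Proof.
move=> mA mB mf mh f0 h0.
have mfT : measurable_fun setT (f \_ A) by apply/(measurable_restrictT _ mA).
have mhT : measurable_fun setT (h \_ B) by apply/(measurable_restrictT _ mB).
have fA0 a : (0 <= (f \_ A) a)%E by rewrite patchE; case: ifP => // _; exact: f0.
have hB0 b : (0 <= (h \_ B) b)%E by rewrite patchE; case: ifP => // _; exact: h0.
pose H (x : 'rV[R]_(d + k)) : \bar R := ((f \_ A) (lsubmx x) * (h \_ B) (rsubmx x))%E.
have mH : measurable_fun setT H.
  apply: emeasurable_funM.
    by apply: (measurableT_comp mfT); exact: measurable_lsubmx.
  by apply: (measurableT_comp mhT); exact: measurable_rsubmx.
have H0 x : (0 <= H x)%E by exact: mule_ge0.
rewrite integral_mkcond (_ : (_ \_ _) = H); last first.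
  apply/funext => x; rewrite patchE /H !patchE.
  case: ifPn => [/set_mem [xA xB]|/negP nx]; first by rewrite !mem_set.
  have [xA|xA] := boolP (lsubmx x \in A); last by rewrite mul0e.
  have [xB|xB] := boolP (rsubmx x \in B); last by rewrite mule0.
  by case: nx; apply/mem_set; split; exact: set_mem.
rewrite (ge0_integral_row_mx mH H0).
rewrite (_ : (fun a => _) = (fun a => (f \_ A) a * \int[L k]_b (h \_ B) b)%E); last first.
  apply/funext => a; rewrite -ge0_integralZl//.
  by apply: eq_integral => b _; rewrite /H row_mxKl row_mxKr.
by rewrite ge0_integralZr//; [rewrite -!integral_mkcond|apply: integral_ge0].
Qed.

Lemma rect_measure A B : measurable A -> measurable B ->
  L (d + k) (rect A B) = (L d A * L k B)%E.
Proof.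
move=> mA mB; have mR := measurable_rect mA mB.
have E m (D : set 'rV[R]_m) : measurable D -> L m D = (\int[L m]_(x in D) (cst 1 x))%E.
  by move=> mD; rewrite integral_cst// mul1e.
rewrite (E _ _ mR) (E _ _ mA) (E _ _ mB).
rewrite -(integral_rect mA mB (f := cst 1%E) (h := cst 1%E))//.
by apply: eq_integral => x _; rewrite mul1e.
Qed.

Lemma measurable_fun_rsubmx dd (T : measurableType dd) B (f : 'rV[R]_k -> T) : measurable B ->
  measurable_fun B f -> measurable_fun [set x : 'rV[R]_(d + k) | B (rsubmx x)] (fun x => f (rsubmx x)).
Proof.
move=> mB mf; apply: (measurable_comp mB _ mf); first by move=> _ [x Ox <-].
by apply: measurable_funTS; exact: measurable_rsubmx.
Qed.

Lemma ae_rsubmx (P : 'rV[R]_k -> Prop) : {ae L k, forall b, P b} ->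
  {ae L (d + k), forall x, P (rsubmx x)}.
Proof.
move=> [N [mN N0 PN]]; exists (rect setT N); split.
- exact: measurable_rect.
- by rewrite rect_measure// N0 mule0.
- by move=> x nP; split => //; apply: PN.
Qed.

Lemma ae_lsubmx (P : 'rV[R]_d -> Prop) : {ae L d, forall a, P a} ->
  {ae L (d + k), forall x, P (lsubmx x)}.
Proof.
move=> [N [mN N0 PN]]; exists (rect N setT); split.
- exact: measurable_rect.
- by rewrite rect_measure// N0 mul0e.
- by move=> x nP; split => //; apply: PN.
Qed.

End rect.

Section positive_measure.
Context {R : realType}.
Local Notation L n := (lebesgue_rV R n).

Lemma lebesgue_rVT_neq0 n : L n setT != 0%E.
Proof.
elim: n => [|n IH]; first by rewrite /= diracT oner_neq0.
rewrite /= /lebesgue_rV_succ /pushforward preimage_setT -setXTT product_measure1E//.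
rewrite mule_eq0 negb_or IH andbT.
have : @lebesgue_measure R setT != 0%E by rewrite -set_itvNyy lebesgue_measure_itv/=.
exact.
Qed.

(** The complement of a bounded set has positive measure; this is where [Gamma] must
    be unbounded. *)
Lemma far_measure_neq0 n (m : R) : (0 < n)%N -> L n [set a | m < enorm a] != 0%E.
Proof.
case: n => // n _.
have mA : measurable [set a : 'rV[R]_n.+1 | m < enorm a].
  by apply: open_measurable_rV; exact: open_gt_fun (@continuous_enorm R _).
have sub : (`]m, +oo[%classic `*` setT : set (measurableTypeR R * 'rV[R]_n)) `<=`
    @cons_rV R n @^-1` [set a | m < enorm a].
  move=> [t y] [/=]; rewrite in_itv /= andbT => mt _.
  apply: (lt_le_trans mt); apply: le_trans (coord_le_enorm _ ord0).
  apply: le_trans (ler_norm _) _; rewrite /cons_rV /= (_ : ord0 = lshift n (ord0 : 'I_1)); last exact/val_inj.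
  by rewrite (@row_mxEl _ 1 1 n) mxE.
rewrite gt_eqF//; apply: (@lt_le_trans _ _ ((@lebesgue_measure R \x L n)%E (`]m, +oo[%classic `*` setT))).
  rewrite product_measure1E//; apply: mule_gt0; last by rewrite lt0e lebesgue_rVT_neq0 measure_ge0.
  by have : (0 < @lebesgue_measure R `]m, +oo[%classic)%E by rewrite lebesgue_measure_itv/= !ltry.
apply: le_measure; rewrite ?inE; [exact: measurableX| |exact: sub].
by rewrite -[X in measurable X]setTI; exact: measurable_cons_rV.
Qed.

Lemma positive_part_of_bigcup dd (T : measurableType dd) (mu : {measure set T -> \bar R}) (F : nat -> set T) :
  (forall j, measurable (F j)) -> mu (\bigcup_j F j) != 0%E -> exists j, mu (F j) != 0%E.
Proof.
move=> mF; move=> muF; apply: contrapT => /forallNP H; move/eqP: muF; apply.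
have /negligibleP -> // : mu.-negligible (\bigcup_j F j).
  apply: negligible_bigcup => j; apply/negligibleP => //.
  by apply/eqP; have /negP := H j; rewrite negbK.
exact: bigcup_measurable.
Qed.

Lemma measurable_gt_level dd (T : measurableType dd) (D : set T) (h : T -> R) (c : R) :
  measurable D -> measurable_fun D h -> measurable (D `&` [set x | c < h x]).
Proof.
move=> mD mh; have := mh mD `]c, +oo[%classic (measurable_itv _).
by congr measurable; apply/seteqP; split => x [Dx]; rewrite /= ?in_itv /= ?andbT.
Qed.

(** The sets where [h] exceeds [1 / (j + 1)] exhaust [D], so they cannot all be
    null. *)
Lemma positive_level dd (T : measurableType dd) (mu : {measure set T -> \bar R}) (D : set T) (h : T -> R) :
  measurable D -> measurable_fun D h -> (forall x, D x -> 0 < h x) -> mu D != 0%E ->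
  exists2 del : R, 0 < del & mu (D `&` [set x | del < h x]) != 0%E.
Proof.
move=> mD mh h0 D0.
have mF (j : nat) : measurable (D `&` [set x | j.+1%:R^-1 < h x]).
  exact: measurable_gt_level.
have DE : \bigcup_j (D `&` [set x | j.+1%:R^-1 < h x]) = D.
  apply/seteqP; split => [x [j _ []]//|x Dx].
  have [j hj] : exists j : nat, (h x)^-1 < j.+1%:R.
    by exists (Num.truncn (h x)^-1); exact: truncnS_gt.
  by exists j => //; split => //=; rewrite invf_plt ?posrE ?h0.
rewrite -DE in D0; have [j Fj] := positive_part_of_bigcup mF D0.
by exists j.+1%:R^-1.
Qed.

End positive_measure.

Lemma positive_integral {R : realType} dd (T : measurableType dd) (mu : {measure set T -> \bar R}) (D : set T) (h : T -> R) :
  measurable D -> measurable_fun D h -> (forall x, D x -> 0 < h x) -> mu D != 0%E ->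
  exists2 c : R, 0 < c & (c%:E <= \int[mu]_(x in D) (h x)%:E)%E.
Proof.
move=> mD mh h0 D0; have [del de0 Sn] := positive_level mD mh h0 D0.
set S := D `&` _ in Sn.
have mS : measurable S by exact: measurable_gt_level.
have S0 : (0 < mu S)%E by rewrite lt0e Sn measure_ge0.
have H : (del%:E * mu S <= \int[mu]_(x in D) (h x)%:E)%E.
  rewrite -integral_cst//; apply: (@le_trans _ _ (\int[mu]_(x in S) (h x)%:E)%E).
    apply: ge0_le_integral => //.
    - by move=> x _; rewrite lee_fin ltW.
    - by apply/measurable_EFinP; apply: measurable_funS mh => // x [].
    - by move=> x [_ /= hx]; rewrite lee_fin ltW.
  apply: ge0_subset_integral => //; first by apply/measurable_EFinP.
    by move=> x Dx; rewrite lee_fin ltW// h0.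
  by move=> x [].
case: (mu S) S0 H => [m| |] // m0 H.
  by exists (del * m); [rewrite mulr_gt0|].
exists 1 => //; apply: le_trans H; rewrite gt0_muley ?lte_fin// leey //.
Qed.

Section cusp.
Context {R : realType} (d k : nat) (r : \bar R).
Hypotheses (d0 : (0 < d)%N) (k0 : (0 < k)%N).
Local Notation L n := (lebesgue_rV R n).
Local Notation Om := (@Omega R d k r).
Local Notation HB := (half_ball r : set 'rV[R]_k).

Let oHB : open HB. Proof. exact: open_half_ball. Qed.
Let mHB : measurable HB. Proof. exact: open_measurable_rV. Qed.

Lemma half_ball_neq0 (b : 'rV[R]_k) : HB b -> 0 < enorm b.
Proof.
move=> [_ bl]; have lk : (k.-1 < k)%N by rewrite (prednK k0).
apply: lt_le_trans (coord_le_enorm b (Ordinal lk)).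
by apply: lt_le_trans (ler_norm _); exact: bl.
Qed.

Definition half_ball_off (j : nat) : set 'rV[R]_k := HB `&` [set b | j.+1%:R^-1 < enorm b].

Lemma open_half_ball_off j : open (half_ball_off j).
Proof. by apply: openI => //; exact: open_gt_fun (@continuous_enorm R k). Qed.

Lemma bigcup_half_ball_off : \bigcup_j half_ball_off j = HB.
Proof.
apply/seteqP; split => [b [j _ []]//|b Hb]; have b0 := half_ball_neq0 Hb.
have [j hj] : exists j : nat, (enorm b)^-1 < j.+1%:R.
  by exists (Num.truncn (enorm b)^-1); exact: truncnS_gt.
by exists j => //; split => //=; rewrite invf_plt ?posrE.
Qed.

Lemma half_ball_off_homo i j : (i <= j)%N -> half_ball_off i `<=` half_ball_off j.
Proof.
move=> ij b [Hb bi]; split => //=; apply: le_lt_trans bi.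
by rewrite lef_pV2 ?posrE ?ltr0Sn// ler_nat.
Qed.

Lemma closure_half_ball_off j : closure (half_ball_off j) `&` [set 0] = set0.
Proof.
apply/seteqP; split => // b [bc] /= b0.
have : [set y : 'rV[R]_k | j.+1%:R^-1 <= enorm y] b.
  have /closure_id -> := @closed_ge_fun R _ _ j.+1%:R^-1 (@continuous_enorm R k).
  by apply: closure_subset bc => y [_ /= /ltW].
by rewrite /= b0 enorm0 leNgt invr_gt0 ltr0Sn.
Qed.

(** Around [Gamma] a region is removed that may get thinner at any speed as one
    moves to infinity along [Gamma].  The closure still misses [Gamma], because
    only finitely many radii matter near a given point; hence [u] is regular on
    every cusp, whatever the radii. *)
Definition cusp (eps : nat -> R) : set 'rV[R]_(d + k) :=
  \bigcup_n (Om `&` [set x | n%:R < enorm (lsubmx x)] `&` [set x | eps n < enorm (rsubmx x)]).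

Lemma continuous_enorm_lsubmx : continuous (fun x : 'rV[R]_(d + k) => enorm (lsubmx x)).
Proof.
move=> x; apply: (@continuous_comp _ _ _ (fun x : 'rV[R]_(d + k) => lsubmx x) enorm).
  exact: continuous_lsubmx.
exact: continuous_enorm.
Qed.

Lemma open_cusp eps : open (cusp eps).
Proof.
apply: bigcup_open => n _; apply: openI; last exact: open_gt_fun (@continuous_enorm_rsubmx R d k).
by apply: openI; [exact: open_Omega|exact: open_gt_fun continuous_enorm_lsubmx].
Qed.

Lemma cusp_sub eps : cusp eps `<=` Om.
Proof. by move=> x [n _ [[]]]. Qed.

Lemma closure_cusp eps : (forall n, 0 < eps n) -> closure (cusp eps) `&` Gamma d k = set0.
Proof.
move=> eps0; apply/seteqP; split => // x [xc]; rewrite /Gamma /= => x0.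
pose m := (Num.truncn (enorm (lsubmx x))).+1.
have nl : \forall y \near x, enorm (lsubmx y) < m%:R.
  apply: open_nbhs_nbhs; split; first exact: open_lt_fun continuous_enorm_lsubmx.
  by rewrite /= truncnS_gt.
have nr : \forall y \near x, forall i : 'I_m, enorm (rsubmx y) < eps i.
  apply: (@filter_forall _ _ _ (nbhs x) (nbhs_filter x)) => i.
  apply: open_nbhs_nbhs; split; first exact: open_lt_fun (@continuous_enorm_rsubmx R d k).
  by rewrite /= x0 enorm0.
have [y [[n _ [[_ /= ny] /= ey]] [yl yr]]] := xc _ (@filterI _ _ (nbhs_filter x) _ _ nl nr).
have nm : (n < m)%N by rewrite -(@ltr_nat R); exact: lt_trans ny yl.
by have := lt_trans ey (yr (Ordinal nm)); rewrite ltxx.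
Qed.

Variables (u : 'rV[R]_(d + k) -> R) (u1 : 'rV[R]_k -> R) (u2 : 'rV[R]_d -> R).
Hypothesis uE : forall x, Om x -> u x = u1 (rsubmx x) * u2 (lsubmx x) /\ 0 < u2 (lsubmx x).
Hypothesis mu1 : measurable_fun HB u1.
Hypothesis mu2 : measurable_fun setT u2.

Let u2_gt0 b : HB b -> forall a, 0 < u2 a.
Proof.
move=> Hb a; have [] // := @uE (row_mx a b); first by rewrite /Omega /= row_mxKr.
by rewrite row_mxKl.
Qed.

Let gt_measurable (M : R) : measurable (HB `&` [set b | M < `|u1 b|]).
Proof.
have mu1' : measurable_fun HB (fun b => `|u1 b|) by exact: measurableT_comp.
exact: measurable_gt_level.
Qed.

(** Were [u1] unbounded near [0], the [n]th radius could be chosen so small that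
    [|u1|] exceeds [n / del] on a non-null set of points at distance more than
    this radius, while [u2 > del] on a non-null set beyond distance [n].  On the
    product of both sets, which lies in the cusp, [|u|] exceeds [n]. *)
Lemma bounded_of_cusps :
  (forall eps, (forall n, 0 < eps n) -> Linfty (cusp eps) u) ->
  exists2 M : R, 0 <= M & {ae L k, forall b, HB b -> `|u1 b| <= M}.
Proof.
move=> Lu; apply: contrapT => nM.
have big M : 0 <= M -> L k (HB `&` [set b | M < `|u1 b|]) != 0%E.
  move=> M0; apply/negP => /eqP z; apply: nM; exists M => //.
  exists (HB `&` [set b | M < `|u1 b|]); split => // b /= nb.
  by apply: contrapT => h; apply: nb => Hb; rewrite leNgt; apply/negP => h'; apply: h.
have [b0 Hb0] : exists b, HB b.
  apply: contrapT => /forallNP nH; have /eqP := big 0 (lexx _); apply.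
  rewrite (_ : _ `&` _ = set0) ?measure0//; apply/seteqP; split => // b [Hb _]; exact: nH Hb.
have pos a := u2_gt0 Hb0 a.
(* [del n] is a positive value exceeded by [u2] on a non-null part of [far n];
   the [n]th radius is then chosen after [del n]. *)
pose far n := [set a : 'rV[R]_d | n%:R < enorm a].
have mfar n : measurable (far n) by apply: open_measurable_rV; exact: open_gt_fun (@continuous_enorm R _).
have lev n : exists del : R, 0 < del /\ L d (far n `&` [set a | del < u2 a]) != 0%E.
  have [del] := positive_level (mfar n) (measurable_funTS mu2) (fun a _ => pos a) (far_measure_neq0 n%:R d0).
  by exists del.
have [del Hdel] := choice lev.
have rad n : exists j, L k (half_ball_off j `&` (HB `&` [set b | n%:R / del n < `|u1 b|])) != 0%E.
  apply: positive_part_of_bigcup.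
    move=> j; apply: measurableI => //; apply: open_measurable_rV; exact: open_half_ball_off.
  rewrite -setI_bigcupl bigcup_half_ball_off setIA setIid; apply: big.
  by rewrite divr_ge0// ltW//; have [] := Hdel n.
have [j Hj] := choice rad.
pose eps n : R := (j n).+1%:R^-1.
have eps0 n : 0 < eps n by rewrite invr_gt0 ltr0Sn.
have [_ [M HM]] := Lu _ eps0.
pose n := (Num.truncn M).+1.
have nM' : M < n%:R by exact: truncnS_gt.
have [de0 dn] := Hdel n.
pose A := far n `&` [set a | del n < u2 a].
pose B := half_ball_off (j n) `&` (HB `&` [set b | n%:R / del n < `|u1 b|]).
have mA : measurable A.
  exact: measurable_gt_level (measurable_funTS mu2).
have mB : measurable B by apply: measurableI => //; apply: open_measurable_rV; exact: open_half_ball_off.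
have : L (d + k) (rect A B) != 0%E by rewrite rect_measure// mule_eq0 negb_or dn Hj.
move/eqP; apply; apply/negligibleP; first exact: measurable_rect.
have [N [mN N0 HN]] := HM; exists N; split => // x [[xn xd] [[xH xe] [_ xu]]].
apply: HN => /= /(_ _)/wrap[]; first by exists n.
have Ox : Om x by [].
have [-> _] := uE Ox; rewrite normrM (gtr0_norm (pos _)); apply/negP; rewrite -ltNge.
apply: (lt_trans nM'); rewrite -(@divfK _ (del n) _ n%:R) ?gt_eqF//.
by apply: ltr_pM => //; rewrite ?divr_ge0// ltW.
Qed.

Variables (p alpha : R) (G1 : 'rV[R]_k -> 'rV[R]_k).
Hypotheses (p0 : 0 < p) (alpha0 : 0 <= alpha).
Hypothesis mG1 : forall i, measurable_fun HB (fun b => G1 b ord0 i).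

Definition half_ball_unit : set 'rV[R]_k := HB `&` [set b | enorm b < 1].

(** Likewise for the gradient of [u1]: were its integral infinite, each radius
    could be taken so small that the part of the cusp beyond distance [n] already
    contributes at least [n]. *)
Lemma gradient_fin_of_cusps :
  (forall eps, (forall n, 0 < eps n) ->
    (\int[L (d + k)]_(x in cusp eps)
      ((u2 (lsubmx x) * enorm (G1 (rsubmx x))) `^ p * weight alpha x)%:E < +oo)%E) ->
  (\int[L k]_(b in half_ball_unit) (enorm (G1 b) `^ p)%:E < +oo)%E.
Proof.
move=> Hc; rewrite ltey; apply/negP => /eqP Ioo.
have [b0 Hb0] : exists b, HB b.
  apply: contrapT => /forallNP nH; move: Ioo.
  by rewrite (_ : half_ball_unit = set0) ?integral_set0//; apply/seteqP; split => // b [Hb _]; exact: nH Hb.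
have pos a := u2_gt0 Hb0 a.
pose far n := [set a : 'rV[R]_d | n%:R < enorm a].
have mfar n : measurable (far n) by apply: open_measurable_rV; exact: open_gt_fun (@continuous_enorm R _).
(* For [|x'| < 1] the weight is at least [(2 + |x''|) `^ (- alpha)], so that
   [f] and [h] separate the variables of the integrand from below. *)
pose f a : R := u2 a `^ p * (2 + enorm a) `^ (- alpha).
pose h b : R := enorm (G1 b) `^ p.
have f_gt0 a : 0 < f a by rewrite mulr_gt0 ?powR_gt0// ltr_wpDr ?enorm_ge0.
have h_ge0 b : 0 <= h b by exact: powR_ge0.
have mf : measurable_fun setT f.
  apply: measurable_funM; first by apply: (measurableT_comp (measurable_powR p)).
  apply: (measurableT_comp (measurable_powR _)); apply: measurable_funD => //.
  exact: continuous_measurable_rV (@continuous_enorm R _).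
have mh : measurable_fun HB h.
  apply: (measurableT_comp (measurable_powR p)); exact: measurable_enorm.
have cn n : exists c : R, 0 < c /\ (c%:E <= \int[L d]_(a in far n) (f a)%:E)%E.
  have [c] := positive_integral (mfar n) (measurable_funTS mf) (fun a _ => f_gt0 a) (far_measure_neq0 n%:R d0).
  by exists c.
have [c Hc'] := choice cn.
pose B j := half_ball_off j `&` [set b | enorm b < 1].
have o1 : open [set b : 'rV[R]_k | enorm b < 1] by exact: open_lt_fun (@continuous_enorm R _).
have mB j : measurable (B j).
  by apply: open_measurable_rV; apply: openI => //; exact: open_half_ball_off.
have BH j : B j `<=` HB by move=> b [[]].
have radius n : exists j, ((n%:R / c n)%:E <= \int[L k]_(b in B j) (h b)%:E)%E.
  apply: contrapT => /forallNP nj.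
  have := @ge0_nondecreasing_set_cvg_integral _ _ _ B (fun b => (h b)%:E) (L k).
  have -> : \bigcup_j B j = half_ball_unit by rewrite -setI_bigcupl bigcup_half_ball_off.
  rewrite Ioo => /(_ _ mB) cv.
  have {}cv : (\int[L k]_(x in B i) (h x)%:E)%E @[i --> \oo] --> +oo%E.
    apply: cv.
    - by move=> i j ij; apply/subsetPset => b [bi b1]; split => //; exact: half_ball_off_homo bi.
    - by move=> i; apply/measurable_EFinP; exact: measurable_funS (BH i) mh.
    - by move=> i b _; rewrite lee_fin.
  have : (+oo <= (n%:R / c n)%:E :> \bar R)%E; last by rewrite leye_eq.
  rewrite -(cvg_lim _ cv)//; apply: lime_le; first by apply: cvgP cv.
  by apply: nearW => j; have /negP := nj j; rewrite -ltNge => /ltW.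
have [j Hj] := choice radius.
pose eps n : R := (j n).+1%:R^-1.
have eps0 n : 0 < eps n by rewrite invr_gt0 ltr0Sn.
have mOm : measurable Om by apply: open_measurable_rV; exact: open_Omega.
have mG1x : measurable_fun Om (fun x => enorm (G1 (rsubmx x))).
  apply: (@measurable_fun_rsubmx R d k _ _ HB (fun b => enorm (G1 b))) => //.
  exact: measurable_enorm.
have mF : measurable_fun Om (fun x => ((u2 (lsubmx x) * enorm (G1 (rsubmx x))) `^ p * weight alpha x)%:E).
  apply/measurable_EFinP; apply: measurable_funM.
    apply: (measurableT_comp (measurable_powR p)); apply: measurable_funM => //.
    by apply: measurable_funTS; apply: (measurableT_comp mu2); exact: measurable_lsubmx.
  apply: (measurableT_comp (measurable_powR _)); apply: measurable_funD => //.
  by apply: measurable_funTS; exact: continuous_measurable_rV (@continuous_enorm R _).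
have mF1 : measurable_fun Om (fun x => ((f (lsubmx x))%:E * (h (rsubmx x))%:E)%E).
  apply/measurable_EFinP; apply: measurable_funM.
    by apply: measurable_funTS; apply: (measurableT_comp mf); exact: measurable_lsubmx.
  exact: (measurableT_comp (measurable_powR p) mG1x).
have := Hc _ eps0; set I := (\int[_]_(x in cusp eps) _)%E => Ifin.
(* The part of the cusp over [far n] and off the [n]th radius contributes at
   least [c n * (n / c n)]. *)
have In n : (n%:R%:E <= I)%E.
  have [c0 Hcn] := Hc' n.
  apply: (@le_trans _ _ (\int[L d]_(a in far n) (f a)%:E * \int[L k]_(b in B (j n)) (h b)%:E)%E).
    apply: (@le_trans _ _ ((c n)%:E * (n%:R / c n)%:E)%E).
      by rewrite -EFinM mulrC divfK ?gt_eqF.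
    by apply: lee_pmul => //; rewrite lee_fin ?divr_ge0// ltW.
  have mfn : measurable_fun (far n) (fun a => (f a)%:E) by apply/measurable_EFinP; exact: measurable_funTS.
  have mhn : measurable_fun (B (j n)) (fun b => (h b)%:E) by apply/measurable_EFinP; exact: measurable_funS (BH _) mh.
  have f0 a : (0 <= (f a)%:E)%E by rewrite lee_fin ltW.
  have h0 b : (0 <= (h b)%:E)%E by rewrite lee_fin.
  rewrite -(integral_rect (mfar n) (mB (j n)) mfn mhn f0 h0).
  apply: (@le_trans _ _ (\int[L (d + k)]_(x in rect (far n) (B (j n)))
      ((u2 (lsubmx x) * enorm (G1 (rsubmx x))) `^ p * weight alpha x)%:E)%E).
    apply: ge0_le_integral => //.
    - exact: measurable_rect.
    - by move=> x _; rewrite -EFinM lee_fin mulr_ge0// ltW.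
    - by apply: measurable_funS mF1 => // x [_ /BH].
    - by apply: measurable_funS mF => // x [_ /BH].
    move=> x [_ [_ /= x1]]; rewrite -EFinM lee_fin /f /h powRM ?enorm_ge0 ?(ltW (pos _))//.
    rewrite mulrAC ler_wpM2l ?mulr_ge0 ?powR_ge0// /weight !powRN lef_pV2 ?posrE ?powR_gt0 ?ltr_wpDr ?enorm_ge0//.
    apply: powR_le => //; first by rewrite addr_ge0// enorm_ge0.
    by have := enorm_le_split x; lra.
  apply: ge0_subset_integral => //.
  - exact: measurable_rect.
  - by apply: open_measurable_rV; exact: open_cusp.
  - by apply: measurable_funS mF => //; exact: cusp_sub.
  - by move=> x _; rewrite lee_fin mulr_ge0 ?powR_ge0.
  - by move=> x [xa [[xH xe] _]]; exists n.
have In0 : (0 <= I)%E by exact: le_trans (In 0%N).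
have Ifi : I \is a fin_num by rewrite ge0_fin_numE.
have := In (Num.truncn (fine I)).+1; rewrite -(fineK Ifi) lee_fin leNgt => /negP; apply.
exact: truncnS_gt.
Qed.

End cusp.

(** * Sobolev regularity of the solution up to the singular set *)

Section sobolev_of_product.
Context {R : realType} (d k : nat) (r : \bar R).
Hypotheses (d0 : (0 < d)%N) (k0 : (0 < k)%N).
Local Notation L n := (lebesgue_rV R n).
Local Notation Om := (@Omega R d k r).
Local Notation HB := (half_ball r : set 'rV[R]_k).
Variables (p alpha : R).
Hypotheses (p0 : 0 < p) (alpha0 : 0 <= alpha).

Lemma integral_setU_fin dd (T : measurableType dd) (mu : {measure set T -> \bar R}) (A B : set T) (f : T -> \bar R) :
  measurable A -> measurable B -> measurable_fun (A `|` B) f -> (forall x, 0 <= f x)%E ->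
  (\int[mu]_(x in A) f x < +oo)%E -> (\int[mu]_(x in B) f x < +oo)%E ->
  (\int[mu]_(x in A `|` B) f x < +oo)%E.
Proof.
move=> mA mB mf f0 fA fB.
have mBA : measurable (B `\` A) by exact: measurableD.
rewrite (_ : A `|` B = A `|` (B `\` A)); last first.
  apply/seteqP; split => x [Ax|Bx]; [by left| |by left|by right; case: Bx].
  by have [Ax|nAx] := pselect (A x); [left|right].
rewrite ge0_integral_setU//; last 2 first.
- by apply: measurable_funS mf; [exact: measurableU|move=> x [|[]]; [left|right]].
- by apply/disj_setPS => x [Ax []].
apply: lte_add_pinfty => //; apply: le_lt_trans fB; apply: ge0_subset_integral => //.
  by apply: measurable_funS mf => [|x Bx]; [exact: measurableU|right].
Qed.

Lemma weight_ge0 n (a : R) (x : 'rV[R]_n) : 0 <= weight a x.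
Proof. exact: powR_ge0. Qed.

Lemma weight_le_lsub (x : 'rV[R]_(d + k)) : weight alpha x <= weight alpha (lsubmx x).
Proof.
rewrite /weight !powRN lef_pV2 ?posrE ?powR_gt0 ?ltr_pwDl ?enorm_ge0//.
by apply: powR_le => //; [rewrite addr_ge0 ?enorm_ge0|rewrite lerD2l; exact: enorm_lsub_le].
Qed.

Lemma measurable_weight n (a : R) (D : set 'rV[R]_n) : measurable_fun D (weight a).
Proof.
apply: measurable_funTS; apply: (measurableT_comp (measurable_powR _)); apply: measurable_funD => //.
exact: continuous_measurable_rV (@continuous_enorm R _).
Qed.

Lemma half_ball_unit_fin : (L k (@half_ball_unit R k r) < +oo)%E.
Proof.
apply: le_lt_trans (@cbox_fin R k (fun=> - 1) (fun=> 1)).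
apply: le_measure; rewrite ?inE; last first.
- by move=> x [_ /= xe] i; rewrite -ler_norml (le_trans (coord_le_enorm _ _))// ltW.
- exact: measurable_cbox.
apply: open_measurable_rV; apply: openI; first exact: open_half_ball.
exact: open_lt_fun (@continuous_enorm R k).
Qed.

Variables (u : 'rV[R]_(d + k) -> R) (u1 : 'rV[R]_k -> R) (u2 : 'rV[R]_d -> R).
Hypothesis uE : forall x, Om x -> u x = u1 (rsubmx x) * u2 (lsubmx x) /\ 0 < u2 (lsubmx x).
Hypothesis W1 : locally_off (W1p p (weight alpha)) HB [set 0] u1.
Hypothesis W2 : W1p p (weight alpha) setT u2.
Hypothesis B2 : Linfty setT u2.
Hypothesis Wu : locally_off (W1p p (weight alpha)) Om (Gamma d k) u.
Hypothesis Bu : locally_off Linfty Om (Gamma d k) u.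

Let oHB : open HB. Proof. exact: open_half_ball. Qed.
Let mHB : measurable HB. Proof. exact: open_measurable_rV oHB. Qed.
Let oOm : open Om. Proof. exact: open_Omega. Qed.
Let mOm : measurable Om. Proof. exact: open_measurable_rV oOm. Qed.

(** Regularity on all cusps forbids any singularity: it bounds [u1] and makes the
    gradient of [u1] integrable near [0], after which the integrals over the part
    of [Om] near [Gamma] factor into those of [u1] and [u2].  Away from [Gamma]
    there is nothing to prove. *)
Lemma sobolev_of_product : W1p p (weight alpha) Om u /\ Linfty Om u.
Proof.
have [G1 HG1] : exists G, is_weak_gradient HB u1 G.
  apply: (@weak_grad_glue R k HB (@half_ball_off R k r)).
  - exact: oHB.
  - by move=> j; exact: (@open_half_ball_off R k r k0 j).
  - by move=> i j ij; exact: half_ball_off_homo.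
  - exact: (@bigcup_half_ball_off R k r k0).
  move=> j; have [] // := W1 (@open_half_ball_off R k r k0 j) _ (@closure_half_ball_off R k r j).
  by move=> b [].
have mu1 : measurable_fun HB u1 by exact: HG1.1.1.
have mG1 i : measurable_fun HB (fun b => G1 b ord0 i) by exact: weak_grad_measurable HG1.
have [[mu2 Iu2] exG2 [_ IG2]] := W2.
set G2 := weak_gradient setT u2 in IG2.
have HG2 : is_weak_gradient setT u2 G2 by exact: weak_gradientP.
have mG2 i : measurable_fun setT (fun b => G2 b ord0 i) by exact: weak_grad_measurable HG2.
have [M1 M10 HM1] := bounded_of_cusps d0 k0 uE mu1 mu2
  (fun eps e0 => Bu (@open_cusp R d k r k0 eps) (@cusp_sub R d k r eps) (@closure_cusp R d k r eps e0)).
have [_ [M2 HM2]] := B2.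
pose G (x : 'rV[R]_(d + k)) := row_mx (u1 (rsubmx x) *: G2 (lsubmx x)) (u2 (lsubmx x) *: G1 (rsubmx x)).
have HG : is_weak_gradient Om u G.
  apply: weak_grad_eq (weak_grad_prod oHB HG1 HG2) => x /set_mem Ox.
  by have [-> _] := uE Ox.
have mu : measurable_fun Om u by exact: HG.1.1.
have mG i : measurable_fun Om (fun x => G x ord0 i) by exact: weak_grad_measurable HG.
have bu : {ae L (d + k), forall x, Om x -> `|u x| <= M1 * M2}.
  apply: filterS2 (ae_rsubmx (d := d) HM1) (ae_lsubmx (k := k) HM2) => x h1 h2 Ox.
  have [-> _] := uE Ox; rewrite normrM; apply: ler_pM => //; [exact: h1|exact: h2].
split; last by split => //; exists (M1 * M2).
have exG : exists G, is_weak_gradient Om u G by exists G.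
have mG1x : measurable_fun Om (fun x => enorm (G1 (rsubmx x))).
  apply: (@measurable_fun_rsubmx R d k _ _ HB (fun b => enorm (G1 b)) mHB).
  exact: measurable_enorm.
have mu2x : measurable_fun setT (fun x : 'rV[R]_(d + k) => u2 (lsubmx x)).
  by apply: (measurableT_comp mu2); exact: measurable_lsubmx.
have GE x : enorm (G x) ^+ 2 = (`|u1 (rsubmx x)| * enorm (G2 (lsubmx x))) ^+ 2 +
    (`|u2 (lsubmx x)| * enorm (G1 (rsubmx x))) ^+ 2.
  by rewrite enorm_sqr_split row_mxKl row_mxKr !enormZ.
have ae_int (D : set 'rV[R]_(d + k)) (v v' : 'rV[R]_(d + k) -> 'rV[R]_(d + k)) : measurable D ->
    (forall i, measurable_fun D (fun x => v x ord0 i)) -> (forall i, measurable_fun D (fun x => v' x ord0 i)) ->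
    {ae L (d + k), forall x, D x -> v x = v' x} ->
    (\int[L (d + k)]_(x in D) (`|enorm (v x)| `^ p * weight alpha x)%:E =
     \int[L (d + k)]_(x in D) (`|enorm (v' x)| `^ p * weight alpha x)%:E)%E.
  move=> mD mv mv' vv'; apply: ge0_ae_eq_integral => //.
  - apply/measurable_EFinP; apply: measurable_funM; last exact: measurable_weight.
    by apply: measurable_powR_abs; exact: measurable_enorm.
  - apply/measurable_EFinP; apply: measurable_funM; last exact: measurable_weight.
    by apply: measurable_powR_abs; exact: measurable_enorm.
  - by move=> x _; rewrite lee_fin mulr_ge0 ?powR_ge0.
  - by move=> x _; rewrite lee_fin mulr_ge0 ?powR_ge0.
  by apply: filterS vv' => x h Dx; rewrite h.
have fin_sub U : open U -> U `<=` Om -> closure U `&` Gamma d k = set0 ->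
    (\int[L (d + k)]_(x in U) (`|enorm (G x)| `^ p * weight alpha x)%:E < +oo)%E.
  move=> oU UO cU; have [_ exGU [mgU IgU]] := Wu oU UO cU.
  have mU := open_measurable_rV oU; have HGU := weak_grad_sub oOm oU UO HG.
  rewrite -(ae_int U (weak_gradient U u)) //.
  - by move=> i; exact: weak_grad_measurable (weak_gradientP exGU).
  - by move=> i; exact: weak_grad_measurable HGU.
  - exact: weak_gradientE.
have IG1 : (\int[L k]_(b in @half_ball_unit R k r) (enorm (G1 b) `^ p)%:E < +oo)%E.
  apply: (gradient_fin_of_cusps d0 k0 uE mu2 alpha0 mG1) => eps e0.
  have oU := @open_cusp R d k r k0 eps; have mU := open_measurable_rV oU.
  have UO := @cusp_sub R d k r eps.
  apply: le_lt_trans (fin_sub _ oU UO (@closure_cusp R d k r eps e0)).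
  apply: ge0_le_integral => //.
  - by move=> x _; rewrite lee_fin mulr_ge0 ?powR_ge0.
  - apply/measurable_EFinP; apply: measurable_funM; last exact: measurable_weight.
    apply: (measurableT_comp (measurable_powR p)); apply: measurable_funM; first exact: measurable_funTS.
    exact: measurable_funS UO mG1x.
  - apply/measurable_EFinP; apply: measurable_funM; last exact: measurable_weight.
    by apply: measurable_powR_abs; apply: measurable_enorm => i; exact: measurable_funS UO (mG i).
  move=> x Ux; rewrite lee_fin ler_wpM2r ?powR_ge0//.
  have [_ u20] := uE (UO _ Ux).
  apply: powR_le; [exact: ltW|by rewrite mulr_ge0 ?enorm_ge0// ltW|].
  rewrite ger0_norm ?enorm_ge0// -(@ler_pXn2r _ 2) ?nnegrE ?mulr_ge0 ?enorm_ge0 ?(ltW u20)//.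
  by have -> := GE x; rewrite (gtr0_norm u20) lerDr sqr_ge0.
(* [O1] keeps away from [Gamma] and is covered by the hypothesis on [u];
   [O2] is a product set around [Gamma], where the variables separate. *)
pose O1 := Om `&` [set x | 2^-1 < enorm (rsubmx x)].
pose O2 := rect (setT : set 'rV[R]_d) (@half_ball_unit R k r).
have oO1 : open O1 by apply: openI => //; exact: open_gt_fun (@continuous_enorm_rsubmx R d k).
have O1O : O1 `<=` Om by move=> x [].
have cO1 : closure O1 `&` Gamma d k = set0.
  apply/seteqP; split => // x [xc]; rewrite /Gamma /= => x0.
  have : [set y : 'rV[R]_(d + k) | 2^-1 <= enorm (rsubmx y)] x.
    have /closure_id -> := @closed_ge_fun R _ _ 2^-1 (@continuous_enorm_rsubmx R d k).
    by apply: closure_subset xc => y [_ /= /ltW].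
  by rewrite /= x0 enorm0 leNgt invr_gt0 ltr0Sn.
have mO1 := open_measurable_rV oO1.
have mHU : measurable (@half_ball_unit R k r).
  by apply: open_measurable_rV; apply: openI => //; exact: open_lt_fun (@continuous_enorm R k).
have mO2 : measurable O2 by exact: measurable_rect.
have OE : Om = O1 `|` O2.
  apply/seteqP; split => [x Ox|x [[]//|[_ []//]]].
  have [h|h] := ltP 2^-1 (enorm (rsubmx x)); [by left|right; split => //; split => //=].
  by apply: le_lt_trans h _; lra.
have O2O : O2 `<=` Om by rewrite OE => x; right.
have fin2 (f : 'rV[R]_d -> R) (h : 'rV[R]_k -> R) : measurable_fun setT f ->
    measurable_fun (@half_ball_unit R k r) h -> (forall a, 0 <= f a) -> (forall b, 0 <= h b) ->
    (\int[L d]_a (f a)%:E < +oo)%E -> (\int[L k]_(b in @half_ball_unit R k r) (h b)%:E < +oo)%E ->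
    (\int[L (d + k)]_(x in O2) (f (lsubmx x) * h (rsubmx x))%:E < +oo)%E.
  move=> mf mh f0 h0 If Ih.
  under eq_integral do rewrite EFinM.
  rewrite (@integral_rect R d k _ _ (fun a => (f a)%:E) (fun b => (h b)%:E) measurableT mHU).
  - apply: lte_mul_pinfty => //; first by apply: integral_ge0 => a _; rewrite lee_fin.
    by rewrite ge0_fin_numE//; apply: integral_ge0 => a _; rewrite lee_fin.
  - exact/measurable_EFinP.
  - exact/measurable_EFinP.
  - by move=> a; rewrite lee_fin.
  - by move=> a; rewrite lee_fin.
have cst_fin (c : R) : 0 <= c -> (\int[L k]_(b in @half_ball_unit R k r) (c%:E) < +oo)%E.
  move=> c0; rewrite integral_cst//; apply: lte_mul_pinfty => //; exact: half_ball_unit_fin.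
pose f2 a := `|u2 a| `^ p * weight alpha a.
pose fG a := `|enorm (G2 a)| `^ p * weight alpha a.
have f20 a : 0 <= f2 a by rewrite mulr_ge0 ?powR_ge0.
have fG0 a : 0 <= fG a by rewrite mulr_ge0 ?powR_ge0.
have mf2 : measurable_fun setT f2.
  by apply: measurable_funM; [exact: measurable_powR_abs|exact: measurable_weight].
have mfG : measurable_fun setT fG.
  apply: measurable_funM; last exact: measurable_weight.
  by apply: measurable_powR_abs; exact: measurable_enorm.
pose h1 b := 2 `^ p * enorm (G1 b) `^ p.
have h10 b : 0 <= h1 b by rewrite mulr_ge0 ?powR_ge0.
have mh : measurable_fun (@half_ball_unit R k r) (fun b => enorm (G1 b) `^ p).
  apply: (measurableT_comp (measurable_powR p)); apply: measurable_enorm => i.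
  by apply: measurable_funS (mG1 i) => // b [].
have mh1 : measurable_fun (@half_ball_unit R k r) h1 by apply: measurable_funM => //; exact: measurable_cst.
have h1fin : (\int[L k]_(b in @half_ball_unit R k r) (h1 b)%:E < +oo)%E.
  under eq_integral do rewrite EFinM.
  rewrite ge0_integralZl//; last 2 first.
  - exact/measurable_EFinP.
  - by move=> b _; rewrite lee_fin powR_ge0.
  by apply: lte_mul_pinfty => //; rewrite lee_fin powR_ge0.
have bu1 : {ae L (d + k), forall x, Om x -> `|u1 (rsubmx x)| <= M1}.
  by apply: filterS (ae_rsubmx (d := d) HM1) => x h Ox; exact: h.
have mp (g : 'rV[R]_(d + k) -> R) (D : set 'rV[R]_(d + k)) : measurable D -> D `<=` Om -> measurable_fun Om g ->
    measurable_fun D (fun x => (`|g x| `^ p * weight alpha x)%:E).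
  move=> mD DO mg; apply/measurable_EFinP; apply: measurable_funM; last exact: measurable_weight.
  by apply: measurable_powR_abs; exact: measurable_funS DO mg.
have mlr (f : 'rV[R]_d -> R) (h : 'rV[R]_k -> R) : measurable_fun setT f ->
    measurable_fun (@half_ball_unit R k r) h -> measurable_fun O2 (fun x => (f (lsubmx x) * h (rsubmx x))%:E).
  move=> mf mh'; apply/measurable_EFinP; apply: measurable_funM.
    by apply: measurable_funTS; apply: (measurableT_comp mf); exact: measurable_lsubmx.
  rewrite (_ : O2 = [set x | (@half_ball_unit R k r) (rsubmx x)]); last by apply/seteqP; split => x; [case|split].
  exact: measurable_fun_rsubmx.
have pos_p (g : 'rV[R]_(d + k) -> R) x : (0 <= (`|g x| `^ p * weight alpha x)%:E)%E.
  by rewrite lee_fin mulr_ge0 ?powR_ge0.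
have mGx : measurable_fun Om (fun x => enorm (G x)) by exact: measurable_enorm.
have Iu : (\int[L (d + k)]_(x in Om) (`|u x| `^ p * weight alpha x)%:E < +oo)%E.
  rewrite OE; apply: (integral_setU_fin mO1 mO2).
  - by rewrite -OE; exact: mp.
  - exact: pos_p.
  - by have [[_ h] _ _] := Wu oO1 O1O cO1.
  have c0 : 0 <= M1 `^ p by exact: powR_ge0.
  apply: le_lt_trans (fin2 f2 (fun=> M1 `^ p) mf2 (measurable_cst _) f20 (fun=> c0) Iu2 (cst_fin _ c0)).
  apply: ae_ge0_le_integral => //.
  - exact: mp.
  - by move=> x _; rewrite lee_fin mulr_ge0.
  - by apply: (mlr f2 (fun=> M1 `^ p)) => //; exact: measurable_cst.
  apply: filterS bu1 => x h Ox; have {}h := h (O2O _ Ox).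
  have [-> _] := uE (O2O _ Ox); rewrite lee_fin normrM powRM// /f2 -mulrA mulrC.
  apply: ler_pM; rewrite ?mulr_ge0 ?powR_ge0//; last by apply: powR_le => //; exact: ltW.
  by rewrite ler_wpM2l ?powR_ge0//; exact: weight_le_lsub.
have IG : (\int[L (d + k)]_(x in Om) (`|enorm (G x)| `^ p * weight alpha x)%:E < +oo)%E.
  rewrite OE; apply: (integral_setU_fin mO1 mO2).
  - by rewrite -OE; exact: mp Om mOm (fun x => id) mGx.
  - by move=> x; exact: pos_p (fun x => enorm (G x)) x.
  - exact: fin_sub.
  have c0 : 0 <= 2 `^ p * M1 `^ p by rewrite mulr_ge0 ?powR_ge0.
  have i1 := fin2 fG (fun=> 2 `^ p * M1 `^ p) mfG (measurable_cst _) fG0 (fun=> c0) IG2 (cst_fin _ c0).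
  have i2 := fin2 f2 h1 mf2 mh1 f20 h10 Iu2 h1fin.
  apply: le_lt_trans (lte_add_pinfty i1 i2).
  have m1 : measurable_fun O2 (fun x => (fG (lsubmx x) * (2 `^ p * M1 `^ p))%:E).
    by apply: (mlr fG (fun=> 2 `^ p * M1 `^ p)) => //; exact: measurable_cst.
  have m2 := mlr f2 h1 mf2 mh1.
  rewrite -ge0_integralD//; last 2 first.
  - by move=> x _; rewrite lee_fin mulr_ge0.
  - by move=> x _; rewrite lee_fin mulr_ge0.
  apply: ae_ge0_le_integral => //.
  - by move=> x _; exact: pos_p (fun x => enorm (G x)) x.
  - exact: mp O2 mO2 O2O mGx.
  - by move=> x _; rewrite -EFinD lee_fin addr_ge0// mulr_ge0.
  - exact: emeasurable_funD.
  apply: filterS bu1 => x h Ox; have {}h := h (O2O _ Ox).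
  rewrite -EFinD lee_fin /fG /f2 /h1 ger0_norm ?enorm_ge0//.
  have w1 := weight_le_lsub x; have w0 := weight_ge0 alpha x.
  have eG : enorm (G x) `^ p <= 2 `^ p * (M1 `^ p * `|enorm (G2 (lsubmx x))| `^ p + `|u2 (lsubmx x)| `^ p * enorm (G1 (rsubmx x)) `^ p).
    apply: (@le_trans _ _ ((M1 * `|enorm (G2 (lsubmx x))| + `|u2 (lsubmx x)| * enorm (G1 (rsubmx x))) `^ p)).
      apply: powR_le; [exact: ltW|exact: enorm_ge0|].
      apply: le_trans (enorm_le_split _) _; rewrite row_mxKl row_mxKr !enormZ.
      by rewrite lerD2r ler_pM ?enorm_ge0// ger0_norm ?enorm_ge0.
    rewrite -!powRM ?enorm_ge0//.
    by apply: powR_add_le; rewrite ?mulr_ge0 ?enorm_ge0// ltW.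
  apply: le_trans (ler_pM _ w0 eG w1) _; first exact: powR_ge0.
  by rewrite le_eqVlt; apply/orP; left; apply/eqP; ring.
have mW i : measurable_fun Om (fun x => weak_gradient Om u x ord0 i).
  exact: weak_grad_measurable (weak_gradientP exG).
split; [by split|exact: exG|split; first exact: measurable_enorm].
have -> := ae_int Om (weak_gradient Om u) G mOm mW mG (weak_gradientE oOm HG).
exact: IG.
Qed.

End sobolev_of_product.

(** * Cutoff functions on pieces of the singular set *)

Section cutoff.
Context {R : realType}.
Local Notation L n := (lebesgue_rV R n).
Local Notation S := (@smooth_step R).

Lemma smooth_step_derive_bounded : exists2 C : R, 0 <= C & forall t, `|derive1 S t| <= C.
Proof.
have cS : continuous (derive1 S) by exact: smooth1_continuous (smooth1_derive (@smooth1_step R)).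
have cK : compact `[(0 : R), 1] by exact: segment_compact.
have /compact_bounded [M [Mr HM]] : compact (derive1 S @` `[(0 : R), 1]).
  by apply: continuous_compact => //; exact: continuous_subspaceT.
exists (`|M| + 1) => [|t]; first by rewrite addr_ge0.
have [t01|nt] := pselect (0 <= t <= 1).
  apply: (HM (`|M| + 1)); first by rewrite (le_lt_trans (ler_norm _)) ?ltrDl.
  by exists t => //; rewrite /= in_itv.
rewrite smooth_step_derive_out ?normr0 ?addr_ge0//.
have [t0|t0] := ltP t 0; [by left|right].
by rewrite ltNge; apply/negP => t1; apply: nt; rewrite t0.
Qed.

Lemma cube_measure n (s : R) : 0 <= s -> L n (cbox (fun=> - s) (fun=> s)) = ((2 * s) ^+ n)%:E.
Proof.
move=> s0; rewrite cbox_measure.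
have -> : (2 * s) ^+ n = \prod_(i < n) (2 * s) by rewrite prodr_const card_ord.
rewrite -prodEFin; apply: eq_bigr => i _; rewrite lebesgue_measure_itv /= lte_fin.
case: ifPn => [_|]; first by rewrite -EFinB; congr EFin; lra.
by rewrite -leNgt => h; congr EFin; lra.
Qed.

Variables (d k : nat).
Local Notation n := (d + k)%N.
Implicit Types x : 'rV[R]_n.

Definition head_sq x : R := dotrV x x - tail_sq d x.

Lemma head_sqE x : head_sq x = enorm (lsubmx x) ^+ 2.
Proof. by rewrite /head_sq -enorm_sqr enorm_sqr_split enorm_rsubmx addrK. Qed.

Lemma head_sq_ge0 x : 0 <= head_sq x.
Proof. by rewrite head_sqE sqr_ge0. Qed.

Lemma smooth_dotrV2 : smooth (fun x => dotrV x x).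
Proof. by apply: smooth_sum => i; apply: smoothM; exact: smooth_coord. Qed.

Lemma smooth_head_sq : smooth head_sq.
Proof. by apply: smoothB; [exact: smooth_dotrV2|exact: smooth_tail_sq]. Qed.

Lemma partial_sqr (j i : 'I_n) x : partial i (fun x => x ord0 j * x ord0 j) x = (j == i)%:R * (2 * x ord0 j).
Proof. by rewrite partialM ?partial_coord; [ring|exact: smooth_coord|exact: smooth_coord]. Qed.

Lemma partial_head_sq i x : partial i head_sq x = if (d <= i)%N then 0 else 2 * x ord0 i.
Proof.
rewrite /head_sq partialB; [|exact: smooth_dotrV2|exact: smooth_tail_sq].
have -> : partial i (fun x => dotrV x x) x = 2 * x ord0 i.
  rewrite /dotrV partial_sum; last by move=> j; apply: smoothM; exact: smooth_coord.
  rewrite (bigD1 i)//= big1 ?addr0 => [|j ji]; first by rewrite partial_sqr eqxx mul1r.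
  by rewrite partial_sqr (negbTE ji) mul0r.
by rewrite partial_tail_sq; case: ifP => _; rewrite ?subrr ?subr0.
Qed.

Lemma coord_sqr_le_tail (i : 'I_n) x : (d <= i)%N -> x ord0 i ^+ 2 <= tail_sq d x.
Proof.
move=> di; rewrite /tail_sq (bigD1 i)//= di expr2 lerDl.
by apply: sumr_ge0 => j _; case: ifP => // _; rewrite -expr2 sqr_ge0.
Qed.

Lemma coord_sqr_le_head (i : 'I_n) x : (i < d)%N -> x ord0 i ^+ 2 <= head_sq x.
Proof.
move=> di; rewrite head_sqE -(_ : lsubmx x ord0 (Ordinal di) = x ord0 i); last first.
  by rewrite mxE; congr (x _ _); exact/val_inj.
by rewrite -real_normK ?num_real// ler_pXn2r ?nnegrE ?enorm_ge0//; exact: coord_le_enorm.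
Qed.

(** The functions [slab m] form a partition of unity of the half line, evaluated
    below at the squared distance to the origin along [Gamma].  They cut a
    neighbourhood of the unbounded set [Gamma] into bounded patches, each of which
    may then be given its own radius. *)
Definition slab (m : nat) (t : R) : R := S (t + 1 - m%:R) - S (t - m%:R).

(** Equal to [1] for [|x'| <= s] and to [0] for [|x'|^2 >= 2 * s^2]. *)
Definition tube (s : R) x : R := 1 - S (s ^- 2 * tail_sq d x - 1).

Definition patch_cut (m : nat) (s : R) x : R := slab m (head_sq x) * tube s x.

Lemma slabE m t : slab m t = S (t + 1 - m%:R) * (1 - S (t - m%:R)).
Proof.
rewrite /slab; have [h|h] := leP 0 (t - m%:R).
  by rewrite (@smooth_step_1 _ (t + 1 - _)) ?mul1r//; lra.
by rewrite (@smooth_step_0 _ (t - _)) ?subr0 ?mulr1// ltW.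
Qed.

Lemma slab_ge0 m t : 0 <= slab m t.
Proof. by rewrite slabE mulr_ge0 ?smooth_step_ge0// subr_ge0 smooth_step_le1. Qed.

Lemma slab_le1 m t : slab m t <= 1.
Proof. by rewrite slabE mulr_ile1 ?smooth_step_ge0 ?smooth_step_le1// ?subr_ge0 ?smooth_step_le1// lerBlDr lerDl smooth_step_ge0. Qed.

Lemma slab_out m t : m%:R + 1 <= t -> slab m t = 0.
Proof. by move=> h; rewrite slabE (@smooth_step_1 _ (t - _)) ?subrr ?mulr0//; lra. Qed.

Lemma slab_low m t : t <= m%:R - 1 -> slab m t = 0.
Proof. by move=> h; rewrite slabE (@smooth_step_0 _ (t + 1 - _)) ?mul0r//; lra. Qed.

(** The sum telescopes. *)
Lemma sum_slab M t : 0 <= t -> t <= M%:R - 1 -> \sum_(m < M) slab m t = 1.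
Proof.
move=> t0 tM.
have -> : \sum_(m < M) slab m t = S (t + 1) - S (t + 1 - M%:R).
  elim: {tM} M => [|M IH]; first by rewrite big_ord0 subr0 subrr.
  rewrite big_ord_recr /= IH /slab -natr1.
  by rewrite (_ : t + 1 - (M%:R + 1) = t - M%:R); [ring|ring].
by rewrite smooth_step_1 ?smooth_step_0 ?subr0//; lra.
Qed.

Lemma tube_ge0 s x : 0 <= tube s x.
Proof. by rewrite subr_ge0 smooth_step_le1. Qed.

Lemma tube_le1 s x : tube s x <= 1.
Proof. by rewrite lerBlDr lerDl smooth_step_ge0. Qed.

Lemma tube_in s x : 0 < s -> tail_sq d x <= s ^+ 2 -> tube s x = 1.
Proof.
move=> s0 h; rewrite /tube smooth_step_0 ?subr0//.
by rewrite subr_le0 mulrC ler_pdivrMr ?mul1r// exprn_gt0.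
Qed.

Lemma tube_out s x : 0 < s -> 2 * s ^+ 2 <= tail_sq d x -> tube s x = 0.
Proof.
move=> s0 h; rewrite /tube smooth_step_1 ?subrr//.
by rewrite lerBrDr mulrC ler_pdivlMr// exprn_gt0.
Qed.

Lemma patch_cut_ge0 m s x : 0 <= patch_cut m s x.
Proof. by rewrite mulr_ge0 ?slab_ge0 ?tube_ge0. Qed.

Lemma patch_cut_le_slab m s x : patch_cut m s x <= slab m (head_sq x).
Proof. by rewrite ler_piMr ?slab_ge0 ?tube_le1. Qed.

Lemma smooth_patch_cut m s : smooth (patch_cut m s).
Proof.
apply: smoothM; first apply: smoothB.
- apply: (@smooth_comp R n S (fun x => head_sq x + 1 - m%:R)); first exact: smooth1_step.
  by apply: smoothB; [apply: smoothD; [exact: smooth_head_sq|exact: smooth_cst]|exact: smooth_cst].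
- apply: (@smooth_comp R n S (fun x => head_sq x - m%:R)); first exact: smooth1_step.
  by apply: smoothB; [exact: smooth_head_sq|exact: smooth_cst].
- apply: smoothB; first exact: smooth_cst.
  apply: (@smooth_comp R n S (fun x => s ^- 2 * tail_sq d x - 1)); first exact: smooth1_step.
  by apply: smoothB; [apply: smoothM; [exact: smooth_cst|exact: smooth_tail_sq]|exact: smooth_cst].
Qed.

(** The set carrying [patch_cut m s] and its gradient: bounded, and of measure at
    most a constant times [s ^+ k]. *)
Definition patch_supp (m : nat) (s : R) : set 'rV[R]_n :=
  [set x | head_sq x <= m%:R + 1] `&` [set x | tail_sq d x <= 2 * s ^+ 2].

Lemma patch_cut_supp m s x : 0 < s -> ~ patch_supp m s x -> patch_cut m s x = 0.
Proof.
move=> s0 nx; rewrite /patch_cut; have [h|h] := leP (head_sq x) (m%:R + 1); last first.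
  by rewrite slab_out ?mul0r// ltW.
have [h'|h'] := leP (tail_sq d x) (2 * s ^+ 2); first by exfalso; apply: nx.
by rewrite tube_out ?mulr0// ltW.
Qed.

Lemma partial_patch_cut m s i x : partial i (patch_cut m s) x =
  slab m (head_sq x) * - (derive1 S (s ^- 2 * tail_sq d x - 1) * (s ^- 2 * partial i (@tail_sq R d n) x)) +
  tube s x * ((derive1 S (head_sq x + 1 - m%:R) - derive1 S (head_sq x - m%:R)) * partial i head_sq x).
Proof.
have sh1 : smooth (fun x => head_sq x + 1 - m%:R).
  by apply: smoothB; [apply: smoothD; [exact: smooth_head_sq|exact: smooth_cst]|exact: smooth_cst].
have sh2 : smooth (fun x => head_sq x - m%:R).
  by apply: smoothB; [exact: smooth_head_sq|exact: smooth_cst].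
have st0 : smooth (fun x => s ^- 2 * tail_sq d x).
  by apply: smoothM; [exact: smooth_cst|exact: smooth_tail_sq].
have st : smooth (fun x => s ^- 2 * tail_sq d x - 1) by apply: smoothB => //; exact: smooth_cst.
have s1 := @smooth1_step R.
rewrite /patch_cut partialM; last 2 first.
- by apply: smoothB; [exact: (smooth_comp s1 sh1)|exact: (smooth_comp s1 sh2)].
- by apply: smoothB; [exact: smooth_cst|exact: (smooth_comp s1 st)].
congr (_ * _ + _ * _).
  rewrite /tube partialB; [|exact: smooth_cst|exact: (smooth_comp s1 st)].
  rewrite partial_cst sub0r (partial_comp _ _ s1 st); congr (- (_ * _)).
  rewrite partialB// ?partial_cst ?subr0; last exact: smooth_cst.
  by rewrite partialM ?partial_cst ?mulr0 ?addr0//; [exact: smooth_cst|exact: smooth_tail_sq].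
rewrite /slab partialB; [|exact: (smooth_comp s1 sh1)|exact: (smooth_comp s1 sh2)].
rewrite (partial_comp _ _ s1 sh1) (partial_comp _ _ s1 sh2) mulrBl.
congr (_ * _ - _ * _).
  rewrite partialB ?partial_cst ?subr0; [|apply: smoothD; [exact: smooth_head_sq|exact: smooth_cst]|exact: smooth_cst].
  by rewrite partialD ?partial_cst ?addr0; [|exact: smooth_head_sq|exact: smooth_cst].
by rewrite partialB ?partial_cst ?subr0; [|exact: smooth_head_sq|exact: smooth_cst].
Qed.

Lemma partial_patch_cut_supp m s i x : 0 < s -> ~ patch_supp m s x -> partial i (patch_cut m s) x = 0.
Proof.
move=> s0 nx; rewrite partial_patch_cut.
have [h|h] := leP (head_sq x) (m%:R + 1); last first.
  rewrite slab_out ?(ltW h)// [derive1 S (_ + 1 - _)]smooth_step_derive_out; last by right; lra.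
  have -> : derive1 S (head_sq x - m%:R) = 0 by apply: smooth_step_derive_out; right; lra.
  by rewrite subrr !mul0r mulr0 addr0.
have [h'|h'] := leP (tail_sq d x) (2 * s ^+ 2); first by exfalso; apply: nx.
rewrite tube_out ?(ltW h')// smooth_step_derive_out ?mul0r ?oppr0 ?mulr0 ?add0r//.
by right; rewrite ltrBrDr mulrC ltr_pdivlMr// exprn_gt0.
Qed.

(** The tube contributes a factor [1 / s], the slab a constant depending on [m]. *)
Lemma patch_cut_gradient_bound m : exists2 K : R, 0 <= K &
  forall s x, 0 < s <= 1 -> enorm (gradient (patch_cut m s) x) <= K / s.
Proof.
have [C C0 HC] := smooth_step_derive_bounded.
pose K := 2 * C * (2 * (m%:R + 1)) + C * 4.
have m0 : 0 <= m%:R :> R by [].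
have K0 : 0 <= K by rewrite /K addr_ge0// !mulr_ge0// addr_ge0.
exists (n%:R * K); first by rewrite mulr_ge0.
move=> s x /andP[s0 s1].
have Ks0 : 0 <= K / s by rewrite divr_ge0// ltW.
rewrite -mulrA; apply: enorm_le_max => // i; rewrite mxE.
have [xs|nx] := pselect (patch_supp m s x); last by rewrite partial_patch_cut_supp// normr0.
have [hx tx] := xs.
rewrite partial_patch_cut; apply: (le_trans (ler_normD _ _)).
rewrite /K [leRHS]mulrDl addrC; apply: lerD.
  rewrite !normrM ger0_norm ?tube_ge0// -[leRHS]mul1r ler_pM ?mulr_ge0 ?tube_le1 ?tube_ge0//.
  have h1 : `|derive1 S (head_sq x + 1 - m%:R) - derive1 S (head_sq x - m%:R)| <= 2 * C.
    by apply: (le_trans (ler_normB _ _)); rewrite mulr2n mulrDl mul1r lerD.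
  have h2 : `|partial i head_sq x| <= 2 * (m%:R + 1).
    rewrite partial_head_sq; case: ifPn => [_|]; first by rewrite normr0 mulr_ge0// addr_ge0.
    rewrite -ltnNge => di; rewrite normrM ger0_norm// ler_pM2l//.
    rewrite -(@ler_pXn2r _ 2) ?nnegrE ?addr_ge0// real_normK ?num_real//.
    apply: (le_trans (coord_sqr_le_head x di)); apply: (le_trans hx).
    by rewrite expr2 ler_peMr ?addr_ge0// lerDr.
  apply: (le_trans (ler_pM _ _ h1 h2)) => //.
  rewrite ler_peMr ?mulr_ge0 ?addr_ge0// invf_ge1//.
rewrite normrM ger0_norm ?slab_ge0// -[leRHS]mul1r ler_pM ?slab_ge0 ?slab_le1// normrN normrM.
rewrite -mulrA ler_pM//.
rewrite normrM ger0_norm; last by rewrite invr_ge0 exprn_ge0// ltW.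
have h3 : `|partial i (@tail_sq R d n) x| <= 4 * s.
  rewrite partial_tail_sq; case: ifPn => [di|_]; last by rewrite normr0 mulr_ge0// ltW.
  rewrite normrM ger0_norm// (_ : 4 * s = 2 * (2 * s)); last by ring.
  rewrite ler_pM2l// -(@ler_pXn2r _ 2) ?nnegrE ?mulr_ge0 ?(ltW s0)// real_normK ?num_real//.
  apply: (le_trans (coord_sqr_le_tail x di)); apply: (le_trans tx).
  by rewrite exprMn ler_pM2r ?exprn_gt0// expr2; lra.
apply: (@le_trans _ _ (s ^- 2 * (4 * s))); first by rewrite ler_wpM2l// invr_ge0 exprn_ge0// ltW.
by rewrite le_eqVlt; apply/orP; left; apply/eqP; field; rewrite gt_eqF.
Qed.

Lemma measurable_patch_supp m s : measurable (patch_supp m s).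
Proof.
have cl (f : 'rV[R]_n -> R) c : smooth f -> measurable [set x | f x <= c].
  move=> sf; rewrite (_ : [set x | f x <= c] = [set x | - c <= - f x]).
    apply: closed_measurable_rV; apply: closed_ge_fun => x; apply: continuousN.
    exact: smooth_continuous sf x.
  by apply/seteqP; split => x /=; rewrite lerN2.
by apply: measurableI; apply: cl; [exact: smooth_head_sq|exact: smooth_tail_sq].
Qed.

Lemma patch_supp_bounded m s x : 0 < s <= 1 -> patch_supp m s x -> enorm x <= m%:R + 3.
Proof.
move=> /andP[s0 s1] [hx tx]; have m0 : 0 <= m%:R :> R by [].
have s2 : s ^+ 2 <= 1 by rewrite expr2 mulr_ile1 ?(ltW s0).
rewrite -(@ler_pXn2r _ 2) ?nnegrE ?enorm_ge0 ?addr_ge0// enorm_sqr.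
have -> : dotrV x x = head_sq x + tail_sq d x by rewrite /head_sq subrK.
move: hx tx; rewrite /= sqrrD; nra.
Qed.

Lemma patch_supp_homo m s s' : 0 <= s' <= s -> patch_supp m s' `<=` patch_supp m s.
Proof.
move=> /andP[s0 ss] x [hx tx]; split => //=; apply: (le_trans tx).
by rewrite ler_pM2l// ler_pXn2r ?nnegrE// (le_trans s0).
Qed.

(** The set is contained in the product of a cube of dimension [d] and a cube of
    dimension [k] and side of order [s]. *)
Lemma patch_supp_measure m : exists2 K : R, 0 <= K & forall s, 0 < s ->
  (L n (patch_supp m s) <= (K * s ^+ k)%:E)%E.
Proof.
have m0 : 0 <= m%:R :> R by [].
exists ((2 * (m%:R + 1)) ^+ d * 4 ^+ k) => [|s s0].
  by rewrite mulr_ge0 ?exprn_ge0// mulr_ge0// addr_ge0.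
apply: (@le_trans _ _ (L n (rect (cbox (fun=> - (m%:R + 1)) (fun=> m%:R + 1)) (cbox (fun=> - (2 * s)) (fun=> 2 * s))))).
  apply: le_measure; rewrite ?inE; [exact: measurable_patch_supp|apply: measurable_rect; exact: measurable_cbox|].
  move=> x [hx tx]; split => i; rewrite -ler_norml.
    apply: le_trans (coord_le_enorm _ _) _; rewrite -(@ler_pXn2r _ 2) ?nnegrE ?enorm_ge0 ?addr_ge0//.
    rewrite -head_sqE; apply: (le_trans hx); rewrite expr2 ler_peMr ?addr_ge0// lerDr //.
  apply: le_trans (coord_le_enorm _ _) _; rewrite -(@ler_pXn2r _ 2) ?nnegrE ?enorm_ge0 ?mulr_ge0 ?(ltW s0)//.
  rewrite enorm_rsubmx; apply: (le_trans tx).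
  by rewrite exprMn ler_pM2r ?exprn_gt0// expr2; lra.
rewrite rect_measure; [|exact: measurable_cbox|exact: measurable_cbox].
rewrite !cube_measure ?mulr_ge0 ?addr_ge0 ?(ltW s0)// -EFinM lee_fin.
by rewrite le_eqVlt; apply/orP; left; apply/eqP; rewrite -mulrA -exprMn; congr (_ * _ ^+ _); ring.
Qed.

End cutoff.

(** * Traces of products *)

(** Monotonicity and linearity in one step, for the recurring bounds by two terms. *)
Lemma ae_integral_le_lincomb {R : realType} dd (T : measurableType dd) (mu : {measure set T -> \bar R})
    (D : set T) (f a b : T -> R) (c1 c2 : R) : measurable D ->
  measurable_fun D f -> measurable_fun D a -> measurable_fun D b ->
  (forall x, 0 <= f x) -> (forall x, 0 <= a x) -> (forall x, 0 <= b x) -> 0 <= c1 -> 0 <= c2 ->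
  {ae mu, forall x, D x -> f x <= c1 * a x + c2 * b x} ->
  (\int[mu]_(x in D) (f x)%:E <=
   c1%:E * (\int[mu]_(x in D) (a x)%:E) + c2%:E * (\int[mu]_(x in D) (b x)%:E))%E.
Proof.
move=> mD mf ma mb f0 a0 b0 c10 c20 H.
have mE (h : T -> R) : measurable_fun D h -> measurable_fun D (EFin \o h).
  by move=> mh; apply/measurable_EFinP.
have E0 (h : T -> R) : (forall x, 0 <= h x) -> forall x, D x -> (0 <= (h x)%:E)%E.
  by move=> h0 x _; rewrite lee_fin.
have mca : measurable_fun D (fun x => c1 * a x) by apply: measurable_funM => //; exact: measurable_cst.
have mcb : measurable_fun D (fun x => c2 * b x) by apply: measurable_funM => //; exact: measurable_cst.
rewrite -(ge0_integralZl mu mD (mE _ ma) (E0 _ a0)) ?lee_fin//.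
rewrite -(ge0_integralZl mu mD (mE _ mb) (E0 _ b0)) ?lee_fin//.
have ca0 x : 0 <= c1 * a x by exact: mulr_ge0.
have cb0 x : 0 <= c2 * b x by exact: mulr_ge0.
have E := ge0_integralD mu mD (E0 _ ca0) (mE _ mca) (E0 _ cb0) (mE _ mcb).
apply: (@le_trans _ _ (\int[mu]_(x in D) (c1 * a x + c2 * b x)%:E)%E); last by rewrite le_eqVlt; apply/orP; left; apply/eqP; exact: E.
apply: (ae_ge0_le_integral mD (E0 _ f0) (mE _ mf)).
- by move=> x _; rewrite lee_fin addr_ge0.
- by apply: (mE (fun x => c1 * a x + c2 * b x)); exact: measurable_funD.
- by apply: filterS H => x h Dx; rewrite lee_fin; exact: h.
Qed.

Section trace_mul.
Context {R : realType} (d k : nat) (r : \bar R) (p : R).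
Hypotheses (k2 : (1 < k)%N) (p0 : 0 < p).
Local Notation n := (d + k)%N.
Local Notation L n := (lebesgue_rV R n).
Local Notation Om := (Omega d k r).
Local Notation S := (@surface R d k r k2).

Let k0 : (0 < k)%N. Proof. exact: ltnW. Qed.
Let oOm : open Om. Proof. exact: (@open_Omega R d k r k0). Qed.

Lemma gradientM (f g : 'rV[R]_n -> R) x : smooth f -> smooth g ->
  gradient (fun x => f x * g x) x = g x *: gradient f x + f x *: gradient g x.
Proof. by move=> sf sg; apply/rowP => i; rewrite !mxE partialM// addrC. Qed.

Lemma smooth_gradient_bounded (eta : 'rV[R]_n -> R) (V : set 'rV[R]_n) (M : R) : smooth eta ->
  (forall x, V x -> enorm x <= M) -> exists2 C : R, 0 <= C & forall x, V x -> enorm (gradient eta x) <= C.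
Proof.
move=> se VM; have cK := @compact_cbox R n (fun=> - M) (fun=> M).
have VK x : V x -> cbox (fun=> - M) (fun=> M) x.
  by move=> Vx i; rewrite -ler_norml; apply: le_trans (coord_le_enorm _ _) (VM _ Vx).
have b i : exists c : R, 0 <= c /\ forall x, V x -> `|partial i eta x| <= c.
  have [c [cr Hc]] := continuous_bounded_on (smooth_continuous (smooth_partial i se)) cK.
  exists (`|c| + 1); split => [|x Vx]; first by rewrite addr_ge0.
  by apply: (Hc (`|c| + 1)); [rewrite (le_lt_trans (ler_norm _)) ?ltrDl|exact: VK].
have [c Hc] := choice b.
exists (\sum_i c i) => [|x Vx]; first by apply: sumr_ge0 => i _; have [] := Hc i.
apply: le_trans (enorm_le_sum _) _; apply: ler_sum => i _; rewrite mxE.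
by have [_ h] := Hc i; exact: h.
Qed.

(** The functions approximating [u], multiplied by [eta], approximate the product:
    on a bounded set [eta] and its gradient are bounded. *)
Lemma is_trace_mul (u eta v : 'rV[R]_n -> R) : (exists G, is_weak_gradient Om u G) ->
  smooth eta -> (forall x, `|eta x| <= 1) ->
  is_trace p (surface_measure d k r) Om set0 u v ->
  is_trace p (surface_measure d k r) Om (Gamma d k) (fun x => u x * eta x) (fun x => v x * eta x).
Proof.
move=> uG se e1 [mv Hv]; have HG := weak_gradientP uG.
have mu : measurable_fun Om u by exact: HG.1.1.
set G := weak_gradient Om u in HG Hv.
have mG i : measurable_fun Om (fun x => G x ord0 i) by exact: weak_grad_measurable HG.
have mS D (f : 'rV[R]_n -> R) : smooth f -> measurable_fun D f.
  by move=> sf; apply: measurable_funTS; apply: continuous_measurable_rV; exact: smooth_continuous.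
have HGe := weak_gradM oOm se HG.
set Ge := weak_gradient Om (fun x => u x * eta x).
have exGe : exists G', is_weak_gradient Om (fun x => u x * eta x) G' by eexists; exact: HGe.
have mGe i : measurable_fun Om (fun x => Ge x ord0 i) by exact: weak_grad_measurable (weak_gradientP exGe).
split; first by apply: measurable_funM => //; exact: mS.
move=> V oV [M VM] _.
have [f [sf fu fG fv]] := Hv V oV (ex_intro _ M VM) (setI0 _).
have [C C0 HC] := smooth_gradient_bounded se VM.
have mOV : measurable (Om `&` V) by apply: open_measurable_rV; exact: openI oOm oV.
have OVO : Om `&` V `<=` Om by move=> x [].
have mBV : measurable (topo_boundary Om `&` V).
  by apply: measurableI; [exact: measurable_topo_boundary|exact: open_measurable_rV].
have msub (D D' : set 'rV[R]_n) (h : 'rV[R]_n -> R) : measurable D -> D' `<=` D -> measurable_fun D h -> measurable_fun D' h.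
  by move=> mD DD; exact: measurable_funS.
have mOm := open_measurable_rV oOm.
have muV := msub _ _ _ mOm OVO mu.
have mGV i := msub _ _ _ mOm OVO (mG i).
have mGeV i := msub _ _ _ mOm OVO (mGe i).
have mvV : measurable_fun (topo_boundary Om `&` V) v.
  by apply: msub mv; [exact: measurable_topo_boundary|move=> x []].
have e1p (a : R) x : `|a * eta x| `^ p <= `|a| `^ p.
  by apply: powR_le; rewrite ?(ltW p0)// normrM ler_piMr.
have mpw (D : set 'rV[R]_n) (h : 'rV[R]_n -> R) : measurable_fun D h -> measurable_fun D (fun x => (`|h x| `^ p)%:E).
  by move=> mh; apply/measurable_EFinP; exact: measurable_powR_abs.
pose dg j x := enorm (gradient (f j) x - G x).
pose du j x := f j x - u x.
have mdu j : measurable_fun (Om `&` V) (du j) by apply: measurable_funB => //; exact: mS.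
have mdg j : measurable_fun (Om `&` V) (dg j).
  apply: measurable_enorm => i; under eq_fun do rewrite !mxE.
  by apply: measurable_funB => //; apply: mS; exact: smooth_partial.
exists (fun j x => f j x * eta x); split.
- by move=> j; exact: smoothM.
- apply: (@squeeze_cvge _ _ _ _ (cst 0%E) _ _) fu; [|exact: cvg_cst].
  apply: nearW => j; apply/andP; split; first by apply: integral_ge0 => x _; rewrite lee_fin powR_ge0.
  apply: ge0_le_integral => //.
  - apply: mpw; apply: measurable_funB; first by apply: mS; exact: smoothM.
    by apply: measurable_funM => //; exact: mS.
  - exact: mpw (mdu j).
  by move=> x _; rewrite lee_fin -mulrBl.
- have cvC : ((2 `^ p)%:E * (\int[L n]_(x in Om `&` V) (dg j x `^ p)%:E) +
     (2 `^ p * C `^ p)%:E * (\int[L n]_(x in Om `&` V) (`|du j x| `^ p)%:E))%E @[j --> \oo] --> 0%E.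
    rewrite -[X in _ --> X](_ : ((2 `^ p)%:E * 0 + (2 `^ p * C `^ p)%:E * 0 = 0)%E); last by rewrite !mule0 adde0.
    have cG := cvgeZl (isT : (2 `^ p)%:E \is a fin_num) fG.
    have cU := cvgeZl (isT : (2 `^ p * C `^ p)%:E \is a fin_num) fu.
    by apply: (cvgeD _ cG cU); rewrite !mule0.
  apply: (@squeeze_cvge _ _ _ _ (cst 0%E) _ _) cvC; [|exact: cvg_cst].
  apply: nearW => j; apply/andP; split; first by apply: integral_ge0 => x _; rewrite lee_fin powR_ge0.
  have mdgp : measurable_fun (Om `&` V) (fun x => dg j x `^ p).
    by apply: (measurableT_comp (measurable_powR p)).
  have mDg : measurable_fun (Om `&` V) (fun x => enorm (gradient (fun x => f j x * eta x) x - Ge x) `^ p).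
    apply: (measurableT_comp (measurable_powR p)); apply: measurable_enorm => i.
    under eq_fun do rewrite !mxE; apply: measurable_funB; last exact: mGeV.
    by apply: mS; apply: smooth_partial; exact: smoothM.
  apply: (ae_integral_le_lincomb mOV mDg mdgp (measurable_powR_abs _ (mdu j))).
  - by move=> x; exact: powR_ge0.
  - by move=> x; exact: powR_ge0.
  - by move=> x; exact: powR_ge0.
  - exact: powR_ge0.
  - by rewrite mulr_ge0 ?powR_ge0.
  apply: filterS (weak_gradientE oOm HGe) => x h [Ox Vx]; have {}h := h Ox.
  rewrite -/Ge in h *; rewrite gradientM// h.
  have -> : eta x *: gradient (f j) x + f j x *: gradient eta x - (eta x *: G x + u x *: gradient eta x) =
     eta x *: (gradient (f j) x - G x) + du j x *: gradient eta x.
    by apply/rowP => i; rewrite !mxE /du; ring.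
  apply: (@le_trans _ _ ((dg j x + `|du j x| * C) `^ p)).
    apply: powR_le; rewrite ?(ltW p0) ?enorm_ge0//; apply: le_trans (enorm_triangle _ _) _.
    rewrite !enormZ; apply: lerD; first by rewrite ler_piMl ?enorm_ge0.
    by rewrite ler_wpM2l// HC.
  apply: le_trans (powR_add_le _ _ (ltW p0)) _; rewrite ?mulr_ge0 ?enorm_ge0//.
  by rewrite powRM// mulrDr lerD2l le_eqVlt; apply/orP; left; apply/eqP; ring.
- apply: (@squeeze_cvge _ _ _ _ (cst 0%E) _ _) fv; [|exact: cvg_cst].
  apply: nearW => j; apply/andP; split.
    by apply: (@integral_ge0 _ _ _ S) => x _; rewrite lee_fin powR_ge0.
  apply: (@ge0_le_integral _ _ _ S) => //.
  - apply: mpw; apply: measurable_funB; first by apply: mS; exact: smoothM.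
    by apply: measurable_funM => //; exact: mS.
  - by apply: mpw; apply: measurable_funB => //; exact: mS.
  by move=> x _; rewrite lee_fin -mulrBl.
Qed.

Lemma is_trace_off (u v : 'rV[R]_n -> R) (K : set 'rV[R]_n) :
  is_trace p (surface_measure d k r) Om set0 u v -> is_trace p (surface_measure d k r) Om K u v.
Proof. by move=> [mv Hv]; split => // V oV VM _; apply: Hv => //; exact: setI0. Qed.

End trace_mul.

(** * Limits and sums of small integrals *)

Section estimates.
Context {R : realType}.
Local Notation L n := (lebesgue_rV R n).

(** Every point sees finitely many of the terms [c m], so their sum converges
    everywhere, and the integrals [e / 2, e / 4, ...] add up to [e].  This is how
    costs controlled patch by patch become a cost of the whole cutoff. *)
Lemma integral_le_geometric dd (T : measurableType dd) (mu : {measure set T -> \bar R})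
    (D : set T) (h : T -> R) (c : nat -> T -> R) (e : R) : measurable D -> 0 <= e ->
  measurable_fun D h -> (forall m, measurable_fun D (c m)) ->
  (forall x, 0 <= h x) -> (forall m x, 0 <= c m x) ->
  (forall x, D x -> exists M : nat, h x <= \sum_(m < M) c m x) ->
  (forall m, (\int[mu]_(x in D) (c m x)%:E <= (e * 2^-1 ^+ m.+1)%:E)%E) ->
  (\int[mu]_(x in D) (h x)%:E <= e%:E)%E.
Proof.
move=> mD e0 mh mc h0 c0 hc Ic.
have mcE m : measurable_fun D (fun x => (c m x)%:E) by apply/measurable_EFinP; exact: mc.
have cE0 m x : D x -> (0 <= (c m x)%:E)%E by rewrite lee_fin.
apply: (@le_trans _ _ (\int[mu]_(x in D) (\sum_(0 <= m <oo) (c m x)%:E))%E).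
  apply: ge0_le_integral; first exact: mD.
  - by move=> x _; rewrite lee_fin.
  - exact/measurable_EFinP.
  - by apply: ge0_emeasurable_sum => // m x Dx _; exact: cE0.
  move=> x Dx; have [M hM] := hc x Dx.
  apply: (@le_trans _ _ (\sum_(0 <= m < M) (c m x)%:E)%E).
    by rewrite sumEFin lee_fin big_mkord.
  by apply: nneseries_lim_ge => m _ _; exact: cE0.
rewrite (integral_nneseries mu mD mcE cE0).
apply: lime_le; first by apply: is_cvg_nneseries => m _ _; apply: integral_ge0 => x Dx; exact: cE0.
apply: nearW => M; apply: (@le_trans _ _ (\sum_(0 <= m < M) (e * 2^-1 ^+ m.+1)%:E)%E).
  by apply: lee_sum => m _; exact: Ic.
rewrite sumEFin lee_fin (_ : \sum_(0 <= m < M) e * 2^-1 ^+ m.+1 = e * (1 - 2^-1 ^+ M)); last first.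
  rewrite big_mkord; elim: M => [|M IH]; first by rewrite big_ord0 expr0 subrr mulr0.
  by rewrite big_ord_recr /= IH exprS; lra.
by rewrite ler_piMr// lerBlDr lerDl exprn_ge0.
Qed.

(** Iterating [powR_add_le] costs a factor [2 `^ p] at each term; the constants grow
    geometrically, which is harmless since the radii are chosen after them. *)
Lemma powR_sum_le (p : R) (M : nat) (a : nat -> R) : 0 < p -> (forall m, 0 <= a m) ->
  (\sum_(m < M) a m) `^ p <= \sum_(m < M) (2 `^ p) ^+ m.+1 * a m `^ p.
Proof.
move=> p0; elim: M a => [|M IH] a a0; first by rewrite !big_ord0 powR0// gt_eqF.
rewrite big_ord_recl [leRHS]big_ord_recl.
apply: le_trans (powR_add_le _ _ (ltW p0)) _ => //; first by apply: sumr_ge0.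
rewrite mulrDr expr1 lerD2l.
have /= := IH (fun m => a m.+1) (fun m => a0 m.+1).
move=> /(ler_wpM2l (powR_ge0 2 p)) /le_trans; apply.
by rewrite mulr_sumr; apply: ler_sum => m _; rewrite (_ : bump 0 m = m.+1)// [in leRHS]exprS -!mulrA.
Qed.

(** Transfers both integrability and the value, up to [e], from the identity tested
    with the cutoff function to the identity without it. *)
Lemma integral_perturb dd (T : measurableType dd) (mu : {measure set T -> \bar R})
    (D : set T) (f f' h : T -> R) (e : R) : measurable D ->
  measurable_fun D f -> measurable_fun D h -> mu.-integrable D (EFin \o f') ->
  {ae mu, forall x, D x -> f x = f' x + h x} ->
  (\int[mu]_(x in D) (`|h x|)%:E <= e%:E)%E ->
  mu.-integrable D (EFin \o f) /\
  (`|\int[mu]_(x in D) (f x)%:E - \int[mu]_(x in D) (f' x)%:E| <= e%:E)%E.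
Proof.
move=> mD mf mh If' fE Ih.
have IH : mu.-integrable D (EFin \o h).
  apply/integrableP; split; first exact/measurable_EFinP.
  by apply: le_lt_trans (ltry e); apply: le_trans Ih.
have ID := integrableD mD If' IH.
have mfE : measurable_fun D (EFin \o f) by exact/measurable_EFinP.
have ae : ae_eq mu D ((EFin \o f') \+ (EFin \o h))%E (EFin \o f).
  by apply: filterS fE => x hx Dx; rewrite /= hx.
split; first exact: ae_integrable mD mfE ae ID.
have <- : (\int[mu]_(x in D) (f' x)%:E + \int[mu]_(x in D) (h x)%:E = \int[mu]_(x in D) (f x)%:E)%E.
  rewrite -(integralD mD If' IH); apply: ae_eq_integral => //.
  by have /integrableP[] := ID.
have fin' := integrable_fin_num mD If'.
rewrite addeAC subee// add0e.
by apply: le_trans (le_abse_integral mu mD (measurable_int _ IH)) _.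
Qed.

Lemma locally_bounded_on (f : R -> R) (M : R) : locally_bounded f ->
  exists2 C : R, 0 <= C & forall t, `|t| <= M -> `|f t| <= C.
Proof.
move=> lf; have cK : compact `[- M, M] by exact: segment_compact.
have [C HC] : exists C : R, forall t, `|t| <= M -> `|f t| <= C.
  move/compact_near_coveringP : cK => /(_ _ (pinfty_nbhs R) (fun C t => `|f t| <= C)) H.
  have [|C HC] := filter_ex (H _ _); last by exists C => t tM; apply: HC; rewrite /= in_itv /= -ler_norml.
  move=> t _; have [C HC] := lf t.
  exists ([set s | `|f s| <= C], [set C' | C < C']) => /=.
    by split => //; exists C; split => //; exact: num_real.
  by move=> [s C'] [/= h1 h2]; exact: le_trans h1 (ltW h2).
exists `|C| => // t tM; exact: le_trans (HC _ tM) (ler_norm _).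
Qed.

Lemma measurable_fun_rV_on dd (T : measurableType dd) n (D : set T) (f : T -> 'rV[R]_n) : measurable D ->
  (forall i, measurable_fun D (fun t => f t ord0 i)) -> measurable_fun D f.
Proof.
move=> mD mf; pose f' t : 'rV[R]_n := \row_i ((fun t => f t ord0 i) \_ D) t.
apply: (@eq_measurable_fun _ _ _ _ _ f').
  by move=> t tD; apply/rowP => i; rewrite mxE patchE tD.
apply: measurable_funTS; apply/measurable_fun_rVP => i; under eq_fun do rewrite mxE.
by apply/(measurable_restrictT _ mD).
Qed.

Variables (d k : nat).
Local Notation n := (d + k)%N.
Implicit Types x : 'rV[R]_n.
Definition rad (j : nat) : R := j.+1%:R^-1.

Lemma rad_gt0 j : 0 < rad j. Proof. by rewrite invr_gt0. Qed.
Lemma rad_le1 j : rad j <= 1. Proof. by rewrite invf_le1// ler1n. Qed.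
Lemma rad01 j : 0 < rad j <= 1. Proof. by rewrite rad_gt0 rad_le1. Qed.

Lemma cvg_rad : rad @ \oo --> (0 : R).
Proof. exact: cvg_harmonic. Qed.

(** The patches shrink to [Gamma], which is negligible for the measure, and the
    integrals tend to [0] by dominated convergence. *)
Lemma integral_patch_cvg0 (mu : {measure set 'rV[R]_n -> \bar R}) (D : set 'rV[R]_n) (f : 'rV[R]_n -> R) m :
  measurable D -> measurable_fun D f -> (forall x, 0 <= f x) ->
  {ae mu, forall x, D x -> ~ Gamma d k x} ->
  (\int[mu]_(x in D `&` patch_supp m 1) (f x)%:E < +oo)%E ->
  (\int[mu]_(x in D `&` patch_supp m (rad j)) (f x)%:E)%E @[j --> \oo] --> 0%E.
Proof.
move=> mD mf f0 nG If; set E := D `&` patch_supp m 1 in If *.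
have mE : measurable E by apply: measurableI => //; exact: measurable_patch_supp.
have mP j : measurable (patch_supp m (rad j) : set 'rV[R]_n) by exact: measurable_patch_supp.
pose F j x : \bar R := (f x * \1_(patch_supp m (rad j)) x)%:E.
have mfE : measurable_fun E f by apply: measurable_funS mf => // x [].
have -> : (fun j => \int[mu]_(x in D `&` patch_supp m (rad j)) (f x)%:E)%E = (fun j => \int[mu]_(x in E) F j x)%E.
  apply/funext => j; rewrite [LHS]integral_mkcond [RHS]integral_mkcond; apply: eq_integral => x _.
  rewrite !patchE /F indicE.
  have [/set_mem [Dx Px]|nx] := boolP (x \in D `&` patch_supp m (rad j)).
    rewrite !mem_set ?mulr1//; split => //.
    by apply: patch_supp_homo Px; rewrite (ltW (rad_gt0 j)) rad_le1.
  case: ifPn => // /set_mem [Dx _]; case: (boolP (x \in _)) => [/set_mem Px|_]; last by rewrite mulr0.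
  by move/negP: nx; case; apply/mem_set.
have mF j : measurable_fun E (F j).
  by apply/measurable_EFinP; apply: measurable_funM => //; apply: measurable_funTS; exact: measurable_indic.
have Iff : mu.-integrable E (EFin \o f).
  apply/integrableP; split; first exact/measurable_EFinP.
  by apply: le_lt_trans If; rewrite le_eqVlt; apply/orP; left; apply/eqP; apply: eq_integral => x _; rewrite /= ger0_norm.
have I0 : (\int[mu]_(x in E) cst 0%E x = 0)%E by apply: integral0_eq.
suff [cv bd] : {ae mu, forall x, E x -> F ^~ x @ \oo --> cst 0%E x} /\
    {ae mu, forall x j, E x -> (`|F j x| <= (EFin \o f) x)%E}.
  by have [_ _] := dominated_convergence mE mF (measurable_cst 0%E) cv Iff bd; rewrite I0.
split.
- apply: filterS nG => x nx [Dx _]; have {}nx := nx Dx.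
  have t0 : 0 < tail_sq d x.
    rewrite lt0r tail_sq_ge0 andbT; apply/eqP => t0; apply: nx.
    by apply: enorm_eq0; apply/eqP; rewrite -sqrf_eq0 enorm_rsubmx t0.
  apply: cvg_near_cst; near=> j; rewrite /F indicE memNset ?mulr0// => -[_ /=].
  apply/negP; rewrite -ltNge.
  have r0 := rad_gt0 j.
  apply: (@le_lt_trans _ _ (2 * rad j)).
    by rewrite ler_pM2l// expr2 ler_piMl ?rad_le1// ltW.
  by rewrite mulrC -ltr_pdivlMr//; near: j; apply: (cvgr_lt _ cvg_rad); rewrite divr_gt0.
- apply: aeW => x j Ex; rewrite /F /= lee_fin normrM ger0_norm// ler_piMr// ger0_norm indicE//.
  by case: (_ \in _).
Unshelve. all: by end_near. Qed.

(** Zero [p]-capacity of [Gamma]: the gradient is at most [K / s] on a set of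
    measure at most [K' * s ^+ k], and [s `^ (k - p)] tends to [0]. *)
Lemma gradient_patch_cvg0 (p : R) m : 0 < p < k%:R ->
  (\int[L n]_x (enorm (gradient (patch_cut m (rad j)) x) `^ p)%:E)%E @[j --> \oo] --> 0%E.
Proof.
move=> /andP[p0 pk].
have [K K0 HK] := @patch_cut_gradient_bound R d k m.
have [K' K'0 HK'] := @patch_supp_measure R d k m.
have e : (fun j => ((K `^ p * K') * rad j `^ (k%:R - p))%:E) @ \oo --> 0%E.
  apply: cvg_EFin; first by near=> j.
  rewrite -[X in _ --> X](mulr0 (K `^ p * K')); apply: cvgMr.
  apply: cvg_powR0; [by rewrite subr_gt0|by move=> j; rewrite ltW// rad_gt0|exact: cvg_rad].
apply: (@squeeze_cvge _ _ _ _ (cst 0%E) _ _) e; [|exact: cvg_cst].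
apply: nearW => j; apply/andP; split; first by apply: integral_ge0 => x _; rewrite lee_fin powR_ge0.
have s0 := rad_gt0 j.
rewrite (@integral_support _ _ _ (L n) setT (patch_supp m (rad j)))//; last first.
  move=> x _ nx; rewrite (_ : gradient _ x = 0) ?enorm0 ?powR0 ?gt_eqF//.
  by apply/rowP => i; rewrite !mxE partial_patch_cut_supp.
apply: (@le_trans _ _ (\int[L n]_(x in patch_supp m (rad j)) ((K / rad j) `^ p)%:E)%E).
  apply: ge0_le_integral => //; first exact: measurable_patch_supp.
  - by move=> x _; rewrite lee_fin powR_ge0.
  - apply/measurable_EFinP; apply: (measurableT_comp (measurable_powR p)); apply: measurable_enorm => i.
    under eq_fun do rewrite mxE; apply: measurable_funTS; apply: continuous_measurable_rV.
    by apply: smooth_continuous; apply: smooth_partial; exact: smooth_patch_cut.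
  - by move=> x _; rewrite lee_fin powR_le ?(ltW p0) ?enorm_ge0// HK// rad01.
rewrite integral_cst; last exact: measurable_patch_supp.
apply: le_trans (lee_wpmul2l _ (HK' _ s0)) _; first by rewrite lee_fin powR_ge0.
rewrite -EFinM lee_fin powRM ?invr_ge0 ?(ltW s0)//.
have -> : rad j `^ (k%:R - p) = rad j ^+ k * (rad j)^-1 `^ p.
  rewrite powRB ?gt_eqF// powR_mulrn ?(ltW s0)//; congr (_ * _).
  by rewrite -powRN -[in RHS](powR_inv1 (ltW s0)) -powRrM mulN1r.
by rewrite le_eqVlt; apply/orP; left; apply/eqP; ring.
Unshelve. all: by end_near. Qed.

End estimates.

(** * The global cutoff function *)

Section cutoff_sum.
Context {R : realType} (d k : nat).
Local Notation n := (d + k)%N.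
Implicit Types x : 'rV[R]_n.
Variable s : nat -> R.
Hypothesis s01 : forall m, 0 < s m <= 1.

Let sgt0 m : 0 < s m. Proof. by have /andP[] := s01 m. Qed.

(** Near [x] all patches of index at least [patch_count x] vanish.  Stopping the
    sum there amounts to summing all of them, and [cutoff] coincides locally with
    a finite sum. *)
Definition patch_count x : nat := (Num.truncn (head_sq x)).+3.
Definition patch_sum x : R := \sum_(m < patch_count x) patch_cut m (s m) x.
Definition cutoff x : R := 1 - patch_sum x.

Lemma patch_countP x : head_sq x < (patch_count x)%:R - 1 - 1.
Proof. by rewrite /patch_count -!natr1 !addrK natr1; exact: truncnS_gt. Qed.

Lemma patch_sumE (M : nat) x : head_sq x <= M%:R - 1 -> patch_sum x = \sum_(m < M) patch_cut m (s m) x.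
Proof.
have widen M1 M2 : (M1 <= M2)%N -> head_sq x <= M1%:R - 1 ->
    \sum_(m < M1) patch_cut m (s m) x = \sum_(m < M2) patch_cut m (s m) x.
  have E M' : \sum_(m < M') patch_cut m (s m) x = \sum_(0 <= m < M') patch_cut m (s m) x by rewrite big_mkord.
  move=> M12 hM; rewrite !E [RHS](@big_cat_nat _ _ _ M1 0 M2)//=.
  rewrite [X in _ = _ + X]big_nat [X in _ = _ + X]big1 ?addr0// => m /andP[Mm _].
  by rewrite /patch_cut slab_low ?mul0r//; apply: (le_trans hM); rewrite lerD2r ler_nat.
move=> hM; have hN : head_sq x <= (patch_count x)%:R - 1 by have := patch_countP x; lra.
by rewrite /patch_sum; have [h|/ltnW h] := leqP M (patch_count x); [rewrite -(widen _ _ h hM)|rewrite (widen _ _ h hN)].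
Qed.

Lemma patch_sum_ge0 x : 0 <= patch_sum x.
Proof. by apply: sumr_ge0 => m _; exact: patch_cut_ge0. Qed.

Lemma patch_sum_le1 x : patch_sum x <= 1.
Proof.
have hN : head_sq x <= (patch_count x)%:R - 1 by have := patch_countP x; lra.
rewrite -(sum_slab (head_sq_ge0 x) hN).
by apply: ler_sum => m _; exact: patch_cut_le_slab.
Qed.

Lemma cutoff01 x : 0 <= cutoff x <= 1.
Proof. by rewrite /cutoff subr_ge0 patch_sum_le1 lerBlDr lerDl patch_sum_ge0. Qed.

Lemma cutoff_norm_le1 x : `|cutoff x| <= 1.
Proof. by have /andP[c0 c1] := cutoff01 x; rewrite ger0_norm. Qed.

Lemma near_head_sq x (c : R) : head_sq x < c -> \forall y \near x, head_sq y < c.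
Proof.
move=> h; apply: open_nbhs_nbhs; split => //.
exact: open_lt_fun (smooth_continuous (@smooth_head_sq R d k)).
Qed.

Lemma near_cutoff x : \forall y \near x, cutoff y = 1 - \sum_(m < patch_count x) patch_cut m (s m) y.
Proof.
have h : head_sq x < (patch_count x)%:R - 1 by have := patch_countP x; lra.
by apply: filterS (near_head_sq h) => y hy; rewrite /cutoff (patch_sumE (ltW hy)).
Qed.

Let smooth_partial_sum (M : nat) : smooth (fun x => 1 - \sum_(m < M) patch_cut m (s m) x).
Proof.
apply: smoothB; first exact: smooth_cst.
by apply: (@smooth_sum R n _ _ (fun (m : 'I_M) x => patch_cut m (s m) x)) => m; exact: smooth_patch_cut.
Qed.

Lemma smooth_cutoff : smooth cutoff.
Proof.
apply: smooth_local => x; exists (fun y => 1 - \sum_(m < patch_count x) patch_cut m (s m) y); first exact: smooth_partial_sum.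
by apply: filterS (near_cutoff x) => y ->.
Qed.

Lemma enorm_gradient_cutoff x :
  enorm (gradient cutoff x) <= \sum_(m < patch_count x) enorm (gradient (patch_cut m (s m)) x).
Proof.
have -> : gradient cutoff x = - \sum_(m < patch_count x) gradient (patch_cut m (s m)) x.
  apply/rowP => i; rewrite !mxE (near_eq_partial i (near_cutoff x)) partialB; last 2 first.
  - exact: smooth_cst.
  - by apply: (@smooth_sum R n _ _ (fun (m : 'I__) x => patch_cut m (s m) x)) => m; exact: smooth_patch_cut.
  rewrite partial_cst sub0r (@partial_sum R n _ _ (fun (m : 'I__) x => patch_cut m (s m) x)); last first.
    by move=> m; exact: smooth_patch_cut.
  by rewrite summxE; congr (- _); apply: eq_bigr => m _; rewrite mxE.
rewrite enormN; elim/big_ind2 : _ => [|x1 x2 y1 y2 h1 h2|m _]; first by rewrite enorm0.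
- exact: le_trans (enorm_triangle _ _) (lerD h1 h2).
- by [].
Qed.

(** Near [x] only finitely many patches matter, and all of their tubes are equal to
    [1] there; the slabs add up to [1]. *)
Lemma cutoff_near_Gamma x : Gamma d k x -> \forall y \near x, cutoff y = 0.
Proof.
rewrite /Gamma /= => x0; have tx : tail_sq d x = 0 by rewrite -enorm_rsubmx x0 enorm0 expr0n.
have h : head_sq x < (patch_count x)%:R - 1 by have := patch_countP x; lra.
have nt : \forall y \near x, forall m : 'I_(patch_count x), tail_sq d y < s m ^+ 2.
  apply: (@filter_forall _ _ _ (nbhs x) (nbhs_filter x)) => m.
  apply: open_nbhs_nbhs; split; last by rewrite /= tx exprn_gt0.
  exact: open_lt_fun (smooth_continuous (@smooth_tail_sq R d n)).
have := @filterI _ _ (nbhs_filter x) _ _ (near_head_sq h) nt.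
apply: filterS => y [hy ty]; rewrite /cutoff (patch_sumE (ltW hy)).
rewrite -(sum_slab (head_sq_ge0 y) (ltW hy)) -sumrB big1// => m _.
by rewrite /patch_cut tube_in ?mulr1 ?subrr// ltW.
Qed.

End cutoff_sum.

Section restriction.
Context {R : realType} (n : nat).
Implicit Types U V : set 'rV[R]_n.
Local Notation L n := (lebesgue_rV R n).

Lemma Linfty_sub U V u : measurable U -> V `<=` U -> Linfty U u -> Linfty V u.
Proof.
move=> mU VU [mu [M HM]]; split; first exact: measurable_funS VU mu.
by exists M; apply: filterS HM => x h Vx; apply: h; exact: VU.
Qed.

Lemma W1p_sub (p alpha : R) U V u : open U -> open V -> V `<=` U ->
  W1p p (weight alpha) U u -> W1p p (weight alpha) V u.
Proof.
move=> oU oV VU [[mu Iu] exG [mG IG]].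
have mU := open_measurable_rV oU; have mV := open_measurable_rV oV.
have HG := weak_gradientP exG.
have HGV := weak_grad_sub oU oV VU HG.
have exV : exists G, is_weak_gradient V u G by eexists; exact: HGV.
have pos (h : 'rV[R]_n -> R) x : (0 <= (`|h x| `^ p * weight alpha x)%:E)%E.
  by rewrite lee_fin mulr_ge0 ?powR_ge0.
have mp D (h : 'rV[R]_n -> R) : measurable_fun D h -> measurable_fun D (fun x => (`|h x| `^ p * weight alpha x)%:E).
  move=> mh; apply/measurable_EFinP; apply: measurable_funM; last exact: measurable_weight.
  exact: measurable_powR_abs.
have sub_fin (h : 'rV[R]_n -> R) : measurable_fun U h ->
    (\int[L n]_(x in U) (`|h x| `^ p * weight alpha x)%:E < +oo)%E ->
    (\int[L n]_(x in V) (`|h x| `^ p * weight alpha x)%:E < +oo)%E.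
  move=> mh If; apply: le_lt_trans If; apply: (ge0_subset_integral _ mV mU (mp _ _ mh)); last exact: VU.
  by move=> x _; exact: pos.
have mGV : measurable_fun V (fun x => enorm (weak_gradient V u x)).
  by apply: measurable_enorm => i; exact: weak_grad_measurable (weak_gradientP exV).
split; [split; [exact: measurable_funS VU mu|exact: sub_fin Iu]|exact: exV|split; first exact: mGV].
apply: le_lt_trans (sub_fin _ mG IG).
apply: (ae_ge0_le_integral mV) => //.
- by move=> x _; exact: pos (fun x => enorm (weak_gradient V u x)) x.
- exact: mp mGV.
- by move=> x _; exact: pos (fun x => enorm (weak_gradient U u x)) x.
- by apply: mp; exact: measurable_funS VU mG.
by apply: filterS (weak_gradientE oV HGV) => x h Vx; rewrite h.
Qed.

End restriction.

(** * Bounded traces, and the cost of a cutoff *)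

Section traces.
Context {R : realType} (d k : nat) (r : \bar R) (p alpha : R).
Hypotheses (k2 : (1 < k)%N) (r0 : (0 < r)%E) (p1 : 1 < p) (alpha0 : 0 <= alpha).
Local Notation n := (d + k)%N.
Local Notation L n := (lebesgue_rV R n).
Local Notation Om := (Omega d k r).
Local Notation S := (@surface R d k r k2).

Let k0 : (0 < k)%N. Proof. exact: ltnW. Qed.
Let oOm : open Om. Proof. exact: (@open_Omega R d k r k0). Qed.
Let mOm : measurable Om. Proof. exact: open_measurable_rV oOm. Qed.
Let p0 : 0 < p. Proof. exact: lt_trans ltr01 p1. Qed.

Lemma Omega_Gamma x : Om x -> ~ Gamma d k x.
Proof. by move=> Ox; rewrite /Gamma /= => x0; have := half_ball_neq0 k0 Ox; rewrite x0 enorm0 ltxx. Qed.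

(** In the parameter space of either sheet [Gamma] lies in a hyperplane. *)
Lemma surface_Gamma_null : {ae S, forall x, ~ Gamma d k x}.
Proof.
apply: ae_surface => psi sp.
have dn : (d < n.-1)%N by move: k2; case: (k) => [|[|k']] // _; rewrite !addnS /= ltnS leq_addr.
have dn' : (d < n)%N by apply: leq_trans dn (leq_pred _).
exists [set y : 'rV[R]_n.-1 | y ord0 (Ordinal dn) = 0]; split.
- have -> : [set y : 'rV[R]_n.-1 | y ord0 (Ordinal dn) = 0] = (fun y => y ord0 (Ordinal dn)) @^-1` [set 0] by [].
  rewrite -[X in measurable X]setTI; apply: measurable_rV_coord => //.
- exact: hyperplane_null.
move=> y /= ny; apply: contrapT => yd; apply: ny => _; rewrite /Gamma /= => x0; apply: yd.
have := congr1 (fun b : 'rV[R]_k => b ord0 (Ordinal k0)) x0; rewrite !mxE /=.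
by rewrite (_ : (d + 0)%N = val (Ordinal dn)) ?valK//= addn0.
Qed.

Lemma weight_eball (m : R) (x : 'rV[R]_n) : eball m x -> 1 <= (1 + `|m|) `^ alpha * weight alpha x.
Proof.
rewrite /eball /= => xm; rewrite /weight powRN -(ler_pdivrMr _ _ _) ?invr_gt0 ?powR_gt0 ?ltr_pwDl ?enorm_ge0//.
rewrite invrK mul1r; apply: powR_le => //; first by rewrite addr_ge0 ?enorm_ge0.
by rewrite lerD2l (le_trans (ltW xm)) ?ler_norm.
Qed.

(** On bounded sets the weight is bounded below, so the hypotheses of [trace_exists]
    hold. *)
Lemma trace_bounded f : W1p p (weight alpha) Om f -> Linfty Om f ->
  exists v M, [/\ 0 <= M, {ae L n, forall x, Om x -> `|f x| <= M},
    is_trace p (surface_measure d k r) Om set0 f v & forall x, `|v x| <= M].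
Proof.
move=> [[mf If] exG [mG IG]] [_ [M HM]].
have loc (h : 'rV[R]_n -> R) : measurable_fun Om h ->
    (\int[L n]_(x in Om) (`|h x| `^ p * weight alpha x)%:E < +oo)%E ->
    forall m, (\int[L n]_(x in Om `&` eball m) (`|h x| `^ p)%:E < +oo)%E.
  move=> mh Ih m; have mE := @measurable_Om_eball R d k r k2 m.
  have sub : Om `&` @eball R d k m `<=` Om by move=> x [].
  have mh1 : measurable_fun Om (fun x => `|h x| `^ p * weight alpha x).
    by apply: measurable_funM; [exact: measurable_powR_abs|exact: measurable_weight].
  have c0 : 0 <= (1 + `|m|) `^ alpha by exact: powR_ge0.
  have h10 x : 0 <= `|h x| `^ p * weight alpha x by rewrite mulr_ge0 ?powR_ge0.
  apply: (@le_lt_trans _ _ (((1 + `|m|) `^ alpha)%:E * \int[L n]_(x in Om) (`|h x| `^ p * weight alpha x)%:E)%E); last first.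
    by apply: lte_mul_pinfty => //; rewrite lee_fin.
  apply: (@le_trans _ _ (((1 + `|m|) `^ alpha)%:E * \int[L n]_(x in Om `&` eball m) (`|h x| `^ p * weight alpha x)%:E +
     0%:E * \int[L n]_(x in Om `&` eball m) (`|h x| `^ p * weight alpha x)%:E)%E).
    apply: (ae_integral_le_lincomb mE (measurable_powR_abs _ (measurable_funS mOm sub mh)) (measurable_funS mOm sub mh1) (measurable_funS mOm sub mh1)).
    - by move=> x; exact: powR_ge0.
    - exact: h10.
    - exact: h10.
    - exact: c0.
    - exact: lexx.
    apply: aeW => x [_ xm]; rewrite mul0r addr0 mulrCA ler_peMr ?powR_ge0//.
    exact: weight_eball xm.
  rewrite mul0e adde0; apply: lee_wpmul2l; first by rewrite lee_fin.
  apply: (ge0_subset_integral _ mE mOm); [exact/measurable_EFinP| |exact: sub].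
  by move=> x _; rewrite lee_fin.
have HM' : {ae L n, forall x, Om x -> `|f x| <= Num.max M 0}.
  by apply: filterS HM => x h Ox; rewrite le_max h.
have M0 : 0 <= Num.max M 0 by rewrite le_max lexx orbT.
have HG := weak_gradientP exG.
have locG m i : (\int[L n]_(x in Om `&` eball m) (`|weak_gradient Om f x ord0 i| `^ p)%:E < +oo)%E.
  have mE := @measurable_Om_eball R d k r k2 m.
  have sub : Om `&` @eball R d k m `<=` Om by move=> x [].
  apply: le_lt_trans (loc _ mG IG m); apply: ge0_le_integral; first exact: mE.
  - by move=> x _; rewrite lee_fin powR_ge0.
  - apply/measurable_EFinP; apply: measurable_powR_abs.
    exact: measurable_funS mOm sub (weak_grad_measurable i HG).
  - apply/measurable_EFinP; apply: measurable_powR_abs; exact: measurable_funS mOm sub mG.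
  move=> x _; rewrite lee_fin; apply: powR_le; [exact: ltW|by []|].
  by rewrite [leRHS]ger0_norm ?enorm_ge0// coord_le_enorm.
have [v tv bv] := trace_exists k2 r0 p1 exG M0 HM' (loc _ mf If) locG.
by exists v, (Num.max M 0).
Qed.

End traces.

Section costs.
Context {R : realType} (d k : nat).
Local Notation n := (d + k)%N.
Local Notation L n := (lebesgue_rV R n).
Implicit Types f : 'rV[R]_n -> R.

Lemma near_small (F : nat -> \bar R) (c : R) : 0 < c -> F @ \oo --> 0%E ->
  \forall j \near \oo, (F j <= c%:E)%E.
Proof.
move=> c0 /fine_cvgP[finF cF].
near=> j; have fj : F j \is a fin_num by near: j.
rewrite -(fineK fj) lee_fin; apply: ltW; near: j.
exact: (cvgr_lt 0 cF).
Unshelve. all: by end_near. Qed.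

Lemma measurable_patch_cut m s (D : set 'rV[R]_n) : measurable_fun D (patch_cut m s).
Proof.
apply: measurable_funTS; apply: continuous_measurable_rV.
by apply: smooth_continuous; exact: smooth_patch_cut.
Qed.

Lemma measurable_gradient_smooth (D : set 'rV[R]_n) (eta : 'rV[R]_n -> R) : smooth eta ->
  measurable_fun D (fun x => enorm (gradient eta x)).
Proof.
move=> se; apply: measurable_enorm => i; under eq_fun do rewrite mxE.
apply: measurable_funTS; apply: continuous_measurable_rV.
exact: smooth_continuous (smooth_partial _ se).
Qed.

Lemma patch_cut_le1 m s (x : 'rV[R]_n) : patch_cut m s x <= 1.
Proof. exact: le_trans (patch_cut_le_slab _ _ _) (slab_le1 _ _). Qed.

Lemma integral_patch_cut_cvg0 (mu : {measure set 'rV[R]_n -> \bar R}) (D : set 'rV[R]_n) f m :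
  measurable D -> measurable_fun D f -> (forall x, 0 <= f x) ->
  {ae mu, forall x, D x -> ~ Gamma d k x} ->
  (\int[mu]_(x in D `&` patch_supp m 1) (f x)%:E < +oo)%E ->
  (\int[mu]_(x in D) (f x * patch_cut m (rad j) x)%:E)%E @[j --> \oo] --> 0%E.
Proof.
move=> mD mf f0 nG If; have cv := integral_patch_cvg0 mD mf f0 nG If.
apply: (@squeeze_cvge _ _ _ _ (cst 0%E) _ _) cv; [|exact: cvg_cst].
apply: nearW => j; apply/andP; split.
  by apply: integral_ge0 => x _; rewrite lee_fin mulr_ge0 ?patch_cut_ge0.
have DP : D `&` patch_supp m (rad j) `<=` D by move=> x [].
rewrite (integral_support _ DP); last first.
  move=> x Dx nx; rewrite patch_cut_supp ?mulr0 ?rad_gt0// => h; exact: nx.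
apply: ge0_le_integral.
- by apply: measurableI => //; exact: measurable_patch_supp.
- by move=> x _; rewrite lee_fin mulr_ge0 ?patch_cut_ge0.
- apply/measurable_EFinP; apply: measurable_funM; first exact: measurable_funS DP mf.
  exact: measurable_patch_cut.
- by apply/measurable_EFinP; exact: measurable_funS DP mf.
by move=> x _; rewrite lee_fin ler_piMr ?patch_cut_le1.
Qed.

Variables (p : R) (w f : 'rV[R]_n -> R) (D : set 'rV[R]_n).
Hypotheses (p1 : 1 < p) (pk : p < k%:R) (mD : measurable D).
Hypotheses (mw : measurable_fun D w) (w0 : forall x, 0 <= w x) (w1 : forall x, w x <= 1).
Hypotheses (mf : measurable_fun D f) (f0 : forall x, 0 <= f x).
Hypothesis DG : forall x, D x -> ~ Gamma d k x.

Let p0 : 0 < p. Proof. exact: lt_trans ltr01 p1. Qed.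

Lemma gradient_cost_cvg0 m :
  (\int[L n]_(x in D) (enorm (gradient (patch_cut m (rad j)) x) `^ p * w x)%:E)%E @[j --> \oo] --> 0%E.
Proof.
have pp : 0 < p < k%:R by rewrite p0.
have cv := @gradient_patch_cvg0 R d k p m pp.
apply: (@squeeze_cvge _ _ _ _ (cst 0%E) _ _) cv; [|exact: cvg_cst].
apply: nearW => j; apply/andP; split.
  by apply: integral_ge0 => x _; rewrite lee_fin mulr_ge0 ?powR_ge0.
have mg (E : set 'rV[R]_n) : measurable_fun E (fun x => enorm (gradient (patch_cut m (rad j)) x) `^ p).
  apply: (measurableT_comp (measurable_powR p)); apply: measurable_gradient_smooth; exact: smooth_patch_cut.
apply: (@le_trans _ _ (\int[L n]_(x in D) (enorm (gradient (patch_cut m (rad j)) x) `^ p)%:E)%E).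
  apply: ge0_le_integral; first exact: mD.
  - by move=> x _; rewrite lee_fin mulr_ge0 ?powR_ge0.
  - by apply/measurable_EFinP; apply: measurable_funM.
  - exact/measurable_EFinP.
  by move=> x _; rewrite lee_fin ler_piMr ?powR_ge0.
apply: (ge0_subset_integral _ mD measurableT); [exact/measurable_EFinP| |by []].
by move=> x _; rewrite lee_fin powR_ge0.
Qed.

Hypothesis If : (\int[L n]_(x in D) (f x `^ p * w x)%:E < +oo)%E.

(** By [powRB1_mul_le] the integrand is at most the sum of [f `^ p * w] on a shrinking
    patch and the gradient cost. *)
Lemma flux_cost_cvg0 m :
  (\int[L n]_(x in D) (f x `^ (p - 1) * enorm (gradient (patch_cut m (rad j)) x) * w x)%:E)%E
    @[j --> \oo] --> 0%E.
Proof.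
have mfp : measurable_fun D (fun x => f x `^ p * w x).
  by apply: measurable_funM => //; apply: (measurableT_comp (measurable_powR p)).
have fp0 x : 0 <= f x `^ p * w x by rewrite mulr_ge0 ?powR_ge0.
have Ifm : (\int[L n]_(x in D `&` patch_supp m 1) (f x `^ p * w x)%:E < +oo)%E.
  apply: le_lt_trans If; apply: ge0_subset_integral; last by move=> x [].
  - by apply: measurableI => //; exact: measurable_patch_supp.
  - exact: mD.
  - exact/measurable_EFinP.
  - by move=> x _; rewrite lee_fin.
have cv1 := integral_patch_cvg0 mD mfp fp0 (aeW _ DG) Ifm.
have cv2 := gradient_cost_cvg0 m.
have cv := cvgeD (isT : (0 +? (0 : \bar R))%E) cv1 cv2; rewrite adde0 in cv; have {}cv := cv eventually_filter.
apply: (@squeeze_cvge _ _ _ _ (cst 0%E) _ _) cv; [|exact: cvg_cst].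
apply: nearW => j; apply/andP; split.
  by apply: integral_ge0 => x _; rewrite lee_fin !mulr_ge0 ?powR_ge0 ?enorm_ge0.
have DP : D `&` patch_supp m (rad j) `<=` D by move=> x [].
have mDP : measurable (D `&` patch_supp m (rad j)).
  by apply: measurableI => //; exact: measurable_patch_supp.
rewrite (integral_support _ DP); last first.
  move=> x Dx nx; rewrite (_ : gradient _ x = 0) ?enorm0 ?mulr0 ?mul0r//.
  by apply/rowP => i; rewrite !mxE partial_patch_cut_supp ?rad_gt0// => h; exact: nx.
have mgr (E : set 'rV[R]_n) : measurable_fun E (fun x => enorm (gradient (patch_cut m (rad j)) x)).
  by apply: measurable_gradient_smooth; exact: smooth_patch_cut.
have mgp : measurable_fun D (fun x => enorm (gradient (patch_cut m (rad j)) x) `^ p * w x).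
  by apply: measurable_funM => //; apply: (measurableT_comp (measurable_powR p)).
have mfg : measurable_fun D (fun x => f x `^ (p - 1) * enorm (gradient (patch_cut m (rad j)) x) * w x).
  by apply: measurable_funM => //; apply: measurable_funM => //; apply: (measurableT_comp (measurable_powR _)).
have gp0 x : 0 <= enorm (gradient (patch_cut m (rad j)) x) `^ p * w x by rewrite mulr_ge0 ?powR_ge0.
apply: (@le_trans _ _ (1%:E * \int[L n]_(x in D `&` patch_supp m (rad j)) (f x `^ p * w x)%:E +
   1%:E * \int[L n]_(x in D `&` patch_supp m (rad j)) (enorm (gradient (patch_cut m (rad j)) x) `^ p * w x)%:E)%E).
  apply: (ae_integral_le_lincomb mDP (measurable_funS mD DP mfg) (measurable_funS mD DP mfp) (measurable_funS mD DP mgp)).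
  - by move=> x; rewrite !mulr_ge0 ?powR_ge0 ?enorm_ge0.
  - exact: fp0.
  - exact: gp0.
  - by [].
  - by [].
  apply: aeW => x _; rewrite !mul1r -mulrDl ler_wpM2r//.
  by apply: powRB1_mul_le; rewrite ?enorm_ge0// ltW.
rewrite !mul1e; apply: leeD => //.
apply: (ge0_subset_integral _ mDP mD); [exact/measurable_EFinP| |exact: DP].
by move=> x _; rewrite lee_fin.
Qed.

End costs.

(** * Passing to the limit in the weak identity *)

Lemma ae_integral_lincomb_fin {R : realType} dd (T : measurableType dd) (mu : {measure set T -> \bar R})
    (D : set T) (f a b : T -> R) (c1 c2 : R) : measurable D ->
  measurable_fun D f -> measurable_fun D a -> measurable_fun D b ->
  (forall x, 0 <= f x) -> (forall x, 0 <= a x) -> (forall x, 0 <= b x) -> 0 <= c1 -> 0 <= c2 ->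
  {ae mu, forall x, D x -> f x <= c1 * a x + c2 * b x} ->
  (\int[mu]_(x in D) (a x)%:E < +oo)%E -> (\int[mu]_(x in D) (b x)%:E < +oo)%E ->
  (\int[mu]_(x in D) (f x)%:E < +oo)%E.
Proof.
move=> mD mf ma mb f0 a0 b0 c10 c20 H Ia Ib.
apply: le_lt_trans (ae_integral_le_lincomb mD mf ma mb f0 a0 b0 c10 c20 H) _.
by apply: lte_add_pinfty; apply: lte_mul_pinfty; rewrite ?lee_fin.
Qed.

Lemma measurable_funMw {R : realType} n (a : R) (D : set 'rV[R]_n) (f : 'rV[R]_n -> R) :
  measurable_fun D f -> measurable_fun D (fun x => f x * weight a x).
Proof. by move=> mf; apply: measurable_funM => //; exact: measurable_weight. Qed.

Lemma adde_close {R : realType} (x x' y y' : \bar R) (e1 e2 : R) :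
  x \is a fin_num -> x' \is a fin_num -> y \is a fin_num -> y' \is a fin_num ->
  (`|x - x'| <= e1%:E)%E -> (`|y - y'| <= e2%:E)%E -> (x' + y' = 0)%E ->
  (`|x + y| <= (e1 + e2)%:E)%E.
Proof.
move: x x' y y' => [x| |] // [x'| |] // [y| |] // [y'| |] // _ _ _ _.
rewrite -!EFinB -!EFinD !abse_EFin !lee_fin => h1 h2 [E].
have -> : x + y = (x - x') + (y - y') by lra.
exact: le_trans (ler_normD _ _) (lerD h1 h2).
Qed.

Section cutoff_costs.
Context {R : realType} (d k : nat).
Local Notation n := (d + k)%N.
Local Notation L n := (lebesgue_rV R n).
Variables (s : nat -> R) (D : set 'rV[R]_n) (e : R).
Hypotheses (mD : measurable D) (e0 : 0 <= e).

Lemma measurable_patch_sum (E : set 'rV[R]_n) : measurable_fun E (patch_sum s).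
Proof.
rewrite (_ : patch_sum s = (fun x => 1 - cutoff s x)); last by apply/funext => x; rewrite /cutoff subKr.
apply: measurable_funB; first exact: measurable_cst.
apply: measurable_funTS; apply: continuous_measurable_rV.
by apply: smooth_continuous; exact: smooth_cutoff.
Qed.

Lemma patch_sum_cost (mu : {measure set 'rV[R]_n -> \bar R}) (f : 'rV[R]_n -> R) :
  measurable_fun D f -> (forall x, 0 <= f x) ->
  (forall m, (\int[mu]_(x in D) (f x * patch_cut m (s m) x)%:E <= (e * 2^-1 ^+ m.+1)%:E)%E) ->
  (\int[mu]_(x in D) (f x * patch_sum s x)%:E <= e%:E)%E.
Proof.
move=> mf f0 H.
apply: (@integral_le_geometric _ _ _ mu D _ (fun m x => f x * patch_cut m (s m) x) e mD e0).
- by apply: measurable_funM => //; exact: measurable_patch_sum.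
- by move=> m; apply: measurable_funM => //; exact: measurable_patch_cut.
- by move=> x; rewrite mulr_ge0// patch_sum_ge0.
- by move=> m x; rewrite mulr_ge0// patch_cut_ge0.
- by move=> x _; exists (patch_count x); rewrite -mulr_sumr.
exact: H.
Qed.

Variables (w : 'rV[R]_n -> R) (p : R).
Hypotheses (mw : measurable_fun D w) (w0 : forall x, 0 <= w x) (p0 : 0 < p).

Let mgp m (E : set 'rV[R]_n) : measurable_fun E (fun x => enorm (gradient (patch_cut m (s m)) x)).
Proof. by apply: measurable_gradient_smooth; exact: smooth_patch_cut. Qed.

Let mge (E : set 'rV[R]_n) : measurable_fun E (fun x => enorm (gradient (cutoff s) x)).
Proof. by apply: measurable_gradient_smooth; exact: smooth_cutoff. Qed.

(** The factor [(2 `^ p) ^+ m.+1] lost in [powR_sum_le] is paid by the smallness of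
    the cost of the [m]th patch. *)
Lemma cutoff_gradient_cost :
  (forall m, (\int[L n]_(x in D) (enorm (gradient (patch_cut m (s m)) x) `^ p * w x)%:E <=
     (e * 2^-1 ^+ m.+1 / (2 `^ p) ^+ m.+1)%:E)%E) ->
  (\int[L n]_(x in D) (enorm (gradient (cutoff s) x) `^ p * w x)%:E <= e%:E)%E.
Proof.
move=> H; have pm m : 0 < (2 `^ p) ^+ m.+1 :> R by rewrite exprn_gt0// powR_gt0.
pose c m x := (2 `^ p) ^+ m.+1 * (enorm (gradient (patch_cut m (s m)) x) `^ p * w x).
have mcp m : measurable_fun D (fun x => enorm (gradient (patch_cut m (s m)) x) `^ p * w x).
  by apply: measurable_funM => //; apply: (measurableT_comp (measurable_powR p)).
have cp0 m x : 0 <= enorm (gradient (patch_cut m (s m)) x) `^ p * w x by rewrite mulr_ge0 ?powR_ge0.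
apply: (@integral_le_geometric _ _ _ (L n) D _ c e mD e0).
- by apply: measurable_funM => //; apply: (measurableT_comp (measurable_powR p)).
- by move=> m; apply: measurable_funM; [exact: measurable_cst|exact: mcp].
- by move=> x; rewrite mulr_ge0 ?powR_ge0.
- by move=> m x; rewrite mulr_ge0// ltW.
- move=> x _; exists (patch_count x).
  apply: (@le_trans _ _ ((\sum_(m < patch_count x) enorm (gradient (patch_cut m (s m)) x)) `^ p * w x)).
    rewrite ler_wpM2r//; apply: powR_le; rewrite ?(ltW p0) ?enorm_ge0//.
    exact: enorm_gradient_cutoff.
  rewrite /c; under [leRHS]eq_bigr do rewrite mulrA.
  rewrite -mulr_suml ler_wpM2r//.
  apply: (@powR_sum_le R p (patch_count x) (fun m => enorm (gradient (patch_cut m (s m)) x)) p0) => m.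
  exact: enorm_ge0.
move=> m; have -> : (\int[L n]_(x in D) (c m x)%:E =
    ((2 `^ p) ^+ m.+1)%:E * \int[L n]_(x in D) (enorm (gradient (patch_cut m (s m)) x) `^ p * w x)%:E)%E.
  rewrite -ge0_integralZl//; first exact/measurable_EFinP.
  by move=> x _; rewrite lee_fin.
apply: le_trans (lee_wpmul2l _ (H m)) _; first by rewrite lee_fin ltW.
by rewrite -EFinM lee_fin mulrC divfK// gt_eqF.
Qed.

Lemma cutoff_flux_cost (f : 'rV[R]_n -> R) : measurable_fun D f -> (forall x, 0 <= f x) ->
  (forall m, (\int[L n]_(x in D) (f x * enorm (gradient (patch_cut m (s m)) x) * w x)%:E <=
     (e * 2^-1 ^+ m.+1)%:E)%E) ->
  (\int[L n]_(x in D) (f x * enorm (gradient (cutoff s) x) * w x)%:E <= e%:E)%E.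
Proof.
move=> mf f0 H.
apply: (@integral_le_geometric _ _ _ (L n) D _
  (fun m x => f x * enorm (gradient (patch_cut m (s m)) x) * w x) e mD e0).
- by apply: measurable_funM => //; exact: measurable_funM.
- by move=> m; apply: measurable_funM => //; exact: measurable_funM.
- by move=> x; rewrite !mulr_ge0 ?enorm_ge0.
- by move=> m x; rewrite !mulr_ge0 ?enorm_ge0.
- move=> x _; exists (patch_count x); rewrite -mulr_suml ler_wpM2r// -mulr_sumr.
  by rewrite ler_wpM2l//; exact: enorm_gradient_cutoff.
exact: H.
Qed.

End cutoff_costs.

Section removability.
Context {R : realType} (d k : nat) (r : \bar R).
Variables (A : 'rV[R]_(d + k) -> 'rV[R]_(d + k)) (g b : R -> R) (p alpha beta mu : R).
Hypotheses (k2 : (1 < k)%N) (r0 : (0 < r)%E) (p1 : 1 < p) (pk : p < k%:R).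
Hypotheses (alpha0 : 0 <= alpha) (beta0 : 0 <= beta) (mu0 : 0 < mu).
Hypotheses (mA : measurable_fun setT A) (mg : measurable_fun setT g) (mb : measurable_fun setT b).
Hypothesis (growth : forall eta, enorm (A eta) <= mu^-1 * enorm eta `^ (p - 1)).
Hypotheses (lg : locally_bounded g) (lb : locally_bounded b).
Local Notation n := (d + k)%N.
Local Notation L n := (lebesgue_rV R n).
Local Notation Om := (Omega d k r).
Local Notation S := (@surface R d k r k2).
Local Notation dOm := (topo_boundary Om).
Local Notation w := (weight alpha).
Local Notation Tr := (trace p (surface_measure d k r) Om).

Let k0 : (0 < k)%N. Proof. exact: ltnW. Qed.
Let oOm : open Om. Proof. exact: (@open_Omega R d k r k0). Qed.
Let mOm : measurable Om. Proof. exact: open_measurable_rV oOm. Qed.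
Let mdOm : measurable dOm. Proof. exact: measurable_topo_boundary. Qed.
Let p0 : 0 < p. Proof. exact: lt_trans ltr01 p1. Qed.

Lemma weight_le1 a (x : 'rV[R]_n) : 0 <= a -> weight a x <= 1.
Proof.
move=> a0; rewrite /weight powRN invf_le1 ?powR_gt0 ?ltr_pwDl ?enorm_ge0//.
by rewrite -[leLHS](powRr0 (1 + enorm x)) ler_powR// lerDl enorm_ge0.
Qed.

Lemma traceP K (f v : 'rV[R]_n -> R) : is_trace p (surface_measure d k r) Om K f v ->
  is_trace p (surface_measure d k r) Om K f (Tr K f).
Proof. by move=> Hv; rewrite /trace; exact: (@xgetI _ _ _ v). Qed.

Lemma norm_dotrV_le (x y : 'rV[R]_n) : `|dotrV x y| <= enorm x * enorm y.
Proof.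
rewrite ler_norml dotrV_cauchy andbT lerNl -[leRHS]mulr1 -(enormN x).
rewrite mulr1; apply: le_trans (dotrV_cauchy _ _).
by rewrite le_eqVlt /dotrV -sumrN; apply/orP; left; apply/eqP/eq_bigr => i _; rewrite !mxE mulNr.
Qed.

(** The product rule: [phi] is bounded and the gradient of the cutoff is in L^p, so
    the product has a gradient in L^p. *)
Lemma W1p_mul_cutoff (s : nat -> R) (phi : 'rV[R]_n -> R) (M : R) : (forall m, 0 < s m <= 1) ->
  W1p p w Om phi -> 0 <= M -> {ae L n, forall x, Om x -> `|phi x| <= M} ->
  (\int[L n]_(x in Om) (enorm (gradient (cutoff s) x) `^ p * w x)%:E < +oo)%E ->
  W1p p w Om (fun x => phi x * cutoff s x).
Proof.
move=> s01 [[mphi Iphi] exG [mG IG]] M0 bphi Igrad.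
have se := @smooth_cutoff R d k s.
have HG := weak_gradM oOm se (weak_gradientP exG).
have exG' : exists G, is_weak_gradient Om (fun x => phi x * cutoff s x) G by eexists; exact: HG.
have mc (D : set 'rV[R]_n) : measurable_fun D (cutoff s).
  by apply: measurable_funTS; apply: continuous_measurable_rV; exact: smooth_continuous.
have mG' : measurable_fun Om (fun x => enorm (weak_gradient Om (fun x => phi x * cutoff s x) x)).
  by apply: measurable_enorm => i; exact: weak_grad_measurable (weak_gradientP exG').
have mw D : measurable_fun D (w : 'rV[R]_n -> R) := @measurable_weight R n alpha D.
have w0 (x : 'rV[R]_n) : 0 <= w x := weight_ge0 alpha x.
have mphic : measurable_fun Om (fun x => phi x * cutoff s x) by exact: measurable_funM.
split; [split; first exact: mphic|exact: exG'|split; first exact: mG'].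
  apply: le_lt_trans Iphi; apply: ge0_le_integral; first exact: mOm.
  - by move=> x _; rewrite lee_fin mulr_ge0 ?powR_ge0.
  - by apply/measurable_EFinP; apply: measurable_funMw; exact: measurable_powR_abs.
  - by apply/measurable_EFinP; apply: measurable_funMw; exact: measurable_powR_abs.
  move=> x _; rewrite lee_fin ler_wpM2r// normrM.
  by apply: powR_le; rewrite ?mulr_ge0 ?(ltW p0)// ler_piMr// cutoff_norm_le1.
have mgr : measurable_fun Om (fun x => enorm (gradient (cutoff s) x) `^ p * w x).
  apply: measurable_funMw; apply: (measurableT_comp (measurable_powR p)).
  exact: measurable_gradient_smooth.
have mGp : measurable_fun Om (fun x => `|enorm (weak_gradient Om phi x)| `^ p * w x).
  by apply: measurable_funMw; exact: measurable_powR_abs.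
have mGp' : measurable_fun Om (fun x => `|enorm (weak_gradient Om (fun x => phi x * cutoff s x) x)| `^ p * w x).
  by apply: measurable_funMw; exact: measurable_powR_abs.
apply: (@ae_integral_lincomb_fin _ _ _ (L n) Om _ _ _ (2 `^ p) (2 `^ p * M `^ p) mOm mGp' mGp mgr _ _ _ _ _ _ IG Igrad).
- by move=> x; rewrite mulr_ge0 ?powR_ge0.
- by move=> x; rewrite mulr_ge0 ?powR_ge0.
- by move=> x; rewrite mulr_ge0 ?powR_ge0.
- exact: powR_ge0.
- by rewrite mulr_ge0 ?powR_ge0.
apply: filterS2 (weak_gradientE oOm HG) bphi => x h hb Ox; rewrite (h Ox); have {}hb := hb Ox.
rewrite !mulrA -mulrDl ler_wpM2r// !ger0_norm ?enorm_ge0//.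
have cn := @cutoff_norm_le1 R d k s x.
apply: (@le_trans _ _ ((enorm (weak_gradient Om phi x) + M * enorm (gradient (cutoff s) x)) `^ p)).
  apply: powR_le; rewrite ?(ltW p0) ?enorm_ge0//; apply: (le_trans (enorm_triangle _ _)).
  by rewrite !enormZ lerD// ?ler_piMl ?enorm_ge0// ler_wpM2r ?enorm_ge0.
apply: le_trans (powR_add_le _ _ (ltW p0)) _; rewrite ?mulr_ge0 ?enorm_ge0//.
by rewrite powRM ?enorm_ge0// mulrDr mulrA.
Qed.

(** The integrand over [Om] in the weak identity. *)
Definition bulk (u phi : 'rV[R]_n -> R) (x : 'rV[R]_n) : R :=
  (dotrV (A (weak_gradient Om u x)) (weak_gradient Om phi x) + g (u x) * phi x) * w x.

Lemma measurable_flux u (phi : 'rV[R]_n -> 'rV[R]_n) : W1p p w Om u ->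
  (forall i, measurable_fun Om (fun x => phi x ord0 i)) ->
  measurable_fun Om (fun x => dotrV (A (weak_gradient Om u x)) (phi x)).
Proof.
move=> [_ exGu _] mphi.
have mGui i : measurable_fun Om (fun x => weak_gradient Om u x ord0 i).
  exact: weak_grad_measurable (weak_gradientP exGu).
apply: measurable_dotrV => // i.
apply: (measurableT_comp (measurable_rV_coord i)); apply: (measurableT_comp mA).
exact: (measurable_fun_rV_on mOm mGui).
Qed.

Lemma measurable_bulk u phi : W1p p w Om u -> W1p p w Om phi -> measurable_fun Om (bulk u phi).
Proof.
move=> Wu [[mp_ _] exGp _]; have [[mu_ _] _ _] := Wu.
apply: measurable_funMw; apply: measurable_funD.
  by apply: measurable_flux => // i; exact: weak_grad_measurable (weak_gradientP exGp).
by apply: measurable_funM => //; apply: (measurableT_comp mg).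
Qed.

Lemma W1p_gradient_fin f : W1p p w Om f ->
  (\int[L n]_(x in Om) (enorm (weak_gradient Om f x) `^ p * w x)%:E < +oo)%E.
Proof. by move=> [_ _ [_ I]]; under eq_integral do rewrite -[enorm _]ger0_norm ?enorm_ge0//. Qed.

(** The growth of [A] and [powRB1_mul_le] bound the first term by the [p]th powers of
    both gradients; the second is bounded, on a bounded set. *)
Lemma bulk_locally_fin u phi (Mu Mp Cg : R) m : W1p p w Om u -> W1p p w Om phi ->
  {ae L n, forall x, Om x -> `|u x| <= Mu} -> 0 <= Mp -> {ae L n, forall x, Om x -> `|phi x| <= Mp} ->
  (forall t, `|t| <= Mu -> `|g t| <= Cg) -> 0 <= Cg ->
  (\int[L n]_(x in Om `&` patch_supp m 1) (`|bulk u phi x|)%:E < +oo)%E.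
Proof.
move=> Wu Wp bu Mp0 bp HCg Cg0; have mF := measurable_bulk Wu Wp.
have IGu' := W1p_gradient_fin Wu; have IGp' := W1p_gradient_fin Wp.
have [_ _ [mGu _]] := Wu; have [_ _ [mGp _]] := Wp.
set Gu := weak_gradient Om u in IGu' mGu; set Gp := weak_gradient Om phi in IGp' mGp.
have muV0 : 0 <= mu^-1 by rewrite invr_ge0 ltW.
have w0 (x : 'rV[R]_n) : 0 <= w x := weight_ge0 alpha x.
have w1 (x : 'rV[R]_n) : w x <= 1 := weight_le1 x alpha0.
have mP : measurable (patch_supp m 1 : set 'rV[R]_n) by exact: measurable_patch_supp.
have Pb (x : 'rV[R]_n) : patch_supp m 1 x -> enorm x <= m%:R + 3.
  by apply: patch_supp_bounded; rewrite ltr01 lexx.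
have nF0 x : 0 <= `|bulk u phi x| by [].
have mnF : measurable_fun Om (fun x => `|bulk u phi x|) by exact: measurableT_comp.
have sub : Om `&` patch_supp m 1 `<=` Om by move=> x [].
have mE : measurable (Om `&` patch_supp m 1) := measurableI _ _ mOm mP.
pose a x := (enorm (Gu x) `^ p + enorm (Gp x) `^ p) * w x.
have a0 x : 0 <= a x by rewrite mulr_ge0// addr_ge0 ?powR_ge0.
have mpw (G : 'rV[R]_n -> 'rV[R]_n) : measurable_fun Om (fun x => enorm (G x)) ->
    measurable_fun Om (fun x => enorm (G x) `^ p).
  by move=> mGx; apply: (measurableT_comp (measurable_powR p)).
have ma : measurable_fun Om a.
  by apply: measurable_funMw; apply: measurable_funD; exact: mpw.
have Ia : (\int[L n]_(x in Om) (a x)%:E < +oo)%E.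
  apply: (@ae_integral_lincomb_fin _ _ _ (L n) Om a _ _ 1 1 mOm ma (measurable_funMw alpha (mpw _ mGu)) (measurable_funMw alpha (mpw _ mGp)) a0 _ _ _ _ _ IGu' IGp').
  - by move=> x; rewrite mulr_ge0 ?powR_ge0.
  - by move=> x; rewrite mulr_ge0 ?powR_ge0.
  - by [].
  - by [].
  have E (t1 t2 t3 : R) : (t1 + t2) * t3 = 1 * (t1 * t3) + 1 * (t2 * t3) by rewrite !mul1r mulrDl.
  by apply: aeW => x _; rewrite /a E; exact: lexx.
have IaE : (\int[L n]_(x in Om `&` patch_supp m 1) (a x)%:E < +oo)%E.
  apply: le_lt_trans Ia; apply: (ge0_subset_integral _ mE mOm); [exact/measurable_EFinP| |exact: sub].
  by move=> x _; rewrite lee_fin.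
have LE : (L n (Om `&` patch_supp m 1) < +oo)%E.
  apply: le_lt_trans (Om_eball_fin d r k2 (m%:R + 4)); apply: le_measure; rewrite ?inE; [exact: mE|exact: measurable_Om_eball|].
  by move=> x [Ox /Pb h]; split => //; rewrite /eball /=; lra.
have I1E : (\int[L n]_(x in Om `&` patch_supp m 1) (1%:E) < +oo)%E by rewrite integral_cst// mul1e.
have ge10 : forall x : 'rV[R]_n, 0 <= (1 : R) by [].
have CM0 : 0 <= Cg * Mp by rewrite mulr_ge0.
suff H : {ae L n, forall x, (Om `&` patch_supp m 1) x -> `|bulk u phi x| <= mu^-1 * a x + (Cg * Mp) * 1}.
  have := ae_integral_lincomb_fin mE (measurable_funS mOm sub mnF) (measurable_funS mOm sub ma)
     (measurable_cst (1 : R)) nF0 a0 ge10 muV0 CM0 H IaE I1E; exact.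
apply: filterS2 bu bp => x h1 h2 [Ox _]; have {}h1 := h1 Ox; have {}h2 := h2 Ox.
rewrite /bulk -/Gu -/Gp normrM (ger0_norm (w0 x)) /a mulr1.
apply: (@le_trans _ _ ((mu^-1 * (enorm (Gu x) `^ p + enorm (Gp x) `^ p) + Cg * Mp) * w x)).
  rewrite ler_wpM2r//; apply: (le_trans (ler_normD _ _)); apply: lerD.
    apply: (le_trans (norm_dotrV_le _ _)).
    apply: (@le_trans _ _ (mu^-1 * enorm (Gu x) `^ (p - 1) * enorm (Gp x))).
      by rewrite ler_wpM2r ?enorm_ge0.
    by rewrite -mulrA ler_wpM2l//; apply: powRB1_mul_le; rewrite ?enorm_ge0// ltW.
  by rewrite normrM ler_pM// HCg.
by rewrite mulrDl -mulrA lerD2l ler_piMr// mulr_ge0.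
Qed.

Variable u : 'rV[R]_n -> R.
Hypotheses (Wu : W1p p w Om u) (Bu : Linfty Om u).
Hypothesis Su : weak_solution r A g b p alpha beta u.

(** Test the equation with [phi * eta], where [eta] is a cutoff whose radii are
    chosen, patch by patch, after [u] and [phi], such that all errors caused by [eta]
    are at most of order [e].  The identity for [phi] then holds up to this error.
    Integrability of its two integrands, not known beforehand, comes from the same
    comparison. *)
Lemma weak_identity_of_cutoff phi : W1p p w Om phi -> Linfty Om phi ->
  weak_identity r A g b p alpha beta set0 u phi.
Proof.
move=> Wp Bp.
have [vu [Mu [Mu0 bu tu vuM]]] := trace_bounded k2 r0 p1 alpha0 Wu Bu.
have [vp [Mp [Mp0 bp tp vpM]]] := trace_bounded k2 r0 p1 alpha0 Wp Bp.
have [Cg Cg0 HCg] := locally_bounded_on Mu lg.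
have [Cb Cb0 HCb] := locally_bounded_on Mu lb.
have [[mu_ _] exGu [mGu IGu]] := Wu.
have [[mp_ _] exGp [mGp IGp]] := Wp.
set Gu := weak_gradient Om u in mGu IGu; set Gp := weak_gradient Om phi in mGp IGp.
have mGui i : measurable_fun Om (fun x => Gu x ord0 i) by exact: weak_grad_measurable (weak_gradientP exGu).
have mGpi i : measurable_fun Om (fun x => Gp x ord0 i) by exact: weak_grad_measurable (weak_gradientP exGp).
have mw D : measurable_fun D (w : 'rV[R]_n -> R) := @measurable_weight R n alpha D.
have w0 (x : 'rV[R]_n) : 0 <= w x := weight_ge0 alpha x.
have w1 (x : 'rV[R]_n) : w x <= 1 := weight_le1 x alpha0.
(* [Tr] picks some trace, a priori unrelated for [set0] and [Gamma]; uniqueness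
   identifies all of them with the bounded traces [vu] and [vp]. *)
have uT : {ae S, forall x, dOm x -> Tr set0 u x = vu x}.
  exact: (trace_unique k2 r0 p1 exGu (is_trace_off _ (traceP tu)) (is_trace_off _ tu)).
have uTG : {ae S, forall x, dOm x -> Tr (Gamma d k) u x = vu x}.
  exact: (trace_unique k2 r0 p1 exGu (traceP (is_trace_off _ tu)) (is_trace_off _ tu)).
have pT : {ae S, forall x, dOm x -> Tr set0 phi x = vp x}.
  exact: (trace_unique k2 r0 p1 exGp (is_trace_off _ (traceP tp)) (is_trace_off _ tp)).
pose F := bulk u phi.
pose B x := b (Tr set0 u x) * Tr set0 phi x * weight beta x.
have mF : measurable_fun Om F := measurable_bulk Wu Wp.
have mB : measurable_fun dOm B.
  apply: measurable_funM; last exact: measurable_weight.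
  apply: measurable_funM; last by have [] := traceP tp.
  by apply: (measurableT_comp mb); have [] := traceP tu.
have IGu' := W1p_gradient_fin Wu; rewrite -/Gu in IGu'.
have muV0 : 0 <= mu^-1 by rewrite invr_ge0 ltW.
have mP m : measurable (patch_supp m 1 : set 'rV[R]_n) by exact: measurable_patch_supp.
have Pb m (x : 'rV[R]_n) : patch_supp m 1 x -> enorm x <= m%:R + 3.
  by apply: patch_supp_bounded; rewrite ltr01 lexx.
have nF0 x : 0 <= `|F x| by [].
have nB0 x : 0 <= `|B x| by [].
have mnF : measurable_fun Om (fun x => `|F x|) by exact: measurableT_comp.
have mnB : measurable_fun dOm (fun x => `|B x|) by exact: measurableT_comp.
have IF m := bulk_locally_fin m Wu Wp bu Mp0 bp HCg Cg0.
have IB m : (\int[S]_(x in dOm `&` patch_supp m 1) (`|B x|)%:E < +oo)%E.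
  have sub : dOm `&` patch_supp m 1 `<=` dOm by move=> x [].
  have mE : measurable (dOm `&` patch_supp m 1) := measurableI _ _ mdOm (mP m).
  have c0 : 0 <= Cb * Mp by rewrite mulr_ge0.
  apply: (@le_lt_trans _ _ (\int[S]_(x in dOm `&` patch_supp m 1) ((Cb * Mp)%:E))%E).
    apply: (ae_ge0_le_integral mE).
    - by move=> x _; rewrite lee_fin.
    - by apply/measurable_EFinP; exact: measurable_funS mdOm sub mnB.
    - by move=> x _; rewrite lee_fin.
    - exact: measurable_cst.
    have := @filterI _ _ (ae_filter_ringOfSetsType S) _ _ uT pT.
    apply: filterS => x [h1 h2] [xO _]; rewrite lee_fin /B h1// h2// !normrM (ger0_norm (weight_ge0 _ _)).
    by rewrite -[leRHS]mulr1 ler_pM ?mulr_ge0 ?weight_ge0 ?weight_le1// ler_pM// HCb.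
  rewrite integral_cst//; apply: lte_mul_pinfty => //.
  by apply: (@surface_fin R d k r k2 _ (m%:R + 3) mE) => x [_ /Pb].
have GO : {ae L n, forall x, Om x -> ~ Gamma d k x} by apply: aeW => x; exact: (Omega_Gamma k2).
have GS : {ae S, forall x, dOm x -> ~ Gamma d k x}.
  by apply: filterS (@surface_Gamma_null R d k r k2) => x h _.
have mGup : measurable_fun Om (fun x => enorm (Gu x)) := mGu.
have Gu0 x : 0 <= enorm (Gu x) by exact: enorm_ge0.
have OG x : Om x -> ~ Gamma d k x by exact: (Omega_Gamma k2).
(* [2 + Mp / mu] collects three errors: the bulk and boundary terms lost near
   [Gamma], at most [e] each, and the flux through the gradient of the cutoff. *)
have key (e : R) : 0 < e -> [/\ (L n).-integrable Om (EFin \o F), S.-integrable dOm (EFin \o B) &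
    (`|\int[L n]_(x in Om) (F x)%:E + \int[S]_(x in dOm) (B x)%:E| <= ((2 + Mp * mu^-1) * e)%:E)%E].
  move=> e0.
  have em m : 0 < e * 2^-1 ^+ m.+1 by rewrite mulr_gt0// exprn_gt0.
  have pm m : 0 < (2 `^ p) ^+ m.+1 :> R by rewrite exprn_gt0// powR_gt0.
  have cm m : 0 < 1 * 2^-1 ^+ m.+1 / (2 `^ p) ^+ m.+1 :> R by rewrite mul1r divr_gt0// exprn_gt0.
  (* One radius for each patch, making all four costs of this patch small. *)
  have ex m : exists j : nat, [/\
     (\int[L n]_(x in Om) (enorm (gradient (patch_cut m (rad j)) x) `^ p * w x)%:E <=
        (1 * 2^-1 ^+ m.+1 / (2 `^ p) ^+ m.+1)%:E)%E,
     (\int[L n]_(x in Om) (enorm (Gu x) `^ (p - 1) * enorm (gradient (patch_cut m (rad j)) x) * w x)%:E <=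
        (e * 2^-1 ^+ m.+1)%:E)%E,
     (\int[L n]_(x in Om) (`|F x| * patch_cut m (rad j) x)%:E <= (e * 2^-1 ^+ m.+1)%:E)%E &
     (\int[S]_(x in dOm) (`|B x| * patch_cut m (rad j) x)%:E <= (e * 2^-1 ^+ m.+1)%:E)%E].
    have c1 := near_small (cm m) (gradient_cost_cvg0 p1 pk mOm (mw _) w0 w1 m).
    have c2 := near_small (em m) (flux_cost_cvg0 p1 pk mOm (mw _) w0 w1 mGup Gu0 OG IGu' m).
    have c3 := near_small (em m) (integral_patch_cut_cvg0 mOm mnF nF0 GO (IF m)).
    have c4 := near_small (em m) (integral_patch_cut_cvg0 mdOm mnB nB0 GS (IB m)).
    have [j [[[h1 h2] h3] h4]] := filter_ex (filterI (filterI (filterI c1 c2) c3) c4).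
    by exists j.
  have [j Hj] := choice ex.
  pose s m := rad (j m) : R.
  have s01 m : 0 < s m <= 1 by exact: rad01.
  have se := @smooth_cutoff R d k s.
  pose eta := cutoff s : 'rV[R]_n -> R.
  pose ps := patch_sum s : 'rV[R]_n -> R.
  have etaE x : eta x = 1 - ps x by [].
  have ps0 x : 0 <= ps x by exact: patch_sum_ge0.
  have meta D : measurable_fun D eta.
    by apply: measurable_funTS; apply: continuous_measurable_rV; exact: smooth_continuous.
  have mps D : measurable_fun D ps.
    by rewrite (_ : ps = fun x => 1 - eta x); [exact: measurable_funB|apply/funext => x; rewrite etaE subKr].
  have mge (D : set 'rV[R]_n) : measurable_fun D (fun x => enorm (gradient eta x)).
    exact: measurable_gradient_smooth.
  have mgp m (D : set 'rV[R]_n) : measurable_fun D (fun x => enorm (gradient (patch_cut m (s m)) x)).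
    by apply: measurable_gradient_smooth; exact: smooth_patch_cut.
  have mpc m (D : set 'rV[R]_n) : measurable_fun D (patch_cut m (s m)) by exact: measurable_patch_cut.
  have ge_sum x : enorm (gradient eta x) <= \sum_(m < patch_count x) enorm (gradient (patch_cut m (s m)) x).
    exact: enorm_gradient_cutoff.
  have I1 : (\int[L n]_(x in Om) (enorm (gradient eta x) `^ p * w x)%:E <= 1%:E)%E.
    by apply: (cutoff_gradient_cost mOm ler01 (mw _) w0 p0) => m; have [] := Hj m.
  have I2 : (\int[L n]_(x in Om) (enorm (Gu x) `^ (p - 1) * enorm (gradient eta x) * w x)%:E <= e%:E)%E.
    have mGupp : measurable_fun Om (fun x => enorm (Gu x) `^ (p - 1)) := measurableT_comp (measurable_powR _) mGu.
    apply: (cutoff_flux_cost mOm (ltW e0) (mw _) w0 mGupp) => [x|m]; first exact: powR_ge0.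
    by have [_ ? _ _] := Hj m.
  have I3 : (\int[L n]_(x in Om) (`|F x| * ps x)%:E <= e%:E)%E.
    by apply: (patch_sum_cost mOm (ltW e0) mnF nF0) => m; have [] := Hj m.
  have I4 : (\int[S]_(x in dOm) (`|B x| * ps x)%:E <= e%:E)%E.
    by apply: (patch_sum_cost mdOm (ltW e0) mnB nB0) => m; have [] := Hj m.
  pose psi x := phi x * eta x.
  have Wpsi : W1p p w Om psi by apply: (W1p_mul_cutoff s01 Wp Mp0 bp); exact: le_lt_trans I1 (ltry 1).
  have bpsi : {ae L n, forall x, Om x -> `|psi x| <= Mp}.
    apply: filterS bp => x h Ox; rewrite /psi normrM; apply: le_trans (h Ox).
    by rewrite ler_piMr// cutoff_norm_le1.
  have Bpsi : Linfty Om psi by split; [apply: measurable_funM|exists Mp].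
  have [_ _ /(_ psi)] := Su.
  case.
  - by move=> U oU UO _; exact: W1p_sub oOm oU UO Wpsi.
  - by move=> U oU UO _; exact: Linfty_sub mOm UO Bpsi.
  - move=> x xc; split; first by apply: closure_subset xc => y [].
    move=> /(cutoff_near_Gamma s01) nx; have [y [[_ /= py] cy]] := xc _ nx.
    by move/eqP: py; apply; rewrite /psi /eta cy mulr0.
  set Gs := weak_gradient Om psi => IF' IB' E0.
  have HGs : {ae L n, forall x, Om x -> Gs x = eta x *: Gp x + phi x *: gradient eta x}.
    exact: (weak_gradientE oOm (weak_gradM oOm se (weak_gradientP exGp))).
  have tpsi := is_trace_mul k2 p0 exGp se (@cutoff_norm_le1 R d k s) tp.
  have sT : {ae S, forall x, dOm x -> Tr (Gamma d k) psi x = vp x * eta x}.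
    apply: (trace_unique k2 r0 p1 _ (traceP tpsi) tpsi).
    by have [_ ? _] := Wpsi.
  (* The difference between the integrands for [phi] and for [phi * eta]. *)
  pose h1 x := F x * ps x - phi x * dotrV (A (Gu x)) (gradient eta x) * w x.
  have mge_i i : measurable_fun Om (fun x => gradient eta x ord0 i).
    under eq_fun do rewrite mxE; apply: measurable_funTS; apply: continuous_measurable_rV.
    exact: smooth_continuous (smooth_partial _ se).
  have mh1 : measurable_fun Om h1.
    apply: measurable_funB; first by apply: measurable_funM.
    apply: measurable_funMw; apply: measurable_funM; first exact: mp_.
    exact: (measurable_flux Wu mge_i).
  have Ih1 : (\int[L n]_(x in Om) (`|h1 x|)%:E <= ((1 + Mp * mu^-1) * e)%:E)%E.
    have mnh1 : measurable_fun Om (fun x => `|h1 x|) by exact: measurableT_comp.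
    have mGupp : measurable_fun Om (fun x => enorm (Gu x) `^ (p - 1)) by apply: (measurableT_comp (measurable_powR _)).
    apply: (@le_trans _ _ (1%:E * \int[L n]_(x in Om) (`|F x| * ps x)%:E +
      (Mp * mu^-1)%:E * \int[L n]_(x in Om) (enorm (Gu x) `^ (p - 1) * enorm (gradient eta x) * w x)%:E)%E); last first.
      rewrite mulrDl EFinD mul1r mul1e; apply: leeD => //.
      by rewrite [leRHS]EFinM; apply: lee_wpmul2l => //; rewrite lee_fin mulr_ge0.
    apply: (ae_integral_le_lincomb mOm mnh1 (measurable_funM mnF (mps _))
      (measurable_funMw alpha (measurable_funM mGupp (mge _)))).
    - by [].
    - by move=> x; rewrite mulr_ge0.
    - by move=> x; rewrite !mulr_ge0 ?powR_ge0 ?enorm_ge0.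
    - by [].
    - by rewrite mulr_ge0.
    apply: filterS bp => x h Ox; have {}h := h Ox; rewrite mul1r /h1.
    apply: (le_trans (ler_normB _ _)); rewrite normrM (ger0_norm (ps0 x)) lerD2l.
    rewrite !normrM (ger0_norm (w0 x)) mulrA ler_wpM2r// -mulrA ler_pM//.
    apply: (le_trans (norm_dotrV_le _ _)); rewrite mulrA.
    by rewrite ler_wpM2r ?enorm_ge0.
  pose h2 x := B x * ps x.
  have mh2 : measurable_fun dOm h2 by exact: measurable_funM.
  have Ih2 : (\int[S]_(x in dOm) (`|h2 x|)%:E <= e%:E)%E.
    by under eq_integral do rewrite /h2 normrM (ger0_norm (ps0 _)); exact: I4.
  have FE : {ae L n, forall x, Om x -> F x =
      (dotrV (A (Gu x)) (Gs x) + g (u x) * psi x) * w x + h1 x}.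
    apply: filterS HGs => x h Ox; rewrite (h Ox) /h1 /F /psi.
    have -> : dotrV (A (Gu x)) (eta x *: Gp x + phi x *: gradient eta x) =
      eta x * dotrV (A (Gu x)) (Gp x) + phi x * dotrV (A (Gu x)) (gradient eta x).
      rewrite /dotrV !mulr_sumr -big_split; apply: eq_bigr => i _; rewrite !mxE /=; ring.
    by rewrite etaE /bulk -/Gu -/Gp; ring.
  have BE : {ae S, forall x, dOm x -> B x =
      b (Tr (Gamma d k) u x) * Tr (Gamma d k) psi x * weight beta x + h2 x}.
    have := @filterI _ _ (ae_filter_ringOfSetsType S) _ _ (@filterI _ _ (ae_filter_ringOfSetsType S) _ _ uT uTG)
      (@filterI _ _ (ae_filter_ringOfSetsType S) _ _ pT sT).
    apply: filterS => x [[a1 a2] [a3 a4]] xO; rewrite /h2 /B a1// a2// a3// a4// etaE; ring.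
  have [RF EF] := integral_perturb mOm mF mh1 IF' FE Ih1.
  have [RB EB] := integral_perturb (mu := S) mdOm mB mh2 IB' BE Ih2.
  split => //.
  have fF := integrable_fin_num mOm RF; have fB := integrable_fin_num mdOm RB.
  have fF' := integrable_fin_num mOm IF'; have fB' := @integrable_fin_num _ _ _ S dOm mdOm _ IB'.
  apply: le_trans (adde_close fF fF' fB fB' EF EB E0) _.
  by rewrite lee_fin le_eqVlt; apply/orP; left; apply/eqP; ring.
have [RF RB _] := key 1 ltr01.
split; [exact: RF|exact: RB|].
have fF := integrable_fin_num mOm RF; have fB := integrable_fin_num mdOm RB.
have C0 : 0 < 2 + Mp * mu^-1 by rewrite ltr_wpDr// mulr_ge0.
suff : `|fine (\int[L n]_(x in Om) (F x)%:E) + fine (\int[S]_(x in dOm) (B x)%:E)| <= 0.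
  rewrite normr_le0 => /eqP E; rewrite [LHS](_ : _ = (\int[L n]_(x in Om) (F x)%:E + \int[S]_(x in dOm) (B x)%:E)%E)//.
  by rewrite -(fineK fF) -(fineK fB) -EFinD E.
apply/ler_addgt0Pl => e e0; rewrite addr0.
have [_ _] := key (e / (2 + Mp * mu^-1)) (divr_gt0 e0 C0).
rewrite /= -(fineK fF) -(fineK fB) -EFinD abse_EFin lee_fin => /le_trans; apply.
by rewrite mulrC divfK// gt_eqF.
Qed.

End removability.

(** * Removability *)

Theorem theorem1p3 (R : realType) (N d : nat) (r : \bar R)
    (A : 'rV[R]_(d + (N - d)) -> 'rV[R]_(d + (N - d))) (g b : R -> R)
    (p q alpha beta mu mu1 : R) (u : 'rV[R]_(d + (N - d)) -> R) :
  (3 <= N)%N -> (1 <= d <= N - 2)%N -> (0 < r)%E ->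
  cond_H1 A g b p q alpha beta mu mu1 ->
  cond_H2 A ->
  p * q / (q - p + 1) < N%:R - d%:R ->
  weak_solution r A g b p alpha beta u ->
  cond_A2 r p q alpha u ->
  removable r A g b p alpha beta u.
Proof.
move=> N3 /andP[d0 dN] r0 H1 _ Npq Su A2.
have [[mA [mg lg] [mb lb]] [[_ growth _ _] [[/andP[p1 _] /andP[alpha0 _] /andP[beta0 _]] [_ D0 mu0 _]]]] := H1.
have p0 : 0 < p by exact: lt_trans ltr01 p1.
have dN' : (d <= N)%N by apply: leq_trans dN (leq_subr _ _).
have k2 : (1 < N - d)%N by rewrite (leq_subRL _ dN') addnC -leq_subRL// ltnW.
(* [q / (q - p + 1) >= 1], so that the codimension [N - d] exceeds [p]. *)
have pk : p < (N - d)%:R.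
  rewrite natrB//; apply: le_lt_trans Npq; rewrite ler_pdivlMr// ler_pM2l//; lra.
have [Wu Bu _] := Su.
have [_ [u1 [u2 [_ [W1 _] [W2 _ _ B2] uE _]]]] := A2.
have [Wu' Bu'] := sobolev_of_product d0 (ltnW k2) p0 alpha0 uE W1 W2 B2 Wu Bu.
split; [exact: Wu'|exact: Bu'|] => phi Wp Bp.
exact: (weak_identity_of_cutoff k2 r0 p1 pk alpha0 beta0 mu0 mA mg mb growth lg lb Wu' Bu' Su Wp Bp).
Qed.
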